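(* Let $\mu=\sum_{\lambda\in\Lambda}c_\lambda\delta_\lambda$ with $\Lambda\subset\mathbb R$ locally finite and $c_\lambda$ positive integers, be a temperate distribution whose Fourier transform is a measure $\hat\mu=\sum_{\gamma\in\Gamma}b_\gamma\delta_\gamma$ ($\Gamma\subset\mathbb R$ countable) such that $|\hat\mu|$ is also a temperate distribution. Let $A=\{a_n\}_{n\in\mathbb Z}$ be the multiset in which each $\lambda\in\Lambda$ occurs $c_\lambda$ times, enumerated so that $a_n\le a_{n+1}$, and assume $0\notin A$. Let $$f(z)=(1-z/a_0)\prod_{n=1}^\infty(1-z/a_n)(1-z/a_{-n}),\qquad g(z)=\sum_{\gamma\in\Gamma,\ 0<\gamma<1}b_\gamma\frac{e^{2\pi i\gamma z}-1}{\gamma}.$$ Then $A$ is the zero set (with multiplicities) of some almost periodic entire function of exponential type if and only if $g$ is uniformly bounded on $\mathbb R$. Moreover, if this is the case, then $f$ is an almost periodic entire function.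
   Context: The Fourier transform is taken in the sense of tempered distributions with the convention $\hat\varphi(\lambda)=\int_{\mathbb R}\varphi(t)e^{-2\pi i\lambda t}\,dt$. An entire function $F$ is almost periodic if for every $-\infty<\alpha\le\beta<\infty$ and every $\varepsilon>0$ the set $\{\tau\in\mathbb R:\ \sup_{x\in\mathbb R,\ \alpha\le y\le\beta}|F(x+\tau+iy)-F(x+iy)|<\varepsilon\}$ is relatively dense in $\mathbb R$. ''Zero set of $F$ equals $A$'' means the zeros of $F$ are exactly the points of $\Lambda$, with the zero at $\lambda$ of multiplicity $c_\lambda$. *)

(* Defs.v *)
From Stdlib Require Import Reals ZArith List.
From Coquelicot Require Import Coquelicot.
Open Scope R_scope.

Definition cexp (z : C) : C :=
  (exp (Re z) * cos (Im z), exp (Re z) * sin (Im z)).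

Definition entire (F : C -> C) : Prop :=
  forall z : C, ex_derive (K := C_AbsRing) (V := AbsRing_NormedModule C_AbsRing) F z.

Definition exponential_type (F : C -> C) : Prop :=
  exists A B : R, forall z : C, Cmod (F z) <= A * exp (B * Cmod z).

Definition relatively_dense (S : R -> Prop) : Prop :=
  exists L : R, 0 < L /\ forall a : R, exists tau, S tau /\ a <= tau <= a + L.

(** Almost periodic entire function (definition from the paper):
    for every alpha <= beta and eps > 0 the set of tau with
    sup_{x in R, alpha <= y <= beta} |F(x+tau+iy) - F(x+iy)| < eps
    is relatively dense.  "sup < eps" is written as "bounded by some M < eps". *)
Definition almost_periodic (F : C -> C) : Prop :=
  forall alpha beta eps : R, alpha <= beta -> 0 < eps ->
    relatively_dense (fun tau =>
      exists M : R, M < eps /\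
        forall x y : R, alpha <= y <= beta ->
          Cmod (Cminus (F (x + tau, y)) (F (x, y))) <= M).

Definition zero_order (F : C -> C) (z : C) (k : nat) : Prop :=
  exists h : C -> C, entire h /\ h z <> 0%C /\
    forall w : C, F w = Cmult (Cpow (Cminus w z) k) (h w).

Definition seq_count (a : Z -> R) (z : C) (k : nat) : Prop :=
  exists l : list Z, NoDup l /\ (forall n, In n l <-> RtoC (a n) = z)
                     /\ length l = k.

Definition zero_set_is (F : C -> C) (a : Z -> R) : Prop :=
  forall (z : C) (k : nat), seq_count a z k -> zero_order F z k.

(** Sums over Z by symmetric partial sums: u 0 + sum_{n>=1} (u n + u (-n)). *)
Definition Zsym (u : Z -> C) (n : nat) : C :=
  match n with
  | O => u 0%Z
  | S m => Cplus (u (Z.of_nat (S m))) (u (- Z.of_nat (S m))%Z)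
  end.

Definition schwartz_real (u : R -> R) : Prop :=
  (forall (n : nat) (x : R), ex_derive_n u n x) /\
  (forall k n : nat, exists M : R, forall x : R, Rabs (x ^ k * Derive_n u n x) <= M).

Definition schwartz (phi : R -> C) : Prop :=
  schwartz_real (fun x => Re (phi x)) /\ schwartz_real (fun x => Im (phi x)).

Definition fourier (phi : R -> C) (lam : R) : C :=
  RInt_gen (V := C_R_CompleteNormedModule)
    (fun t => Cmult (phi t) (cexp (0, - 2 * PI * lam * t)))
    (Rbar_locally m_infty) (Rbar_locally p_infty).

(** mu = sum_n delta_{a_n} is a tempered measure:
    sum_n (1 + |a_n|)^{-N} < oo for some N. *)
Definition tempered_A (a : Z -> R) : Prop :=
  exists N : nat, ex_series (K := R_AbsRing) (V := C_R_NormedModule)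
    (Zsym (fun n => RtoC (/ (1 + Rabs (a n)) ^ N))).

(** |hat mu| = sum_k |b_k| delta_{gamma_k} is a tempered measure. *)
Definition tempered_B (gam : nat -> R) (b : nat -> C) : Prop :=
  exists N : nat, ex_series (fun k => Cmod (b k) / (1 + Rabs (gam k)) ^ N).

(** The (distributional) Fourier transform of mu = sum_n delta_{a_n} is
    sum_k b_k delta_{gamma_k}: <mu, hat phi> = <hat mu, phi> for Schwartz phi. *)
Definition fourier_pair (a : Z -> R) (gam : nat -> R) (b : nat -> C) : Prop :=
  forall phi : R -> C, schwartz phi ->
    exists s : C,
      is_series (K := R_AbsRing) (V := C_R_NormedModule)
        (Zsym (fun n => fourier phi (a n))) s /\
      is_series (K := R_AbsRing) (V := C_R_NormedModule)
        (fun k => Cmult (b k) (phi (gam k))) s.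

Definition g_term (gam : nat -> R) (b : nat -> C) (x : R) (k : nat) : C :=
  if Rlt_dec 0 (gam k) then
    if Rlt_dec (gam k) 1 then
      Cdiv (Cmult (b k) (Cminus (cexp (0, 2 * PI * gam k * x)) 1)) (gam k)
    else 0%C
  else 0%C.

Definition g_bounded (gam : nat -> R) (b : nat -> C) : Prop :=
  exists M : R, forall x : R, exists s : C,
    is_series (K := R_AbsRing) (V := C_R_NormedModule) (g_term gam b x) s
    /\ Cmod s <= M.

Fixpoint f_partial (a : Z -> R) (N : nat) (z : C) : C :=
  match N with
  | O => Cminus 1 (Cdiv z (a 0%Z))
  | S m => Cmult (f_partial a m z)
             (Cmult (Cminus 1 (Cdiv z (a (Z.of_nat (S m)))))
                    (Cminus 1 (Cdiv z (a (- Z.of_nat (S m))%Z))))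
  end.

Definition f_product_converges (a : Z -> R) (z w : C) : Prop :=
  filterlim (fun N => f_partial a N z) eventually (locally (T := C_UniformSpace) w).

(* Main.v *)
Require Import Defs.
From Stdlib Require Import Reals ZArith List.
From Stdlib Require Import Lra Lia Psatz Classical ClassicalEpsilon FinFun FunctionalExtensionality.
From Coquelicot Require Import Coquelicot.
Open Scope R_scope.

(** For [Im z > 0] the Fourier pair, tested against smooth approximations of the one-sided wave [t |-> exp (2 pi i z t)], [t > 0],
    evaluates [sum_n 1 / (z - a_n)^2] as an exponential sum over the positive frequencies. Integrating twice, the genus one
    canonical product [P] over [A] equals [const * exp (c0 z - G z)] in the upper half-plane, where
    [G z = sum_(gamma > 0) b_gamma (exp (2 pi i gamma z) - exp (- 2 pi gamma)) / gamma], and [G (x + i) - g x] is bounded, since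
    [|b_gamma| exp (- 2 pi gamma)] is summable.

    If [F] is almost periodic with zero set [A], then [F / P] is zero-free of exponential type, hence an exponential, so
    [F (x + i) = k exp (e x - G (x + i))]. For an almost period [tau] of [F] the increments [G (x + tau + i) - G (x + i)] are
    almost independent of [x]; as [G (x + i) = o (x)] they are small, and [G (x + i)] is bounded because almost periods are
    relatively dense.

    Conversely, bounded [G (x + i)] makes the zero counting function of [A] equal to a linear function up to [O(1)]. So
    [a_n + a_(-n)] is bounded, the symmetric product converges to [f z = P z exp (- c1 z)], and comparing logarithmic derivatives
    on the imaginary axis shows [c1 = Re c0]: in the upper half-plane [f] is [exp (i (Im c0) z - G z)] up to a constant. Bohr's
    theorem on bounded primitives makes it almost periodic on horizontal lines, and the maximum principle extends this to strips. *)

(** The double poles are forced. Testing the pair with Gaussians modulated by [exp (2 pi i x t)]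
    bounds the number of zeros in every unit interval, since the modulation does not change the
    moduli on the spectral side; hence [sum 1 / a_n^2] converges, while [sum 1 / (z - a_n)] need not
    converge absolutely. The wave jumps at [t = 0], so it is multiplied by a smooth ramp
    approximating [t]: the factor [t] produces the double pole, and the smoothing is removed by
    dominated convergence.

    Everything is compared on the line [Im z = 1]. On the real axis [P] has its zeros and the
    [b_gamma] need not be summable, whereas above it the weights [exp (- 2 pi gamma)] make the sums
    absolutely convergent. Positive frequencies may accumulate at [0], where [b_gamma / gamma] need
    not be summable; this is why boundedness of [G] is a genuine condition.

    The quotient [F / P] must also be controlled in the strip that contains the zeros. There [P] is
    bounded below on vertical lines at a fixed distance from all zeros; such lines occur in every
    unit interval, and the maximum principle on rectangles fills the gaps. *)

Lemma choice (A B : Type) (R : A -> B -> Prop) : (forall x, exists y, R x y) -> exists f : A -> B, forall x, R x (f x).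
Proof.
  intros H. exists (fun x => proj1_sig (constructive_indefinite_description _ (H x))). intros x. apply proj2_sig.
Qed.

(** * Moduli of complex numbers *)

Lemma C_ext (z w : C) : Re z = Re w -> Im z = Im w -> z = w.
Proof. destruct z, w; simpl; congruence. Qed.

Lemma Cmod_sq (z : C) : Cmod z * Cmod z = Re z * Re z + Im z * Im z.
Proof. generalize (Cmod2_alt z); simpl; rewrite !Rmult_1_r; auto. Qed.

Lemma Im_le_Cmod (z : C) : Rabs (Im z) <= Cmod z.
Proof.
  generalize (Rmax_Cmod z) (Rmax_r (Rabs (fst z)) (Rabs (snd z))).
  unfold Im; lra.
Qed.

Lemma Cmod_le_abs (z : C) : Cmod z <= Rabs (Re z) + Rabs (Im z).
Proof.
  assert (H := Cmod_sq z).
  assert (H1 := Rabs_pos (Re z)). assert (H2 := Rabs_pos (Im z)).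
  assert (H3 := Cmod_ge_0 z).
  assert (Re z * Re z = Rabs (Re z) * Rabs (Re z)) by (rewrite <- Rabs_mult, Rabs_pos_eq; nra).
  assert (Im z * Im z = Rabs (Im z) * Rabs (Im z)) by (rewrite <- Rabs_mult, Rabs_pos_eq; nra).
  nra.
Qed.

Lemma Cmod_sub_sym (z w : C) : Cmod (z - w) = Cmod (w - z).
Proof. rewrite <- Cmod_opp. f_equal. ring. Qed.

Lemma Cmod_triangle_sub (z w : C) : Cmod z <= Cmod w + Cmod (z - w).
Proof. generalize (Cmod_triangle w (z - w)). replace (w + (z - w))%C with z by ring. auto. Qed.

Lemma Cmod_triangle3 (x y z : C) : Cmod (x - z) <= Cmod (x - y) + Cmod (y - z).
Proof. generalize (Cmod_triangle (x - y) (y - z)). replace (x - y + (y - z))%C with (x - z)%C by ring. auto. Qed.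

Lemma Cmod_minus_le (z w : C) : Cmod (z - w) <= Cmod z + Cmod w.
Proof. unfold Cminus. rewrite <- (Cmod_opp w). apply Cmod_triangle. Qed.

Lemma Cmod_RtoC_nonneg (x : R) : 0 <= x -> Cmod (RtoC x) = x.
Proof. intros H. rewrite Cmod_R. apply Rabs_pos_eq, H. Qed.

(** The factor [K] is arbitrary, so that an estimate can end in any multiple of [eps] without
    rescaling. *)
Lemma Ceq_of_small (z w : C) (K : R) :
  (forall eps, 0 < eps -> Cmod (z - w) <= K * eps) -> z = w.
Proof.
  intros H. apply Ceq_minus, Cmod_eq_0.
  assert (H0 := Cmod_ge_0 (z - w)).
  destruct (Rle_lt_or_eq_dec _ _ H0) as [Hp | <-]; auto.
  exfalso. destruct (Rle_dec K 0).
  - specialize (H 1 Rlt_0_1). nra.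
  - specialize (H (Cmod (z - w) / (2 * K))).
    assert (0 < Cmod (z - w) / (2 * K)) by (apply Rdiv_lt_0_compat; lra).
    specialize (H H1). replace (K * (Cmod (z - w) / (2 * K))) with (Cmod (z - w) / 2) in H by (field; lra).
    lra.
Qed.

(** * Complex and real derivatives of complex-valued functions *)

(** The difference quotient is cleared of its denominator, so that the increment [h = 0] needs no
    separate treatment. *)
Definition cderiv (f : C -> C) (z d : C) : Prop :=
  forall eps, 0 < eps -> exists del, 0 < del /\
    forall h, Cmod h < del -> Cmod (f (z + h) - f z - d * h)%C <= eps * Cmod h.

Definition rderiv (f : R -> C) (t : R) (d : C) : Prop :=
  forall eps, 0 < eps -> exists del, 0 < del /\
    forall h : R, Rabs h < del -> Cmod (f (t + h)%R - f t - d * h)%C <= eps * Rabs h.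

Definition ccont (f : C -> C) (z : C) : Prop :=
  forall eps, 0 < eps -> exists del, 0 < del /\
    forall h, Cmod h < del -> Cmod (f (z + h) - f z)%C < eps.

Definition rcont (f : R -> C) (t : R) : Prop :=
  forall eps, 0 < eps -> exists del, 0 < del /\
    forall h : R, Rabs h < del -> Cmod (f (t + h)%R - f t)%C < eps.

(** Through this bridge the general differentiation rules carry over to the epsilon form; the
    product with [d] is commuted because [is_derive] scales from the left. *)
Lemma cderiv_is_derive (f : C -> C) (z d : C) :
  is_derive (K := C_AbsRing) (V := AbsRing_NormedModule C_AbsRing) f z d <-> cderiv f z d.
Proof.
  split.
  - intros [_ H] eps He.
    specialize (H z (fun P Q => Q)). simpl in H.
    destruct (H (mkposreal eps He)) as [del Hd].
    exists del. split; [apply del|]. intros h Hh.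
    specialize (Hd (z + h)%C).
    assert (Hb : ball (M := AbsRing_UniformSpace C_AbsRing) z del (z + h)%C).
    { change (Cmod ((z + h) - z) < del). replace (z + h - z)%C with h by ring. auto. }
    specialize (Hd Hb). simpl in Hd.
    change (Cmod ((f (z + h) - f z) - (z + h - z) * d)%C <= eps * Cmod (z + h - z)%C) in Hd.
    replace (z + h - z)%C with h in Hd by ring.
    replace (f (z + h) - f z - d * h)%C with (f (z + h) - f z - h * d)%C by ring. auto.
  - intros H. split.
    + apply (is_linear_scal_l (K := C_AbsRing) (V := AbsRing_NormedModule C_AbsRing)).
    + intros x Hx. apply (is_filter_lim_locally_unique (V := AbsRing_NormedModule C_AbsRing) z x) in Hx. rewrite <- Hx. clear x Hx.
      intros eps. destruct (H eps (cond_pos eps)) as [del [Hd0 Hd]].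
      exists (mkposreal del Hd0). refine (fun (y : C) Hy => _).
      change (Cmod (y - z) < del) in Hy.
      specialize (Hd _ Hy). replace (z + (y - z))%C with y in Hd by ring.
      change (Cmod ((f y - f z) - (y - z) * d)%C <= eps * Cmod (y - z)%C).
      replace (f y - f z - (y - z) * d)%C with (f y - f z - d * (y - z))%C by ring. auto.
Qed.

Lemma cderiv_ext (f g : C -> C) (z d : C) :
  (forall w, f w = g w) -> cderiv f z d -> cderiv g z d.
Proof. intros H Hf eps He. destruct (Hf eps He) as [del [H1 H2]]. exists del; split; auto.
  intros h Hh. rewrite <- !H. auto. Qed.

Lemma cderiv_ext_near (f g : C -> C) (z d : C) (r : R) :
  0 < r -> (forall w, Cmod (w - z) < r -> f w = g w) -> cderiv f z d -> cderiv g z d.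
Proof. intros Hr H Hf eps He. destruct (Hf eps He) as [del [H1 H2]].
  exists (Rmin del r); split. apply Rmin_pos; auto.
  intros h Hh. generalize (Rmin_l del r) (Rmin_r del r); intros.
  rewrite <- !H. apply H2; lra.
  replace (z - z)%C with (RtoC 0) by ring. rewrite Cmod_0; auto.
  replace (z + h - z)%C with h by ring. lra. Qed.

Lemma cderiv_eq (f : C -> C) (z d d' : C) : d = d' -> cderiv f z d -> cderiv f z d'.
Proof. intros ->; auto. Qed.

Lemma cderiv_const (c z : C) : cderiv (fun _ => c) z 0.
Proof. apply cderiv_is_derive. apply (is_derive_const (K := C_AbsRing) (V := AbsRing_NormedModule C_AbsRing)). Qed.

Lemma cderiv_id (z : C) : cderiv (fun w => w) z 1.
Proof. apply cderiv_is_derive. apply (is_derive_id (K := C_AbsRing)). Qed.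

Lemma cderiv_plus (f g : C -> C) (z df dg : C) :
  cderiv f z df -> cderiv g z dg -> cderiv (fun w => f w + g w)%C z (df + dg)%C.
Proof. rewrite <- !cderiv_is_derive. intros. apply (is_derive_plus (K := C_AbsRing) (V := AbsRing_NormedModule C_AbsRing) f g z df dg); auto. Qed.

Lemma cderiv_opp (f : C -> C) (z df : C) :
  cderiv f z df -> cderiv (fun w => - f w)%C z (- df)%C.
Proof. rewrite <- !cderiv_is_derive. intros. apply (is_derive_opp (K := C_AbsRing) (V := AbsRing_NormedModule C_AbsRing) f z df); auto. Qed.

Lemma cderiv_minus (f g : C -> C) (z df dg : C) :
  cderiv f z df -> cderiv g z dg -> cderiv (fun w => f w - g w)%C z (df - dg)%C.
Proof. intros. apply cderiv_plus; auto. apply cderiv_opp; auto. Qed.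

Lemma cderiv_mult (f g : C -> C) (z df dg : C) :
  cderiv f z df -> cderiv g z dg -> cderiv (fun w => f w * g w)%C z (df * g z + f z * dg)%C.
Proof. rewrite <- !cderiv_is_derive. intros.
  apply (is_derive_mult (K := C_AbsRing) f g z df dg); auto. intros; apply Cmult_comm. Qed.

Lemma cderiv_scal (c : C) (f : C -> C) (z df : C) :
  cderiv f z df -> cderiv (fun w => c * f w)%C z (c * df)%C.
Proof. intros H. eapply cderiv_eq; [|apply cderiv_mult; [apply cderiv_const|apply H]]. simpl. ring. Qed.

Lemma cderiv_comp (f g : C -> C) (z df dg : C) :
  cderiv f (g z) df -> cderiv g z dg -> cderiv (fun w => f (g w)) z (df * dg)%C.
Proof. rewrite <- !cderiv_is_derive. intros. rewrite Cmult_comm.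
  apply (is_derive_comp (K := C_AbsRing) (V := AbsRing_NormedModule C_AbsRing) f g z df dg); auto. Qed.

Lemma cderiv_ccont (f : C -> C) (z d : C) : cderiv f z d -> ccont f z.
Proof.
  intros H eps He. destruct (H 1 Rlt_0_1) as [del [Hd0 Hd]].
  exists (Rmin del (eps / (2 + Cmod d))).
  assert (0 <= Cmod d) by apply Cmod_ge_0.
  split. apply Rmin_pos; auto. apply Rdiv_lt_0_compat; lra.
  intros h Hh. generalize (Rmin_l del (eps / (2 + Cmod d))) (Rmin_r del (eps / (2 + Cmod d))); intros.
  specialize (Hd h ltac:(lra)).
  generalize (Cmod_triangle_sub (f (z + h) - f z)%C (d * h)%C). rewrite Cmod_mult. intros.
  assert (Cmod h * (2 + Cmod d) < eps).
  { apply Rlt_le_trans with (eps / (2 + Cmod d) * (2 + Cmod d)).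
    apply Rmult_lt_compat_r; lra. right; field; lra. }
  assert (0 <= Cmod h) by apply Cmod_ge_0.
  nra.
Qed.

Lemma cderiv_inv (f : C -> C) (z df : C) :
  f z <> 0%C -> cderiv f z df -> cderiv (fun w => / f w)%C z (- df / (f z * f z))%C.
Proof.
  intros Hz Hf.
  eapply cderiv_eq; [|apply (cderiv_comp (fun w => / w)%C f z (- / (f z * f z))%C df); auto].
  { field; auto. }
  set (u := f z) in *.
  assert (Hu : 0 < Cmod u) by (apply Cmod_gt_0; auto).
  intros eps He.
  (* The first bound keeps [|u + h|] above [|u| / 2]. The remainder [h^2 / (u^2 (u + h))] is then at
     most [2 |h|^2 / |u|^3], which the second bound makes at most [eps |h|]. *)
  exists (Rmin (Cmod u / 2) (eps * (Cmod u * Cmod u * Cmod u) / 2)).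
  split. { apply Rmin_pos; [lra|]. apply Rdiv_lt_0_compat; [|lra]. repeat apply Rmult_lt_0_compat; auto. }
  intros h Hh.
  generalize (Rmin_l (Cmod u / 2) (eps * (Cmod u * Cmod u * Cmod u) / 2))
    (Rmin_r (Cmod u / 2) (eps * (Cmod u * Cmod u * Cmod u) / 2)); intros.
  generalize (Cmod_triangle_sub u (u + h)%C).
  replace (u - (u + h))%C with (- h)%C by ring. rewrite Cmod_opp. intros.
  assert (H2 : Cmod u / 2 < Cmod (u + h)%C) by lra.
  assert (Huh : (u + h)%C <> 0%C) by (apply Cmod_gt_0; lra).
  replace (/ (u + h) - / u - - / (u * u) * h)%C with (h * h / (u * u * (u + h)))%C
    by (field; auto).
  rewrite Cmod_div, !Cmod_mult by (repeat apply Cmult_neq_0; auto).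
  assert (0 <= Cmod h) by apply Cmod_ge_0.
  apply Rle_div_l. { repeat apply Rmult_lt_0_compat; lra. }
  apply Rle_trans with (eps * Cmod h * (Cmod u * Cmod u * (Cmod u / 2))).
  - replace (eps * Cmod h * (Cmod u * Cmod u * (Cmod u / 2))) with (Cmod h * (eps * (Cmod u * Cmod u * Cmod u) / 2)) by field.
    apply Rmult_le_compat_l; lra.
  - apply Rmult_le_compat_l. nra. apply Rmult_le_compat_l; nra.
Qed.

Lemma cderiv_unique (f : C -> C) (z d d' : C) : cderiv f z d -> cderiv f z d' -> d = d'.
Proof.
  intros H H'. apply (Ceq_of_small d d' 2). intros eps He.
  destruct (H eps He) as [r [Hr Hd]]. destruct (H' eps He) as [r' [Hr' Hd']].
  set (h := Rmin r r' / 2).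
  assert (0 < h < r /\ h < r') as [[? ?] ?].
  { unfold h. generalize (Rmin_l r r') (Rmin_r r r') (Rmin_pos r r' Hr Hr'); intros. lra. }
  specialize (Hd h). specialize (Hd' h). rewrite Cmod_RtoC_nonneg in Hd, Hd' by lra.
  specialize (Hd ltac:(lra)). specialize (Hd' ltac:(lra)).
  generalize (Cmod_minus_le (f (z + h) - f z - d' * h)%C (f (z + h) - f z - d * h)%C). intros Ht.
  replace (f (z + h) - f z - d' * h - (f (z + h) - f z - d * h))%C with ((d - d') * h)%C in Ht by ring.
  rewrite Cmod_mult, (Cmod_RtoC_nonneg h) in Ht by lra.
  apply Rmult_le_reg_r with h; lra.
Qed.

Lemma entire_iff (F : C -> C) : entire F <-> exists F', forall z, cderiv F z (F' z).
Proof.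
  split.
  - intros H. apply (choice _ _ (fun z d => cderiv F z d)). intros z.
    destruct (H z) as [d Hd]. exists d. apply cderiv_is_derive; auto.
  - intros [F' H] z. exists (F' z). apply cderiv_is_derive; auto.
Qed.

Lemma ccont_plus (f g : C -> C) z : ccont f z -> ccont g z -> ccont (fun w => f w + g w)%C z.
Proof. intros Hf Hg eps He.
  destruct (Hf (eps/2) ltac:(lra)) as [r [Hr H]]. destruct (Hg (eps/2) ltac:(lra)) as [s [Hs H']].
  exists (Rmin r s). split. apply Rmin_pos; auto.
  intros h Hh. generalize (Rmin_l r s) (Rmin_r r s); intros.
  replace (f (z + h) + g (z + h) - (f z + g z))%C with ((f (z + h) - f z) + (g (z + h) - g z))%C by ring.
  eapply Rle_lt_trans; [apply Cmod_triangle|]. specialize (H h ltac:(lra)). specialize (H' h ltac:(lra)). lra. Qed.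

Lemma rderiv_Re (f : R -> C) t d : rderiv f t d -> is_derive (fun s => Re (f s)) t (Re d).
Proof.
  intros H. apply is_derive_Reals. intros eps He.
  destruct (H (eps / 2) ltac:(lra)) as [del [Hd0 Hd]].
  exists (mkposreal del Hd0). intros h Hh0 Hh. simpl in Hh.
  specialize (Hd h Hh).
  assert (Hr := re_le_Cmod (f (t + h)%R - f t - d * h)%C).
  replace ((Re (f (t + h)) - Re (f t)) / h - Re d) with (Re (f (t + h)%R - f t - d * h)%C / h).
  2: { unfold Cminus. rewrite !re_plus, !re_opp, re_scal_r. field; auto. }
  rewrite Rabs_div by auto. assert (0 < Rabs h) by (apply Rabs_pos_lt; auto).
  apply Rlt_div_l; auto. nra.
Qed.

Lemma rderiv_Im (f : R -> C) t d : rderiv f t d -> is_derive (fun s => Im (f s)) t (Im d).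
Proof.
  intros H. apply is_derive_Reals. intros eps He.
  destruct (H (eps / 2) ltac:(lra)) as [del [Hd0 Hd]].
  exists (mkposreal del Hd0). intros h Hh0 Hh. simpl in Hh.
  specialize (Hd h Hh).
  assert (Hr := Im_le_Cmod (f (t + h)%R - f t - d * h)%C).
  replace ((Im (f (t + h)) - Im (f t)) / h - Im d) with (Im (f (t + h)%R - f t - d * h)%C / h).
  2: { unfold Cminus. rewrite !im_plus, !im_opp, im_scal_r. field; auto. }
  rewrite Rabs_div by auto. assert (0 < Rabs h) by (apply Rabs_pos_lt; auto).
  apply Rlt_div_l; auto. nra.
Qed.

Lemma rderiv_intro (f : R -> C) t d :
  is_derive (fun s => Re (f s)) t (Re d) -> is_derive (fun s => Im (f s)) t (Im d) -> rderiv f t d.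
Proof.
  intros H1 H2 eps He. apply is_derive_Reals in H1, H2.
  destruct (H1 (eps / 2) ltac:(lra)) as [r Hr]. destruct (H2 (eps / 2) ltac:(lra)) as [s Hs].
  exists (Rmin r s). split. apply Rmin_pos; apply cond_pos.
  intros h Hh. generalize (Rmin_l r s) (Rmin_r r s); intros.
  destruct (Req_dec h 0) as [-> | Hn].
  { rewrite Rplus_0_r. replace (f t - f t - d * 0)%C with (RtoC 0) by ring. rewrite Cmod_0, Rabs_R0. lra. }
  specialize (Hr h Hn ltac:(lra)). specialize (Hs h Hn ltac:(lra)).
  assert (0 < Rabs h) by (apply Rabs_pos_lt; auto).
  eapply Rle_trans; [apply Cmod_le_abs|].
  unfold Cminus. rewrite !re_plus, !re_opp, re_scal_r, !im_plus, !im_opp, im_scal_r.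
  replace (Re (f (t + h)) + - Re (f t) + - (Re d * h)) with (((Re (f (t + h)) - Re (f t)) / h - Re d) * h) by (field; auto).
  replace (Im (f (t + h)) + - Im (f t) + - (Im d * h)) with (((Im (f (t + h)) - Im (f t)) / h - Im d) * h) by (field; auto).
  rewrite !Rabs_mult. nra.
Qed.

Lemma rderiv_eq (f : R -> C) t d d' : d = d' -> rderiv f t d -> rderiv f t d'.
Proof. intros ->; auto. Qed.

Lemma rderiv_comp (f : C -> C) (g : R -> C) t df dg :
  cderiv f (g t) df -> rderiv g t dg -> rderiv (fun s => f (g s)) t (df * dg)%C.
Proof.
  intros Hf Hg eps He.
  assert (Pdf := Cmod_ge_0 df). assert (Pdg := Cmod_ge_0 dg).
  (* [e1] controls the outer error, because [|k| <= (1 + |dg|) |h|], and [e2] the inner error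
     multiplied by [|df|]; each contributes [eps / 2]. *)
  set (e1 := eps / (2 * (2 + Cmod dg))). set (e2 := Rmin 1 (eps / (2 * (1 + Cmod df)))).
  assert (He1 : 0 < e1) by (apply Rdiv_lt_0_compat; lra).
  assert (He2 : 0 < e2) by (apply Rmin_pos; [lra|apply Rdiv_lt_0_compat; lra]).
  destruct (Hf e1 He1) as [r [Hr H1]]. destruct (Hg e2 He2) as [s [Hs H2]].
  set (r' := r / (2 + Cmod dg)). assert (0 < r') by (apply Rdiv_lt_0_compat; lra).
  exists (Rmin r' s). split; [apply Rmin_pos; auto|].
  intros h Hh. generalize (Rmin_l r' s) (Rmin_r r' s); intros.
  specialize (H2 h ltac:(lra)).
  set (k := (g (t + h)%R - g t)%C).
  assert (Hk : Cmod (k - dg * h) <= e2 * Rabs h) by apply H2.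
  assert (Ph := Rabs_pos h).
  assert (e2 <= 1) by apply Rmin_l.
  assert (Hk2 : Cmod k <= (1 + Cmod dg) * Rabs h).
  { generalize (Cmod_triangle_sub k (dg * h)%C). rewrite Cmod_mult, Cmod_R. nra. }
  assert (Hk3 : Cmod k < r).
  { assert (Rabs h * (2 + Cmod dg) < r).
    { apply Rlt_le_trans with (r' * (2 + Cmod dg)). apply Rmult_lt_compat_r; lra. unfold r'; right; field; lra. }
    nra. }
  specialize (H1 k Hk3).
  replace (g t + k)%C with (g (t + h)%R) in H1 by (unfold k; ring).
  replace (f (g (t + h)%R) - f (g t) - df * dg * h)%C
    with ((f (g (t + h)%R) - f (g t) - df * k) + df * (k - dg * h))%C by ring.
  eapply Rle_trans; [apply Cmod_triangle|]. rewrite Cmod_mult.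
  assert (e1 * (2 * (2 + Cmod dg)) = eps) by (unfold e1; field; lra).
  assert (e2 * (2 * (1 + Cmod df)) <= eps).
  { apply Rle_trans with (eps / (2 * (1 + Cmod df)) * (2 * (1 + Cmod df))).
    apply Rmult_le_compat_r; [lra|apply Rmin_r]. right; field; lra. }
  assert (e1 * Cmod k <= eps / 2 * Rabs h) by nra.
  assert (Cmod df * Cmod (k - dg * h) <= eps / 2 * Rabs h).
  { apply Rle_trans with (Cmod df * (e2 * Rabs h)). apply Rmult_le_compat_l; auto. nra. }
  lra.
Qed.

Lemma rderiv_line (w u : C) (t : R) : rderiv (fun s : R => w + s * u)%C t u.
Proof.
  intros eps He. exists 1; split; [lra|]. intros h _.
  rewrite RtoC_plus. replace (w + (t + h) * u - (w + t * u) - u * h)%C with (RtoC 0) by ring.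
  rewrite Cmod_0. generalize (Rabs_pos h); nra.
Qed.

Lemma rderiv_mult (f g : R -> C) t df dg :
  rderiv f t df -> rderiv g t dg -> rderiv (fun s => f s * g s)%C t (df * g t + f t * dg)%C.
Proof.
  intros Hf Hg. assert (F1 := rderiv_Re _ _ _ Hf). assert (F2 := rderiv_Im _ _ _ Hf).
  assert (G1 := rderiv_Re _ _ _ Hg). assert (G2 := rderiv_Im _ _ _ Hg).
  apply rderiv_intro.
  - apply (is_derive_ext (fun s => Re (f s) * Re (g s) - Im (f s) * Im (g s))).
    { intros; rewrite re_mult; auto. }
    evar_last. apply @is_derive_minus; apply @is_derive_mult; eauto; intros; apply Rmult_comm.
    rewrite re_plus, !re_mult. unfold minus, plus, opp, mult; simpl. ring.
  - apply (is_derive_ext (fun s => Re (f s) * Im (g s) + Im (f s) * Re (g s))).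
    { intros; rewrite im_mult; auto. }
    evar_last. apply @is_derive_plus; apply @is_derive_mult; eauto; intros; apply Rmult_comm.
    rewrite im_plus, !im_mult. unfold minus, plus, opp, mult; simpl. ring.
Qed.

Lemma rderiv_rcont (f : R -> C) t d : rderiv f t d -> rcont f t.
Proof.
  intros H eps He. destruct (H 1 Rlt_0_1) as [del [Hd0 Hd]].
  exists (Rmin del (eps / (2 + Cmod d))).
  assert (0 <= Cmod d) by apply Cmod_ge_0.
  split. apply Rmin_pos; auto. apply Rdiv_lt_0_compat; lra.
  intros h Hh. generalize (Rmin_l del (eps / (2 + Cmod d))) (Rmin_r del (eps / (2 + Cmod d))); intros.
  specialize (Hd h ltac:(lra)).
  generalize (Cmod_triangle_sub (f (t + h)%R - f t)%C (d * h)%C). rewrite Cmod_mult, Cmod_R. intros.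
  assert (Rabs h * (2 + Cmod d) < eps).
  { apply Rlt_le_trans with (eps / (2 + Cmod d) * (2 + Cmod d)).
    apply Rmult_lt_compat_r; lra. right; field; lra. }
  generalize (Rabs_pos h); nra.
Qed.

Lemma rcont_comp (f : C -> C) (g : R -> C) t : ccont f (g t) -> rcont g t -> rcont (fun s => f (g s)) t.
Proof.
  intros Hf Hg eps He. destruct (Hf eps He) as [r [Hr H]]. destruct (Hg r Hr) as [s [Hs H']].
  exists s; split; auto. intros h Hh. specialize (H _ (H' h Hh)).
  replace (g t + (g (t + h)%R - g t))%C with (g (t + h)%R) in H by ring. auto.
Qed.

Lemma rcont_Re (f : R -> C) t : rcont f t -> continuous (fun s => Re (f s)) t.
Proof.
  intros H. apply continuity_pt_filterlim. intros eps He.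
  destruct (H eps He) as [del [Hd0 Hd]]. exists del; split; auto.
  refine (fun (x : R) HH => _). destruct HH as [_ Hx]. change (Rabs (x - t) < del) in Hx. change (Rabs (Re (f x) - Re (f t)) < eps).
  specialize (Hd (x - t) Hx). replace (t + (x - t)) with x in Hd by ring.
  assert (Hr := re_le_Cmod (f x - f t)%C). unfold Cminus in Hr, Hd. rewrite re_plus, re_opp in Hr.
  unfold Rminus. lra.
Qed.

Lemma rcont_Im (f : R -> C) t : rcont f t -> continuous (fun s => Im (f s)) t.
Proof.
  intros H. apply continuity_pt_filterlim. intros eps He.
  destruct (H eps He) as [del [Hd0 Hd]]. exists del; split; auto.
  refine (fun (x : R) HH => _). destruct HH as [_ Hx]. change (Rabs (x - t) < del) in Hx. change (Rabs (Im (f x) - Im (f t)) < eps).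
  specialize (Hd (x - t) Hx). replace (t + (x - t)) with x in Hd by ring.
  assert (Hr := Im_le_Cmod (f x - f t)%C). unfold Cminus in Hr, Hd. rewrite im_plus, im_opp in Hr.
  unfold Rminus. lra.
Qed.

Lemma rcont_intro (f : R -> C) t :
  continuous (fun s => Re (f s)) t -> continuous (fun s => Im (f s)) t -> rcont f t.
Proof.
  intros H1 H2. apply continuity_pt_filterlim in H1, H2. intros eps He.
  destruct (H1 (eps/2) ltac:(lra)) as [r [Hr H3]]. destruct (H2 (eps/2) ltac:(lra)) as [s [Hs H4]].
  exists (Rmin r s). split; [apply Rmin_pos; auto|]. intros h Hh.
  generalize (Rmin_l r s) (Rmin_r r s); intros.
  destruct (Req_dec h 0) as [-> | Hn].
  { rewrite Rplus_0_r. replace (f t - f t)%C with (RtoC 0) by ring. rewrite Cmod_0; auto. }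
  assert (D : D_x no_cond t (t + h)) by (split; [exact I|lra]).
  assert (E : Rabs (t + h - t) = Rabs h) by (f_equal; ring).
  assert (Dr : Rabs (t + h - t) < r) by lra. assert (Ds : Rabs (t + h - t) < s) by lra.
  specialize (H3 (t + h) (conj D Dr)). specialize (H4 (t + h) (conj D Ds)).
  change (Rabs (Re (f (t + h)) - Re (f t)) < eps / 2) in H3.
  change (Rabs (Im (f (t + h)) - Im (f t)) < eps / 2) in H4.
  eapply Rle_lt_trans; [apply Cmod_le_abs|]. unfold Cminus. rewrite re_plus, re_opp, im_plus, im_opp.
  unfold Rminus in *. lra.
Qed.

Lemma rcont_const c t : rcont (fun _ => c) t.
Proof. apply rcont_intro; apply continuous_const. Qed.

Lemma rcont_plus (f g : R -> C) t : rcont f t -> rcont g t -> rcont (fun s => f s + g s)%C t.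
Proof. intros Hf Hg. apply rcont_intro.
  - apply (continuous_ext (fun s => Re (f s) + Re (g s))). intros; rewrite re_plus; auto.
    apply (continuous_plus (V := R_NormedModule)); apply rcont_Re; auto.
  - apply (continuous_ext (fun s => Im (f s) + Im (g s))). intros; rewrite im_plus; auto.
    apply (continuous_plus (V := R_NormedModule)); apply rcont_Im; auto. Qed.

Lemma rcont_opp (f : R -> C) t : rcont f t -> rcont (fun s => - f s)%C t.
Proof. intros H eps He. destruct (H eps He) as [d [Hd H']]. exists d; split; auto. intros h Hh.
  specialize (H' h Hh). rewrite <- Cmod_opp in H'.
  replace (- f (t + h)%R - - f t)%C with (- (f (t + h)%R - f t))%C by ring. auto. Qed.

Lemma rcont_minus (f g : R -> C) t : rcont f t -> rcont g t -> rcont (fun s => f s - g s)%C t.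
Proof. intros. apply rcont_plus; auto. apply rcont_opp; auto. Qed.

Lemma rcont_mult (f g : R -> C) t : rcont f t -> rcont g t -> rcont (fun s => f s * g s)%C t.
Proof. intros Hf Hg. apply rcont_intro.
  - apply (continuous_ext (fun s => Re (f s) * Re (g s) - Im (f s) * Im (g s))). intros; rewrite re_mult; auto.
    apply (continuous_minus (V := R_NormedModule)); apply (continuous_mult (K := R_AbsRing));
      try apply rcont_Re; try apply rcont_Im; auto.
  - apply (continuous_ext (fun s => Re (f s) * Im (g s) + Im (f s) * Re (g s))). intros; rewrite im_mult; auto.
    apply (continuous_plus (V := R_NormedModule)); apply (continuous_mult (K := R_AbsRing));
      try apply rcont_Re; try apply rcont_Im; auto. Qed.

(** * Integrals of complex-valued functions of a real variable *)

Definition CInt (f : R -> C) (a b : R) : C := (RInt (fun t => Re (f t)) a b, RInt (fun t => Im (f t)) a b).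

Lemma CInt_Re (f : R -> C) a b : Re (CInt f a b) = RInt (fun t => Re (f t)) a b.
Proof. reflexivity. Qed.

Lemma CInt_Im (f : R -> C) a b : Im (CInt f a b) = RInt (fun t => Im (f t)) a b.
Proof. reflexivity. Qed.

Lemma ex_RInt_cont (f : R -> R) a b : (forall t, continuous f t) -> ex_RInt f a b.
Proof. intros H. apply (ex_RInt_continuous (V := R_CompleteNormedModule)). intros; apply H. Qed.

Lemma CInt_ext (f g : R -> C) a b : (forall t, Rmin a b < t < Rmax a b -> f t = g t) -> CInt f a b = CInt g a b.
Proof. intros H. unfold CInt. f_equal; apply RInt_ext; intros; rewrite H; auto. Qed.

Lemma CInt_plus (f g : R -> C) a b : (forall t, rcont f t) -> (forall t, rcont g t) ->
  CInt (fun t => f t + g t)%C a b = (CInt f a b + CInt g a b)%C.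
Proof.
  intros Hf Hg. apply C_ext; rewrite ?re_plus, ?im_plus, ?re_mult, ?im_mult, ?CInt_Re, ?CInt_Im.
  - rewrite <- (RInt_plus (V := R_CompleteNormedModule)). apply RInt_ext; intros; rewrite re_plus; auto.
    apply ex_RInt_cont; intros; apply rcont_Re; auto. apply ex_RInt_cont; intros; apply rcont_Re; auto.
  - rewrite <- (RInt_plus (V := R_CompleteNormedModule)). apply RInt_ext; intros; rewrite im_plus; auto.
    apply ex_RInt_cont; intros; apply rcont_Im; auto. apply ex_RInt_cont; intros; apply rcont_Im; auto.
Qed.

Lemma CInt_scal (c : C) (f : R -> C) a b : (forall t, rcont f t) ->
  CInt (fun t => c * f t)%C a b = (c * CInt f a b)%C.
Proof.
  intros Hf.
  assert (E1 : forall k, ex_RInt (fun t => k * Re (f t)) a b).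
  { intros; apply (ex_RInt_scal (V := R_NormedModule)), ex_RInt_cont; intros; apply rcont_Re; auto. }
  assert (E2 : forall k, ex_RInt (fun t => k * Im (f t)) a b).
  { intros; apply (ex_RInt_scal (V := R_NormedModule)), ex_RInt_cont; intros; apply rcont_Im; auto. }
  assert (S1 : forall k, RInt (fun t => k * Re (f t)) a b = k * RInt (fun t => Re (f t)) a b).
  { intros; apply (RInt_scal (V := R_CompleteNormedModule)), ex_RInt_cont; intros; apply rcont_Re; auto. }
  assert (S2 : forall k, RInt (fun t => k * Im (f t)) a b = k * RInt (fun t => Im (f t)) a b).
  { intros; apply (RInt_scal (V := R_CompleteNormedModule)), ex_RInt_cont; intros; apply rcont_Im; auto. }
  apply C_ext; rewrite ?re_plus, ?im_plus, ?re_mult, ?im_mult, ?CInt_Re, ?CInt_Im.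
  - rewrite (RInt_ext _ (fun t => Re c * Re (f t) - Im c * Im (f t))) by (intros; rewrite re_mult; auto).
    rewrite (RInt_minus (V := R_CompleteNormedModule)) by auto. rewrite S1, S2. reflexivity.
  - rewrite (RInt_ext _ (fun t => Re c * Im (f t) + Im c * Re (f t))) by (intros; rewrite im_mult; auto).
    rewrite (RInt_plus (V := R_CompleteNormedModule)) by auto. rewrite S1, S2. reflexivity.
Qed.

Lemma CInt_opp (f : R -> C) a b : (forall t, rcont f t) -> CInt (fun t => - f t)%C a b = (- CInt f a b)%C.
Proof. intros H. rewrite (CInt_ext _ (fun t => (-(1)) * f t)%C) by (intros; ring).
  rewrite CInt_scal; auto. ring. Qed.

Lemma CInt_minus (f g : R -> C) a b : (forall t, rcont f t) -> (forall t, rcont g t) ->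
  CInt (fun t => f t - g t)%C a b = (CInt f a b - CInt g a b)%C.
Proof. intros. unfold Cminus. rewrite CInt_plus, CInt_opp; auto. intros; apply rcont_opp; auto. Qed.

Lemma CInt_const (c : C) a b : CInt (fun _ => c) a b = (c * (b - a)%R)%C.
Proof. apply C_ext; unfold CInt; simpl; rewrite RInt_const; unfold scal; simpl; unfold mult; simpl; unfold Re, Im; simpl; ring. Qed.

Lemma CInt_Chasles (f : R -> C) a b c : (forall t, rcont f t) -> (CInt f a b + CInt f b c)%C = CInt f a c.
Proof.
  intros Hf. apply C_ext; rewrite ?re_plus, ?im_plus, ?re_mult, ?im_mult, ?CInt_Re, ?CInt_Im.
  - apply (RInt_Chasles (V := R_CompleteNormedModule)); apply ex_RInt_cont; intros; apply rcont_Re; auto.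
  - apply (RInt_Chasles (V := R_CompleteNormedModule)); apply ex_RInt_cont; intros; apply rcont_Im; auto.
Qed.

Lemma CInt_swap (f : R -> C) a b : (forall t, rcont f t) -> CInt f b a = (- CInt f a b)%C.
Proof. intros Hf. assert (H := CInt_Chasles f b a b Hf). assert (H0 : CInt f b b = 0%C).
  { apply C_ext; unfold CInt; simpl; apply (RInt_point (V := R_CompleteNormedModule)). }
  rewrite H0 in H. replace (CInt f b a) with (CInt f b a + CInt f a b - CInt f a b)%C by ring. rewrite H. ring. Qed.

Lemma CInt_FTC (f d : R -> C) a b : (forall t, rderiv f t (d t)) -> (forall t, rcont d t) ->
  CInt d a b = (f b - f a)%C.
Proof.
  intros Hf Hd. apply C_ext; unfold Cminus; rewrite ?re_plus, ?im_plus, ?re_opp, ?im_opp, ?CInt_Re, ?CInt_Im.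
  - apply is_RInt_unique, (is_RInt_derive (V := R_CompleteNormedModule) (fun t => Re (f t))); intros.
    apply rderiv_Re; auto. apply rcont_Re; auto.
  - apply is_RInt_unique, (is_RInt_derive (V := R_CompleteNormedModule) (fun t => Im (f t))); intros.
    apply rderiv_Im; auto. apply rcont_Im; auto.
Qed.

(** Multiplication by the conjugate of the integral [S] rotates it onto the nonnegative axis, where
    real integrals can be compared; this gives [|S|^2 <= |S| RInt g]. *)
Lemma CInt_le (f : R -> C) (g : R -> R) a b : a <= b -> (forall t, rcont f t) -> (forall t, continuous g t) ->
  (forall t, a <= t <= b -> Cmod (f t) <= g t) -> Cmod (CInt f a b) <= RInt g a b.
Proof.
  intros Hab Hf Hg Hle. set (S := CInt f a b).
  assert (HS := Cmod_ge_0 S).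
  assert (Hscal := CInt_scal (Cconj S) f a b Hf). fold S in Hscal.
  assert (Hc : forall t, rcont (fun t => Cconj S * f t)%C t) by (intros; apply rcont_mult; auto; apply rcont_const).
  assert (E : Cmod S * Cmod S <= Cmod S * RInt g a b).
  { replace (Cmod S * Cmod S) with (Re (Cconj S * S)%C).
    2: { rewrite Cmod_sq, re_mult, re_conj, im_conj. ring. }
    rewrite <- Hscal, CInt_Re.
    rewrite <- (RInt_scal (V := R_CompleteNormedModule)) by (apply ex_RInt_cont; auto).
    apply RInt_le; auto.
    - apply ex_RInt_cont; intros; apply (rcont_Re (fun t => Cconj S * f t)%C); auto.
    - apply (ex_RInt_scal (V := R_NormedModule)), ex_RInt_cont; auto.
    - intros t Ht. eapply Rle_trans; [apply Rle_abs|]. eapply Rle_trans; [apply (re_le_Cmod (Cconj S * f t)%C)|].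
      rewrite Cmod_mult, Cmod_conj. unfold scal; simpl; unfold mult; simpl.
      apply Rmult_le_compat_l; auto. apply Hle; lra. }
  destruct (Rle_lt_or_eq_dec _ _ HS) as [Hp | H0].
  - apply Rmult_le_reg_l with (Cmod S); auto.
  - rewrite <- H0. apply Rle_trans with (RInt (fun _ => 0) a b).
    rewrite RInt_const. unfold scal; simpl; unfold mult; simpl. lra.
    apply RInt_le; auto. apply ex_RInt_const. apply ex_RInt_cont; auto.
    intros; eapply Rle_trans; [apply Cmod_ge_0|apply Hle; lra].
Qed.

Lemma CInt_le_const (f : R -> C) (M : R) a b : (forall t, rcont f t) ->
  (forall t, Rmin a b <= t <= Rmax a b -> Cmod (f t) <= M) -> Cmod (CInt f a b) <= M * Rabs (b - a).
Proof.
  intros Hf.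
  assert (P : forall a b, a <= b -> (forall t, a <= t <= b -> Cmod (f t) <= M) -> Cmod (CInt f a b) <= M * (b - a)).
  { intros a0 b0 H1 H2. eapply Rle_trans. apply (CInt_le f (fun _ => M)); auto. intros; apply continuous_const.
    rewrite RInt_const. unfold scal; simpl; unfold mult; simpl. lra. }
  intros H. destruct (Rle_dec a b) as [Hab | Hab].
  - rewrite Rabs_pos_eq by lra. apply P; auto. intros; apply H. rewrite Rmin_left, Rmax_right; auto.
  - rewrite CInt_swap, Cmod_opp, Rabs_left by auto || lra.
    replace (- (b - a)) with (a - b) by ring. apply P. lra. intros; apply H. rewrite Rmin_right, Rmax_left; lra.
Qed.

(** The mean value theorem fails for complex values, but it applies to the real part of
    [Cconj S * f], where [S] is the total increment. *)
Lemma rderiv_bound (f d : R -> C) (M : R) : (forall t, 0 <= t <= 1 -> rderiv f t (d t)) ->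
  (forall t, 0 <= t <= 1 -> Cmod (d t) <= M) -> Cmod (f 1 - f 0)%C <= M.
Proof.
  intros Hf HM. set (S := (f 1 - f 0)%C).
  assert (HS := Cmod_ge_0 S).
  assert (HM0 : 0 <= M) by (eapply Rle_trans; [apply Cmod_ge_0| apply (HM 0); lra]).
  destruct (MVT_gen (fun t => Re (Cconj S * f t)%C) 0 1 (fun t => Re (Cconj S * d t)%C)) as [c [Hc He]].
  - rewrite Rmin_left, Rmax_right by lra. intros t Ht. apply (rderiv_Re (fun t => Cconj S * f t)%C).
    apply (rderiv_comp (fun w => Cconj S * w)%C). 2: apply Hf; lra.
    eapply cderiv_eq; [|apply cderiv_scal, cderiv_id]. ring.
  - rewrite Rmin_left, Rmax_right by lra. intros t Ht. apply continuity_pt_filterlim.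
    apply (rcont_Re (fun t => Cconj S * f t)%C).
    apply rcont_mult. apply rcont_const. eapply rderiv_rcont, Hf; lra.
  - rewrite Rmin_left, Rmax_right in Hc by lra.
    rewrite Rminus_0_r, Rmult_1_r in He.
    assert (E : Cmod S * Cmod S = Re (Cconj S * d c)%C).
    { rewrite <- He, Cmod_sq. unfold S at 1 2 3 4. unfold S. unfold Cminus. rewrite !re_mult, !re_conj, !im_conj, !re_plus, !re_opp, !im_plus, !im_opp. ring. }
    assert (Cmod S * Cmod S <= Cmod S * M).
    { rewrite E. eapply Rle_trans; [apply Rle_abs|]. eapply Rle_trans; [apply re_le_Cmod|].
      rewrite Cmod_mult, Cmod_conj. apply Rmult_le_compat_l; auto. }
    destruct (Rle_lt_or_eq_dec _ _ HS) as [Hp | H0]; [|lra].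
    apply Rmult_le_reg_l with (Cmod S); auto.
Qed.

Lemma segment_bound (f f' : C -> C) (z w : C) (M : R) :
  (forall t, 0 <= t <= 1 -> cderiv f (z + RtoC t * (w - z)) (f' (z + RtoC t * (w - z)))%C) ->
  (forall t, 0 <= t <= 1 -> Cmod (f' (z + RtoC t * (w - z))%C) <= M) ->
  Cmod (f w - f z) <= M * Cmod (w - z).
Proof.
  intros Hf HM.
  assert (H := rderiv_bound (fun t : R => f (z + t * (w - z))%C) (fun t : R => f' (z + t * (w - z)) * (w - z))%C (M * Cmod (w - z))).
  simpl in H. replace (z + 1 * (w - z))%C with w in H by ring. replace (z + 0 * (w - z))%C with z in H by ring.
  apply H.
  - intros t Ht. apply (rderiv_comp f). apply Hf; auto. apply rderiv_line.
  - intros t Ht. rewrite Cmod_mult. apply Rmult_le_compat_r; auto. apply Cmod_ge_0.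
Qed.

(** * Bisection and compactness of rectangles *)

Lemma nested_intervals (x : nat -> R) (u : R) : 0 <= u ->
  (forall n, x n <= x (S n) /\ x (S n) + u / 2 ^ S n <= x n + u / 2 ^ n) ->
  exists p, forall n, x n <= p <= x n + u / 2 ^ n.
Proof.
  intros Hu H.
  assert (P : forall n, 0 < 2 ^ n) by (intros; apply pow_lt; lra).
  assert (Q : forall n, 0 <= u / 2 ^ n) by (intros; apply Rmult_le_pos; auto; apply Rlt_le, Rinv_0_lt_compat, P).
  assert (M : forall n m, x n <= x (n + m)%nat /\ x (n + m)%nat + u / 2 ^ (n + m) <= x n + u / 2 ^ n).
  { intros n m. induction m. rewrite Nat.add_0_r. lra. rewrite Nat.add_succ_r. specialize (H (n + m)%nat). lra. }
  assert (M' : forall n m, x m <= x n + u / 2 ^ n).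
  { intros n m. destruct (Nat.le_ge_cases n m) as [L | L].
    - replace m with (n + (m - n))%nat by lia. generalize (M n (m - n)%nat) (Q (n + (m - n))%nat); lra.
    - replace n with (m + (n - m))%nat by lia. generalize (M m (n - m)%nat) (Q (m + (n - m))%nat); lra. }
  destruct (completeness (fun y => exists n, y = x n)) as [p [Hp1 Hp2]].
  - exists (x 0%nat + u / 2 ^ 0). intros y [n ->]. apply M'.
  - exists (x 0%nat). exists 0%nat; auto.
  - exists p. intros n. split. apply Hp1; exists n; auto.
    apply Hp2. intros y [m ->]. apply M'.
Qed.

(** [Bad x y u v] speaks of the rectangle with lower left corner [(x, y)] and sides [u], [v]. Every
    bad rectangle has a bad quarter, and the successive corners form two nested dyadic sequences
    with common point [(p, q)]. *)
Lemma quadrisection (Bad : R -> R -> R -> R -> Prop) (x0 y0 u0 v0 : R) : 0 <= u0 -> 0 <= v0 ->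
  (forall x y u v, Bad x y u v ->
     Bad x y (u / 2) (v / 2) \/ Bad (x + u / 2) y (u / 2) (v / 2) \/
     Bad x (y + v / 2) (u / 2) (v / 2) \/ Bad (x + u / 2) (y + v / 2) (u / 2) (v / 2)) ->
  Bad x0 y0 u0 v0 ->
  exists p q, x0 <= p <= x0 + u0 /\ y0 <= q <= y0 + v0 /\
    forall n : nat, exists x y, Bad x y (u0 / 2 ^ n) (v0 / 2 ^ n) /\
      x0 <= x /\ x + u0 / 2 ^ n <= x0 + u0 /\ y0 <= y /\ y + v0 / 2 ^ n <= y0 + v0 /\
      x <= p <= x + u0 / 2 ^ n /\ y <= q <= y + v0 / 2 ^ n.
Proof.
  intros Hu Hv Hstep H0.
  (* The successor is made total by keeping the corner of a rectangle that is not bad; the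
     generation [n] is part of the state because it determines the sides. *)
  assert (Hs : forall s : R * R * nat, exists t : R * R,
    let '(x, y, n) := s in let '(x', y') := t in
    (x' = x \/ x' = x + u0 / 2 ^ n / 2) /\ (y' = y \/ y' = y + v0 / 2 ^ n / 2) /\
    (Bad x y (u0 / 2 ^ n) (v0 / 2 ^ n) -> Bad x' y' (u0 / 2 ^ n / 2) (v0 / 2 ^ n / 2))).
  { intros [[x y] n]. destruct (classic (Bad x y (u0 / 2 ^ n) (v0 / 2 ^ n))) as [B | B].
    - destruct (Hstep _ _ _ _ B) as [B1 | [B1 | [B1 | B1]]];
        match type of B1 with Bad ?a ?c _ _ => exists (a, c) end; split; auto.
    - exists (x, y). intuition. }
  apply choice in Hs. destruct Hs as [st Hst].
  pose (S_ := fix S_ (n : nat) : R * R := match n with O => (x0, y0) | S m => st (fst (S_ m), snd (S_ m), m) end).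
  assert (Hn : forall n, (fst (S_ (S n)) = fst (S_ n) \/ fst (S_ (S n)) = fst (S_ n) + u0 / 2 ^ n / 2) /\
    (snd (S_ (S n)) = snd (S_ n) \/ snd (S_ (S n)) = snd (S_ n) + v0 / 2 ^ n / 2) /\
    (Bad (fst (S_ n)) (snd (S_ n)) (u0 / 2 ^ n) (v0 / 2 ^ n) ->
     Bad (fst (S_ (S n))) (snd (S_ (S n))) (u0 / 2 ^ n / 2) (v0 / 2 ^ n / 2))).
  { intros n. specialize (Hst (fst (S_ n), snd (S_ n), n)). simpl in Hst. simpl.
    destruct (st (fst (S_ n), snd (S_ n), n)) as [x' y']. exact Hst. }
  assert (E : forall (u : R) n, u / 2 ^ S n = u / 2 ^ n / 2).
  { intros. simpl. field. apply pow_nonzero; lra. }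
  assert (P : forall (u : R) n, 0 <= u -> 0 <= u / 2 ^ n).
  { intros; apply Rmult_le_pos; auto; apply Rlt_le, Rinv_0_lt_compat, pow_lt; lra. }
  assert (Nx : forall n, fst (S_ n) <= fst (S_ (S n)) /\ fst (S_ (S n)) + u0 / 2 ^ S n <= fst (S_ n) + u0 / 2 ^ n).
  { intros n. rewrite E. generalize (P u0 n Hu). destruct (Hn n) as [[-> | ->] _]; lra. }
  assert (Ny : forall n, snd (S_ n) <= snd (S_ (S n)) /\ snd (S_ (S n)) + v0 / 2 ^ S n <= snd (S_ n) + v0 / 2 ^ n).
  { intros n. rewrite E. generalize (P v0 n Hv). destruct (Hn n) as [_ [[-> | ->] _]]; lra. }
  destruct (nested_intervals _ _ Hu Nx) as [p Hp]. destruct (nested_intervals _ _ Hv Ny) as [q Hq].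
  assert (B : forall n, Bad (fst (S_ n)) (snd (S_ n)) (u0 / 2 ^ n) (v0 / 2 ^ n)).
  { induction n. simpl. unfold Rdiv; rewrite Rinv_1, !Rmult_1_r. auto. rewrite !E. apply Hn, IHn. }
  assert (M : forall n, x0 <= fst (S_ n) /\ fst (S_ n) + u0 / 2 ^ n <= x0 + u0 /\
     y0 <= snd (S_ n) /\ snd (S_ n) + v0 / 2 ^ n <= y0 + v0).
  { induction n. simpl; lra. specialize (Nx n). specialize (Ny n). lra. }
  exists p, q. split; [|split].
  - specialize (Hp 0%nat). simpl in Hp. lra.
  - specialize (Hq 0%nat). simpl in Hq. lra.
  - intros n. exists (fst (S_ n)), (snd (S_ n)). specialize (M n). specialize (B n). specialize (Hp n). specialize (Hq n). tauto.
Qed.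

Lemma small_dyadic (u del : R) : 0 < del -> exists n : nat, u / 2 ^ n < del.
Proof.
  intros Hd. destruct (pow_lt_1_zero (/ 2) ltac:(rewrite Rabs_pos_eq; lra) (del / (1 + Rabs u))) as [n Hn].
  { apply Rdiv_lt_0_compat; auto. generalize (Rabs_pos u); lra. }
  exists n. specialize (Hn n (le_n n)). rewrite <- RPow_abs, Rabs_pos_eq in Hn by lra.
  unfold Rdiv. rewrite <- pow_inv.
  assert (0 < (/ 2) ^ n) by (apply pow_lt; lra).
  assert ((/ 2) ^ n * (1 + Rabs u) < del).
  { apply Rlt_le_trans with (del / (1 + Rabs u) * (1 + Rabs u)).
    apply Rmult_lt_compat_r; auto. generalize (Rabs_pos u); lra. right; field. generalize (Rabs_pos u); lra. }
  generalize (Rle_abs u); intros. nra.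
Qed.

Lemma small_dyadic2 (u v del : R) : 0 <= u -> 0 <= v -> 0 < del -> exists n : nat, u / 2 ^ n + v / 2 ^ n < del.
Proof.
  intros Hu Hv Hd. destruct (small_dyadic (u + v) del Hd) as [n Hn]. exists n.
  unfold Rdiv in *. lra.
Qed.

(** The contrapositive of [quadrisection], as a covering principle: uniform continuity, boundedness
    and the existence of maxima on a rectangle are all obtained from it by choosing [Good]. *)
Lemma rectangle_compact (Good : R -> R -> R -> R -> Prop) (x0 y0 u0 v0 : R) : 0 <= u0 -> 0 <= v0 ->
  (forall x y u v, Good x y (u / 2) (v / 2) -> Good (x + u / 2) y (u / 2) (v / 2) ->
     Good x (y + v / 2) (u / 2) (v / 2) -> Good (x + u / 2) (y + v / 2) (u / 2) (v / 2) -> Good x y u v) ->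
  (forall p q, x0 <= p <= x0 + u0 -> y0 <= q <= y0 + v0 -> exists del, 0 < del /\ forall x y u v, 0 <= u -> 0 <= v ->
     x0 <= x -> x + u <= x0 + u0 -> y0 <= y -> y + v <= y0 + v0 ->
     u + v < del -> x <= p <= x + u -> y <= q <= y + v -> Good x y u v) ->
  Good x0 y0 u0 v0.
Proof.
  intros Hu Hv Hstep Hloc. apply NNPP. intros HB.
  destruct (quadrisection (fun x y u v => ~ Good x y u v) x0 y0 u0 v0 Hu Hv) as [p [q [Hp [Hq H]]]]; auto.
  { intros x y u v Hn. apply NNPP. intros HH. apply Hn, Hstep; apply NNPP; intuition. }
  destruct (Hloc p q Hp Hq) as [del [Hd HG]].
  destruct (small_dyadic2 u0 v0 del Hu Hv Hd) as [n Hn].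
  destruct (H n) as [x [y [Hb Hxy]]]. apply Hb, HG; try tauto.
  all: apply Rmult_le_pos; auto; apply Rlt_le, Rinv_0_lt_compat, pow_lt; lra.
Qed.

(** * Goursat's theorem and primitives *)

(** The counterclockwise boundary integral, with opposite sides joined in one integral so that their
    difference is estimated directly. *)
Definition rect_int (F : C -> C) (x1 x2 y1 y2 : R) : C :=
  (CInt (fun t => F (t, y1) - F (t, y2)) x1 x2 + Ci * CInt (fun t => F (x2, t) - F (x1, t)) y1 y2)%C.

Lemma rderiv_horiz (y t : R) : rderiv (fun s => (s, y)) t 1.
Proof. apply rderiv_intro; simpl; auto_derive; auto. Qed.

Lemma rderiv_vert (x t : R) : rderiv (fun s => (x, s)) t Ci.
Proof. apply rderiv_intro; simpl; auto_derive; auto. Qed.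

Lemma rcont_horiz (F : C -> C) (y t : R) : (forall z, ccont F z) -> rcont (fun s => F (s, y)) t.
Proof. intros. apply (rcont_comp F (fun s => (s, y))). auto. eapply rderiv_rcont, rderiv_horiz. Qed.

Lemma rcont_vert (F : C -> C) (x t : R) : (forall z, ccont F z) -> rcont (fun s => F (x, s)) t.
Proof. intros. apply (rcont_comp F (fun s => (x, s))). auto. eapply rderiv_rcont, rderiv_vert. Qed.

Lemma rect_int_split (F : C -> C) (x1 x2 y1 y2 a b : R) : (forall z, ccont F z) ->
  rect_int F x1 x2 y1 y2 = (rect_int F x1 a y1 b + rect_int F a x2 y1 b +
    rect_int F x1 a b y2 + rect_int F a x2 b y2)%C.
Proof.
  intros HF. unfold rect_int.
  rewrite !CInt_minus; try (intros; apply rcont_horiz; auto); try (intros; apply rcont_vert; auto).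
  rewrite <- (CInt_Chasles (fun t => F (t, y1)) x1 a x2), <- (CInt_Chasles (fun t => F (t, y2)) x1 a x2),
    <- (CInt_Chasles (fun t => F (x1, t)) y1 b y2), <- (CInt_Chasles (fun t => F (x2, t)) y1 b y2);
    try (intros; apply rcont_horiz; auto); try (intros; apply rcont_vert; auto).
  ring.
Qed.

Lemma rect_int_affine (c d : C) (x1 x2 y1 y2 : R) : rect_int (fun z => c + d * z)%C x1 x2 y1 y2 = 0%C.
Proof.
  unfold rect_int.
  rewrite (CInt_ext _ (fun _ => d * Ci * (y1 - y2)%R)%C).
  2: { intros t _. replace (t, y1) with (t + Ci * y1)%C by (apply C_ext; simpl; ring).
    replace (t, y2) with (t + Ci * y2)%C by (apply C_ext; simpl; ring). rewrite RtoC_minus. ring. }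
  rewrite (CInt_ext (fun t => c + d * (x2, t) - (c + d * (x1, t)))%C (fun _ => d * (x2 - x1)%R)%C).
  2: { intros t _. replace (x2, t) with (x2 + Ci * t)%C by (apply C_ext; simpl; ring).
    replace (x1, t) with (x1 + Ci * t)%C by (apply C_ext; simpl; ring). rewrite RtoC_minus. ring. }
  rewrite !CInt_const, !RtoC_minus. ring.
Qed.

(** Let [k] be the ratio of the integral to the area. Some quarter has at least the same ratio. Near
    the limit point [F] is affine up to a small error, affine functions have integral zero, and the
    error forces [k = 0]. *)
Lemma goursat (F : C -> C) (x y u v : R) : 0 < u -> 0 < v ->
  (forall z, exists d, cderiv F z d) -> rect_int F x (x + u) y (y + v) = 0%C.
Proof.
  intros Hu Hv HF.
  assert (Hc : forall z, ccont F z) by (intros z; destruct (HF z) as [d Hd]; eapply cderiv_ccont; eauto).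
  set (k := Cmod (rect_int F x (x + u) y (y + v)) / (u * v)).
  assert (Hk0 : 0 <= k).
  { apply Rmult_le_pos. apply Cmod_ge_0. apply Rlt_le, Rinv_0_lt_compat. nra. }
  destruct (quadrisection (fun a b s t => k * (s * t) <= Cmod (rect_int F a (a + s) b (b + t))) x y u v)
    as [p [q [Hp [Hq H]]]]; try lra.
  { intros a b s t Hb. apply NNPP. intros Hn.
    assert (H1 : Cmod (rect_int F a (a + s/2) b (b + t/2)) < k * (s / 2 * (t / 2))) by (apply Rnot_le_lt; tauto).
    assert (H2 : Cmod (rect_int F (a + s/2) (a + s/2 + s/2) b (b + t/2)) < k * (s / 2 * (t / 2))) by (apply Rnot_le_lt; tauto).
    assert (H3 : Cmod (rect_int F a (a + s/2) (b + t/2) (b + t/2 + t/2)) < k * (s / 2 * (t / 2))) by (apply Rnot_le_lt; tauto).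
    assert (H4 : Cmod (rect_int F (a + s/2) (a + s/2 + s/2) (b + t/2) (b + t/2 + t/2)) < k * (s / 2 * (t / 2))) by (apply Rnot_le_lt; tauto).
    replace (a + s / 2 + s / 2) with (a + s) in * by field. replace (b + t / 2 + t / 2) with (b + t) in * by field.
    rewrite (rect_int_split F a (a + s) b (b + t) (a + s/2) (b + t/2) Hc) in Hb.
    revert Hb. apply Rlt_not_le.
    eapply Rle_lt_trans; [apply Cmod_triangle|].
    eapply Rle_lt_trans; [apply Rplus_le_compat_r, Cmod_triangle|].
    eapply Rle_lt_trans; [apply Rplus_le_compat_r, Rplus_le_compat_r, Cmod_triangle|]. lra. }
  { unfold k. right. field. lra. }
  (* On a rectangle with sides [s], [t] the remainder is at most [eps (s + t)]. Paired sides double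
     it and the lengths add a factor [s + t]. Area and bound both scale by the square of [1 / 2^n],
     which cancels. *)
  assert (Hk : forall eps, 0 < eps -> k * (u * v) <= (2 * (u + v) * (u + v)) * eps).
  { intros eps He. destruct (HF (p, q)) as [d Hd]. destruct (Hd eps He) as [del [Hd0 Hd1]].
    destruct (small_dyadic2 u v del) as [n Hn]; try lra.
    destruct (H n) as [a [b [Hb [_ [_ [_ [_ [Ha1 Hb1]]]]]]]].
    assert (P : 0 < 2 ^ n) by (apply pow_lt; lra).
    assert (Pi : 0 < / 2 ^ n) by (apply Rinv_0_lt_compat; auto).
    set (s := u / 2 ^ n) in *. set (t := v / 2 ^ n) in *.
    assert (0 < s) by (apply Rdiv_lt_0_compat; auto). assert (0 < t) by (apply Rdiv_lt_0_compat; auto).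
    set (z0 := (p, q) : C) in *.
    set (A := fun z => ((F z0 - d * z0) + d * z)%C).
    assert (HA : forall z, ccont A z).
    { intros z. unfold A. eapply cderiv_ccont. apply cderiv_plus. apply cderiv_const. apply cderiv_scal, cderiv_id. }
    set (r := fun z => (F z - A z)%C).
    assert (Hr0 : forall w : C, a <= Re w <= a + s -> b <= Im w <= b + t -> Cmod (r w) <= eps * (s + t)).
    { intros w Hx Hy. set (h := (w - z0)%C).
      assert (Hh : Cmod h <= s + t).
      { eapply Rle_trans; [apply Cmod_le_abs|]. unfold h, Cminus. rewrite re_plus, re_opp, im_plus, im_opp.
        change (Re z0) with p. change (Im z0) with q.
        apply Rplus_le_compat; apply Rabs_le; lra. }
      specialize (Hd1 h ltac:(lra)). replace (z0 + h)%C with w in Hd1 by (unfold h; ring).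
      unfold r, A. replace (F w - (F z0 - d * z0 + d * w))%C with
        (F w - F z0 - d * h)%C by (unfold h; ring). nra. }
    assert (Hr : forall x' y', a <= x' <= a + s -> b <= y' <= b + t -> Cmod (r (x', y')) <= eps * (s + t)).
    { intros; apply Hr0; auto. }
    assert (Hrc : forall z, ccont r z).
    { intros z. unfold r, Cminus. apply ccont_plus; auto.
      unfold A. eapply cderiv_ccont. apply cderiv_opp. apply cderiv_plus. apply cderiv_const. apply cderiv_scal, cderiv_id. }
    assert (E : rect_int F a (a + s) b (b + t) = rect_int r a (a + s) b (b + t)).
    { transitivity (rect_int F a (a + s) b (b + t) - rect_int A a (a + s) b (b + t))%C.
      { unfold A. rewrite rect_int_affine. ring. }
      unfold rect_int, r.
      rewrite !CInt_minus; try (intros; apply rcont_horiz; auto); try (intros; apply rcont_vert; auto);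
       try (intros; apply rcont_minus; [apply rcont_horiz|apply rcont_horiz]; auto);
       try (intros; apply rcont_minus; [apply rcont_vert|apply rcont_vert]; auto).
      ring. }
    rewrite E in Hb.
    assert (B : Cmod (rect_int r a (a + s) b (b + t)) <= 2 * eps * (s + t) * (s + t)).
    { unfold rect_int. eapply Rle_trans; [apply Cmod_triangle|]. rewrite Cmod_mult, Cmod_Ci, Rmult_1_l.
      assert (B1 := CInt_le_const (fun t0 => r (t0, b) - r (t0, (b + t)%R))%C (2 * (eps * (s + t))) a (a + s)).
      assert (B2 := CInt_le_const (fun t0 => r ((a + s)%R, t0) - r (a, t0))%C (2 * (eps * (s + t))) b (b + t)).
      replace (a + s - a) with s in B1 by ring. replace (b + t - b) with t in B2 by ring.
      rewrite Rabs_pos_eq in B1, B2 by lra.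
      rewrite Rmin_left, Rmax_right in B1, B2 by lra.
      eapply Rle_trans. apply Rplus_le_compat; [apply B1|apply B2].
      - intros; apply rcont_minus; apply rcont_horiz; auto.
      - intros. eapply Rle_trans; [apply Cmod_minus_le|].
        generalize (Hr t0 b ltac:(lra) ltac:(lra)) (Hr t0 (b + t) ltac:(lra) ltac:(lra)). lra.
      - intros; apply rcont_minus; apply rcont_vert; auto.
      - intros. eapply Rle_trans; [apply Cmod_minus_le|].
        generalize (Hr (a + s) t0 ltac:(lra) ltac:(lra)) (Hr a t0 ltac:(lra) ltac:(lra)). lra.
      - right; ring. }
    assert (K : k * (s * t) <= 2 * eps * (s + t) * (s + t)) by lra.
    unfold s, t, Rdiv in K.
    apply Rmult_le_reg_r with (/ 2 ^ n * / 2 ^ n). nra.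
    lra. }
  assert (k * (u * v) = Cmod (rect_int F x (x + u) y (y + v))) by (unfold k; field; lra).
  apply (Ceq_of_small _ _ (2 * (u + v) * (u + v))). intros eps He.
  replace (rect_int F x (x + u) y (y + v) - 0)%C with (rect_int F x (x + u) y (y + v)) by ring.
  specialize (Hk eps He). lra.
Qed.

(** Exchanging two parallel sides changes the sign, which reduces every orientation to [goursat]; a
    degenerate rectangle gives a number equal to its opposite. *)
Lemma rect_int_zero (F : C -> C) (x1 x2 y1 y2 : R) :
  (forall z, exists d, cderiv F z d) -> rect_int F x1 x2 y1 y2 = 0%C.
Proof.
  intros HF.
  assert (Hc : forall z, ccont F z) by (intros z; destruct (HF z) as [d Hd]; eapply cderiv_ccont; eauto).
  assert (G : forall x1 x2 y1 y2, x1 < x2 -> y1 < y2 -> rect_int F x1 x2 y1 y2 = 0%C).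
  { intros a b c d Hab Hcd. replace b with (a + (b - a)) by ring. replace d with (c + (d - c)) by ring.
    apply goursat; auto; lra. }
  assert (Hx : forall x1 x2 y1 y2, rect_int F x2 x1 y1 y2 = (- rect_int F x1 x2 y1 y2)%C).
  { intros. unfold rect_int. rewrite !CInt_minus; try (intros; apply rcont_horiz; auto); try (intros; apply rcont_vert; auto).
    rewrite (CInt_swap (fun t => F (t, y3)) x0 x3), (CInt_swap (fun t => F (t, y0)) x0 x3) by (intros; apply rcont_horiz; auto). ring. }
  assert (Hy : forall x1 x2 y1 y2, rect_int F x1 x2 y2 y1 = (- rect_int F x1 x2 y1 y2)%C).
  { intros. unfold rect_int. rewrite !CInt_minus; try (intros; apply rcont_horiz; auto); try (intros; apply rcont_vert; auto).
    rewrite (CInt_swap (fun t => F (x0, t)) y0 y3), (CInt_swap (fun t => F (x3, t)) y0 y3) by (intros; apply rcont_vert; auto). ring. }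
  assert (Z : forall w : C, (w = - w)%C -> w = 0%C).
  { intros w Hw. assert (Re w = - Re w) by (rewrite <- re_opp; congruence). assert (Im w = - Im w) by (rewrite <- im_opp; congruence).
    apply C_ext; simpl; lra. }
  assert (Gx : forall x1 x2 y1 y2, y1 < y2 -> rect_int F x1 x2 y1 y2 = 0%C).
  { intros a b c d Hcd. destruct (Rtotal_order a b) as [H | [-> | H]]; auto. rewrite Hx, G; auto. ring. }
  destruct (Rtotal_order y1 y2) as [H | [-> | H]]; auto. rewrite Hy, Gx; auto. ring.
Qed.

(** The primitive integrates along the real axis and then vertically. The vanishing of [rect_int]
    reroutes the path to a nearby point through [(x, y)], so the increment is an integral over two
    short segments. *)
Lemma entire_primitive (F : C -> C) : (forall z, exists d, cderiv F z d) ->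
  exists Phi, forall z, cderiv Phi z (F z).
Proof.
  intros HF.
  assert (Hc : forall z, ccont F z) by (intros z; destruct (HF z) as [d Hd]; eapply cderiv_ccont; eauto).
  assert (Ch : forall y t, rcont (fun s => F (s, y)) t) by (intros; apply rcont_horiz; auto).
  assert (Cv : forall x t, rcont (fun s => F (x, s)) t) by (intros; apply rcont_vert; auto).
  exists (fun z => CInt (fun t => F (t, 0)) 0 (Re z) + Ci * CInt (fun t => F (Re z, t)) 0 (Im z))%C.
  intros [x y] eps He. destruct (Hc (x, y) (eps / 2) ltac:(lra)) as [del [Hd0 Hd]].
  exists (del / 2); split; [lra|]. intros [h k] Hh.
  assert (Hh1 := re_le_Cmod (h, k)). assert (Hk1 := Im_le_Cmod (h, k)). simpl in Hh1, Hk1.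
  simpl Re. simpl Im. change (Re (h, k)) with h in Hh1.
  assert (E : (CInt (fun t => F (t, 0)) 0 (x + h) + Ci * CInt (fun t => F ((x + h)%R, t)) 0 (y + k) -
     (CInt (fun t => F (t, 0)) 0 x + Ci * CInt (fun t => F (x, t)) 0 y)
     = CInt (fun t => F (t, y)) x (x + h) + Ci * CInt (fun t => F ((x + h)%R, t)) y (y + k))%C).
  { assert (R0 := rect_int_zero F x (x + h) 0 y HF). unfold rect_int in R0.
    rewrite !CInt_minus in R0 by auto.
    rewrite <- (CInt_Chasles (fun t => F (t, 0)) 0 x (x + h)) by auto.
    rewrite <- (CInt_Chasles (fun t => F ((x + h)%R, t)) 0 y (y + k)) by auto.
    apply Ceq_minus. rewrite <- R0. ring. }
  change (Re ((x, y) + (h, k))%C) with (x + h). change (Im ((x, y) + (h, k))%C) with (y + k).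
  rewrite E.
  assert (E2 : (CInt (fun t => F (t, y)) x (x + h) + Ci * CInt (fun t => F ((x + h)%R, t)) y (y + k) - F (x, y) * (h, k)
    = CInt (fun t => F (t, y) - F (x, y)) x (x + h) + Ci * CInt (fun t => F ((x + h)%R, t) - F (x, y)) y (y + k))%C).
  { rewrite !CInt_minus by (auto; intros; apply rcont_const). rewrite !CInt_const.
    replace (x + h - x) with h by ring. replace (y + k - y) with k by ring.
    replace ((h, k) : C) with (h + Ci * k)%C by (apply C_ext; simpl; ring). ring. }
  rewrite E2.
  eapply Rle_trans; [apply Cmod_triangle|]. rewrite Cmod_mult, Cmod_Ci, Rmult_1_l.
  assert (N : forall a b, Rabs (a - x) <= Rabs h -> Rabs (b - y) <= Rabs k -> Cmod (F (a, b) - F (x, y))%C <= eps / 2).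
  { intros a b Ha Hb. apply Rlt_le. replace ((a, b) : C) with ((x, y) + (a - x, b - y)%R)%C by (apply C_ext; simpl; ring).
    apply Hd. eapply Rle_lt_trans; [apply Cmod_le_abs|]. simpl. lra. }
  assert (B1 := CInt_le_const (fun t => F (t, y) - F (x, y))%C (eps / 2) x (x + h)).
  assert (B2 := CInt_le_const (fun t => F ((x + h)%R, t) - F (x, y))%C (eps / 2) y (y + k)).
  replace (x + h - x) with h in B1 by ring. replace (y + k - y) with k in B2 by ring.
  assert (W : forall a d t, Rmin a (a + d) <= t <= Rmax a (a + d) -> Rabs (t - a) <= Rabs d).
  { intros a d t. unfold Rmin, Rmax. destruct (Rle_dec a (a + d)); intros.
    rewrite !Rabs_pos_eq; lra. rewrite (Rabs_left d) by lra. rewrite Rabs_left1; lra. }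
  eapply Rle_trans. apply Rplus_le_compat; [apply B1|apply B2].
  - intros; apply rcont_minus; auto; apply rcont_const.
  - intros. apply N. apply W; auto. replace (y - y) with 0 by ring. rewrite Rabs_R0. apply Rabs_pos.
  - intros; apply rcont_minus; auto; apply rcont_const.
  - intros. apply N. right; f_equal; ring. apply W; auto.
  - change (Im (h, k)) with k in Hk1. nra.
Qed.

(** * The complex exponential *)

Lemma cexp_plus (z w : C) : cexp (z + w) = (cexp z * cexp w)%C.
Proof.
  unfold cexp. rewrite re_plus, im_plus, exp_plus, cos_plus, sin_plus.
  apply C_ext; simpl; ring.
Qed.

Lemma cexp_0 : cexp 0 = 1%C.
Proof. unfold cexp. simpl. rewrite exp_0, cos_0, sin_0. apply C_ext; simpl; ring. Qed.

Lemma Cmod_cexp (z : C) : Cmod (cexp z) = exp (Re z).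
Proof.
  assert (H := Cmod_sq (cexp z)). unfold cexp in H at 3 4 5 6. simpl in H.
  assert (H0 := Cmod_ge_0 (cexp z)). assert (H1 := exp_pos (Re z)).
  assert (H2 := sin2_cos2 (Im z)). unfold Rsqr in H2.
  assert (Cmod (cexp z) * Cmod (cexp z) = exp (Re z) * exp (Re z)).
  { rewrite H. replace (exp (Re z) * exp (Re z)) with (exp (Re z) * exp (Re z) * (sin (Im z) * sin (Im z) + cos (Im z) * cos (Im z))) by (rewrite H2; ring). ring. }
  nra.
Qed.

Lemma cexp_neq_0 (z : C) : cexp z <> 0%C.
Proof. apply Cmod_gt_0. rewrite Cmod_cexp. apply exp_pos. Qed.

Lemma cexp_neg (z : C) : cexp (- z) = (/ cexp z)%C.
Proof.
  assert (H := cexp_plus z (- z)). replace (z + - z)%C with (RtoC 0) in H by ring. rewrite cexp_0 in H.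
  assert (Hz := cexp_neq_0 z).
  replace (cexp (- z)) with (cexp z * cexp (- z) * / cexp z)%C by (field; auto). rewrite <- H. ring.
Qed.

Lemma cexp_conj (z : C) : cexp (Cconj z) = Cconj (cexp z).
Proof. unfold cexp. rewrite re_conj, im_conj, cos_neg, sin_neg. apply C_ext; simpl; ring. Qed.

Lemma rderiv_cexp_line (h : C) (t : R) : rderiv (fun s : R => cexp (s * h)) t (h * cexp (t * h))%C.
Proof.
  destruct h as [a b].
  assert (Er : forall s : R, Re (s * (a, b)) = s * a) by (intros; simpl; ring).
  assert (Ei : forall s : R, Im (s * (a, b)) = s * b) by (intros; simpl; ring).
  apply rderiv_intro; rewrite ?re_mult, ?im_mult; unfold cexp; rewrite Er, Ei; simpl Re; simpl Im.
  - apply (is_derive_ext (fun s => exp (s * a) * cos (s * b))).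
    { intros s. simpl. f_equal; f_equal; ring. }
    auto_derive; auto. ring.
  - apply (is_derive_ext (fun s => exp (s * a) * sin (s * b))).
    { intros s. simpl. f_equal; f_equal; ring. }
    auto_derive; auto. ring.
Qed.

Lemma exp_le (x y : R) : x <= y -> exp x <= exp y.
Proof. intros [H | ->]; [left; apply exp_increasing; auto | right; auto]. Qed.

Lemma Cmod_cexp_line (h : C) (t : R) : 0 <= t <= 1 -> Cmod (cexp (t * h)) <= exp (Cmod h).
Proof.
  intros Ht. rewrite Cmod_cexp. apply exp_le. rewrite re_scal_l.
  generalize (re_le_Cmod h) (Rle_abs (Re h)) (Cmod_ge_0 h); intros.
  destruct (Rle_dec 0 (Re h)); nra.
Qed.

Lemma cexp_bound1 (h : C) : Cmod (cexp h - 1) <= Cmod h * exp (Cmod h).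
Proof.
  assert (H := rderiv_bound (fun s : R => cexp (s * h)) (fun t : R => h * cexp (t * h))%C (Cmod h * exp (Cmod h))).
  cbv beta in H. rewrite Cmult_1_l, Cmult_0_l, cexp_0 in H. apply H.
  - intros; apply rderiv_cexp_line.
  - intros t Ht. rewrite Cmod_mult. apply Rmult_le_compat_l. apply Cmod_ge_0. apply Cmod_cexp_line; auto.
Qed.

Lemma rderiv_minus (f g : R -> C) t df dg :
  rderiv f t df -> rderiv g t dg -> rderiv (fun s => f s - g s)%C t (df - dg)%C.
Proof.
  intros Hf Hg eps He. destruct (Hf (eps / 2) ltac:(lra)) as [r [Hr H1]]. destruct (Hg (eps / 2) ltac:(lra)) as [s [Hs H2]].
  exists (Rmin r s). split. apply Rmin_pos; auto. intros h Hh.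
  generalize (Rmin_l r s) (Rmin_r r s); intros. specialize (H1 h ltac:(lra)). specialize (H2 h ltac:(lra)).
  replace (f (t + h)%R - g (t + h)%R - (f t - g t) - (df - dg) * h)%C with
   ((f (t + h)%R - f t - df * h) - (g (t + h)%R - g t - dg * h))%C by ring.
  eapply Rle_trans; [apply Cmod_minus_le|]. lra.
Qed.

Lemma cexp_bound2 (h : C) : Cmod (cexp h - 1 - h) <= Cmod h * Cmod h * exp (Cmod h).
Proof.
  assert (H := rderiv_bound (fun s : R => cexp (s * h) - (1 + s * h))%C (fun t : R => h * cexp (t * h) - h)%C
    (Cmod h * Cmod h * exp (Cmod h))).
  cbv beta in H. rewrite Cmult_1_l, Cmult_0_l, cexp_0 in H.
  replace (cexp h - (1 + h) - (1 - (1 + 0)))%C with (cexp h - 1 - h)%C in H by ring. apply H.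
  - intros; apply rderiv_minus. apply rderiv_cexp_line. apply rderiv_line.
  - intros t Ht. replace (h * cexp (t * h) - h)%C with (h * (cexp (t * h) - 1))%C by ring. rewrite Cmod_mult, Rmult_assoc.
    apply Rmult_le_compat_l. apply Cmod_ge_0. eapply Rle_trans; [apply cexp_bound1|].
    assert (Cmod (t * h) <= Cmod h). { rewrite Cmod_mult, Cmod_RtoC_nonneg by lra. generalize (Cmod_ge_0 h); nra. }
    apply Rmult_le_compat; auto. apply Cmod_ge_0. left; apply exp_pos. apply exp_le; auto.
Qed.

Lemma cderiv_of_quadratic (f : C -> C) (z d : C) (M r : R) : 0 < r ->
  (forall h, Cmod h < r -> Cmod (f (z + h) - f z - d * h)%C <= M * (Cmod h * Cmod h)) -> cderiv f z d.
Proof.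
  intros Hr H eps He.
  set (M' := Rmax M 1). assert (1 <= M') by apply Rmax_r. assert (M <= M') by apply Rmax_l.
  exists (Rmin r (eps / M')). split. apply Rmin_pos; auto. apply Rdiv_lt_0_compat; lra.
  intros h Hh. generalize (Rmin_l r (eps / M')) (Rmin_r r (eps / M')); intros.
  specialize (H h ltac:(lra)). assert (P := Cmod_ge_0 h).
  assert (Cmod h * M' <= eps).
  { apply Rle_trans with (eps / M' * M'). apply Rmult_le_compat_r; lra. right; field; lra. }
  assert (M * (Cmod h * Cmod h) <= M' * (Cmod h * Cmod h)) by (apply Rmult_le_compat_r; nra).
  nra.
Qed.

Lemma cderiv_cexp (z : C) : cderiv cexp z (cexp z).
Proof.
  apply (cderiv_of_quadratic _ _ _ (Cmod (cexp z) * exp 1) 1). lra. intros h Hh.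
  rewrite cexp_plus. replace (cexp z * cexp h - cexp z - cexp z * h)%C with (cexp z * (cexp h - 1 - h))%C by ring.
  rewrite Cmod_mult, Rmult_assoc. apply Rmult_le_compat_l. apply Cmod_ge_0.
  eapply Rle_trans; [apply cexp_bound2|]. rewrite (Rmult_comm (exp 1)). apply Rmult_le_compat_l. generalize (Cmod_ge_0 h); nra.
  apply exp_le; lra.
Qed.

Lemma cderiv_zero_const (f : C -> C) : (forall z, cderiv f z 0) -> forall z w, f z = f w.
Proof.
  intros H z w. apply Ceq_minus, Cmod_eq_0, Rle_antisym; [|apply Cmod_ge_0].
  assert (B := segment_bound f (fun _ => 0%C) w z 0). rewrite Rmult_0_l in B. apply B; auto.
  intros. rewrite Cmod_0. lra.
Qed.

(** * Circle averages *)

Definition cis (t : R) : C := (cos t, sin t).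

Lemma Cmod_cis t : Cmod (cis t) = 1.
Proof.
  assert (H := Cmod_sq (cis t)). unfold cis in H at 3 4 5 6. simpl in H.
  assert (H2 := sin2_cos2 t). unfold Rsqr in H2. generalize (Cmod_ge_0 (cis t)). nra.
Qed.

Lemma cis_plus s t : cis (s + t) = (cis s * cis t)%C.
Proof. unfold cis. rewrite cos_plus, sin_plus. apply C_ext; simpl; ring. Qed.

Lemma rderiv_cis (k t : R) : rderiv (fun s => cis (k * s)) t (Ci * k * cis (k * t))%C.
Proof. apply rderiv_intro; unfold cis; simpl; auto_derive; auto; simpl; ring. Qed.

Lemma rderiv_cis1 (t : R) : rderiv cis t (Ci * cis t)%C.
Proof. apply rderiv_intro; unfold cis; simpl; auto_derive; auto; simpl; ring. Qed.

Lemma rcont_cis (k t : R) : rcont (fun s => cis (k * s)) t.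
Proof. eapply rderiv_rcont, rderiv_cis. Qed.

Lemma rcont_cis1 (t : R) : rcont cis t.
Proof. eapply rderiv_rcont, rderiv_cis1. Qed.

Lemma rcont_circle (F : C -> C) (w z : C) (t : R) : (forall u, ccont F u) -> rcont (fun s => F (w + z * cis s))%C t.
Proof. intros HF. apply (rcont_comp F (fun s => w + z * cis s)%C). auto.
  apply rcont_plus. apply rcont_const. apply rcont_mult. apply rcont_const. apply rcont_cis1. Qed.

Lemma uniform_cont_disc (f : C -> C) (r eps : R) : (forall z, ccont f z) -> 0 < eps ->
  exists del, 0 < del /\ forall z h, Cmod z <= r -> Cmod h < del -> Cmod (f (z + h) - f z)%C <= eps.
Proof.
  intros Hf He. destruct (Rle_dec 0 r) as [Hr | Hr].
  2: { exists 1. split. lra. intros z h Hz. generalize (Cmod_ge_0 z); lra. }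
  assert (G : exists del, 0 < del /\ forall z h, (-r <= Re z <= -r + 2 * r) -> -r <= Im z <= -r + 2 * r -> Cmod h < del ->
     Cmod (f (z + h) - f z)%C <= eps).
  { apply (rectangle_compact (fun x y u v => exists del, 0 < del /\ forall z h, (x <= Re z <= x + u) -> y <= Im z <= y + v -> Cmod h < del ->
     Cmod (f (z + h) - f z)%C <= eps)); try lra.
    - intros x y u v [d1 [D1 H1]] [d2 [D2 H2]] [d3 [D3 H3]] [d4 [D4 H4]].
      exists (Rmin (Rmin d1 d2) (Rmin d3 d4)). split. repeat apply Rmin_pos; auto.
      intros z h Hx Hy Hh.
      generalize (Rmin_l (Rmin d1 d2) (Rmin d3 d4)) (Rmin_r (Rmin d1 d2) (Rmin d3 d4)) (Rmin_l d1 d2) (Rmin_r d1 d2) (Rmin_l d3 d4) (Rmin_r d3 d4); intros.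
      destruct (Rle_dec (Re z) (x + u / 2)); destruct (Rle_dec (Im z) (y + v / 2)).
      apply H1; lra. apply H3; lra. apply H2; lra. apply H4; lra.
    - intros p q Hp Hq. destruct (Hf (p, q) (eps / 2) ltac:(lra)) as [d [Hd H]].
      exists (d / 2). split. lra. intros x y u v _ _ _ _ _ _ Huv Hxp Hyq. exists (d / 2). split. lra.
      intros z h Hx Hy Hh. set (z0 := (p, q) : C) in *.
      assert (Hz : Cmod (z - z0) < d / 2).
      { eapply Rle_lt_trans; [apply Cmod_le_abs|]. unfold Cminus; rewrite re_plus, re_opp, im_plus, im_opp.
        change (Re z0) with p. change (Im z0) with q.
        assert (Rabs (Re z + - p) <= u) by (apply Rabs_le; lra). assert (Rabs (Im z + - q) <= v) by (apply Rabs_le; lra). lra. }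
      assert (H1 := H (z - z0)%C ltac:(lra)). assert (H2 := H (z - z0 + h)%C).
      replace (z0 + (z - z0))%C with z in H1 by ring. replace (z0 + (z - z0 + h))%C with (z + h)%C in H2 by ring.
      assert (Cmod (z - z0 + h) < d) by (eapply Rle_lt_trans; [apply Cmod_triangle|]; lra).
      specialize (H2 H0). eapply Rle_trans; [apply (Cmod_triangle3 _ (f z0))|]. rewrite (Cmod_sub_sym (f z0)). lra. }
  destruct G as [d [Hd H]]. exists d. split; auto. intros z h Hz Hh.
  generalize (re_le_Cmod z) (Im_le_Cmod z). intros A B. apply Rabs_le_between in A, B. apply H; auto; lra.
Qed.

Lemma bounded_disc (f : C -> C) (r : R) : (forall z, ccont f z) -> exists M, 0 <= M /\ forall z, Cmod z <= r -> Cmod (f z) <= M.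
Proof.
  intros Hf. destruct (Rle_dec 0 r) as [Hr | Hr].
  2: { exists 1. split. lra. intros z Hz. generalize (Cmod_ge_0 z); lra. }
  assert (G : exists M, 0 <= M /\ forall z, (-r <= Re z <= -r + 2 * r) -> -r <= Im z <= -r + 2 * r -> Cmod (f z) <= M).
  { apply (rectangle_compact (fun x y u v => exists M, 0 <= M /\ forall z, (x <= Re z <= x + u) -> y <= Im z <= y + v -> Cmod (f z) <= M)); try lra.
    - intros x y u v [d1 [D1 H1]] [d2 [D2 H2]] [d3 [D3 H3]] [d4 [D4 H4]].
      exists (d1 + d2 + d3 + d4). split. lra.
      intros z Hx Hy.
      destruct (Rle_dec (Re z) (x + u / 2)); destruct (Rle_dec (Im z) (y + v / 2)).
      specialize (H1 z); lra. specialize (H3 z); lra. specialize (H2 z); lra. specialize (H4 z); lra.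
    - intros p q Hp Hq. destruct (Hf (p, q) 1 ltac:(lra)) as [d [Hd H]].
      exists d. split. lra. intros x y u v _ _ _ _ _ _ Huv Hxp Hyq. set (z0 := (p, q) : C) in *.
      exists (Cmod (f z0) + 1). split. generalize (Cmod_ge_0 (f z0)); lra.
      intros z Hx Hy.
      assert (Hz : Cmod (z - z0) < d).
      { eapply Rle_lt_trans; [apply Cmod_le_abs|]. unfold Cminus; rewrite re_plus, re_opp, im_plus, im_opp.
        change (Re z0) with p. change (Im z0) with q.
        assert (Rabs (Re z + - p) <= u) by (apply Rabs_le; lra). assert (Rabs (Im z + - q) <= v) by (apply Rabs_le; lra). lra. }
      assert (H1 := H (z - z0)%C ltac:(lra)).
      replace (z0 + (z - z0))%C with z in H1 by ring. generalize (Cmod_triangle_sub (f z) (f z0)); lra. }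
  destruct G as [M [HM H]]. exists M. split; auto. intros z Hz.
  generalize (re_le_Cmod z) (Im_le_Cmod z). intros A B. apply Rabs_le_between in A, B. apply H; lra.
Qed.

(** Cauchy's formulas are obtained by differentiating circle integrals under the integral sign, for
    which a continuous derivative is assumed; [entire_is_C1] later supplies it for every entire
    function. *)
Definition is_C1 (F F' : C -> C) : Prop := (forall z, cderiv F z (F' z)) /\ forall z, ccont F' z.

Lemma is_C1_cont (F F' : C -> C) : is_C1 F F' -> forall z, ccont F z.
Proof. intros [H _] z. eapply cderiv_ccont; eauto. Qed.

Lemma uniform_deriv_disc (F F' : C -> C) (r eps : R) : is_C1 F F' -> 0 < eps ->
  exists del, 0 < del /\ forall z h, Cmod z <= r -> Cmod h < del -> Cmod (F (z + h) - F z - F' z * h)%C <= eps * Cmod h.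
Proof.
  intros [HF HF'] He. destruct (uniform_cont_disc F' r eps HF' He) as [d [Hd H]].
  exists d. split; auto. intros z h Hz Hh.
  assert (B := segment_bound (fun w => F w - F' z * w)%C (fun w => F' w - F' z)%C z (z + h) eps).
  replace (z + h - z)%C with h in B by ring.
  replace (F (z + h) - F z - F' z * h)%C with (F (z + h) - F' z * (z + h) - (F z - F' z * z))%C by ring.
  apply B.
  - intros t Ht. apply cderiv_minus; auto. eapply cderiv_eq; [|apply cderiv_scal, cderiv_id]. ring.
  - intros t Ht. apply H; auto. rewrite Cmod_mult, Cmod_RtoC_nonneg by lra. generalize (Cmod_ge_0 h); nra.
Qed.

Lemma cderiv_CInt (Psi D : C -> R -> C) (w : C) (a b : R) :
  (forall z t, rcont (Psi z) t) -> (forall t, rcont (D w) t) ->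
  (forall eps, 0 < eps -> exists del, 0 < del /\ forall h, Cmod h < del ->
     forall t, Cmod (Psi (w + h) t - Psi w t - D w t * h)%C <= eps * Cmod h) ->
  cderiv (fun z => CInt (Psi z) a b) w (CInt (D w) a b).
Proof.
  intros HP HD H eps He.
  set (e := eps / (1 + Rabs (b - a))). assert (P := Rabs_pos (b - a)).
  assert (0 < e) by (apply Rdiv_lt_0_compat; lra).
  destruct (H e H0) as [d [Hd Hb]]. exists d. split; auto. intros h Hh.
  rewrite (Cmult_comm (CInt (D w) a b) h), <- CInt_scal, <- !CInt_minus; auto.
  2: intros; apply rcont_minus; auto.
  2: intros; apply rcont_mult; auto; apply rcont_const.
  eapply Rle_trans. apply CInt_le_const with (M := e * Cmod h).
  - intros; apply rcont_minus. apply rcont_minus; auto. apply rcont_mult; auto; apply rcont_const.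
  - intros t _. rewrite (Cmult_comm h). auto.
  - assert (e * (1 + Rabs (b - a)) = eps) by (unfold e; field; lra). generalize (Cmod_ge_0 h); intros. nra.
Qed.

Section Circle.
Variables (F F' : C -> C) (w : C).
Hypothesis HC : is_C1 F F'.

(** For integral [k] this is [2 pi] times the Taylor coefficient of order [- k] at [w] times
    [z^(-k)]. The radius vector [z] is complex so that the integral can be differentiated in it. *)
Definition circ (k : R) (z : C) : C := CInt (fun t => F (w + z * cis t) * cis (k * t))%C 0 (2 * PI).
Definition circ' (k : R) (z : C) : C := CInt (fun t => (F' (w + z * cis t) * cis t) * cis (k * t))%C 0 (2 * PI).

Lemma circ_cont k z t : rcont (fun t => F (w + z * cis t) * cis (k * t))%C t.
Proof. apply rcont_mult. apply rcont_circle. eapply is_C1_cont; eauto. apply rcont_cis. Qed.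

Lemma circ'_cont k z t : rcont (fun t => (F' (w + z * cis t) * cis t) * cis (k * t))%C t.
Proof. apply rcont_mult. apply rcont_mult. apply rcont_circle. apply HC. apply rcont_cis1. apply rcont_cis. Qed.

Lemma circ_deriv k z : cderiv (circ k) z (circ' k z).
Proof.
  apply (cderiv_CInt (fun z t => F (w + z * cis t) * cis (k * t))%C (fun z t => (F' (w + z * cis t) * cis t) * cis (k * t))%C).
  intros; apply circ_cont. intros; apply circ'_cont.
  intros eps He. destruct (uniform_deriv_disc F F' (Cmod w + Cmod z) eps HC He) as [d [Hd H]].
  exists d; split; auto. intros h Hh t.
  specialize (H (w + z * cis t)%C (h * cis t)%C).
  replace (F (w + (z + h) * cis t) * cis (k * t) - F (w + z * cis t) * cis (k * t) - F' (w + z * cis t) * cis t * cis (k * t) * h)%C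
    with ((F (w + z * cis t + h * cis t) - F (w + z * cis t) - F' (w + z * cis t) * (h * cis t)) * cis (k * t))%C.
  2: { replace (w + z * cis t + h * cis t)%C with (w + (z + h) * cis t)%C by ring. ring. }
  rewrite Cmod_mult, Cmod_cis, Rmult_1_r. rewrite (Cmod_mult h), Cmod_cis, Rmult_1_r in H. apply H; auto.
  eapply Rle_trans; [apply Cmod_triangle|]. rewrite Cmod_mult, Cmod_cis. lra.
Qed.

(** The integrand is periodic in [t], so its [t]-derivative, which is [i] times the integrand of the
    left side, integrates to zero. The solutions of the equation are the multiples of [z^(-k)]. *)
Lemma circ_ode (k : R) (z : C) : cis (k * (2 * PI)) = 1%C -> (z * circ' k z + k * circ k z = 0)%C.
Proof.
  intros Hk.
  assert (E := CInt_FTC (fun t => F (w + z * cis t) * cis (k * t))%C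
    (fun t => Ci * (z * ((F' (w + z * cis t) * cis t) * cis (k * t)) + k * (F (w + z * cis t) * cis (k * t))))%C 0 (2 * PI)).
  rewrite CInt_scal, CInt_plus, !CInt_scal in E; try (intros; apply circ_cont); try (intros; apply circ'_cont).
  2, 3: intros; apply rcont_mult; [apply rcont_const|]; try apply circ_cont; try apply circ'_cont.
  2: intros; apply rcont_plus; apply rcont_mult; try apply rcont_const; try apply circ_cont; try apply circ'_cont.
  fold (circ k z) in E. fold (circ' k z) in E.
  rewrite Hk, Rmult_0_r in E.
  assert (C2 : cis (2 * PI) = cis 0) by (unfold cis; rewrite cos_2PI, sin_2PI, cos_0, sin_0; auto).
  assert (C0 : cis 0 = 1%C) by (unfold cis; rewrite cos_0, sin_0; auto).
  rewrite C2, C0 in E.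
  assert (E2 : (Ci * (z * circ' k z + k * circ k z) = 0)%C).
  { rewrite E. ring.
    - intros t. eapply rderiv_eq; [|apply rderiv_mult].
      2: apply (rderiv_comp F (fun t => w + z * cis t)%C); [apply HC|].
      2: { apply (rderiv_comp (fun u => w + z * u)%C). eapply cderiv_eq; [|apply cderiv_plus; [apply cderiv_const|apply cderiv_scal, cderiv_id]]. reflexivity. apply rderiv_cis1. }
      2: apply rderiv_cis. cbv beta. ring.
    - intros t. apply rcont_mult. apply rcont_const. apply rcont_plus; apply rcont_mult; try apply rcont_const.
      apply circ'_cont. apply circ_cont. }
  apply (f_equal (Cmult (- Ci))) in E2.
  assert (I2 : (Ci * Ci = -(1))%C) by (apply C_ext; simpl; ring).
  transitivity (- (Ci * Ci) * (z * circ' k z + k * circ k z))%C. rewrite I2; ring.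
  transitivity (- Ci * (Ci * (z * circ' k z + k * circ k z)))%C. ring. rewrite E2; ring.
Qed.

Lemma CInt_cis (k : R) : k <> 0 -> cis (k * (2 * PI)) = 1%C -> CInt (fun t => cis (k * t)) 0 (2 * PI) = 0%C.
Proof.
  intros Hk H.
  assert (K : RtoC k <> 0%C) by (intros E; apply RtoC_inj in E; auto).
  assert (E := CInt_FTC (fun t => / (Ci * k) * cis (k * t))%C (fun t => cis (k * t)) 0 (2 * PI)).
  rewrite E. rewrite H, Rmult_0_r. unfold cis. rewrite cos_0, sin_0. unfold RtoC at 2. ring.
  - intros t. eapply rderiv_eq; [|apply rderiv_mult; [|apply rderiv_cis]].
    2: { instantiate (1 := 0%C). apply rderiv_intro; simpl; auto_derive; auto. }
    cbv beta; field. split; auto. apply Ci_nz.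
  - intros; apply rcont_cis.
Qed.

(** For [k = 0] the equation makes [circ 0] constant, so it equals its value at [z = 0]. At [0]
    itself the derivative vanishes because [cis] has mean zero. *)
Lemma mean_value (z : C) : CInt (fun t => F (w + z * cis t))%C 0 (2 * PI) = (2 * PI * F w)%C.
Proof.
  assert (K : cis (0 * (2 * PI)) = 1%C) by (rewrite Rmult_0_l; unfold cis; rewrite cos_0, sin_0; auto).
  assert (E0 : forall u, circ 0 u = CInt (fun t => F (w + u * cis t))%C 0 (2 * PI)).
  { intros u. apply CInt_ext. intros. rewrite Rmult_0_l. unfold cis at 2. rewrite cos_0, sin_0. unfold RtoC. apply Cmult_1_r. }
  rewrite <- E0.
  assert (Z : forall u, cderiv (circ 0) u 0%C).
  { intros u. eapply cderiv_eq; [|apply circ_deriv].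
    destruct (Ceq_dec u 0) as [-> | Hu].
    - unfold circ'. rewrite (CInt_ext _ (fun t => F' w * cis (1 * t))%C).
      rewrite CInt_scal by (intros; apply rcont_cis). rewrite CInt_cis. ring. lra. rewrite Rmult_1_l. unfold cis; rewrite cos_2PI, sin_2PI; auto.
      intros. rewrite Rmult_0_l, Rmult_1_l. unfold cis at 3. rewrite cos_0, sin_0. fold (RtoC 1). rewrite Cmult_0_l, Cplus_0_r. ring.
    - assert (H := circ_ode 0 u K). rewrite Cmult_0_l, Cplus_0_r in H.
      replace (circ' 0 u) with (/ u * (u * circ' 0 u))%C by (field; auto). rewrite H. ring. }
  rewrite (cderiv_zero_const _ Z z 0%C). rewrite E0.
  rewrite (CInt_ext _ (fun _ => F w)). rewrite CInt_const. rewrite RtoC_minus, RtoC_mult. ring.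
  intros. f_equal. ring.
Qed.

(** For [k = 1] the equation says that [u * circ 1 u] has derivative zero, and this product vanishes
    at [u = 0]. *)
Lemma circle_positive_moment (z : C) : z <> 0%C -> CInt (fun t => F (w + z * cis t) * cis (1 * t))%C 0 (2 * PI) = 0%C.
Proof.
  intros Hz. change (circ 1 z = 0%C).
  assert (K : cis (1 * (2 * PI)) = 1%C) by (rewrite Rmult_1_l; unfold cis; rewrite cos_2PI, sin_2PI; auto).
  assert (Z : forall u, cderiv (fun u => u * circ 1 u)%C u 0%C).
  { intros u. eapply cderiv_eq; [|apply cderiv_mult; [apply cderiv_id|apply circ_deriv]].
    rewrite <- (circ_ode 1 u K). simpl. ring. }
  assert (E := cderiv_zero_const _ Z z 0%C). simpl in E. rewrite Cmult_0_l in E.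
  replace (circ 1 z) with (/ z * (z * circ 1 z))%C by (field; auto). rewrite E. ring.
Qed.

(** For [k = -1] the equation reads [circ = z circ'], so [circ / z] is constant along a ray, and its
    limit at the origin is [circ' (-1) 0], which is visibly [2 pi F' w]. *)
Lemma circle_derivative (z : C) : CInt (fun t => F (w + z * cis t) * cis (-1 * t))%C 0 (2 * PI) = (2 * PI * (z * F' w))%C.
Proof.
  change (circ (-1) z = (2 * PI * (z * F' w))%C).
  assert (K : cis (-1 * (2 * PI)) = 1%C).
  { replace (-1 * (2 * PI)) with (- (2 * PI)) by ring. unfold cis; rewrite cos_neg, sin_neg, cos_2PI, sin_2PI, Ropp_0; auto. }
  assert (O : forall u, circ (-1) u = (u * circ' (-1) u)%C).
  { intros u. assert (H := circ_ode (-1) u K). apply Ceq_minus.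
    replace (circ (-1) u - u * circ' (-1) u)%C with (- (u * circ' (-1) u + RtoC (-1) * circ (-1) u))%C by ring. rewrite H. ring. }
  assert (D0 : circ' (-1) 0 = (2 * PI * F' w)%C).
  { unfold circ'. rewrite (CInt_ext _ (fun t => F' w)).
    rewrite CInt_const. rewrite RtoC_minus, RtoC_mult. ring.
    intros t _. rewrite Cmult_0_l, Cplus_0_r, <- Cmult_assoc, <- cis_plus. replace (t + -1 * t) with 0 by ring.
    unfold cis; rewrite cos_0, sin_0. apply Cmult_1_r. }
  destruct (Ceq_dec z 0) as [-> | Hz].
  { rewrite O. ring. }
  (* Only the segment from [t z] to [z] with [t > 0] is used: it avoids the origin, where the
     quotient is undefined. *)
  assert (Zc : forall t : R, 0 < t <= 1 -> circ' (-1) (t * z)%C = circ' (-1) z).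
  { intros t Ht.
    assert (NZ : forall s : R, 0 <= s <= 1 -> (t * z + s * (z - t * z))%C <> 0%C).
    { intros s Hs. replace (t * z + s * (z - t * z))%C with (RtoC (t + s * (1 - t)) * z)%C.
      apply Cmult_neq_0; auto. intros E; apply RtoC_inj in E. nra.
      rewrite RtoC_plus, RtoC_mult, RtoC_minus. ring. }
    assert (E : forall u : C, u <> 0%C -> circ' (-1) u = (/ u * circ (-1) u)%C). { intros u Hu. rewrite O. field. exact Hu. }
    rewrite (E z), (E (t * z)%C); auto.
    2: { specialize (NZ 0 ltac:(lra)). replace (t * z + 0 * (z - t * z))%C with (t * z)%C in NZ by ring. auto. }
    symmetry. apply Ceq_minus, Cmod_eq_0, Rle_antisym; [|apply Cmod_ge_0].
    assert (B := segment_bound (fun u => / u * circ (-1) u)%C (fun _ => 0%C) (t * z)%C z 0). rewrite Rmult_0_l in B. apply B.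
    - intros s Hs. eapply cderiv_eq; [|apply cderiv_mult; [apply cderiv_inv; [|apply cderiv_id]|apply circ_deriv]]; auto.
      simpl. rewrite O. field. apply NZ; auto.
    - intros. rewrite Cmod_0; lra. }
  rewrite O. replace (2 * PI * (z * F' w))%C with (z * (2 * PI * F' w))%C by ring. rewrite <- D0. f_equal.
  apply (Ceq_of_small _ _ 1). intros eps He. rewrite Rmult_1_l.
  destruct (circ_deriv (-1) 0%C eps He) as [d [Hd H]].
  assert (Pz : 0 < Cmod z) by (apply Cmod_gt_0; auto).
  set (t := Rmin 1 (d / (2 * Cmod z))).
  assert (Ht : 0 < t <= 1).
  { split. apply Rmin_pos. lra. apply Rdiv_lt_0_compat; lra. apply Rmin_l. }
  assert (Hh : Cmod (t * z) < d).
  { rewrite Cmod_mult, Cmod_RtoC_nonneg by lra. apply Rle_lt_trans with (d / (2 * Cmod z) * Cmod z).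
    apply Rmult_le_compat_r. lra. apply Rmin_r. replace (d / (2 * Cmod z) * Cmod z) with (d / 2) by (field; lra). lra. }
  specialize (H _ Hh). rewrite Cplus_0_l, (O (t * z)%C), (O 0%C), Zc in H by auto.
  replace (t * z * circ' (-1) z - 0 * circ' (-1) 0 - circ' (-1) 0 * (t * z))%C with ((circ' (-1) z - circ' (-1) 0) * (t * z))%C in H by ring.
  rewrite Cmod_mult in H. apply Rmult_le_reg_r with (Cmod (t * z)); auto.
  rewrite Cmod_mult, Cmod_RtoC_nonneg by lra. apply Rmult_lt_0_compat; lra.
Qed.
End Circle.

(** * Consequences for entire functions *)

Lemma two_PI_neq_0 : (2 * PI)%C <> 0%C.
Proof. rewrite <- RtoC_mult. intros E. apply RtoC_inj in E. generalize PI_RGT_0; lra. Qed.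

(** Cauchy's integral for the derivative over the unit circle about [w]. It makes sense for
    functions that are only continuous, and so serves as the candidate derivative of a limit
    function. *)
Definition unit_moment (F : C -> C) (w : C) : C := (/ (2 * PI) * CInt (fun t => F (w + 1 * cis t) * cis (-1 * t)) 0 (2 * PI))%C.

Lemma rcont_unit_moment (F : C -> C) w t : (forall z, ccont F z) -> rcont (fun t => F (w + 1 * cis t) * cis (-1 * t))%C t.
Proof. intros. apply rcont_mult. apply rcont_circle; auto. apply rcont_cis. Qed.

Lemma unit_moment_C1 (F F' : C -> C) (w : C) : is_C1 F F' -> unit_moment F w = F' w.
Proof. intros H. unfold unit_moment. rewrite (circle_derivative F F' w H). field. repeat split; intros E; apply RtoC_inj in E; generalize PI_RGT_0; lra. Qed.

Lemma Cmod_inv_2PI : Cmod (/ (2 * PI))%C = / (2 * PI).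
Proof. rewrite Cmod_inv by apply two_PI_neq_0. rewrite <- RtoC_mult, Cmod_RtoC_nonneg; auto. generalize PI_RGT_0; lra. Qed.

Lemma unit_moment_bound (F : C -> C) (w : C) (M : R) : (forall z, ccont F z) ->
  (forall z, Cmod (z - w) = 1 -> Cmod (F z) <= M) -> Cmod (unit_moment F w) <= M.
Proof.
  intros HF HM. unfold unit_moment. rewrite Cmod_mult, Cmod_inv_2PI.
  assert (P := PI_RGT_0).
  assert (B := CInt_le_const (fun t => F (w + 1 * cis t) * cis (-1 * t))%C M 0 (2 * PI)).
  rewrite Rminus_0_r, (Rabs_pos_eq (2 * PI)) in B by lra.
  apply Rle_trans with (/ (2 * PI) * (M * (2 * PI))).
  - apply Rmult_le_compat_l. left; apply Rinv_0_lt_compat; lra. apply B.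
    intros; apply rcont_unit_moment; auto.
    intros. rewrite Cmod_mult, Cmod_cis, Rmult_1_r. apply HM.
    replace (w + 1 * cis t - w)%C with (cis t) by ring. apply Cmod_cis.
  - right; field; lra.
Qed.

Lemma unit_moment_minus (F G : C -> C) (w : C) : (forall z, ccont F z) -> (forall z, ccont G z) ->
  unit_moment (fun z => F z - G z)%C w = (unit_moment F w - unit_moment G w)%C.
Proof.
  intros HF HG. unfold unit_moment.
  rewrite (CInt_ext _ (fun t => F (w + 1 * cis t) * cis (-1 * t) - G (w + 1 * cis t) * cis (-1 * t))%C) by (intros; ring).
  rewrite CInt_minus by (intros; apply rcont_unit_moment; auto). ring.
Qed.

Lemma ccont_minus (f g : C -> C) z : ccont f z -> ccont g z -> ccont (fun w => f w - g w)%C z.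
Proof.
  intros Hf Hg. apply ccont_plus; auto. intros eps He. destruct (Hg eps He) as [d [Hd H]]. exists d; split; auto.
  intros h Hh. replace (- g (z + h) - - g z)%C with (- (g (z + h) - g z))%C by ring. rewrite Cmod_opp; auto.
Qed.

Lemma ccont_shift (F : C -> C) (h z : C) : (forall u, ccont F u) -> ccont (fun u => F (u + h)%C) z.
Proof. intros HF eps He. destruct (HF (z + h)%C eps He) as [d [Hd H]]. exists d; split; auto.
  intros k Hk. replace (z + k + h)%C with (z + h + k)%C by ring. auto. Qed.

Lemma unit_moment_shift (F : C -> C) (w h : C) : unit_moment F (w + h) = unit_moment (fun z => F (z + h)%C) w.
Proof. unfold unit_moment. f_equal. apply CInt_ext. intros. f_equal. f_equal. ring. Qed.

Lemma unit_moment_cont (F : C -> C) (w : C) : (forall z, ccont F z) -> ccont (unit_moment F) w.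
Proof.
  intros HF eps He. destruct (uniform_cont_disc F (Cmod w + 1) (eps / 2) HF ltac:(lra)) as [d [Hd H]].
  exists d; split; auto. intros h Hh.
  rewrite unit_moment_shift, <- unit_moment_minus; auto.
  2: intros; apply ccont_shift; auto.
  apply Rle_lt_trans with (eps / 2); [|lra]. apply unit_moment_bound.
  - intros; apply ccont_minus; auto. apply ccont_shift; auto.
  - intros z Hz. apply H; auto. generalize (Cmod_triangle_sub z w); lra.
Qed.

Lemma unit_moment_deriv (F F' : C -> C) (w : C) : is_C1 F F' -> cderiv (unit_moment F) w (unit_moment F' w).
Proof.
  intros HC. apply cderiv_scal.
  apply (cderiv_CInt (fun w t => F (w + 1 * cis t) * cis (-1 * t))%C (fun w t => F' (w + 1 * cis t) * cis (-1 * t))%C).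
  - intros; apply rcont_unit_moment. eapply is_C1_cont; eauto.
  - intros; apply rcont_unit_moment. apply HC.
  - intros eps He. destruct (uniform_deriv_disc F F' (Cmod w + 1) eps HC He) as [d [Hd H]].
    exists d; split; auto. intros h Hh t.
    replace (F (w + h + 1 * cis t) * cis (-1 * t) - F (w + 1 * cis t) * cis (-1 * t) - F' (w + 1 * cis t) * cis (-1 * t) * h)%C
     with ((F (w + 1 * cis t + h) - F (w + 1 * cis t) - F' (w + 1 * cis t) * h) * cis (-1 * t))%C.
    2: { replace (w + 1 * cis t + h)%C with (w + h + 1 * cis t)%C by ring. ring. }
    rewrite Cmod_mult, Cmod_cis, Rmult_1_r. apply H; auto.
    eapply Rle_trans; [apply Cmod_triangle|]. rewrite Cmod_mult, Cmod_cis, Cmod_1. lra.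
Qed.

Lemma entire_cont (F : C -> C) : entire F -> forall z, ccont F z.
Proof. intros H z. apply entire_iff in H. destruct H as [F' H]. eapply cderiv_ccont; eauto. Qed.

(** A primitive [Phi] of [F] has the continuous derivative [F], so Cauchy's formula represents [F]
    as a circle integral of [Phi]. Differentiating this under the integral shows that [F'] is a
    circle integral of [F], hence continuous. *)
Lemma entire_is_C1 (F : C -> C) : entire F -> exists F', is_C1 F F'.
Proof.
  intros HF. assert (HF0 := entire_cont F HF). apply entire_iff in HF. destruct HF as [d Hd].
  destruct (entire_primitive F) as [Phi HPhi]. { intros z. exists (d z); auto. }
  assert (HC : is_C1 Phi F) by (split; auto).
  exists (unit_moment F). split.
  - intros z. apply cderiv_ext with (unit_moment Phi). intros; apply unit_moment_C1; auto.
    apply unit_moment_deriv; auto.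
  - intros; apply unit_moment_cont; auto.
Qed.

Lemma entire_deriv (F : C -> C) : entire F -> exists F', (forall z, cderiv F z (F' z)) /\ entire F'.
Proof.
  intros HF. destruct (entire_is_C1 F HF) as [F' HC]. exists F'. split. apply HC.
  apply entire_iff. exists (unit_moment F'). intros z.
  apply cderiv_ext with (unit_moment F). intros; apply unit_moment_C1; auto.
  apply unit_moment_deriv; auto.
Qed.

Lemma entire_C1 (F F' : C -> C) : entire F -> (forall z, cderiv F z (F' z)) -> is_C1 F F'.
Proof.
  intros HF H. destruct (entire_is_C1 F HF) as [G [HG HG']]. split; auto.
  intros z eps He. destruct (HG' z eps He) as [d [Hd Hb]]. exists d; split; auto. intros h Hh.
  rewrite (cderiv_unique F (z + h) (F' (z + h)%C) (G (z + h)%C)), (cderiv_unique F z (F' z) (G z)); auto.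
Qed.

Lemma entire_of_deriv (F F' : C -> C) : entire F -> (forall z, cderiv F z (F' z)) -> entire F'.
Proof.
  intros HF H. destruct (entire_deriv F HF) as [G [HG HG']]. apply entire_iff in HG'. destruct HG' as [G' HG'].
  apply entire_iff. exists G'. intros z. apply cderiv_ext with G; auto. intros. eapply cderiv_unique; eauto.
Qed.

Lemma cauchy_estimate (F F' : C -> C) (w : C) (r M : R) : is_C1 F F' -> 0 < r ->
  (forall z, Cmod (z - w) = r -> Cmod (F z) <= M) -> Cmod (F' w) <= M / r.
Proof.
  intros HC Hr HM. assert (P := PI_RGT_0).
  assert (E := circle_derivative F F' w HC r).
  assert (B := CInt_le_const (fun t => F (w + r * cis t) * cis (-1 * t))%C M 0 (2 * PI)).
  rewrite E, Rminus_0_r, (Rabs_pos_eq (2 * PI)) in B by lra.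
  rewrite !Cmod_mult, !Cmod_RtoC_nonneg in B by lra.
  apply Rle_div_r; auto. apply Rmult_le_reg_r with (2 * PI). lra.
  eapply Rle_trans; [|apply B].
  - right; ring.
  - intros. apply rcont_mult. apply rcont_circle. eapply is_C1_cont; eauto. apply rcont_cis.
  - intros. rewrite Cmod_mult, Cmod_cis, Rmult_1_r. apply HM.
    replace (w + r * cis t - w)%C with (r * cis t)%C by ring. rewrite Cmod_mult, Cmod_cis, Cmod_RtoC_nonneg; lra.
Qed.

(** * Limits of sequences and of entire functions *)

Definition Clim (u : nat -> C) (l : C) : Prop :=
  forall eps, 0 < eps -> exists N, forall n, (N <= n)%nat -> Cmod (u n - l) <= eps.

Lemma Clim_unique (u : nat -> C) (l l' : C) : Clim u l -> Clim u l' -> l = l'.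
Proof.
  intros H H'. apply (Ceq_of_small _ _ 2). intros eps He.
  destruct (H eps He) as [N HN]. destruct (H' eps He) as [N' HN'].
  specialize (HN (N + N')%nat ltac:(lia)). specialize (HN' (N + N')%nat ltac:(lia)).
  eapply Rle_trans; [apply (Cmod_triangle3 _ (u (N + N')%nat))|]. rewrite (Cmod_sub_sym l). lra.
Qed.

Definition locally_uniform (Fn : nat -> C -> C) (F : C -> C) : Prop :=
  forall r eps, 0 < eps -> exists N, forall n z, (N <= n)%nat -> Cmod z <= r -> Cmod (Fn n z - F z) <= eps.

Lemma locally_uniform_cont (Fn : nat -> C -> C) (F : C -> C) :
  (forall n z, ccont (Fn n) z) -> locally_uniform Fn F -> forall z, ccont F z.
Proof.
  intros Hc HU z eps He. destruct (HU (Cmod z + 1) (eps / 4) ltac:(lra)) as [N HN].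
  destruct (Hc N z (eps / 4) ltac:(lra)) as [d [Hd H]].
  exists (Rmin d 1). split. apply Rmin_pos; lra. intros h Hh. generalize (Rmin_l d 1) (Rmin_r d 1); intros.
  assert (G1 := HN N z (le_n N) ltac:(lra)). assert (G2 := HN N (z + h)%C (le_n N)).
  assert (G3 : Cmod (z + h) <= Cmod z + 1) by (eapply Rle_trans; [apply Cmod_triangle|]; lra).
  specialize (G2 G3). specialize (H h ltac:(lra)).
  assert (T1 := Cmod_triangle3 (F (z + h)%C) (Fn N (z + h)%C) (F z)). assert (T2 := Cmod_triangle3 (Fn N (z + h)%C) (Fn N z) (F z)).
  rewrite (Cmod_sub_sym (F (z + h)%C) (Fn N (z + h)%C)) in T1. lra.
Qed.

(** Cauchy estimates on unit circles bound [Fn], [Fn'] and [Fn2] in turn, each costing one unit of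
    radius around [z]. The quadratic remainder of [Fn] at [z] is thus bounded independently of [n],
    and the bound passes to the limit. *)
Lemma locally_uniform_limit (Fn Fn' : nat -> C -> C) (F : C -> C) :
  (forall n, entire (Fn n)) -> (forall n z, cderiv (Fn n) z (Fn' n z)) -> locally_uniform Fn F ->
  exists F', (forall z, cderiv F z (F' z)) /\ forall z, Clim (fun n => Fn' n z) (F' z).
Proof.
  intros HE HD HU.
  assert (Hc : forall n z, ccont (Fn n) z) by (intros; apply entire_cont; auto).
  assert (HFc := locally_uniform_cont Fn F Hc HU).
  assert (C1 : forall n, is_C1 (Fn n) (Fn' n)) by (intros; apply entire_C1; auto).
  assert (E' : forall n, entire (Fn' n)) by (intros n; eapply entire_of_deriv; eauto).
  assert (Dx : forall n, exists D2, forall z, cderiv (Fn' n) z (D2 z)) by (intros n; apply entire_iff; auto).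
  apply choice in Dx. destruct Dx as [Fn2 HD2].
  assert (C2 : forall n, is_C1 (Fn' n) (Fn2 n)) by (intros; apply entire_C1; auto).
  assert (L : forall z, Clim (fun n => Fn' n z) (unit_moment F z)).
  { intros z eps He. destruct (HU (Cmod z + 1) eps He) as [N HN]. exists N. intros n Hn.
    rewrite <- (unit_moment_C1 _ _ _ (C1 n)), <- unit_moment_minus by auto.
    apply unit_moment_bound. intros; apply ccont_minus; auto.
    intros u Hu. apply HN; auto. generalize (Cmod_triangle_sub u z); lra. }
  exists (unit_moment F). split; auto.
  intros z. destruct (bounded_disc F (Cmod z + 3) HFc) as [M [HM0 HM]].
  destruct (HU (Cmod z + 3) 1 ltac:(lra)) as [N HN].
  assert (B0 : forall n u, (N <= n)%nat -> Cmod u <= Cmod z + 3 -> Cmod (Fn n u) <= M + 1).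
  { intros n u Hn Hu. specialize (HN n u Hn Hu). specialize (HM u Hu). generalize (Cmod_triangle_sub (Fn n u) (F u)); lra. }
  assert (B1 : forall n u, (N <= n)%nat -> Cmod u <= Cmod z + 2 -> Cmod (Fn' n u) <= M + 1).
  { intros n u Hn Hu. replace (M + 1) with ((M + 1) / 1) by field. apply (cauchy_estimate (Fn n)); auto. lra.
    intros v Hv. apply B0; auto. generalize (Cmod_triangle_sub v u); lra. }
  assert (B2 : forall n u, (N <= n)%nat -> Cmod u <= Cmod z + 1 -> Cmod (Fn2 n u) <= M + 1).
  { intros n u Hn Hu. replace (M + 1) with ((M + 1) / 1) by field. apply (cauchy_estimate (Fn' n)); auto. lra.
    intros v Hv. apply B1; auto. generalize (Cmod_triangle_sub v u); lra. }
  apply (cderiv_of_quadratic _ _ _ (M + 1) 1). lra. intros h Hh.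
  apply le_epsilon. intros eps He.
  destruct (HU (Cmod z + 1) (eps / 3) ltac:(lra)) as [N1 HN1]. destruct (L z (eps / 3) ltac:(lra)) as [N2 HN2].
  set (n := (N + N1 + N2)%nat).
  assert (Zh : forall t, 0 <= t <= 1 -> Cmod (z + t * (z + h - z)) <= Cmod z + 1).
  { intros t Ht. replace (z + h - z)%C with h by ring. eapply Rle_trans; [apply Cmod_triangle|].
    rewrite Cmod_mult, Cmod_RtoC_nonneg by lra. generalize (Cmod_ge_0 h); nra. }
  assert (Q : Cmod (Fn n (z + h)%C - Fn n z - Fn' n z * h)%C <= (M + 1) * (Cmod h * Cmod h)).
  { assert (S := segment_bound (fun u => Fn n u - Fn' n z * u)%C (fun u => Fn' n u - Fn' n z)%C z (z + h)%C ((M + 1) * Cmod h)).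
    replace (Fn n (z + h)%C - Fn n z - Fn' n z * h)%C with (Fn n (z + h)%C - Fn' n z * (z + h) - (Fn n z - Fn' n z * z))%C by ring.
    replace (z + h - z)%C with h in S by ring. rewrite <- Rmult_assoc. apply S.
    - intros t Ht. apply cderiv_minus; auto. eapply cderiv_eq; [|apply cderiv_scal, cderiv_id]. ring.
    - intros t Ht. assert (S2 := segment_bound (Fn' n) (Fn2 n) z (z + t * h)%C (M + 1)).
      replace (z + t * h - z)%C with (t * h)%C in S2 by ring.
      eapply Rle_trans. apply S2.
      + intros; apply HD2.
      + intros s Hs. apply B2. unfold n; lia. eapply Rle_trans; [apply Cmod_triangle|].
        rewrite !Cmod_mult, !Cmod_RtoC_nonneg by lra. generalize (Cmod_ge_0 h); intros.
        assert (0 <= s * t <= 1) by nra. nra.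
      + rewrite Cmod_mult, Cmod_RtoC_nonneg by lra. generalize (Cmod_ge_0 h); intros.
        apply Rmult_le_compat_l. lra. nra. }
  assert (H1 := HN1 n z ltac:(unfold n; lia) ltac:(lra)). assert (H2 := HN1 n (z + h)%C ltac:(unfold n; lia)).
  assert (Cmod (z + h) <= Cmod z + 1) by (eapply Rle_trans; [apply Cmod_triangle|]; lra). specialize (H2 H).
  specialize (HN2 n ltac:(unfold n; lia)).
  replace (F (z + h) - F z - unit_moment F z * h)%C with
    (Fn n (z + h) - Fn n z - Fn' n z * h + ((Fn n z - F z) - (Fn n (z + h) - F (z + h)) + (Fn' n z - unit_moment F z) * h))%C by ring.
  eapply Rle_trans; [apply Cmod_triangle|]. apply Rplus_le_compat. exact Q.
  eapply Rle_trans; [apply Cmod_triangle|]. rewrite Cmod_mult.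
  assert (T := Cmod_minus_le (Fn n z - F z)%C (Fn n (z + h)%C - F (z + h)%C)%C).
  assert (Cmod (Fn' n z - unit_moment F z) * Cmod h <= eps / 3).
  { generalize (Cmod_ge_0 h) (Cmod_ge_0 (Fn' n z - unit_moment F z)%C); intros. nra. }
  lra.
Qed.

(** Borel-Caratheodory. *)
Lemma deriv_bounded_of_Re (L L' : C -> C) (A B : R) : is_C1 L L' -> 0 <= B ->
  (forall z, Re (L z) <= A + B * Cmod z) -> forall w, Cmod (L' w) <= 2 * B.
Proof.
  intros HC HB HR w. assert (P := PI_RGT_0).
  assert (HL : forall z, ccont L z) by (eapply is_C1_cont; eauto).
  assert (X : forall r, 0 < r -> Cmod (L' w) * r <= 2 * (A + B * (Cmod w + r) - Re (L w))).
  { intros r Hr. set (M := A + B * (Cmod w + r)).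
    set (u := fun t => Re (L (w + r * cis t)%C)).
    assert (Cu : forall t, continuous u t) by (intros; apply rcont_Re, rcont_circle; auto).
    assert (Cf : forall k t, rcont (fun t => L (w + r * cis t) * cis (k * t))%C t).
    { intros; apply rcont_mult. apply rcont_circle; auto. apply rcont_cis. }
    assert (Ccf : forall t, rcont (fun t => Cconj (L (w + r * cis t)%C))%C t).
    { intros t. apply rcont_intro. exact (rcont_Re _ _ (rcont_circle L w r t HL)).
      apply (continuous_opp (V := R_NormedModule)). exact (rcont_Im _ _ (rcont_circle L w r t HL)). }
    assert (Hr0 : RtoC r <> 0%C) by (intros E; apply RtoC_inj in E; lra).
    assert (E1 := circle_derivative L L' w HC r).
    assert (E2 := circle_positive_moment L L' w HC r Hr0).
    assert (E3 := mean_value L L' w HC r).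
    assert (E4 : CInt (fun t => Cconj (L (w + r * cis t)) * cis (-1 * t))%C 0 (2 * PI) = 0%C).
    { transitivity (Cconj (CInt (fun t => L (w + r * cis t) * cis (1 * t))%C 0 (2 * PI))).
      2: { rewrite E2. apply C_ext; simpl; ring. }
      rewrite (CInt_ext _ (fun t => Cconj (L (w + r * cis t) * cis (1 * t))%C)).
      2: { intros. rewrite Cmult_conj. f_equal. unfold cis. replace (-1 * t) with (-(1 * t)) by ring.
           rewrite cos_neg, sin_neg. reflexivity. }
      apply C_ext. rewrite CInt_Re, re_conj, CInt_Re. apply RInt_ext. intros; apply re_conj.
      rewrite CInt_Im, im_conj, CInt_Im. rewrite (RInt_ext _ (fun t => - Im (L (w + r * cis t) * cis (1 * t))%C)) by (intros; apply im_conj).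
      apply (RInt_opp (V := R_CompleteNormedModule)). apply ex_RInt_cont. intros; apply rcont_Im, Cf. }
    assert (E5 : CInt (fun t => cis (-1 * t)) 0 (2 * PI) = 0%C).
    { apply CInt_cis. lra. replace (-1 * (2 * PI)) with (-(2 * PI)) by ring. unfold cis; rewrite cos_neg, sin_neg, cos_2PI, sin_2PI, Ropp_0; auto. }
    (* The moment of the conjugate vanishes, so adding it replaces [L] by twice its real part; the
       constant [M] has moment zero. The weight [M - u] is then nonnegative, and the integral of its
       modulus is given by the mean value property. *)
    assert (E6 : CInt (fun t => RtoC (M - u t) * cis (-1 * t))%C 0 (2 * PI) = (- (PI * (r * L' w)))%C).
    { rewrite (CInt_ext _ (fun t => M * cis (-1 * t) - / 2 * (L (w + r * cis t) * cis (-1 * t) + Cconj (L (w + r * cis t)) * cis (-1 * t)))%C).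
      2: { intros t _. rewrite RtoC_minus. unfold u. rewrite re_alt. field. }
      rewrite CInt_minus, !CInt_scal, CInt_plus, E1, E4, E5; [field|..].
      all: intros; repeat first [apply rcont_plus | apply rcont_mult | apply rcont_const | apply rcont_cis | apply Ccf | apply rcont_circle; auto].
    }
    assert (Hu : forall t, 0 <= M - u t).
    { intros t. unfold u, M. specialize (HR (w + r * cis t)%C).
      assert (Cmod (w + r * cis t) <= Cmod w + r).
      { eapply Rle_trans; [apply Cmod_triangle|]. rewrite Cmod_mult, Cmod_cis, Cmod_RtoC_nonneg; lra. }
      nra. }
    assert (E7 := CInt_le (fun t => RtoC (M - u t) * cis (-1 * t))%C (fun t => M - u t) 0 (2 * PI)).
    assert (Cv : forall t, continuous (fun t => M - u t) t).
    { intros. apply (continuous_minus (V := R_NormedModule)). apply continuous_const. apply Cu. }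
    assert (E8 : RInt (fun t => M - u t) 0 (2 * PI) = 2 * PI * (M - Re (L w))).
    { rewrite (RInt_minus (V := R_CompleteNormedModule)); [|apply ex_RInt_const|apply ex_RInt_cont; auto].
      rewrite RInt_const. unfold u. rewrite <- CInt_Re. rewrite E3.
      rewrite <- RtoC_mult, re_scal_l. unfold minus, plus, opp, scal; simpl; unfold mult; simpl. ring. }
    rewrite E6, E8 in E7.
    rewrite Cmod_opp, !Cmod_mult, !Cmod_RtoC_nonneg in E7 by lra.
    assert (PI * (r * Cmod (L' w)) <= 2 * PI * (M - Re (L w))).
    { apply E7. lra.
      - intros; apply rcont_mult; [|apply rcont_cis]. apply rcont_intro. apply Cv. simpl. apply continuous_const.
      - auto.
      - intros. rewrite Cmod_mult, Cmod_cis, Rmult_1_r, Cmod_RtoC_nonneg; auto. lra. }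
    apply Rmult_le_reg_l with PI; auto. unfold M in *. lra. }
  apply Rnot_lt_le. intros Hlt.
  set (q := Cmod (L' w) - 2 * B). assert (0 < q) by (unfold q; lra).
  set (K := 2 * (A + B * Cmod w - Re (L w))).
  assert (HX : forall r, 0 < r -> q * r <= K) by (intros r Hr; specialize (X r Hr); unfold q, K; lra).
  specialize (HX ((Rabs K + 1) / q)). assert (0 < (Rabs K + 1) / q) by (apply Rdiv_lt_0_compat; auto; generalize (Rabs_pos K); lra).
  specialize (HX H0). replace (q * ((Rabs K + 1) / q)) with (Rabs K + 1) in HX by (field; lra).
  generalize (Rle_abs K); lra.
Qed.

Lemma liouville (F F' : C -> C) (M : R) : is_C1 F F' -> (forall z, Cmod (F z) <= M) -> forall z, F' z = 0%C.
Proof.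
  intros HC HM z. apply Cmod_eq_0, Rle_antisym; [|apply Cmod_ge_0].
  assert (HM0 : 0 <= M) by (eapply Rle_trans; [apply Cmod_ge_0| apply (HM 0%C)]).
  apply le_epsilon. intros eps He. rewrite Rplus_0_l.
  apply Rle_trans with (M / ((M + 1) / eps)).
  apply (cauchy_estimate F); auto. apply Rdiv_lt_0_compat; lra.
  replace (M / ((M + 1) / eps)) with (eps * (M / (M + 1))) by (field; lra).
  rewrite <- (Rmult_1_r eps) at 2. apply Rmult_le_compat_l. lra. apply Rle_div_l; lra.
Qed.

(** Integrating [H' / H] gives an entire logarithm [L]. Exponential type bounds [Re L] linearly, so
    [L'] is bounded and hence constant. *)
Lemma zero_free_exponential_type (H : C -> C) : entire H -> (forall z, H z <> 0%C) -> exponential_type H ->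
  exists c, forall z, H z = (H 0 * cexp (c * z))%C.
Proof.
  intros HE HZ [A [B HB]].
  destruct (entire_deriv H HE) as [H' [HH' HEH']].
  assert (HEH'' := HEH'). apply entire_iff in HEH''. destruct HEH'' as [H2 HH2].
  set (K := fun z => (H' z * / H z)%C).
  assert (HK : entire K).
  { apply entire_iff. exists (fun z => (H2 z * / H z + H' z * (- H' z / (H z * H z)))%C). intros z.
    apply (cderiv_mult H' (fun z => / H z)%C); auto. apply (cderiv_inv H); auto. }
  assert (HKx := HK). apply entire_iff in HKx. destruct HKx as [K' HK'].
  destruct (entire_primitive K) as [L0 HL0]. { intros z; exists (K' z); auto. }
  set (L := fun z => (L0 z - L0 0)%C).
  assert (HL : forall z, cderiv L z (K z)).
  { intros z. eapply cderiv_eq; [|apply cderiv_minus; [apply HL0|apply cderiv_const]]. ring. }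
  assert (HC : is_C1 L K). { apply entire_C1; auto. apply entire_iff; eauto. }
  assert (HexpL : forall z, H z = (H 0 * cexp (L z))%C).
  { intros z. assert (Z : forall z, cderiv (fun z => H z * cexp (- L z))%C z 0%C).
    { intros u. eapply cderiv_eq; [|apply cderiv_mult; [apply HH'|apply (cderiv_comp cexp (fun z => - L z)%C)]].
      2: apply cderiv_cexp. 2: apply cderiv_opp, HL. unfold K. field. apply HZ. }
    assert (E := cderiv_zero_const _ Z z 0%C). cbv beta in E.
    replace (L 0) with (RtoC 0) in E by (unfold L; ring). rewrite Copp_0, cexp_0, cexp_neg in E.
    replace (H z) with (H z * / cexp (L z) * cexp (L z))%C by (field; apply cexp_neq_0). rewrite E. ring. }
  assert (H0p : 0 < Cmod (H 0)) by (apply Cmod_gt_0, HZ).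
  assert (HA : 0 < A). { specialize (HB 0%C). rewrite Cmod_0, Rmult_0_r, exp_0 in HB. lra. }
  assert (HRe : forall z, Re (L z) <= ln (A / Cmod (H 0)) + Rabs B * Cmod z).
  { intros z. specialize (HB z). rewrite HexpL, Cmod_mult, Cmod_cexp in HB.
    destruct (Rle_lt_dec (Re (L z)) (ln (A / Cmod (H 0)) + Rabs B * Cmod z)) as [|Hlt]; auto. exfalso.
    apply exp_increasing in Hlt. rewrite exp_plus, exp_ln in Hlt by (apply Rdiv_lt_0_compat; auto).
    assert (exp (B * Cmod z) <= exp (Rabs B * Cmod z)).
    { apply exp_le. apply Rmult_le_compat_r. apply Cmod_ge_0. apply Rle_abs. }
    apply Rmult_lt_compat_l with (r := Cmod (H 0)) in Hlt; auto.
    replace (Cmod (H 0) * (A / Cmod (H 0) * exp (Rabs B * Cmod z))) with (A * exp (Rabs B * Cmod z)) in Hlt by (field; lra).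
    assert (A * exp (B * Cmod z) <= A * exp (Rabs B * Cmod z)) by (apply Rmult_le_compat_l; lra). lra. }
  assert (HKb := deriv_bounded_of_Re L K _ _ HC (Rabs_pos B) HRe).
  assert (HCK : is_C1 K K') by (apply entire_C1; auto).
  assert (HK0 := liouville K K' _ HCK HKb).
  assert (HKc : forall z, K z = K 0%C). { intros z. apply cderiv_zero_const. intros u. rewrite <- (HK0 u). auto. }
  exists (K 0%C). intros z. rewrite HexpL. f_equal. f_equal.
  assert (Z : forall z, cderiv (fun z => L z - K 0 * z)%C z 0%C).
  { intros u. eapply cderiv_eq; [|apply cderiv_minus; [apply HL|apply cderiv_scal, cderiv_id]]. rewrite (HKc u). ring. }
  assert (E := cderiv_zero_const _ Z z 0%C). cbv beta in E.
  apply Ceq_minus. rewrite E. unfold L. ring.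
Qed.

(** * The maximum principle *)

(** Without a maximum each point is exceeded by some other point, which by continuity also exceeds
    all values nearby. Compactness then yields one point exceeding every value on the rectangle, its
    own included. *)
Lemma rectangle_max (v : C -> R) (x0 y0 u0 v0 : R) : 0 <= u0 -> 0 <= v0 ->
  (forall z eps, 0 < eps -> exists del, 0 < del /\ forall h, Cmod h < del -> Rabs (v (z + h)%C - v z) < eps) ->
  exists p : C, x0 <= Re p <= x0 + u0 /\ y0 <= Im p <= y0 + v0 /\
    forall z, x0 <= Re z <= x0 + u0 -> y0 <= Im z <= y0 + v0 -> v z <= v p.
Proof.
  intros Hu Hv Hc. apply NNPP. intros Hn.
  set (inR := fun z => x0 <= Re z <= x0 + u0 /\ y0 <= Im z <= y0 + v0).
  assert (N : forall p, inR p -> exists z, inR z /\ v p < v z).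
  { intros p Hp. apply NNPP. intros Hz. apply Hn. exists p. split; [apply Hp|split; [apply Hp|]]. intros z H1 H2. apply Rnot_lt_le. intros Hl. apply Hz. exists z. split; auto. split; auto. }
  assert (G : exists z', inR z' /\ forall z, x0 <= Re z <= x0 + u0 -> y0 <= Im z <= y0 + v0 -> v z < v z').
  { apply (rectangle_compact (fun x y a b => exists z', inR z' /\ forall z, x <= Re z <= x + a -> y <= Im z <= y + b -> v z < v z')); auto.
    - intros x y a b [z1 [I1 H1]] [z2 [I2 H2]] [z3 [I3 H3]] [z4 [I4 H4]].
      assert (X : forall p q, inR p -> inR q -> exists m, inR m /\ v p <= v m /\ v q <= v m).
      { intros p q Ip Iq. destruct (Rle_dec (v p) (v q)). exists q; split; auto; lra. exists p; split; auto; lra. }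
      destruct (X z1 z2 I1 I2) as [m1 [J1 K1]]. destruct (X z3 z4 I3 I4) as [m2 [J2 K2]].
      destruct (X m1 m2 J1 J2) as [m [J K]]. exists m. split; auto. intros z Hx Hy.
      destruct (Rle_dec (Re z) (x + a / 2)); destruct (Rle_dec (Im z) (y + b / 2)).
      specialize (H1 z); lra. specialize (H3 z); lra. specialize (H2 z); lra. specialize (H4 z); lra.
    - intros p q Hp Hq. set (z0 := (p, q) : C). destruct (N z0) as [z' [Hz' Hlt]]. split; auto.
      destruct (Hc z0 (v z' - v z0) ltac:(lra)) as [d [Hd H]]. exists d. split; auto.
      intros x y a b _ _ _ _ _ _ Hab Hx Hy. exists z'. split; auto. intros z Hzx Hzy.
      assert (Hz : Cmod (z - z0) < d).
      { eapply Rle_lt_trans; [apply Cmod_le_abs|]. unfold Cminus; rewrite re_plus, re_opp, im_plus, im_opp.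
        change (Re z0) with p. change (Im z0) with q.
        assert (Rabs (Re z + - p) <= a) by (apply Rabs_le; lra). assert (Rabs (Im z + - q) <= b) by (apply Rabs_le; lra). lra. }
      specialize (H _ Hz). replace (z0 + (z - z0))%C with z in H by ring. apply Rabs_lt_between in H. lra. }
  destruct G as [z' [[H1 H2] H]]. specialize (H z' H1 H2). lra.
Qed.

(** If [k > 0], points on the left force [phi' 0 >= 0]; then [phi'] is positive just to the right of
    [0], and [phi] exceeds [phi 0] there. *)
Lemma second_derivative_test (phi phi' : R -> R) (k r : R) : (forall s, is_derive phi s (phi' s)) ->
  is_derive phi' 0 k -> 0 < r -> (forall s, Rabs s < r -> phi s <= phi 0) -> k <= 0.
Proof.
  intros H1 H2 Hr Hmax. apply Rnot_lt_le. intros Hk.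
  assert (P0 : 0 <= phi' 0).
  { apply Rnot_lt_le. intros Hneg. assert (D := H1 0). apply is_derive_Reals in D.
    destruct (D (- phi' 0 / 2) ltac:(lra)) as [d Hd].
    set (h := - Rmin (r / 2) (d / 2)).
    assert (Hh : 0 < - h /\ - h < r /\ - h < d).
    { unfold h. rewrite Ropp_involutive. assert (Pd := cond_pos d). generalize (Rmin_l (r / 2) (d / 2)) (Rmin_r (r / 2) (d / 2)); intros. split. apply Rmin_pos; lra. lra. }
    specialize (Hd h ltac:(lra)). rewrite Rabs_left in Hd by lra. specialize (Hd ltac:(lra)).
    specialize (Hmax h). rewrite Rabs_left in Hmax by lra. specialize (Hmax ltac:(lra)).
    rewrite Rplus_0_l in Hd. apply Rabs_lt_between in Hd.
    assert ((phi h - phi 0) / h * h = phi h - phi 0) by (field; lra). nra. }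
  apply is_derive_Reals in H2. destruct (H2 (k / 2) ltac:(lra)) as [d Hd].
  set (h := Rmin (r / 2) (d / 2)). assert (Pd := cond_pos d).
  assert (Hh : 0 < h /\ h < r /\ h < d).
  { unfold h. generalize (Rmin_l (r / 2) (d / 2)) (Rmin_r (r / 2) (d / 2)); intros. split. apply Rmin_pos; lra. lra. }
  destruct (MVT_gen phi 0 h phi') as [c [Hc He]].
  - intros; apply H1.
  - intros. apply continuity_pt_filterlim. apply (ex_derive_continuous phi). exists (phi' x). apply H1.
  - rewrite Rmin_left, Rmax_right in Hc by lra.
    specialize (Hmax h). rewrite Rabs_pos_eq in Hmax by lra. specialize (Hmax ltac:(lra)).
    assert (Hle : phi' c <= 0) by nra.
    (* The mean value point may be the endpoint [0] itself. Then [phi' 0 = 0], and halving the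
       interval produces a point [c3 > 0], where the derivative is positive. *)
    destruct (Req_dec c 0) as [-> | Hc0].
    + assert (E0 : phi' 0 = 0) by lra. assert (phi h = phi 0) by nra.
      destruct (MVT_gen phi 0 (h / 2) phi') as [c2 [Hc2 He2]].
      * intros; apply H1.
      * intros. apply continuity_pt_filterlim. apply (ex_derive_continuous phi). exists (phi' x). apply H1.
      * rewrite Rmin_left, Rmax_right in Hc2 by lra.
        destruct (MVT_gen phi (h / 2) h phi') as [c3 [Hc3 He3]].
        -- intros; apply H1.
        -- intros. apply continuity_pt_filterlim. apply (ex_derive_continuous phi). exists (phi' x). apply H1.
        -- rewrite Rmin_left, Rmax_right in Hc3 by lra.
           assert (Pos : forall s, 0 < s <= h -> 0 < phi' s).
           { intros s Hs. specialize (Hd s ltac:(lra)). rewrite Rabs_pos_eq in Hd by lra. specialize (Hd ltac:(lra)).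
             rewrite Rplus_0_l, E0 in Hd. apply Rabs_lt_between in Hd.
             assert ((phi' s - 0) / s * s = phi' s) by (field; lra). nra. }
           specialize (Pos c3 ltac:(lra)).
           assert (phi (h/2) < phi h) by nra.
           assert (0 <= phi' c2). { destruct (Req_dec c2 0) as [-> | Hn]. lra.
             specialize (Hd c2 Hn). rewrite Rabs_pos_eq in Hd by lra. specialize (Hd ltac:(lra)).
             rewrite Rplus_0_l, E0 in Hd. apply Rabs_lt_between in Hd.
             assert ((phi' c2 - 0) / c2 * c2 = phi' c2) by (field; lra). nra. }
           nra.
    + specialize (Hd c Hc0). rewrite Rabs_pos_eq in Hd by lra. specialize (Hd ltac:(lra)).
      rewrite Rplus_0_l in Hd. apply Rabs_lt_between in Hd.
      assert ((phi' c - phi' 0) / c * c = phi' c - phi' 0) by (field; lra). nra.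
Qed.

(** [|F|^2 + e x^2] has Laplacian [4 |F'|^2 + 2 e > 0], hence no interior maximum. *)
Lemma rectangle_max_principle (F : C -> C) (x1 x2 y1 y2 M : R) : entire F -> x1 < x2 -> y1 < y2 ->
  (forall z, x1 <= Re z <= x2 -> y1 <= Im z <= y2 -> Re z = x1 \/ Re z = x2 \/ Im z = y1 \/ Im z = y2 -> Cmod (F z) <= M) ->
  forall z, x1 <= Re z <= x2 -> y1 <= Im z <= y2 -> Cmod (F z) <= M.
Proof.
  intros HE Hx Hy HM z Hzx Hzy.
  assert (HM0 : 0 <= M). { eapply Rle_trans; [apply Cmod_ge_0|apply (HM (x1, y1))]; simpl; auto; lra. }
  destruct (entire_deriv F HE) as [F' [HF HE']]. apply entire_iff in HE'. destruct HE' as [F2 HF'].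
  set (K := (Rabs x1 + Rabs x2) * (Rabs x1 + Rabs x2)).
  assert (Kz : forall w, x1 <= Re w <= x2 -> Re w * Re w <= K).
  { intros w Hw. unfold K. assert (Rabs (Re w) <= Rabs x1 + Rabs x2).
    { apply Rabs_le. generalize (Rabs_pos x1) (Rabs_pos x2) (Rle_abs x1) (Rle_abs x2) (Rle_abs (- x1)) (Rle_abs (- x2)). rewrite !Rabs_Ropp. lra. }
    replace (Re w * Re w) with (Rabs (Re w) * Rabs (Re w)). apply Rmult_le_compat; auto; apply Rabs_pos.
    rewrite <- Rabs_mult, Rabs_pos_eq; nra. }
  assert (S : forall e, 0 < e -> Cmod (F z) * Cmod (F z) <= M * M + e * K).
  { intros e He.
    set (v := fun w => Re (F w) * Re (F w) + Im (F w) * Im (F w) + e * (Re w * Re w)).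
    assert (vE : forall w, v w = Cmod (F w) * Cmod (F w) + e * (Re w * Re w)) by (intros; unfold v; rewrite Cmod_sq; ring).
    assert (Hvc : forall w eps, 0 < eps -> exists del, 0 < del /\ forall h, Cmod h < del -> Rabs (v (w + h)%C - v w) < eps).
    { intros w eps Heps.
      assert (HcF : ccont F w) by (eapply cderiv_ccont; eauto).
      set (B := 2 * Cmod (F w) + 1). set (X := 2 * Rabs (Re w) + 1).
      assert (0 < B) by (unfold B; generalize (Cmod_ge_0 (F w)); lra).
      assert (0 < X) by (unfold X; generalize (Rabs_pos (Re w)); lra).
      destruct (HcF (Rmin 1 (eps / 2 / B))) as [d [Hd H']].
      { apply Rmin_pos. lra. repeat apply Rdiv_lt_0_compat; lra. }
      exists (Rmin d (Rmin 1 (eps / 2 / (e * X)))). split.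
      { repeat apply Rmin_pos; auto. lra. repeat apply Rdiv_lt_0_compat; try lra. nra. }
      intros h Hh. generalize (Rmin_l d (Rmin 1 (eps / 2 / (e * X)))) (Rmin_r d (Rmin 1 (eps / 2 / (e * X)))) (Rmin_l 1 (eps / 2 / (e * X))) (Rmin_r 1 (eps / 2 / (e * X))); intros.
      specialize (H' h ltac:(lra)). generalize (Rmin_l 1 (eps / 2 / B)) (Rmin_r 1 (eps / 2 / B)); intros.
      rewrite !vE.
      set (p := Cmod (F (w + h)%C)) in *. set (q := Cmod (F w)) in *.
      assert (T1 := Cmod_triangle_sub (F (w + h)%C) (F w)). assert (T2 := Cmod_triangle_sub (F w) (F (w + h)%C)). rewrite (Cmod_sub_sym (F w)) in T2. fold p q in T1, T2.
      set (D := Cmod (F (w + h)%C - F w)) in *.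
      assert (p >= 0 /\ q >= 0) by (split; apply Rle_ge, Cmod_ge_0).
      assert (D * B < eps / 2). { apply Rlt_le_trans with (eps / 2 / B * B). apply Rmult_lt_compat_r; lra. right; field; lra. }
      assert (Q1 : Rabs (p * p - q * q) <= D * B).
      { replace (p * p - q * q) with ((p - q) * (p + q)) by ring. rewrite Rabs_mult. apply Rmult_le_compat; try apply Rabs_pos.
        apply Rabs_le; lra. apply Rabs_le. unfold B. lra. }
      assert (Hre := re_le_Cmod h).
      assert (Q2 : Rabs (Re (w + h) * Re (w + h) - Re w * Re w) <= Cmod h * X).
      { rewrite re_plus. replace ((Re w + Re h) * (Re w + Re h) - Re w * Re w) with (Re h * (2 * Re w + Re h)) by ring. rewrite Rabs_mult. apply Rmult_le_compat; try apply Rabs_pos; auto.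
        eapply Rle_trans; [apply Rabs_triang|]. rewrite Rabs_mult, (Rabs_pos_eq 2) by lra. unfold X. lra. }
      assert (e * (Cmod h * X) < eps / 2).
      { apply Rlt_le_trans with (eps / 2 / (e * X) * (e * X)). 2: right; field; lra.
        replace (e * (Cmod h * X)) with (Cmod h * (e * X)) by ring. apply Rmult_lt_compat_r; nra. }
      replace (p * p + e * (Re (w + h) * Re (w + h)) - (q * q + e * (Re w * Re w))) with ((p * p - q * q) + e * (Re (w + h) * Re (w + h) - Re w * Re w)) by ring.
      eapply Rle_lt_trans; [apply Rabs_triang|]. rewrite Rabs_mult, (Rabs_pos_eq e) by lra.
      assert (e * Rabs (Re (w + h) * Re (w + h) - Re w * Re w) <= e * (Cmod h * X)) by (apply Rmult_le_compat_l; lra). lra. }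
    destruct (rectangle_max v x1 y1 (x2 - x1) (y2 - y1)) as [p [Hpx [Hpy Hpm]]]; try lra; auto.
    replace (x1 + (x2 - x1)) with x2 in * by ring. replace (y1 + (y2 - y1)) with y2 in * by ring.
    assert (Hb : Re p = x1 \/ Re p = x2 \/ Im p = y1 \/ Im p = y2).
    { apply NNPP. intros Hn.
      assert (Hp1 : x1 < Re p < x2 /\ y1 < Im p < y2).
      { split; split; apply Rnot_le_lt; intros Hc; apply Hn; lra. }
      (* Half the second derivative of [v] in the direction [u]. Adding the cases [u = 1] and
         [u = Ci] cancels the terms with [F2], because [u^2] is [1] and [-1]. *)
      assert (L : forall u : C, Cmod u = 1 ->
         Re (F' p * u)%C * Re (F' p * u)%C + Im (F' p * u)%C * Im (F' p * u)%C + Re (F p) * Re (F2 p * u * u)%C + Im (F p) * Im (F2 p * u * u)%C + e * (Re u * Re u) <= 0).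
      { intros u Hu1.
        assert (Df : forall s, rderiv (fun s : R => F (p + s * u)%C) s (F' (p + s * u) * u)%C).
        { intros s. apply (rderiv_comp F (fun s : R => p + s * u)%C). auto. apply rderiv_line. }
        assert (Df' : forall s, rderiv (fun s : R => F' (p + s * u) * u)%C s (F2 (p + s * u) * u * u)%C).
        { intros s. eapply rderiv_eq; [|apply rderiv_mult; [apply (rderiv_comp F' (fun s : R => p + s * u)%C); [auto|apply rderiv_line]|]].
          2: { instantiate (1 := 0%C). apply rderiv_intro; simpl; auto_derive; auto. } cbv beta. ring. }
        assert (Hre : forall s : R, Re (p + s * u)%C = Re p + s * Re u) by (intros; rewrite re_plus, re_scal_l; auto).
        assert (Him : forall s : R, Im (p + s * u)%C = Im p + s * Im u) by (intros; rewrite im_plus, im_scal_l; auto).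
        assert (E0 : (p + 0 * u)%C = p) by ring.
        apply Rmult_le_reg_l with 2; [lra|]. rewrite Rmult_0_r.
        apply (second_derivative_test (fun s : R => v (p + s * u)%C)
          (fun s : R => 2 * (Re (F (p + s * u)%C) * Re (F' (p + s * u) * u)%C + Im (F (p + s * u)%C) * Im (F' (p + s * u) * u)%C + e * ((Re p + s * Re u) * Re u)))
          _ (Rmin (Rmin (Re p - x1) (x2 - Re p)) (Rmin (Im p - y1) (y2 - Im p)))).
        - intros s. unfold v. assert (A1 := rderiv_Re _ _ _ (Df s)). assert (A2 := rderiv_Im _ _ _ (Df s)).
          apply (is_derive_ext (fun s : R => Re (F (p + s * u)%C) * Re (F (p + s * u)%C) + Im (F (p + s * u)%C) * Im (F (p + s * u)%C) + e * ((Re p + s * Re u) * (Re p + s * Re u)))).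
          { intros t. rewrite Hre. auto. }
          evar_last. apply @is_derive_plus. apply @is_derive_plus; apply @is_derive_mult; eauto; intros; apply Rmult_comm.
          instantiate (1 := e * (2 * ((Re p + s * Re u) * Re u))). auto_derive; auto; ring.
          unfold plus, mult; simpl. ring.
        - assert (A1 := rderiv_Re _ _ _ (Df 0)). assert (A2 := rderiv_Im _ _ _ (Df 0)).
          assert (A3 := rderiv_Re _ _ _ (Df' 0)). assert (A4 := rderiv_Im _ _ _ (Df' 0)).
          evar_last. apply is_derive_scal. apply @is_derive_plus. apply @is_derive_plus; apply @is_derive_mult; eauto; intros; apply Rmult_comm.
          instantiate (1 := e * (Re u * Re u)). auto_derive; auto; ring.
          unfold plus, mult, scal; simpl; unfold mult; simpl. rewrite E0. ring.
        - repeat apply Rmin_pos; lra.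
        - intros s Hs. rewrite E0. apply Hpm.
          + rewrite Hre. assert (Rabs (s * Re u) <= Rabs s). { rewrite Rabs_mult. generalize (re_le_Cmod u) (Rabs_pos s); intros; nra. }
            apply Rabs_le_between in H. generalize (Rmin_l (Rmin (Re p - x1) (x2 - Re p)) (Rmin (Im p - y1) (y2 - Im p))) (Rmin_l (Re p - x1) (x2 - Re p)) (Rmin_r (Re p - x1) (x2 - Re p)); lra.
          + rewrite Him. assert (Rabs (s * Im u) <= Rabs s). { rewrite Rabs_mult. generalize (Im_le_Cmod u) (Rabs_pos s); intros; nra. }
            apply Rabs_le_between in H. generalize (Rmin_r (Rmin (Re p - x1) (x2 - Re p)) (Rmin (Im p - y1) (y2 - Im p))) (Rmin_l (Im p - y1) (y2 - Im p)) (Rmin_r (Im p - y1) (y2 - Im p)); lra. }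
      assert (L1 := L 1%C Cmod_1). assert (L2 := L Ci Cmod_Ci).
      rewrite !Cmult_1_r in L1. rewrite !re_mult, !im_mult, !re_mult in L2.
      change (Re Ci) with 0 in L2. change (Im Ci) with 1 in L2. change (Re 1) with 1 in L1. change (Re (RtoC 1)) with 1 in L1.
      assert (0 <= Re (F' p) * Re (F' p)) by nra. assert (0 <= Im (F' p) * Im (F' p)) by nra. lra. }
    specialize (HM p Hpx Hpy Hb). assert (0 <= Cmod (F p)) by apply Cmod_ge_0.
    specialize (Hpm z Hzx Hzy). rewrite !vE in Hpm. specialize (Kz p Hpx).
    assert (Cmod (F p) * Cmod (F p) <= M * M) by (apply Rmult_le_compat; auto).
    assert (e * (Re p * Re p) <= e * K) by (apply Rmult_le_compat_l; lra).
    assert (0 <= e * (Re z * Re z)) by (apply Rmult_le_pos; nra). lra. }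
  assert (Q : Cmod (F z) * Cmod (F z) <= M * M).
  { apply le_epsilon. intros eps Heps. assert (0 <= K) by (specialize (Kz z Hzx); nra).
    specialize (S (eps / (K + 1))). assert (0 < eps / (K + 1)) by (apply Rdiv_lt_0_compat; lra). specialize (S H0).
    assert (eps / (K + 1) * K <= eps).
    { replace eps with (eps / (K + 1) * (K + 1)) at 2 by (field; lra). apply Rmult_le_compat_l; lra. } lra. }
  generalize (Cmod_ge_0 (F z)); intros. nra.
Qed.

(** A Phragmen-Lindelof argument: the factor [exp (- d z^2)] has modulus [exp (- d (x^2 - y^2))] and
    decays along the strip, so the maximum principle applies on a long rectangle; then [d] tends to
    [0]. *)
Lemma strip_max_principle (F : C -> C) (s K M : R) : entire F -> 0 < s ->
  (forall z, - s <= Im z <= s -> Cmod (F z) <= K) ->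
  (forall z, Im z = s \/ Im z = - s -> Cmod (F z) <= M) ->
  forall z, - s <= Im z <= s -> Cmod (F z) <= M.
Proof.
  intros HE Hs HK HM z Hz.
  assert (HM0 : 0 <= M). { eapply Rle_trans; [apply Cmod_ge_0|apply (HM (0, s))]. simpl; auto. }
  assert (HK0 : 0 <= K). { eapply Rle_trans; [apply Cmod_ge_0|apply (HK (0, s))]. simpl; lra. }
  assert (HFd := HE). apply entire_iff in HFd. destruct HFd as [F' HF].
  assert (X : forall d, 0 < d <= 1 -> Cmod (F z) * exp (- d * (Re z * Re z)) <= (M + d) * exp (d * (s * s))).
  { intros d Hd.
    set (G := fun w => (F w * cexp (- d * (w * w)))%C).
    assert (HG : entire G).
    { apply entire_iff. exists (fun w => F' w * cexp (- d * (w * w)) + F w * (cexp (- d * (w * w)) * (- d * (w + w))))%C. intros w.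
      apply (cderiv_mult F (fun w => cexp (- d * (w * w)))%C); auto. apply (cderiv_comp cexp (fun w => - d * (w * w))%C). apply cderiv_cexp.
      eapply cderiv_eq; [|apply cderiv_scal, cderiv_mult; apply cderiv_id]. cbv beta; ring. }
    assert (HGm : forall w, Cmod (G w) = Cmod (F w) * exp (- d * (Re w * Re w) + d * (Im w * Im w))).
    { intros w. unfold G. rewrite Cmod_mult, Cmod_cexp. f_equal. f_equal. rewrite <- RtoC_opp, re_scal_l, re_mult. ring. }
    (* As [R1 >= 1], one has [d R1^2 >= K / d], and [exp x >= 1 + x] makes [K exp (- d R1^2)] at
       most [d] on the vertical sides. *)
    set (R1 := Rabs (Re z) + 1 + K / (d * d)).
    assert (0 <= K / (d * d)). { apply Rmult_le_pos; auto. left; apply Rinv_0_lt_compat; nra. }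
    assert (HR1 : 1 <= R1) by (unfold R1; generalize (Rabs_pos (Re z)); lra).
    assert (Hzr := Rabs_le_between (Re z) (Rabs (Re z))). destruct Hzr as [Hzr _]. specialize (Hzr (Rle_refl _)).
    assert (B := rectangle_max_principle G (- R1) R1 (- s) s ((M + d) * exp (d * (s * s))) HG ltac:(lra) ltac:(lra)).
    apply Rle_trans with (Cmod (G z)).
    { rewrite HGm, exp_plus, <- (Rmult_assoc (Cmod (F z))). rewrite <- (Rmult_1_r (Cmod (F z) * exp (- d * (Re z * Re z)))) at 1.
      apply Rmult_le_compat_l. apply Rmult_le_pos. apply Cmod_ge_0. left; apply exp_pos.
      rewrite <- exp_0. apply exp_le. apply Rmult_le_pos; nra. }
    apply B; [|unfold R1; lra|lra].
    intros w Hwx Hwy Hbd. rewrite HGm, exp_plus, <- (Rmult_assoc (Cmod (F w))).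
    assert (E1 : exp (d * (Im w * Im w)) <= exp (d * (s * s))) by (apply exp_le, Rmult_le_compat_l; nra).
    apply Rmult_le_compat; auto. { apply Rmult_le_pos. apply Cmod_ge_0. left; apply exp_pos. } left; apply exp_pos.
    assert (E2 : exp (- d * (Re w * Re w)) <= 1) by (rewrite <- exp_0; apply exp_le; nra).
    assert (E3 := exp_pos (- d * (Re w * Re w))). assert (E4 := Cmod_ge_0 (F w)).
    assert (C1 : Im w = - s \/ Im w = s -> Cmod (F w) * exp (- d * (Re w * Re w)) <= M + d).
    { intros Hor. specialize (HM w ltac:(tauto)). nra. }
    assert (C2 : Re w * Re w = R1 * R1 -> Cmod (F w) * exp (- d * (Re w * Re w)) <= M + d).
    { intros ->. specialize (HK w Hwy). replace (- d * (R1 * R1)) with (- (d * (R1 * R1))) by ring. rewrite exp_Ropp.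
      assert (E5 := exp_ineq1_le (d * (R1 * R1))).
      assert (K / d <= d * (R1 * R1)).
      { replace (K / d) with (d * (K / (d * d))) by (field; lra). apply Rmult_le_compat_l. lra.
        apply Rle_trans with R1. unfold R1; generalize (Rabs_pos (Re z)); lra. nra. }
      apply Rle_trans with (K * / exp (d * (R1 * R1))). apply Rmult_le_compat_r; auto. left; apply Rinv_0_lt_compat, exp_pos.
      apply Rle_trans with d; [|lra]. apply (Rle_div_l K d). apply exp_pos.
      apply Rle_trans with (d * (K / d)). right; field; lra. apply Rmult_le_compat_l; lra. }
    destruct Hbd as [Hb | [Hb | Hb]]; [apply C2; rewrite Hb; ring|apply C2; rewrite Hb; ring|apply C1; tauto]. }
  set (f := fun d => (M + d) * exp (d * (s * s)) * exp (d * (Re z * Re z))).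
  assert (Y : forall d, 0 < d <= 1 -> Cmod (F z) <= f d).
  { intros d Hd. specialize (X d Hd). unfold f. replace (- d * (Re z * Re z)) with (- (d * (Re z * Re z))) in X by ring.
    rewrite exp_Ropp in X. apply (Rle_div_l (Cmod (F z))) in X; auto. apply exp_pos. }
  assert (Cf : continuity_pt f 0).
  { apply continuity_pt_filterlim, (ex_derive_continuous f). unfold f. auto_derive. auto. }
  apply le_epsilon. intros eps He. destruct (Cf eps He) as [a [Ha Hf]].
  set (d := Rmin 1 (a / 2)). assert (0 < d <= 1 /\ d < a).
  { unfold d. generalize (Rmin_l 1 (a/2)) (Rmin_r 1 (a/2)). intros. repeat split; try lra. apply Rmin_pos; lra. }
  specialize (Hf d). assert (Hd : D_x no_cond 0 d /\ Rabs (d - 0) < a).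
  { split. split; [exact I|lra]. rewrite Rminus_0_r, Rabs_pos_eq; lra. }
  specialize (Hf Hd). change (Rabs (f d - f 0) < eps) in Hf.
  assert (f 0 = M) by (unfold f; rewrite !Rmult_0_l, exp_0; ring).
  apply Rabs_lt_between in Hf. specialize (Y d ltac:(lra)). lra.
Qed.

(** * Absolutely convergent series *)

(** The terms of index below [n] are summed, so the empty sum occurs and the index is shifted by one
    against [sum_n]. *)
Fixpoint rsum (u : nat -> R) (n : nat) : R := match n with O => 0 | S m => rsum u m + u m end.
Fixpoint psum (u : nat -> C) (n : nat) : C := match n with O => 0%C | S m => (psum u m + u m)%C end.

Lemma rsum_sum_n (u : nat -> R) n : sum_n u n = rsum u (S n).
Proof. induction n. rewrite sum_O. simpl. ring. rewrite sum_Sn, IHn. reflexivity. Qed.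

Lemma psum_sum_n (u : nat -> C) n : sum_n (G := C_R_NormedModule) u n = psum u (S n).
Proof. induction n. rewrite sum_O. simpl. ring. rewrite sum_Sn, IHn. reflexivity. Qed.

Lemma rsum_is_series (u : nat -> R) (l : R) : is_series u l <->
  forall eps, 0 < eps -> exists N, forall n, (N <= n)%nat -> Rabs (rsum u n - l) <= eps.
Proof.
  split.
  - intros H eps He. apply is_series_Reals in H. destruct (H eps He) as [N HN].
    exists (S N). intros n Hn. destruct n as [|n]; [lia|]. specialize (HN n ltac:(lia)).
    rewrite <- rsum_sum_n, sum_n_Reals. left. exact HN.
  - intros H. apply is_series_Reals. intros eps He. destruct (H (eps / 2) ltac:(lra)) as [N HN].
    exists N. intros n Hn. specialize (HN (S n) ltac:(lia)). rewrite <- rsum_sum_n, sum_n_Reals in HN. unfold R_dist. lra.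
Qed.

Lemma is_series_Clim (u : nat -> C) (l : C) :
  is_series (K := R_AbsRing) (V := C_R_NormedModule) u l <-> Clim (psum u) l.
Proof.
  assert (HB := filterlim_locally_ball_norm (K := R_AbsRing) (U := C_R_NormedModule) (F := eventually)
    (sum_n (G := C_R_NormedModule) u) l).
  refine (iff_trans HB _). clear HB. split.
  - intros H eps He. destruct (H (mkposreal eps He)) as [N HN]. exists (S N). intros n Hn. destruct n as [|n]; [lia|].
    specialize (HN n ltac:(lia)). unfold ball_norm in HN. rewrite psum_sum_n in HN.
    change (@norm R_AbsRing C_R_NormedModule (psum u (S n) - l)%C < eps) in HN. left. rewrite Cmod_norm. exact HN.
  - intros H eps. destruct (H (eps / 2)) as [N HN]. { generalize (cond_pos eps); lra. }
    exists N. intros n Hn. specialize (HN (S n) ltac:(lia)). unfold ball_norm. rewrite psum_sum_n.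
    change (@norm R_AbsRing C_R_NormedModule (psum u (S n) - l)%C < eps). eapply Rle_lt_trans; [right; symmetry; apply Cmod_norm|]. generalize (cond_pos eps); lra.
Qed.

Lemma rsum_le (u v : nat -> R) n : (forall k, u k <= v k) -> rsum u n <= rsum v n.
Proof. intros H. induction n; simpl. lra. specialize (H n); lra. Qed.

Lemma rsum_incr (u : nat -> R) m n : (forall k, 0 <= u k) -> (m <= n)%nat -> rsum u m <= rsum u n.
Proof. intros H Hmn. induction Hmn; simpl. lra. specialize (H m0); lra. Qed.

Lemma rsum_le_Series (M : nat -> R) n : (forall k, 0 <= M k) -> ex_series M -> rsum M n <= Series M.
Proof.
  intros HM HS. apply Series_correct in HS. rewrite rsum_is_series in HS.
  apply le_epsilon. intros eps He. destruct (HS eps He) as [N HN]. specialize (HN (n + N)%nat ltac:(lia)).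
  apply Rabs_le_between in HN. generalize (rsum_incr M n (n + N) HM ltac:(lia)). lra.
Qed.

Lemma rsum_tail (M : nat -> R) eps : (forall k, 0 <= M k) -> ex_series M -> 0 < eps ->
  exists N, forall n, (N <= n)%nat -> Series M - rsum M n <= eps.
Proof.
  intros HM HS He. apply Series_correct in HS. rewrite rsum_is_series in HS.
  destruct (HS eps He) as [N HN]. exists N. intros n Hn. specialize (HN n Hn). apply Rabs_le_between in HN. lra.
Qed.

Lemma ex_series_of_rsum (M : nat -> R) (K : R) : (forall k, 0 <= M k) -> (forall n, rsum M n <= K) -> ex_series M.
Proof.
  intros HM HK. destruct (ex_finite_lim_seq_incr (rsum M) K) as [l Hl]; auto.
  { intros n. simpl. specialize (HM n). lra. }
  exists l. apply rsum_is_series. intros eps He. apply is_lim_seq_spec in Hl. destruct (Hl (mkposreal eps He)) as [N HN].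
  exists N. intros n Hn. left. apply HN; auto.
Qed.

Lemma ex_series_dom (M M' : nat -> R) : (forall k, 0 <= M' k <= M k) -> ex_series M -> ex_series M'.
Proof. intros H HS. apply (ex_series_of_rsum _ (Series M)). intros; apply H. intros n.
  apply Rle_trans with (rsum M n). apply rsum_le. intros; apply H. apply rsum_le_Series; auto. intros k; specialize (H k); lra. Qed.

Lemma ex_series_scal_R (c : R) (M : nat -> R) : ex_series M -> ex_series (fun k => c * M k).
Proof. intros; apply (ex_series_scal_l (V := R_NormedModule)); auto. Qed.

Lemma ex_series_plus_R (M M' : nat -> R) : ex_series M -> ex_series M' -> ex_series (fun k => M k + M' k).
Proof. intros; apply (ex_series_plus (V := R_NormedModule)); auto. Qed.

Lemma Clim_plus u v l m : Clim u l -> Clim v m -> Clim (fun n => u n + v n)%C (l + m)%C.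
Proof.
  intros Hu Hv eps He. destruct (Hu (eps / 2) ltac:(lra)) as [N HN]. destruct (Hv (eps / 2) ltac:(lra)) as [N' HN'].
  exists (N + N')%nat. intros n Hn. specialize (HN n ltac:(lia)). specialize (HN' n ltac:(lia)).
  replace (u n + v n - (l + m))%C with ((u n - l) + (v n - m))%C by ring. eapply Rle_trans; [apply Cmod_triangle|]. lra.
Qed.

Lemma Clim_const (l : C) : Clim (fun _ => l) l.
Proof. intros eps He. exists 0%nat. intros. replace (l - l)%C with (RtoC 0) by ring. rewrite Cmod_0; lra. Qed.

Lemma Clim_ext (u v : nat -> C) l : (forall n, u n = v n) -> Clim u l -> Clim v l.
Proof. intros H Hu eps He. destruct (Hu eps He) as [N HN]. exists N. intros. rewrite <- H. auto. Qed.

Lemma Clim_ext_ge (u v : nat -> C) l N0 : (forall n, (N0 <= n)%nat -> u n = v n) -> Clim u l -> Clim v l.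
Proof. intros H Hu eps He. destruct (Hu eps He) as [N HN]. exists (N0 + N)%nat. intros. rewrite <- H by lia. apply HN; lia. Qed.

Lemma Clim_continuous (f : C -> C) u l : ccont f l -> Clim u l -> Clim (fun n => f (u n)) (f l).
Proof.
  intros Hf Hu eps He. destruct (Hf eps He) as [d [Hd H]]. destruct (Hu (d / 2) ltac:(lra)) as [N HN].
  exists N. intros n Hn. specialize (HN n Hn). specialize (H (u n - l)%C ltac:(lra)).
  replace (l + (u n - l))%C with (u n) in H by ring. lra.
Qed.

Lemma Clim_scal c u l : Clim u l -> Clim (fun n => c * u n)%C (c * l)%C.
Proof. apply (Clim_continuous (fun z => c * z)%C). eapply cderiv_ccont, cderiv_scal, cderiv_id. Qed.

Lemma Clim_Cmod_le u l (K : R) : Clim u l -> (exists N, forall n, (N <= n)%nat -> Cmod (u n) <= K) -> Cmod l <= K.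
Proof.
  intros Hu [N0 HK]. apply le_epsilon. intros eps He. destruct (Hu eps He) as [N HN].
  specialize (HN (N + N0)%nat ltac:(lia)). specialize (HK (N + N0)%nat ltac:(lia)). rewrite Cmod_sub_sym in HN.
  generalize (Cmod_triangle_sub l (u (N + N0)%nat)). lra.
Qed.

Lemma Clim_Im u l : Clim u l -> is_lim_seq (fun n => Im (u n)) (Im l).
Proof.
  intros H. apply is_lim_seq_spec. intros eps. destruct (H (eps / 2)) as [N HN]. generalize (cond_pos eps); lra.
  exists N. intros n Hn. specialize (HN n Hn). generalize (Im_le_Cmod (u n - l)%C). unfold Cminus at 1. rewrite im_plus, im_opp.
  generalize (cond_pos eps). unfold Rminus. lra.
Qed.

Lemma Clim_subseq u l (f : nat -> nat) : (forall n, (n <= f n)%nat) -> Clim u l -> Clim (fun n => u (f n)) l.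
Proof. intros Hf H eps He. destruct (H eps He) as [N HN]. exists N. intros n Hn. apply HN. specialize (Hf n); lia. Qed.

Lemma Clim_cauchy (u : nat -> C) (M : nat -> R) : (forall k, 0 <= M k) -> ex_series M ->
  (forall n, Cmod (u (S n) - u n)%C <= M n) ->
  exists l, Clim u l /\ forall n, Cmod (l - u n) <= Series M - rsum M n.
Proof.
  intros HM HS Hu.
  assert (D : forall m n, (m <= n)%nat -> Cmod (u n - u m) <= rsum M n - rsum M m).
  { intros m n Hmn. induction Hmn. replace (u m - u m)%C with (RtoC 0) by ring. rewrite Cmod_0; lra.
    eapply Rle_trans; [apply (Cmod_triangle3 _ (u m0))|]. simpl. specialize (Hu m0). lra. }
  assert (CR : ex_finite_lim_seq (fun n => Re (u n)) /\ ex_finite_lim_seq (fun n => Im (u n))).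
  { assert (X : forall p : C -> R, (forall z w, Rabs (p z - p w) <= Cmod (z - w)%C) -> ex_finite_lim_seq (fun n => p (u n))).
    { intros p Hp. apply ex_lim_seq_cauchy_corr. intros eps. destruct (rsum_tail M (eps / 2) HM HS) as [N HN]. generalize (cond_pos eps); lra.
      assert (Y : forall n m, (N <= m)%nat -> (m <= n)%nat -> Rabs (p (u n) - p (u m)) < eps).
      { intros n m Hm Hmn. eapply Rle_lt_trans; [apply Hp|]. eapply Rle_lt_trans; [apply D; auto|].
        specialize (HN m Hm). generalize (rsum_le_Series M n HM HS) (cond_pos eps). lra. }
      exists N. intros n m Hn Hm. destruct (Nat.le_ge_cases m n). apply Y; auto. rewrite Rabs_minus_sym. apply Y; auto. }
    split; apply X; intros z w.
    - generalize (re_le_Cmod (z - w)%C). unfold Cminus at 1. rewrite re_plus, re_opp. auto.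
    - generalize (Im_le_Cmod (z - w)%C). unfold Cminus at 1. rewrite im_plus, im_opp. auto. }
  destruct CR as [[x Hx] [y Hy]].
  assert (L : Clim u (x, y)).
  { intros eps He. apply is_lim_seq_spec in Hx, Hy.
    destruct (Hx (mkposreal (eps / 2) ltac:(lra))) as [N HN]. destruct (Hy (mkposreal (eps / 2) ltac:(lra))) as [N' HN'].
    exists (N + N')%nat. intros n Hn. specialize (HN n ltac:(lia)). specialize (HN' n ltac:(lia)). simpl in HN, HN'.
    eapply Rle_trans; [apply Cmod_le_abs|]. unfold Cminus; rewrite re_plus, re_opp, im_plus, im_opp.
    change (Re (x, y)) with x. change (Im (x, y)) with y. unfold Rminus in *. lra. }
  exists (x, y). split; auto. intros m.
  apply (Clim_Cmod_le (fun n => u n - u m)%C).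
  - apply Clim_plus; auto. apply Clim_const.
  - exists m. intros n Hn. eapply Rle_trans; [apply D; auto|]. generalize (rsum_le_Series M n HM HS). lra.
Qed.

(** A total function on sequences; it is the sum whenever the partial sums converge, by
    [Clim_Csum]. *)
Definition Csum (u : nat -> C) : C := (Series (fun k => Re (u k)), Series (fun k => Im (u k))).

Lemma psum_Re u n : Re (psum u n) = rsum (fun k => Re (u k)) n.
Proof. induction n. reflexivity. simpl psum. rewrite re_plus, IHn. reflexivity. Qed.

Lemma psum_Im u n : Im (psum u n) = rsum (fun k => Im (u k)) n.
Proof. induction n. reflexivity. simpl psum. rewrite im_plus, IHn. reflexivity. Qed.

Lemma Clim_Csum u l : Clim (psum u) l -> Csum u = l.
Proof.
  intros H. apply C_ext; unfold Csum; simpl; apply is_series_unique, rsum_is_series; intros eps He;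
    destruct (H eps He) as [N HN]; exists N; intros n Hn; specialize (HN n Hn).
  - rewrite <- psum_Re. generalize (re_le_Cmod (psum u n - l)%C). unfold Cminus at 1; rewrite re_plus, re_opp. unfold Rminus; lra.
  - rewrite <- psum_Im. generalize (Im_le_Cmod (psum u n - l)%C). unfold Cminus at 1; rewrite im_plus, im_opp. unfold Rminus; lra.
Qed.

Section Dominated.
Variables (u : nat -> C) (M : nat -> R).
Hypothesis Hu : forall k, Cmod (u k) <= M k.
Hypothesis HM : ex_series M.

Lemma dominating_nonneg k : 0 <= M k.
Proof. eapply Rle_trans; [apply Cmod_ge_0|apply Hu]. Qed.

Lemma Csum_tail n : Cmod (Csum u - psum u n) <= Series M - rsum M n.
Proof.
  destruct (Clim_cauchy (psum u) M dominating_nonneg HM) as [l [Hl Hb]].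
  { intros k. simpl. replace (psum u k + u k - psum u k)%C with (u k) by ring. auto. }
  rewrite (Clim_Csum u l Hl). auto.
Qed.

Lemma Csum_lim : Clim (psum u) (Csum u).
Proof.
  destruct (Clim_cauchy (psum u) M dominating_nonneg HM) as [l [Hl Hb]].
  { intros k. simpl. replace (psum u k + u k - psum u k)%C with (u k) by ring. auto. }
  rewrite (Clim_Csum u l Hl). auto.
Qed.

Lemma Csum_le : Cmod (Csum u) <= Series M.
Proof. generalize (Csum_tail 0). simpl. replace (Csum u - 0)%C with (Csum u) by ring. lra. Qed.
End Dominated.

Lemma psum_plus u v n : psum (fun k => u k + v k)%C n = (psum u n + psum v n)%C.
Proof. induction n; simpl. ring. rewrite IHn. ring. Qed.

Lemma psum_scal c u n : psum (fun k => c * u k)%C n = (c * psum u n)%C.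
Proof. induction n; simpl. ring. rewrite IHn. ring. Qed.

Lemma psum_ext u v n : (forall k, u k = v k) -> psum u n = psum v n.
Proof. intros H. induction n; simpl. auto. rewrite IHn, H; auto. Qed.

Lemma Csum_ext u v : (forall k, u k = v k) -> Csum u = Csum v.
Proof. intros H. unfold Csum. f_equal; apply Series_ext; intros; rewrite H; auto. Qed.

Lemma Csum_plus u v M M' : (forall k, Cmod (u k) <= M k) -> ex_series M -> (forall k, Cmod (v k) <= M' k) -> ex_series M' ->
  Csum (fun k => u k + v k)%C = (Csum u + Csum v)%C.
Proof.
  intros H1 H2 H3 H4. apply Clim_Csum. apply (Clim_ext (fun n => psum u n + psum v n)%C). intros; rewrite psum_plus; auto.
  apply Clim_plus; eapply Csum_lim; eauto.
Qed.

Lemma Csum_scal c u M : (forall k, Cmod (u k) <= M k) -> ex_series M -> Csum (fun k => c * u k)%C = (c * Csum u)%C.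
Proof.
  intros H1 H2. apply Clim_Csum. apply (Clim_ext (fun n => c * psum u n)%C). intros; rewrite psum_scal; auto.
  apply Clim_scal; eapply Csum_lim; eauto.
Qed.

Lemma Csum_minus u v M M' : (forall k, Cmod (u k) <= M k) -> ex_series M -> (forall k, Cmod (v k) <= M' k) -> ex_series M' ->
  Csum (fun k => u k - v k)%C = (Csum u - Csum v)%C.
Proof.
  intros H1 H2 H3 H4. unfold Cminus. rewrite (Csum_plus u (fun k => - v k)%C M M'); auto.
  - f_equal. rewrite (Csum_ext _ (fun k => (-(1)) * v k)%C) by (intros; ring). rewrite (Csum_scal _ v M'); auto. ring.
  - intros; rewrite Cmod_opp; auto.
Qed.

(** Summing the quadratic remainders of the terms gives a quadratic remainder of the sum; the other
    two majorants only guarantee that the sums may be split. *)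
Lemma Csum_cderiv (u : nat -> C -> C) (u' : nat -> C) (M0 M1 M2 : nat -> R) (z : C) (r : R) : 0 < r ->
  ex_series M0 -> ex_series M1 -> ex_series M2 ->
  (forall k h, Cmod h < r -> Cmod (u k (z + h)%C) <= M0 k) -> (forall k, Cmod (u' k) <= M1 k) ->
  (forall k h, Cmod h < r -> Cmod (u k (z + h) - u k z - u' k * h)%C <= M2 k * (Cmod h * Cmod h)) ->
  cderiv (fun w => Csum (fun k => u k w)) z (Csum u').
Proof.
  intros Hr E0 E1 E2 H0 H1 H2.
  assert (H0' : forall k, Cmod (u k z) <= M0 k).
  { intros k. replace z with (z + 0)%C by ring. apply H0. rewrite Cmod_0; auto. }
  apply (cderiv_of_quadratic _ _ _ (Series M2) r); auto. intros h Hh.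
  rewrite (Cmult_comm (Csum u') h), <- (Csum_scal h u' M1), <- (Csum_minus (fun k => u k (z + h)%C) (fun k => u k z) M0 M0); auto.
  rewrite <- (Csum_minus _ _ (fun k => M0 k + M0 k) (fun k => Cmod h * M1 k)).
  - rewrite <- Series_scal_r. apply Csum_le.
    + intros k. rewrite (Cmult_comm h). auto.
    + apply ex_series_scal_r; auto.
  - intros k. eapply Rle_trans; [apply Cmod_minus_le|]. specialize (H0 k h Hh). specialize (H0' k). lra.
  - apply ex_series_plus_R; auto.
  - intros k. rewrite Cmod_mult. apply Rmult_le_compat_l; auto. apply Cmod_ge_0.
  - apply ex_series_scal_R; auto.
Qed.

(** Dominated convergence for series as [d] decreases to [0]. It removes the smoothing of the test
    functions, and with [d] as a reciprocal height it gives the decay of the exponential sums. *)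
Lemma Csum_tannery (u : R -> nat -> C) (l : nat -> C) (M : nat -> R) :
  ex_series M -> (forall d k, 0 < d -> Cmod (u d k) <= M k) -> (forall k, Cmod (l k) <= M k) ->
  (forall k eps, 0 < eps -> exists del, 0 < del /\ forall d, 0 < d < del -> Cmod (u d k - l k) <= eps) ->
  forall eps, 0 < eps -> exists del, 0 < del /\ forall d, 0 < d < del -> Cmod (Csum (u d) - Csum l) <= eps.
Proof.
  intros HM Hu Hl Hk eps He.
  assert (PM : forall k, 0 <= M k) by (intros k; eapply Rle_trans; [apply Cmod_ge_0|apply Hl]).
  destruct (rsum_tail M (eps / 4) PM HM ltac:(lra)) as [N HN].
  assert (P : forall n e, 0 < e -> exists del, 0 < del /\ forall d, 0 < d < del -> Cmod (psum (u d) n - psum l n) <= e).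
  { induction n; intros e Hee.
    - exists 1. split. lra. intros. simpl. replace (0 - 0)%C with (RtoC 0) by ring. rewrite Cmod_0; lra.
    - destruct (IHn (e / 2) ltac:(lra)) as [d1 [D1 H1]]. destruct (Hk n (e / 2) ltac:(lra)) as [d2 [D2 H2]].
      exists (Rmin d1 d2). split. apply Rmin_pos; auto. intros d Hd. generalize (Rmin_l d1 d2) (Rmin_r d1 d2); intros.
      specialize (H1 d ltac:(lra)). specialize (H2 d ltac:(lra)). simpl.
      replace (psum (u d) n + u d n - (psum l n + l n))%C with ((psum (u d) n - psum l n) + (u d n - l n))%C by ring.
      eapply Rle_trans; [apply Cmod_triangle|]. lra. }
  destruct (P N (eps / 4) ltac:(lra)) as [del [Hd H]]. exists del. split; auto. intros d Hdd. specialize (H d Hdd).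
  assert (T1 := Csum_tail (u d) M (fun k => Hu d k (proj1 Hdd)) HM N). assert (T2 := Csum_tail l M Hl HM N).
  specialize (HN N (le_n N)).
  replace (Csum (u d) - Csum l)%C with ((Csum (u d) - psum (u d) N) + ((psum (u d) N - psum l N) - (Csum l - psum l N)))%C by ring.
  eapply Rle_trans; [apply Cmod_triangle|]. assert (T3 := Cmod_minus_le (psum (u d) N - psum l N)%C (Csum l - psum l N)%C). lra.
Qed.

Lemma ex_series_inv_sq : ex_series (fun k => / ((1 + INR k) * (1 + INR k))).
Proof.
  assert (P : forall k, 0 < 1 + INR k) by (intros; generalize (pos_INR k); lra).
  apply (ex_series_of_rsum _ 2).
  - intros k. left. apply Rinv_0_lt_compat. apply Rmult_lt_0_compat; auto.
  - assert (X : forall n, rsum (fun k => / ((1 + INR k) * (1 + INR k))) (S n) <= 2 - / (1 + INR n)).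
    { set (f := fun k => / ((1 + INR k) * (1 + INR k))). induction n. unfold f; simpl. right. field.
      change (rsum f (S n) + f (S n) <= 2 - / (1 + INR (S n))). unfold f at 2. assert (Pn := P n).
      rewrite S_INR. assert (/ ((1 + (INR n + 1)) * (1 + (INR n + 1))) <= / (1 + INR n) - / (1 + (INR n + 1))).
      { replace (/ (1 + INR n) - / (1 + (INR n + 1))) with (/ ((1 + INR n) * (1 + (INR n + 1)))) by (field; lra).
        apply Rinv_le_contravar. nra. nra. } lra. }
    intros [|n]. simpl; lra. specialize (X n). assert (Pn := P n). apply Rinv_0_lt_compat in Pn. lra.
Qed.

(** * Test functions *)

(** Higher derivatives need not be computed once the function lies in a class that is closed under
    differentiation and consists of rapidly decreasing functions. *)
Lemma schwartz_of_class (P : (R -> R) -> Prop) :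
  (forall u, P u -> exists u', (forall x, is_derive u x (u' x)) /\ P u') ->
  (forall u (k : nat), P u -> exists M, forall x, Rabs (x ^ k * u x) <= M) ->
  forall u, P u -> schwartz_real u.
Proof.
  intros Hd Hb u Hu.
  assert (X : forall n, exists w, P w /\ forall x, Derive_n u n x = w x).
  { induction n as [|n [w [Hw Ew]]]. exists u; auto. destruct (Hd w Hw) as [w' [Hw' Pw']]. exists w'; split; auto.
    intros x. simpl. rewrite (Derive_ext _ w) by auto. apply is_derive_unique; auto. }
  split.
  - intros [|n] x; simpl; auto. destruct (X n) as [w [Hw Ew]]. destruct (Hd w Hw) as [w' [Hw' _]].
    apply (ex_derive_ext w). intros; rewrite Ew; auto. exists (w' x); auto.
  - intros k n. destruct (X n) as [w [Hw Ew]]. destruct (Hb w k Hw) as [M HM]. exists M. intros x. rewrite Ew; auto.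
Qed.

Lemma exp_INR_mult (n : nat) (y : R) : exp (INR n * y) = exp y ^ n.
Proof.
  induction n. simpl. rewrite Rmult_0_l, exp_0; auto.
  rewrite S_INR, Rmult_plus_distr_r, exp_plus, IHn, Rmult_1_l. simpl. ring.
Qed.

(** The [m]-th power of [x / m <= exp (x / m)]; for [m = 0] the constant is [0 ^ 0 = 1]. *)
Lemma pow_le_exp (m : nat) (x : R) : 0 <= x -> x ^ m <= (INR m) ^ m * exp x.
Proof.
  intros Hx. destruct m as [|m]. { simpl. generalize (exp_ineq1_le x). lra. }
  assert (P : 0 < INR (S m)) by (apply lt_0_INR; lia).
  assert (E : exp x = exp (x / INR (S m)) ^ S m).
  { rewrite <- exp_INR_mult. f_equal. field. lra. }
  rewrite E, <- Rpow_mult_distr. apply pow_incr. split; auto.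
  assert (H := exp_ineq1_le (x / INR (S m))).
  apply Rle_trans with (INR (S m) * (x / INR (S m))). right; field; lra. apply Rmult_le_compat_l; lra.
Qed.

(** Completing the square with [PI > 2]. The Gaussian thereby absorbs a factor [exp |y|] at the cost
    of [exp 1]. *)
Lemma sub_PI_sq_le_1 (y : R) : y - PI * (y * y) <= 1.
Proof.
  assert (P := PI2_1). assert (0 <= y * y) by apply Rle_0_sqr.
  assert (0 <= (PI - 2) * (y * y)) by (apply Rmult_le_pos; lra).
  assert (0 <= (y - 1 / 2) * (y - 1 / 2)) by apply Rle_0_sqr. lra.
Qed.

Lemma abs_pow_gauss (m : nat) (x : R) : Rabs (x ^ m) * exp (- PI * (x * x)) <= (INR m) ^ m * exp 1.
Proof.
  rewrite <- RPow_abs. assert (H := pow_le_exp m (Rabs x) (Rabs_pos x)).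
  assert (P := PI2_1). assert (Q := exp_pos (- PI * (x * x))).
  apply Rle_trans with (INR m ^ m * exp (Rabs x) * exp (- PI * (x * x))). apply Rmult_le_compat_r; lra.
  rewrite Rmult_assoc, <- exp_plus. apply Rmult_le_compat_l. apply pow_le, pos_INR. apply exp_le.
  assert (x * x = Rabs x * Rabs x) by (rewrite <- Rabs_mult, Rabs_pos_eq; nra).
  rewrite H0. generalize (sub_PI_sq_le_1 (Rabs x)). lra.
Qed.

(** The parts of a modulated Gaussian together with what differentiation makes of them: each
    derivative of the Gaussian brings down a power of [x] and each derivative of the phase exchanges
    cosine and sine. *)
Inductive gauss_class (beta : R) : (R -> R) -> Prop :=
| gauss_cos j : gauss_class beta (fun x => x ^ j * exp (- PI * (x * x)) * cos (beta * x))
| gauss_sin j : gauss_class beta (fun x => x ^ j * exp (- PI * (x * x)) * sin (beta * x))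
| gauss_plus u v : gauss_class beta u -> gauss_class beta v -> gauss_class beta (fun x => u x + v x)
| gauss_scal c u : gauss_class beta u -> gauss_class beta (fun x => c * u x).

Lemma gauss_class_schwartz (beta : R) u : gauss_class beta u -> schwartz_real u.
Proof.
  apply schwartz_of_class; clear u.
  - intros u Hu. induction Hu as [j | j | u v Hu [u' [H1 H1']] Hv [v' [H2 H2']] | c u Hu [u' [H1 H1']]].
    + exists (fun x => (INR j * (x ^ pred j * exp (- PI * (x * x)) * cos (beta * x)) + (- 2 * PI) * (x ^ S j * exp (- PI * (x * x)) * cos (beta * x)))
        + (- beta) * (x ^ j * exp (- PI * (x * x)) * sin (beta * x))). split.
      * intros x. auto_derive; auto. simpl. ring.
      * apply gauss_plus. apply gauss_plus; apply gauss_scal, gauss_cos. apply gauss_scal, gauss_sin.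
    + exists (fun x => (INR j * (x ^ pred j * exp (- PI * (x * x)) * sin (beta * x)) + (- 2 * PI) * (x ^ S j * exp (- PI * (x * x)) * sin (beta * x)))
        + beta * (x ^ j * exp (- PI * (x * x)) * cos (beta * x))). split.
      * intros x. auto_derive; auto. simpl. ring.
      * apply gauss_plus. apply gauss_plus; apply gauss_scal, gauss_sin. apply gauss_scal, gauss_cos.
    + exists (fun x => u' x + v' x). split. intros x. apply (is_derive_plus (V := R_NormedModule)); auto. apply gauss_plus; auto.
    + exists (fun x => c * u' x). split. intros x. apply is_derive_scal; auto. apply gauss_scal; auto.
  - intros u k Hu. induction Hu as [j | j | u v Hu [M1 H1] Hv [M2 H2] | c u Hu [M1 H1]].
    + exists (INR (k + j) ^ (k + j) * exp 1). intros x. eapply Rle_trans; [|apply (abs_pow_gauss (k + j) x)].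
      rewrite <- !Rmult_assoc, <- pow_add, !Rabs_mult, (Rabs_pos_eq (exp _)) by (left; apply exp_pos).
      rewrite <- (Rmult_1_r (Rabs (x ^ (k + j)) * exp _)) at 2. apply Rmult_le_compat_l.
      apply Rmult_le_pos. apply Rabs_pos. left; apply exp_pos. apply Rabs_le, COS_bound.
    + exists (INR (k + j) ^ (k + j) * exp 1). intros x. eapply Rle_trans; [|apply (abs_pow_gauss (k + j) x)].
      rewrite <- !Rmult_assoc, <- pow_add, !Rabs_mult, (Rabs_pos_eq (exp _)) by (left; apply exp_pos).
      rewrite <- (Rmult_1_r (Rabs (x ^ (k + j)) * exp _)) at 2. apply Rmult_le_compat_l.
      apply Rmult_le_pos. apply Rabs_pos. left; apply exp_pos. apply Rabs_le, SIN_bound.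
    + exists (M1 + M2). intros x. rewrite Rmult_plus_distr_l. eapply Rle_trans; [apply Rabs_triang|]. specialize (H1 x). specialize (H2 x). lra.
    + exists (Rabs c * M1). intros x. replace (x ^ k * (c * u x)) with (c * (x ^ k * u x)) by ring. rewrite Rabs_mult.
      apply Rmult_le_compat_l; auto. apply Rabs_pos.
Qed.

(** * The Fourier transform of modulated Gaussians *)

Lemma is_RInt_CInt (f : R -> C) a b : (forall t, rcont f t) -> is_RInt (V := C_R_NormedModule) f a b (CInt f a b).
Proof.
  intros Hf. apply (is_RInt_fct_extend_pair (U := R_NormedModule) (V := R_NormedModule)).
  - apply (RInt_correct (V := R_CompleteNormedModule)). apply ex_RInt_cont. intros; apply (rcont_Re f); auto.
  - apply (RInt_correct (V := R_CompleteNormedModule)). apply ex_RInt_cont. intros; apply (rcont_Im f); auto.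
Qed.

Lemma fourier_value (phi : R -> C) (a : R) (l : C) : (forall t, rcont phi t) ->
  (forall eps, 0 < eps -> exists T0, forall S T, T0 <= S -> T0 <= T ->
     Cmod (CInt (fun t => phi t * cexp (0, - 2 * PI * a * t)%R)%C (- S) T - l) <= eps) ->
  fourier phi a = l.
Proof.
  intros Hphi H. unfold fourier.
  assert (Hc : forall t, rcont (fun t => phi t * cexp (0, - 2 * PI * a * t)%R)%C t).
  { intros t. apply rcont_mult; auto. apply (rcont_comp cexp (fun t => (0, - 2 * PI * a * t)%R)).
    eapply cderiv_ccont, cderiv_cexp. apply rderiv_rcont with (0, - 2 * PI * a)%R. apply rderiv_intro; simpl; auto_derive; auto; ring. }
  apply (is_RInt_gen_unique (V := C_R_CompleteNormedModule)).
  intros P [eps HP]. destruct (H (eps / 2)) as [T0 HT]. { generalize (cond_pos eps); lra. }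
  apply (Filter_prod _ _ _ (fun x => x < - T0) (fun x => T0 < x)).
  - exists (- T0). auto.
  - exists T0. auto.
  - intros x y Hx Hy. exists (CInt (fun t => phi t * cexp (0, - 2 * PI * a * t)%R)%C x y). split.
    + simpl. apply is_RInt_CInt; auto.
    + apply HP. specialize (HT (- x) y ltac:(lra) ltac:(lra)). rewrite Ropp_involutive in HT.
      set (I := CInt _ x y) in *.
      assert (E := re_le_Cmod (I - l)%C). assert (E2 := Im_le_Cmod (I - l)%C). generalize (cond_pos eps); intros Pe.
      split.
      * change (Rabs (Re I - Re l) < eps). unfold Cminus in E at 1. rewrite re_plus, re_opp in E. unfold Rminus. lra.
      * change (Rabs (Im I - Im l) < eps). unfold Cminus in E2 at 1. rewrite im_plus, im_opp in E2. unfold Rminus. lra.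
Qed.

Definition gauss (t : R) : R := exp (- PI * (t * t)).

Lemma gauss_cont t : continuous gauss t.
Proof. apply (ex_derive_continuous gauss). unfold gauss. auto_derive. auto. Qed.

(** Tails are compared with [exp (1 - t)]. The total mass is carried along as a positive constant
    [c] instead of being evaluated. *)
Lemma gauss_integral_limit : exists c, 0 < c /\ forall eps, 0 < eps -> exists T0, forall S T, T0 <= S -> T0 <= T ->
  Rabs (RInt gauss (- S) T - c) <= eps.
Proof.
  assert (P := PI2_1).
  assert (Ex : forall a b, ex_RInt gauss a b) by (intros; apply ex_RInt_cont; intros; apply gauss_cont).
  assert (Pos : forall a b, a <= b -> 0 <= RInt gauss a b).
  { intros. apply RInt_ge_0; auto. intros; left; apply exp_pos. }
  assert (Tail : forall a b, 0 <= a -> a <= b -> RInt gauss a b <= exp 1 * exp (- a)).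
  { intros a b Ha Hab.
    apply Rle_trans with (RInt (fun t => exp 1 * exp (- t)) a b).
    - apply RInt_le; auto. apply ex_RInt_cont. intros; apply (ex_derive_continuous (fun t => exp 1 * exp (- t))). auto_derive; auto.
      intros t Ht. unfold gauss. rewrite <- exp_plus. apply exp_le. generalize (sub_PI_sq_le_1 t). lra.
    - rewrite (is_RInt_unique _ _ _ (minus (- (exp 1 * exp (- b))) (- (exp 1 * exp (- a))))).
      + unfold minus, plus, opp; simpl. generalize (exp_pos 1) (exp_pos (- b)); intros. nra.
      + apply (is_RInt_derive (V := R_CompleteNormedModule) (fun t => - (exp 1 * exp (- t)))).
        intros; auto_derive; auto; ring. intros; apply (ex_derive_continuous (fun t => exp 1 * exp (- t))). auto_derive; auto. }
  assert (Ch : forall a b c, RInt gauss a b + RInt gauss b c = RInt gauss a c).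
  { intros. apply (RInt_Chasles (V := R_CompleteNormedModule)); auto. }
  assert (Sym : forall S, RInt gauss (- S) 0 = RInt gauss 0 S).
  { intros S. assert (H := RInt_correct (V := R_CompleteNormedModule) gauss (- S) (- 0) (Ex _ _)).
    apply (is_RInt_comp_opp (V := R_NormedModule)) in H. rewrite Ropp_0 in H.
    apply (is_RInt_swap (V := R_NormedModule)) in H. apply (is_RInt_opp (V := R_NormedModule)) in H.
    rewrite (opp_opp (G := R_AbelianGroup)) in H. symmetry. apply is_RInt_unique.
    apply (is_RInt_ext (V := R_NormedModule)) with (2 := H). intros x _.
    change (- - gauss (- x) = gauss x). unfold gauss. rewrite Ropp_involutive. f_equal. ring. }
  destruct (ex_finite_lim_seq_incr (fun n => RInt gauss 0 (INR n)) (exp 1 * exp (- 0))) as [l Hl].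
  { intros n. rewrite <- (Ch 0 (INR n) (INR (S n))). generalize (Pos (INR n) (INR (S n))). rewrite S_INR. intros; specialize (H ltac:(lra)); lra. }
  { intros n. apply Tail. lra. apply pos_INR. }
  assert (B : forall T, 0 <= T -> Rabs (RInt gauss 0 T - l) <= exp 1 * exp (- T)).
  { intros T HT. apply is_lim_seq_spec in Hl. apply le_epsilon. intros eps He. destruct (Hl (mkposreal eps He)) as [N HN]. simpl in HN.
    destruct (INR_unbounded T) as [m Hm]. specialize (HN (N + m)%nat ltac:(lia)).
    assert (T <= INR (N + m)) by (rewrite plus_INR; generalize (pos_INR N); lra).
    rewrite <- (Ch 0 T (INR (N + m))) in HN.
    generalize (Pos T _ H) (Tail T _ HT H). intros. apply Rabs_lt_between in HN. apply Rabs_le. lra. }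
  assert (Pl : 0 < l).
  { assert (H0 : 0 < RInt gauss 0 1). { apply RInt_gt_0. lra. intros; apply exp_pos. intros; apply gauss_cont. }
    apply Rlt_le_trans with (RInt gauss 0 1); auto.
    apply le_epsilon. intros eps He. apply is_lim_seq_spec in Hl. destruct (Hl (mkposreal eps He)) as [N HN]. simpl in HN.
    specialize (HN (S N) ltac:(lia)). rewrite <- (Ch 0 1 (INR (S N))) in HN. 
    assert (1 <= INR (S N)) by (rewrite S_INR; generalize (pos_INR N); lra).
    generalize (Pos 1 _ H). apply Rabs_lt_between in HN. lra. }
  exists (2 * l). split. lra. intros eps He.
  assert (P1 := exp_pos 1).
  exists (Rmax 0 (2 * exp 1 / eps)). intros S T HS HT.
  generalize (Rmax_l 0 (2 * exp 1 / eps)) (Rmax_r 0 (2 * exp 1 / eps)); intros.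
  rewrite <- (Ch (- S) 0 T), Sym.
  assert (Z : forall x, Rmax 0 (2 * exp 1 / eps) <= x -> exp 1 * exp (- x) <= eps / 2).
  { intros x Hx. rewrite exp_Ropp. apply (Rle_div_l (exp 1)). apply exp_pos.
    assert (E := exp_ineq1_le x). assert (2 * exp 1 / eps <= exp x) by lra.
    apply (Rle_div_l (2 * exp 1)) in H1; lra. }
  assert (BS := B S ltac:(lra)). assert (BT := B T ltac:(lra)). assert (ZS := Z S HS). assert (ZT := Z T HT).
  replace (RInt gauss 0 S + RInt gauss 0 T - 2 * l) with ((RInt gauss 0 S - l) + (RInt gauss 0 T - l)) by ring.
  eapply Rle_trans; [apply Rabs_triang|]. lra.
Qed.

Definition gauss_line (z : C) (t : R) : C := (gauss t * cexp (t * z))%C.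

Lemma rderiv_gauss (t : R) : rderiv (fun s => RtoC (gauss s)) t (RtoC (- 2 * PI * t * gauss t)).
Proof. apply rderiv_intro; unfold gauss; simpl; auto_derive; auto; ring. Qed.

Lemma gauss_line_cont z t : rcont (gauss_line z) t.
Proof. apply rcont_mult. eapply rderiv_rcont, rderiv_gauss. eapply rderiv_rcont, rderiv_cexp_line. Qed.

Lemma rcont_RtoC t : rcont RtoC t.
Proof. apply rderiv_rcont with (RtoC 1). apply rderiv_intro; simpl; auto_derive; auto. Qed.

Lemma gauss_line_deriv (z : C) (a b : R) :
  cderiv (fun z => CInt (gauss_line z) a b) z (CInt (fun t => t * gauss_line z t)%C a b).
Proof.
  apply (cderiv_CInt gauss_line (fun z t => t * gauss_line z t)%C).
  - intros; apply gauss_line_cont.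
  - intros; apply rcont_mult. apply rcont_RtoC. apply gauss_line_cont.
  - intros eps He.
    (* In the second-order remainder [t^2] is bounded by [exp (t^2)]. As [PI > 2], the Gaussian
       still dominates, and completing the square bounds the total exponent by [K^2] uniformly in
       [t]. *)
    set (K := Cmod z + 2).
    set (M := exp (K * K)). assert (HM : 0 < M) by apply exp_pos.
    exists (Rmin 1 (eps / M)). split. apply Rmin_pos. lra. apply Rdiv_lt_0_compat; auto.
    intros h Hh t. generalize (Rmin_l 1 (eps / M)) (Rmin_r 1 (eps / M)); intros.
    unfold gauss_line. replace (t * (z + h))%C with (t * z + t * h)%C by ring. rewrite cexp_plus.
    replace (gauss t * (cexp (t * z) * cexp (t * h)) - gauss t * cexp (t * z) - t * (gauss t * cexp (t * z)) * h)%C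
      with (gauss t * cexp (t * z) * (cexp (t * h) - 1 - t * h))%C by ring.
    rewrite !Cmod_mult. assert (B := cexp_bound2 (t * h)%C). rewrite !Cmod_mult, Cmod_R in B.
    rewrite Cmod_RtoC_nonneg by (left; apply exp_pos).
    assert (P := PI2_1). assert (Pz := Cmod_ge_0 z). assert (Ph := Cmod_ge_0 h). assert (Pt := Rabs_pos t).
    assert (C1 : Cmod (cexp (t * z)) <= exp (Rabs t * Cmod z)).
    { rewrite Cmod_cexp. apply exp_le. eapply Rle_trans; [apply Rle_abs|]. eapply Rle_trans; [apply re_le_Cmod|]. rewrite Cmod_mult, Cmod_R. lra. }
    assert (C2 : exp (Rabs t * Cmod h) <= exp (Rabs t)) by (apply exp_le; nra).
    assert (C3 : Rabs t * Rabs t <= exp (Rabs t * Rabs t)) by (generalize (exp_ineq1_le (Rabs t * Rabs t)); lra).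
    apply Rle_trans with (gauss t * exp (Rabs t * Cmod z) * (Cmod h * Cmod h * (exp (Rabs t * Rabs t) * exp (Rabs t)))).
    + apply Rmult_le_compat; try apply Cmod_ge_0.
      * apply Rmult_le_pos. left; apply exp_pos. apply Cmod_ge_0.
      * apply Rmult_le_compat_l; auto. left; apply exp_pos.
      * eapply Rle_trans; [apply B|]. replace (Rabs t * Cmod h * (Rabs t * Cmod h) * exp (Rabs t * Cmod h)) with (Cmod h * Cmod h * (Rabs t * Rabs t * exp (Rabs t * Cmod h))) by ring.
        apply Rmult_le_compat_l. nra. apply Rmult_le_compat; auto. nra. left; apply exp_pos.
    + replace (gauss t * exp (Rabs t * Cmod z) * (Cmod h * Cmod h * (exp (Rabs t * Rabs t) * exp (Rabs t))))
        with (Cmod h * (Cmod h * (gauss t * exp (Rabs t * Cmod z) * exp (Rabs t * Rabs t) * exp (Rabs t)))) by ring.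
      rewrite (Rmult_comm eps). apply Rmult_le_compat_l; auto.
      assert (gauss t * exp (Rabs t * Cmod z) * exp (Rabs t * Rabs t) * exp (Rabs t) <= M).
      { unfold gauss, M. rewrite <- !exp_plus. apply exp_le. unfold K.
        assert (t * t = Rabs t * Rabs t) by (rewrite <- Rabs_mult, Rabs_pos_eq; nra). rewrite H1.
        assert (0 <= (Rabs t - (Cmod z + 1)) * (Rabs t - (Cmod z + 1))) by apply Rle_0_sqr.
        assert (0 <= Rabs t * Rabs t) by apply Rle_0_sqr. assert (0 <= Cmod z * Cmod z) by apply Rle_0_sqr.
        assert (0 <= (PI - 2) * (Rabs t * Rabs t)) by (apply Rmult_le_pos; lra). lra. }
      apply Rle_trans with (Cmod h * M). apply Rmult_le_compat_l; auto.
      apply Rle_trans with (eps / M * M). apply Rmult_le_compat_r; lra. right; field; lra.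
Qed.

Lemma gauss_line_parts (z : C) (a b : R) :
  (z * CInt (gauss_line z) a b - 2 * PI * CInt (fun t => t * gauss_line z t) a b = gauss_line z b - gauss_line z a)%C.
Proof.
  assert (Ct : forall t, rcont (fun t => t * gauss_line z t)%C t) by (intros; apply rcont_mult; [apply rcont_RtoC|apply gauss_line_cont]).
  rewrite <- !CInt_scal, <- CInt_minus; auto; try (intros; apply gauss_line_cont).
  2, 3: intros; apply rcont_mult; auto; try apply rcont_const; apply gauss_line_cont.
  apply CInt_FTC.
  - intros t. eapply rderiv_eq; [|apply rderiv_mult; [apply rderiv_gauss|apply rderiv_cexp_line]].
    unfold gauss_line. cbv beta. rewrite !RtoC_mult. ring.
  - intros; apply rcont_minus; apply rcont_mult; auto; try apply rcont_const; apply gauss_line_cont.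
Qed.

(** [J z = int_{-S}^T e^{-pi t^2 + z t} dt] satisfies [J' = (z J - boundary) / (2 pi)]. *)
Lemma gauss_line_estimate (om S T : R) :
  Cmod (CInt (gauss_line (0, om)) (- S) T * exp (om * om / (4 * PI)) - CInt (gauss_line 0) (- S) T)%C
   <= (gauss S + gauss T) * exp (om * om / (4 * PI)) * Rabs om.
Proof.
  assert (P := PI2_1).
  set (J := fun z => CInt (gauss_line z) (- S) T).
  set (Ez := fun z => (gauss_line z T - gauss_line z (- S))%C).
  (* An integrating factor: [(J q)' = - Ez q / (2 pi)], and at [z = i om] it takes the value
     [exp (om^2 / (4 pi))]. *)
  set (q := fun z => cexp (- (/ (4 * PI))%R * (z * z))%C).
  assert (Hq : forall z, cderiv q z (q z * (- (/ (4 * PI))%R * (z + z)))%C).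
  { intros z. apply (cderiv_comp cexp (fun z => - (/ (4 * PI))%R * (z * z))%C). apply cderiv_cexp.
    eapply cderiv_eq; [|apply cderiv_scal, cderiv_mult; apply cderiv_id]. cbv beta; ring. }
  assert (HP0 : RtoC PI <> 0%C) by (intros E; apply RtoC_inj in E; lra).
  assert (HK : forall z, cderiv (fun z => J z * q z)%C z (- (/ (2 * PI))%R * (Ez z * q z))%C).
  { intros z. eapply cderiv_eq; [|apply cderiv_mult; [apply gauss_line_deriv|apply Hq]].
    assert (E := gauss_line_parts z (- S) T). fold (J z) in E. fold (Ez z) in E. rewrite <- E. fold (J z).
    rewrite !RtoC_inv, !RtoC_mult by lra. field. auto. }
  assert (G : forall t, 0 < gauss t) by (intros; apply exp_pos).
  assert (B := segment_bound (fun z => J z * q z)%C (fun z => - (/ (2 * PI))%R * (Ez z * q z))%C 0 (0, om)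
     ((gauss S + gauss T) * exp (om * om / (4 * PI)))).
  cbv beta in B.
  replace (q 0%C) with (RtoC 1) in B.
  2: { unfold q. replace (- (/ (4 * PI))%R * (0 * 0))%C with (RtoC 0) by ring. rewrite cexp_0; auto. }
  replace (q (0, om)) with (RtoC (exp (om * om / (4 * PI)))) in B.
  2: { unfold q. replace (- (/ (4 * PI))%R * ((0, om) * (0, om)))%C with (RtoC (om * om / (4 * PI))).
       unfold cexp; simpl. rewrite cos_0, sin_0. apply C_ext; simpl; ring. apply C_ext; simpl; field; lra. }
  assert (Z0 : forall z : C, (z - 0)%C = z) by (intros; ring). rewrite Z0 in B.
  assert (Hom : Cmod (0, om) = Rabs om).
  { unfold Cmod; simpl. replace (0 * (0 * 1) + om * (om * 1)) with (Rsqr om) by (unfold Rsqr; ring). apply sqrt_Rsqr_abs. }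
  rewrite Hom in B. unfold J in B. rewrite Cmult_1_r in B. apply B.
  - intros; apply HK.
  - intros t Ht. rewrite Cplus_0_l. replace (t * (0, om))%C with ((0, t * om) : C) by (apply C_ext; simpl; ring).
    rewrite Cmod_mult, Cmod_opp, Cmod_RtoC_nonneg by (left; apply Rinv_0_lt_compat; lra).
    rewrite Cmod_mult.
    assert (B1 : Cmod (Ez (0, t * om)) <= gauss S + gauss T).
    { unfold Ez, gauss_line. eapply Rle_trans; [apply Cmod_minus_le|]. rewrite !Cmod_mult, !Cmod_cexp, !Cmod_RtoC_nonneg by (left; auto).
      replace (Re (T * (0, t * om)%R)%C) with 0 by (simpl; ring). replace (Re ((- S)%R * (0, t * om)%R)%C) with 0 by (simpl; ring).
      rewrite exp_0. replace (gauss (- S)) with (gauss S). lra. unfold gauss. f_equal. ring. }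
    assert (B2 : Cmod (q (0, t * om)) <= exp (om * om / (4 * PI))).
    { unfold q. rewrite Cmod_cexp. apply exp_le. simpl. apply Rle_trans with (t * t * (om * om / (4 * PI))). right; field; lra.
      rewrite <- (Rmult_1_l (om * om / (4 * PI))) at 2. apply Rmult_le_compat_r. apply Rmult_le_pos. nra. left; apply Rinv_0_lt_compat; lra. nra. }
    assert (B3 : / (2 * PI) <= 1). { rewrite <- Rinv_1. apply Rinv_le_contravar; lra. }
    assert (B4 := Cmod_ge_0 (Ez (0, t * om))). assert (B5 := Cmod_ge_0 (q (0, t * om))).
    assert (0 < / (2 * PI)) by (apply Rinv_0_lt_compat; lra).
    apply Rle_trans with (1 * (Cmod (Ez (0, t * om)) * Cmod (q (0, t * om)))). apply Rmult_le_compat_r; auto. nra.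
    rewrite Rmult_1_l. apply Rmult_le_compat; auto.
Qed.

Definition gauss_wave (x t : R) : C := (gauss t * cexp (0, 2 * PI * x * t)%R)%C.

Lemma gauss_wave_schwartz x : schwartz (gauss_wave x).
Proof.
  split; apply (gauss_class_schwartz (2 * PI * x)).
  - replace (fun t => Re (gauss_wave x t)) with (fun t => t ^ 0 * exp (- PI * (t * t)) * cos ((2 * PI * x) * t)). apply gauss_cos.
    apply functional_extensionality. intros t. unfold gauss_wave, gauss. rewrite re_scal_l. unfold cexp. simpl. rewrite exp_0. ring.
  - replace (fun t => Im (gauss_wave x t)) with (fun t => t ^ 0 * exp (- PI * (t * t)) * sin ((2 * PI * x) * t)). apply gauss_sin.
    apply functional_extensionality. intros t. unfold gauss_wave, gauss. rewrite im_scal_l. unfold cexp. simpl. rewrite exp_0. ring.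
Qed.

(** Modulation by [x] turns the transform at [a] into the Gaussian integral with frequency
    [om = 2 pi (x - a)]. The boundary terms of [gauss_line_estimate] vanish as [S] and [T] grow. *)
Lemma gauss_wave_fourier : exists c, 0 < c /\ forall x a, fourier (gauss_wave x) a = RtoC (c * gauss (a - x)).
Proof.
  assert (P := PI2_1).
  destruct gauss_integral_limit as [c [Hc HL]]. exists c. split; auto. intros x a.
  set (om := 2 * PI * (x - a)).
  set (q := exp (om * om / (4 * PI))). assert (Hq : 0 < q) by apply exp_pos.
  assert (Eq : c * gauss (a - x) = c / q).
  { unfold Rdiv. f_equal. unfold q. rewrite <- exp_Ropp. unfold gauss. f_equal. unfold om. field. lra. }
  rewrite Eq. apply fourier_value.
  { intros t. apply rcont_mult. eapply rderiv_rcont, rderiv_gauss.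
    apply (rcont_comp cexp (fun t => (0, 2 * PI * x * t)%R)). eapply cderiv_ccont, cderiv_cexp.
    apply rderiv_rcont with (0, 2 * PI * x)%R. apply rderiv_intro; simpl; auto_derive; auto; ring. }
  intros eps He.
  assert (Ei : forall S T, CInt (fun t => gauss_wave x t * cexp (0, - 2 * PI * a * t)%R)%C (- S) T = CInt (gauss_line (0, om)) (- S) T).
  { intros. apply CInt_ext. intros t _. unfold gauss_wave, gauss_line. rewrite <- Cmult_assoc, <- cexp_plus. f_equal. f_equal.
    apply C_ext; simpl; unfold om; ring. }
  assert (E0 : forall S T, CInt (gauss_line 0) (- S) T = RtoC (RInt gauss (- S) T)).
  { intros. apply C_ext; rewrite ?CInt_Re, ?CInt_Im.
    - apply RInt_ext. intros; unfold gauss_line. rewrite Cmult_0_r, cexp_0. simpl. ring.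
    - rewrite (RInt_ext _ (fun _ => 0)). rewrite RInt_const. unfold scal; simpl; unfold mult; simpl. ring.
      intros; unfold gauss_line. rewrite Cmult_0_r, cexp_0. simpl. ring. }
  destruct (HL (eps * q / 2)) as [T1 HT1]. { apply Rmult_lt_0_compat; [|lra]. apply Rmult_lt_0_compat; auto. }
  set (Kb := 2 * (q * Rabs om + 1)). assert (HKb : 0 < Kb) by (unfold Kb; generalize (Rabs_pos om); intros; nra).
  exists (Rmax T1 (Rmax 1 (Kb / (eps * q / 2)))). intros S T HS HT. rewrite Ei.
  generalize (Rmax_l T1 (Rmax 1 (Kb / (eps * q / 2)))) (Rmax_r T1 (Rmax 1 (Kb / (eps * q / 2)))) (Rmax_l 1 (Kb / (eps * q / 2))) (Rmax_r 1 (Kb / (eps * q / 2))); intros.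
  specialize (HT1 S T ltac:(lra) ltac:(lra)).
  assert (G := gauss_line_estimate om S T). fold q in G. rewrite E0 in G.
  set (I := CInt (gauss_line (0, om)) (- S) T) in *.
  assert (Dg : forall y, 1 <= y -> Kb / (eps * q / 2) <= y -> gauss y * Kb <= eps * q / 2).
  { intros y H1y Hy. unfold gauss. replace (- PI * (y * y)) with (- (PI * (y * y))) by ring. rewrite exp_Ropp.
    rewrite Rmult_comm. apply (Rle_div_l Kb). apply exp_pos.
    apply (Rle_div_l Kb) in Hy. 2: nra. assert (E := exp_ineq1_le (PI * (y * y))).
    rewrite Rmult_comm. apply Rle_trans with (y * (eps * q / 2)). lra. apply Rmult_le_compat_r. nra. nra. }
  assert (D1 := Dg S ltac:(lra) ltac:(lra)). assert (D2 := Dg T ltac:(lra) ltac:(lra)).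
  assert (G2 : Cmod (I * q - c)%C <= eps * q).
  { eapply Rle_trans; [apply (Cmod_triangle3 _ (RtoC (RInt gauss (- S) T)))|]. rewrite <- RtoC_minus, Cmod_R.
    assert ((gauss S + gauss T) * q * Rabs om <= eps * q / 2).
    { assert (0 < gauss S /\ 0 < gauss T) by (split; apply exp_pos). unfold Kb in *. nra. } lra. }
  replace (I - (c / q)%R)%C with ((I * q - c) / q)%C.
  2: { rewrite RtoC_div by lra. field. intros E; apply RtoC_inj in E; lra. }
  rewrite Cmod_div by (intros E; apply RtoC_inj in E; lra). rewrite (Cmod_RtoC_nonneg q) by lra. apply Rle_div_l; auto.
Qed.

(** * Smooth one-sided exponentials *)

(** The smooth function that is flat at [0]. The powers of [1 / t] close the family under
    differentiation. *)
Definition flat (k : nat) (t : R) : R := if Rle_dec t 0 then 0 else exp (- / t) * (/ t) ^ k.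

Lemma flat_nonpos k t : t <= 0 -> flat k t = 0.
Proof. intros H. unfold flat. destruct (Rle_dec t 0); lra. Qed.

Lemma flat_pos k t : 0 < t -> flat k t = exp (- / t) * (/ t) ^ k.
Proof. intros H. unfold flat. destruct (Rle_dec t 0); lra. Qed.

Lemma flat_bound k t : 0 <= flat k t <= INR k ^ k.
Proof.
  destruct (Rle_dec t 0) as [H | H].
  - rewrite flat_nonpos by auto. split. lra. apply pow_le, pos_INR.
  - rewrite flat_pos by lra. assert (P : 0 < / t) by (apply Rinv_0_lt_compat; lra). split.
    + apply Rmult_le_pos. left; apply exp_pos. apply pow_le; lra.
    + rewrite Rmult_comm, exp_Ropp. apply (Rle_div_l ((/ t) ^ k)). apply exp_pos. apply pow_le_exp. lra.
Qed.

Lemma flat_quadratic k t : 0 <= flat k t <= INR (k + 2) ^ (k + 2) * (t * t).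
Proof.
  destruct (flat_bound (k + 2) t) as [B1 B2]. split. apply flat_bound.
  assert (E : flat k t = flat (k + 2) t * (t * t)).
  { destruct (Rle_dec t 0). rewrite !flat_nonpos by auto. ring.
    rewrite !flat_pos by lra. rewrite pow_add. simpl. field. lra. }
  rewrite E. apply Rmult_le_compat_r; auto. apply Rle_0_sqr.
Qed.

(** The indices [k + 2] and [k + 1] come from differentiating [exp (- 1 / t)] and [t^(-k)]. At the
    origin the derivative exists because [flat k] is at most quadratic there. *)
Lemma flat_deriv k t : is_derive (flat k) t (flat (k + 2) t - INR k * flat (k + 1) t).
Proof.
  destruct (Rtotal_order t 0) as [H | [-> | H]].
  - apply (is_derive_ext_loc (fun _ => 0)).
    + exists (mkposreal (- t) ltac:(lra)). intros s Hs. change (Rabs (s - t) < - t) in Hs. apply Rabs_lt_between in Hs.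
      rewrite flat_nonpos; lra.
    + rewrite !flat_nonpos by lra. auto_derive; auto. ring.
  - rewrite !flat_nonpos by lra. apply is_derive_Reals. intros eps He.
    set (M := INR (k + 2) ^ (k + 2) + 1). assert (HM : 0 < M) by (unfold M; generalize (pow_le (INR (k + 2)) (k + 2) (pos_INR _)); lra).
    exists (mkposreal (eps / M) ltac:(apply Rdiv_lt_0_compat; auto)). intros h Hh0 Hh. simpl in Hh.
    rewrite Rplus_0_l, (flat_nonpos k 0) by lra.
    assert (B := flat_quadratic k h).
    replace ((flat k h - 0) / h - (0 - INR k * 0)) with (flat k h / h) by (field; auto).
    assert (Ph : 0 < Rabs h) by (apply Rabs_pos_lt; auto).
    rewrite Rabs_div by auto. apply (Rlt_div_l (Rabs (flat k h))); auto. rewrite Rabs_pos_eq by apply B.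
    assert (h * h = Rabs h * Rabs h) by (rewrite <- Rabs_mult, Rabs_pos_eq; nra).
    apply Rle_lt_trans with ((M - 1) * (Rabs h * Rabs h)). rewrite <- H. unfold M. replace (INR (k + 2) ^ (k + 2) + 1 - 1) with (INR (k + 2) ^ (k + 2)) by ring. apply B.
    assert (Rabs h * M < eps). { apply Rlt_le_trans with (eps / M * M). apply Rmult_lt_compat_r; auto. right; field; lra. } nra.
  - apply (is_derive_ext_loc (fun t => exp (- / t) * (/ t) ^ k)).
    + exists (mkposreal t H). intros s Hs. change (Rabs (s - t) < t) in Hs. apply Rabs_lt_between in Hs.
      rewrite flat_pos; lra.
    + rewrite !flat_pos by lra. auto_derive. lra. rewrite !pow_add. destruct k; simpl; field; lra.
Qed.

(** Smooth and supported in [[0, d]]; separate indices at the two ends keep the family closed under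
    differentiation. *)
Definition bump0 (d : R) (j k : nat) (t : R) : R := flat j (t / d) * flat k (1 - t / d).

Lemma bump0_deriv d j k t : d <> 0 -> is_derive (bump0 d j k) t
  (/ d * (bump0 d (j + 2) k t + - INR j * bump0 d (j + 1) k t) + / d * (- (1) * bump0 d j (k + 2) t + INR k * bump0 d j (k + 1) t)).
Proof.
  intros Hd. unfold bump0.
  evar_last. apply (is_derive_mult (K := R_AbsRing)).
  apply (is_derive_comp (K := R_AbsRing) (V := R_NormedModule) (flat j) (fun t => t / d)). apply flat_deriv. instantiate (1 := / d). auto_derive; auto. field; auto.
  apply (is_derive_comp (K := R_AbsRing) (V := R_NormedModule) (flat k) (fun t => 1 - t / d)). apply flat_deriv. instantiate (1 := - / d). auto_derive; auto. field; auto.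
  intros; apply Rmult_comm.
  unfold plus, mult, scal; simpl; unfold mult; simpl. ring.
Qed.

Lemma continuous_of_derive (f f' : R -> R) t : (forall t, is_derive f t (f' t)) -> continuous f t.
Proof. intros H. apply (ex_derive_continuous f). exists (f' t). auto. Qed.

Lemma bump0_cont d j k t : d <> 0 -> continuous (bump0 d j k) t.
Proof. intros Hd. apply (ex_derive_continuous (bump0 d j k)). eexists. apply bump0_deriv; auto. Qed.

Lemma bump0_nonneg d j k t : 0 <= bump0 d j k t.
Proof. apply Rmult_le_pos; apply flat_bound. Qed.

Lemma bump0_left d j k t : 0 < d -> t <= 0 -> bump0 d j k t = 0.
Proof. intros Hd Ht. unfold bump0. rewrite flat_nonpos. ring. apply (Rle_div_l t); lra. Qed.

Lemma bump0_right d j k t : 0 < d -> d <= t -> bump0 d j k t = 0.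
Proof. intros Hd Ht. unfold bump0. rewrite (flat_nonpos k). ring. assert (1 <= t / d) by (apply (Rle_div_r 1); lra). lra. Qed.

(** [bump d] is a smooth probability density on [[0, d]]. Its primitive [ramp1 d] rises smoothly
    from [0] to [1], and [ramp d] is a smooth substitute for [max t 0] with error at most [d]. *)
Definition bump_mass (d : R) : R := RInt (bump0 d 0 0) 0 d.
Definition bump (d t : R) : R := / bump_mass d * bump0 d 0 0 t.
Definition ramp1 (d t : R) : R := RInt (bump d) 0 t.
Definition ramp (d t : R) : R := RInt (ramp1 d) 0 t.

Section Ramp.
Variable d : R.
Hypothesis Hd : 0 < d.

Lemma bump_mass_pos : 0 < bump_mass d.
Proof.
  unfold bump_mass. apply RInt_gt_0. exact Hd.
  - intros t Ht. unfold bump0. apply Rmult_lt_0_compat.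
    + rewrite flat_pos. apply Rmult_lt_0_compat. apply exp_pos. simpl; lra. apply Rdiv_lt_0_compat; lra.
    + rewrite flat_pos. apply Rmult_lt_0_compat. apply exp_pos. simpl; lra. assert (t / d < 1) by (apply (Rlt_div_l t); lra). lra.
  - intros; apply bump0_cont; lra.
Qed.

Lemma bump_cont t : continuous (bump d) t.
Proof. apply (continuous_scal_r (K := R_AbsRing) (V := R_NormedModule)). apply bump0_cont. lra. Qed.

Lemma bump_nonneg t : 0 <= bump d t.
Proof. apply Rmult_le_pos. left; apply Rinv_0_lt_compat, bump_mass_pos. apply bump0_nonneg. Qed.

Lemma bump_left t : t <= 0 -> bump d t = 0.
Proof. intros. unfold bump. rewrite bump0_left; auto. ring. Qed.

Lemma bump_right t : d <= t -> bump d t = 0.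
Proof. intros. unfold bump. rewrite bump0_right; auto. ring. Qed.

Lemma bump_integral : RInt (bump d) 0 d = 1.
Proof.
  unfold bump. transitivity (/ bump_mass d * RInt (bump0 d 0 0) 0 d).
  - apply (RInt_scal (V := R_CompleteNormedModule) (bump0 d 0 0)). apply ex_RInt_cont. intros; apply bump0_cont; lra.
  - change (/ bump_mass d * bump_mass d = 1). apply Rinv_l. generalize bump_mass_pos; lra.
Qed.

Lemma ramp1_deriv t : is_derive (ramp1 d) t (bump d t).
Proof.
  apply (is_derive_RInt (V := R_NormedModule) (bump d) (ramp1 d) 0 t).
  - exists (mkposreal 1 Rlt_0_1). intros s _. apply (RInt_correct (V := R_CompleteNormedModule)). apply ex_RInt_cont. apply bump_cont.
  - apply bump_cont.
Qed.

Lemma ramp1_cont t : continuous (ramp1 d) t.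
Proof. apply (continuous_of_derive _ (bump d)). apply ramp1_deriv. Qed.

Lemma ramp_deriv t : is_derive (ramp d) t (ramp1 d t).
Proof.
  apply (is_derive_RInt (V := R_NormedModule) (ramp1 d) (ramp d) 0 t).
  - exists (mkposreal 1 Rlt_0_1). intros s _. apply (RInt_correct (V := R_CompleteNormedModule)). apply ex_RInt_cont. apply ramp1_cont.
  - apply ramp1_cont.
Qed.

Lemma RInt_zero (f : R -> R) a b : (forall t, Rmin a b < t < Rmax a b -> f t = 0) -> RInt f a b = 0.
Proof.
  intros H. rewrite (RInt_ext f (fun _ => 0)) by auto. rewrite RInt_const. unfold scal; simpl; unfold mult; simpl. ring.
Qed.

Lemma ramp1_left t : t <= 0 -> ramp1 d t = 0.
Proof. intros H. apply RInt_zero. rewrite Rmin_right, Rmax_left by auto. intros; apply bump_left; lra. Qed.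

Lemma ramp_left t : t <= 0 -> ramp d t = 0.
Proof. intros H. apply RInt_zero. rewrite Rmin_right, Rmax_left by auto. intros; apply ramp1_left; lra. Qed.

Lemma ramp1_Chasles s t : ramp1 d s + RInt (bump d) s t = ramp1 d t.
Proof. apply (RInt_Chasles (V := R_CompleteNormedModule)); apply ex_RInt_cont, bump_cont. Qed.

Lemma ramp1_right t : d <= t -> ramp1 d t = 1.
Proof.
  intros H. rewrite <- (ramp1_Chasles d). unfold ramp1. rewrite bump_integral, RInt_zero. ring.
  rewrite Rmin_left by auto. intros; apply bump_right; lra.
Qed.

Lemma ramp1_bounds t : 0 <= ramp1 d t <= 1.
Proof.
  destruct (Rle_dec t 0). rewrite ramp1_left; lra.
  destruct (Rle_dec d t). rewrite ramp1_right; lra.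
  assert (I : forall a b, a <= b -> 0 <= RInt (bump d) a b).
  { intros. apply RInt_ge_0; auto. apply ex_RInt_cont, bump_cont. intros; apply bump_nonneg. }
  split. apply I; lra. rewrite <- (ramp1_right d) by lra. rewrite <- (ramp1_Chasles t d). generalize (I t d); lra.
Qed.

Lemma ramp_bounds t : 0 <= t -> t - d <= ramp d t <= t.
Proof.
  intros Ht.
  assert (E : forall a b, ex_RInt (ramp1 d) a b) by (intros; apply ex_RInt_cont, ramp1_cont).
  assert (C1 : forall a b, RInt (fun _ => 1) a b = b - a) by (intros; rewrite RInt_const; unfold scal; simpl; unfold mult; simpl; ring).
  assert (U : ramp d t <= t).
  { apply Rle_trans with (RInt (fun _ => 1) 0 t); [|rewrite C1; lra].
    apply RInt_le; auto. apply ex_RInt_const. intros; apply ramp1_bounds. }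
  split; auto.
  destruct (Rle_dec t d).
  - apply Rle_trans with 0. lra. apply RInt_ge_0; auto. intros; apply ramp1_bounds.
  - unfold ramp. rewrite <- (RInt_Chasles (V := R_CompleteNormedModule) (ramp1 d) 0 d t); auto.
    assert (0 <= RInt (ramp1 d) 0 d) by (apply RInt_ge_0; auto; [lra|intros; apply ramp1_bounds]).
    rewrite (RInt_ext (ramp1 d) (fun _ => 1) d t). rewrite C1. unfold plus; simpl. lra.
    rewrite Rmin_left by lra. intros; apply ramp1_right; lra.
Qed.

Inductive ramp_base : (R -> R) -> Prop :=
| rb_ramp : ramp_base (ramp d)
| rb_ramp1 : ramp_base (ramp1 d)
| rb_bump j k : ramp_base (bump0 d j k).

Lemma ramp_base_bound v : ramp_base v -> (forall t, t <= 0 -> v t = 0) /\ exists V, 0 <= V /\ forall t, 0 <= t -> Rabs (v t) <= V * (1 + t).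
Proof.
  intros [| | j k].
  - split. apply ramp_left. exists 1. split. lra. intros t Ht. assert (H := ramp_bounds t Ht).
    assert (0 <= ramp d t). { apply RInt_ge_0; auto. apply ex_RInt_cont, ramp1_cont. intros; apply ramp1_bounds. } rewrite Rabs_pos_eq; lra.
  - split. apply ramp1_left. exists 1. split. lra. intros t Ht. assert (H := ramp1_bounds t). rewrite Rabs_pos_eq; lra.
  - split. intros; apply bump0_left; auto. exists (INR j ^ j * INR k ^ k).
    assert (0 <= INR j ^ j) by apply pow_le, pos_INR. assert (0 <= INR k ^ k) by apply pow_le, pos_INR.
    split. apply Rmult_le_pos; auto. intros t Ht. rewrite Rabs_pos_eq by apply bump0_nonneg.
    rewrite <- (Rmult_1_r (bump0 d j k t)). apply Rmult_le_compat; try lra. apply bump0_nonneg.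
    apply Rmult_le_compat; apply flat_bound.
Qed.

Variables (al be : R).
Hypothesis Hal : al < 0.

(** Generated by the parts of [ramp_wave]. The constructor [rc_ext] lets a computed derivative be
    rewritten pointwise into a combination of generators. *)
Inductive ramp_class : (R -> R) -> Prop :=
| rc_cos v : ramp_base v -> ramp_class (fun x => v x * (exp (al * x) * cos (be * x)))
| rc_sin v : ramp_base v -> ramp_class (fun x => v x * (exp (al * x) * sin (be * x)))
| rc_plus u v : ramp_class u -> ramp_class v -> ramp_class (fun x => u x + v x)
| rc_scal c u : ramp_class u -> ramp_class (fun x => c * u x)
| rc_ext u v : (forall x, u x = v x) -> ramp_class u -> ramp_class v.

(** The multiplier [h] stands for the exponential times either cosine or sine, so both cases of the
    class share one computation. *)
Lemma ramp_base_deriv v : ramp_base v -> exists v', (forall x, is_derive v x (v' x)) /\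
  forall h, (forall w, ramp_base w -> ramp_class (fun x => w x * h x)) -> ramp_class (fun x => v' x * h x).
Proof.
  intros [| | j k].
  - exists (ramp1 d). split. apply ramp_deriv. intros h Hh. apply Hh, rb_ramp1.
  - exists (bump d). split. apply ramp1_deriv. intros h Hh.
    apply (rc_ext (fun x => / bump_mass d * (bump0 d 0 0 x * h x))). intros; unfold bump; ring. apply rc_scal, Hh, rb_bump.
  - eexists. split. intros; apply bump0_deriv; lra. intros h Hh.
    apply (rc_ext (fun x => / d * (bump0 d (j + 2) k x * h x + - INR j * (bump0 d (j + 1) k x * h x)) +
       / d * (- (1) * (bump0 d j (k + 2) x * h x) + INR k * (bump0 d j (k + 1) x * h x)))).
    intros; ring.
    apply rc_plus; apply rc_scal, rc_plus; try apply rc_scal; apply Hh, rb_bump.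
Qed.

Lemma ramp_class_schwartz u : ramp_class u -> schwartz_real u.
Proof.
  apply schwartz_of_class; clear u.
  - intros u Hu. induction Hu as [v Hv | v Hv | u v Hu [u' [H1 H1']] Hv [v' [H2 H2']] | c u Hu [u' [H1 H1']] | u v Huv Hu [u' [H1 H1']]].
    + destruct (ramp_base_deriv v Hv) as [v' [Dv Cv]].
      exists (fun x => v' x * (exp (al * x) * cos (be * x)) + (al * (v x * (exp (al * x) * cos (be * x))) + - be * (v x * (exp (al * x) * sin (be * x))))). split.
      * intros x. evar_last. apply (is_derive_mult (K := R_AbsRing)). apply Dv.
        instantiate (1 := al * (exp (al * x) * cos (be * x)) - be * (exp (al * x) * sin (be * x))). auto_derive; auto; ring.
        intros; apply Rmult_comm. unfold plus, mult; simpl. ring.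
      * apply rc_plus. apply Cv. intros; apply rc_cos; auto. apply rc_plus; apply rc_scal. apply rc_cos; auto. apply rc_sin; auto.
    + destruct (ramp_base_deriv v Hv) as [v' [Dv Cv]].
      exists (fun x => v' x * (exp (al * x) * sin (be * x)) + (al * (v x * (exp (al * x) * sin (be * x))) + be * (v x * (exp (al * x) * cos (be * x))))). split.
      * intros x. evar_last. apply (is_derive_mult (K := R_AbsRing)). apply Dv.
        instantiate (1 := al * (exp (al * x) * sin (be * x)) + be * (exp (al * x) * cos (be * x))). auto_derive; auto; ring.
        intros; apply Rmult_comm. unfold plus, mult; simpl. ring.
      * apply rc_plus. apply Cv. intros; apply rc_sin; auto. apply rc_plus; apply rc_scal. apply rc_sin; auto. apply rc_cos; auto.
    + exists (fun x => u' x + v' x). split. intros x. apply (is_derive_plus (V := R_NormedModule)); auto. apply rc_plus; auto.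
    + exists (fun x => c * u' x). split. intros x. apply is_derive_scal; auto. apply rc_scal; auto.
    + exists u'. split; auto. intros x. apply (is_derive_ext u); auto.
  - assert (Base : forall v (w : R -> R) (k : nat), ramp_base v -> (forall x, Rabs (w x) <= 1) ->
      exists M, forall x, Rabs (x ^ k * (v x * (exp (al * x) * w x))) <= M).
    { intros v w k Hv Hw. destruct (ramp_base_bound v Hv) as [V0 [V [HV HVb]]].
      assert (X : forall (m : nat) x, 0 <= x -> x ^ m * exp (al * x) <= INR m ^ m * (/ - al) ^ m).
      { intros m x Hx. assert (H := pow_le_exp m (- al * x) ltac:(nra)).
        rewrite Rpow_mult_distr in H. replace (al * x) with (- (- al * x)) by ring. rewrite exp_Ropp.
        apply (Rle_div_l (x ^ m)). apply exp_pos.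
        apply Rmult_le_reg_l with ((- al) ^ m). apply pow_lt; lra. eapply Rle_trans; [apply H|]. right.
        rewrite <- (Rmult_1_l (INR m ^ m)) at 1. replace 1 with ((- al * / - al) ^ m). rewrite Rpow_mult_distr; ring.
        rewrite Rinv_r by lra. apply pow1. }
      exists (V * (INR k ^ k * (/ - al) ^ k + INR (S k) ^ S k * (/ - al) ^ S k)).
      intros x. destruct (Rle_dec x 0) as [Hx | Hx].
      - rewrite V0 by auto. rewrite Rmult_0_l, Rmult_0_r, Rabs_R0. apply Rmult_le_pos; auto.
        assert (0 < / - al) by (apply Rinv_0_lt_compat; lra).
        apply Rplus_le_le_0_compat; apply Rmult_le_pos; apply pow_le; try apply pos_INR; lra.
      - assert (X1 := X k x ltac:(lra)). assert (X2 := X (S k) x ltac:(lra)).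
        rewrite !Rabs_mult, (Rabs_pos_eq (exp _)) by (left; apply exp_pos). rewrite (Rabs_pos_eq (x ^ k)) by (apply pow_le; lra).
        apply Rle_trans with (x ^ k * (V * (1 + x) * (exp (al * x) * 1))).
        + apply Rmult_le_compat_l. apply pow_le; lra. apply Rmult_le_compat; try apply Rabs_pos.
          apply Rmult_le_pos. left; apply exp_pos. apply Rabs_pos. apply HVb; lra. apply Rmult_le_compat_l; auto. left; apply exp_pos.
        + replace (x ^ k * (V * (1 + x) * (exp (al * x) * 1))) with (V * (x ^ k * exp (al * x) + x ^ S k * exp (al * x))) by (simpl; ring).
          apply Rmult_le_compat_l; auto. lra. }
    intros u k Hu. induction Hu as [v Hv | v Hv | u v Hu [M1 H1] Hv [M2 H2] | c u Hu [M1 H1] | u v Huv Hu [M1 H1]].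
    + apply Base; auto. intros; apply Rabs_le, COS_bound.
    + apply Base; auto. intros; apply Rabs_le, SIN_bound.
    + exists (M1 + M2). intros x. rewrite Rmult_plus_distr_l. eapply Rle_trans; [apply Rabs_triang|]. specialize (H1 x). specialize (H2 x). lra.
    + exists (Rabs c * M1). intros x. replace (x ^ k * (c * u x)) with (c * (x ^ k * u x)) by ring. rewrite Rabs_mult.
      apply Rmult_le_compat_l; auto. apply Rabs_pos.
    + exists M1. intros x. rewrite <- Huv; auto.
Qed.
End Ramp.

(** * The smoothed one-sided wave and its transform *)

(** For [d] tending to [0] this becomes [t exp (2 pi i z t)] on [t > 0], whose transform at [a] is
    [- 1 / (4 pi^2 (z - a)^2)], summable over the zeros. *)
Definition ramp_wave (d : R) (z : C) (t : R) : C := (ramp d t * cexp (t * (2 * PI * Ci * z)))%C.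

Lemma freq_Re (z : C) : Re (2 * PI * Ci * z)%C = - 2 * PI * Im z.
Proof. rewrite <- RtoC_mult, <- Cmult_assoc, re_scal_l, (Cmult_comm Ci), re_mult_Ci. ring. Qed.

Lemma freq_Im (z : C) : Im (2 * PI * Ci * z)%C = 2 * PI * Re z.
Proof. rewrite <- RtoC_mult, <- Cmult_assoc, im_scal_l, im_mult. simpl. unfold Re. ring. Qed.

Lemma ramp_wave_schwartz d z : 0 < d -> 0 < Im z -> schwartz (ramp_wave d z).
Proof.
  intros Hd Hz. assert (P := PI2_1).
  split; apply (ramp_class_schwartz d Hd (- 2 * PI * Im z) (2 * PI * Re z)); try nra.
  - apply (rc_ext d _ _ (fun x => ramp d x * (exp (- 2 * PI * Im z * x) * cos (2 * PI * Re z * x)))).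
    + intros x. unfold ramp_wave. rewrite re_scal_l. unfold cexp. rewrite !re_scal_l, !im_scal_l, freq_Re, freq_Im.
      simpl. f_equal. f_equal; f_equal; ring.
    + apply rc_cos, rb_ramp.
  - apply (rc_ext d _ _ (fun x => ramp d x * (exp (- 2 * PI * Im z * x) * sin (2 * PI * Re z * x)))).
    + intros x. unfold ramp_wave. rewrite im_scal_l. unfold cexp. rewrite !re_scal_l, !im_scal_l, freq_Re, freq_Im.
      simpl. f_equal. f_equal; f_equal; ring.
    + apply rc_sin, rb_ramp.
Qed.

Definition bump_transform (d : R) (w : C) : C := CInt (fun t => bump d t * cexp (t * w))%C 0 d.

Lemma rcont_real (f : R -> R) t : continuous f t -> rcont (fun s => RtoC (f s)) t.
Proof. intros H. apply rcont_intro; simpl. auto. apply continuous_const. Qed.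

Lemma bump_transform_cont d w t : 0 < d -> rcont (fun t => bump d t * cexp (t * w))%C t.
Proof. intros. apply rcont_mult. apply rcont_real, bump_cont; auto. eapply rderiv_rcont, rderiv_cexp_line. Qed.

Lemma bump_transform_le1 d w : 0 < d -> Re w <= 0 -> Cmod (bump_transform d w) <= 1.
Proof.
  intros Hd Hw. rewrite <- (bump_integral d Hd). apply CInt_le.
  - lra. - intros; apply bump_transform_cont; auto. - apply bump_cont; auto.
  - intros t Ht. rewrite Cmod_mult, Cmod_cexp, re_scal_l, Cmod_RtoC_nonneg by (apply bump_nonneg; auto).
    rewrite <- (Rmult_1_r (bump d t)) at 2. apply Rmult_le_compat_l. apply bump_nonneg; auto. rewrite <- exp_0. apply exp_le. nra.
Qed.

Lemma bump_transform_near1 d w : 0 < d -> Cmod (bump_transform d w - 1) <= d * Cmod w * exp (d * Cmod w).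
Proof.
  intros Hd.
  assert (E : (bump_transform d w - 1)%C = CInt (fun t => bump d t * (cexp (t * w) - 1))%C 0 d).
  { rewrite (CInt_ext (fun t => bump d t * (cexp (t * w) - 1))%C (fun t => bump d t * cexp (t * w) - bump d t)%C) by (intros; ring).
    rewrite CInt_minus. fold (bump_transform d w). f_equal.
    - apply C_ext; rewrite ?CInt_Re, ?CInt_Im; simpl. symmetry; apply bump_integral; auto. symmetry. apply RInt_zero; auto.
    - intros; apply bump_transform_cont; auto.
    - intros; apply rcont_real, bump_cont; auto. }
  rewrite E. apply Rle_trans with (d * Cmod w * exp (d * Cmod w) * RInt (bump d) 0 d); [|rewrite (bump_integral d Hd); lra].
  assert (S1 : d * Cmod w * exp (d * Cmod w) * RInt (bump d) 0 d = RInt (fun t => d * Cmod w * exp (d * Cmod w) * bump d t) 0 d).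
  { symmetry. apply (RInt_scal (V := R_CompleteNormedModule)), ex_RInt_cont, bump_cont; auto. }
  rewrite S1. apply CInt_le. lra.
  - intros t. apply rcont_mult. apply rcont_real, bump_cont; auto. apply rcont_minus. eapply rderiv_rcont, rderiv_cexp_line. apply rcont_const.
  - intros t. apply (continuous_scal_r (K := R_AbsRing) (V := R_NormedModule)). apply bump_cont; auto.
  - intros t Ht. rewrite Cmod_mult, Cmod_RtoC_nonneg by (apply bump_nonneg; auto). rewrite Rmult_comm. apply Rmult_le_compat_r. apply bump_nonneg; auto.
    eapply Rle_trans; [apply cexp_bound1|]. rewrite Cmod_mult, Cmod_RtoC_nonneg by lra. assert (Pw := Cmod_ge_0 w).
    apply Rmult_le_compat. nra. left; apply exp_pos. apply Rmult_le_compat_r; lra. apply exp_le. apply Rmult_le_compat_r; lra.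
Qed.

(** Two integrations by parts, expressed by the antiderivative [An]: the second derivative of
    [ramp d] is [bump d]. The boundary terms at [T] decay because [Re w < 0]. *)
Lemma ramp_wave_fourier (d : R) (z : C) (a : R) : 0 < d -> 0 < Im z ->
  fourier (ramp_wave d z) a = (bump_transform d (2 * PI * Ci * (z - a)) / ((2 * PI * Ci * (z - a)) * (2 * PI * Ci * (z - a))))%C.
Proof.
  intros Hd Hz. assert (P := PI2_1). set (w := (2 * PI * Ci * (z - a))%C).
  assert (Rw : Re w = - 2 * PI * Im z). { unfold w. rewrite freq_Re. unfold Cminus. rewrite im_plus, im_opp, im_RtoC. ring. }
  assert (Hy : Re w < 0) by (rewrite Rw; nra).
  assert (Hw0 : w <> 0%C) by (intros E; rewrite E in Hy; simpl in Hy; lra).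
  assert (Pw : 0 < Cmod w) by (apply Cmod_gt_0; auto).
  assert (RC : forall t, rderiv (fun s => RtoC (ramp d s)) t (RtoC (ramp1 d t))).
  { intros t. apply rderiv_intro; simpl. apply ramp_deriv; auto. auto_derive; auto. }
  assert (RC1 : forall t, rderiv (fun s => RtoC (ramp1 d s)) t (RtoC (bump d t))).
  { intros t. apply rderiv_intro; simpl. apply ramp1_deriv; auto. auto_derive; auto. }
  assert (Cw : forall t, rcont (fun t => ramp d t * cexp (t * w))%C t).
  { intros. apply rcont_mult. eapply rderiv_rcont, RC. eapply rderiv_rcont, rderiv_cexp_line. }
  apply fourier_value.
  { intros t. apply rcont_mult. eapply rderiv_rcont, RC. eapply rderiv_rcont, rderiv_cexp_line. }
  intros eps He.
  assert (Ei : forall S T, CInt (fun t => ramp_wave d z t * cexp (0, - 2 * PI * a * t)%R)%C (- S) T = CInt (fun t => ramp d t * cexp (t * w))%C (- S) T).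
  { intros. apply CInt_ext. intros t _. unfold ramp_wave. rewrite <- Cmult_assoc, <- cexp_plus. f_equal. f_equal.
    apply C_ext; rewrite ?re_plus, ?im_plus, !re_scal_l || rewrite ?re_plus, ?im_plus, !im_scal_l; unfold w; rewrite !freq_Re || rewrite !freq_Im;
    unfold Cminus; rewrite ?re_plus, ?im_plus, ?re_opp, ?im_opp, ?re_RtoC, ?im_RtoC; simpl; ring. }
  set (Q := (2 / Cmod w + / (Cmod w * Cmod w)) / (2 * PI * Im z)).
  assert (HQ : 0 < Q).
  { unfold Q. apply Rdiv_lt_0_compat; [|nra]. assert (0 < / (Cmod w * Cmod w)) by (apply Rinv_0_lt_compat; nra).
    assert (0 < 2 / Cmod w) by (apply Rdiv_lt_0_compat; lra). lra. }
  set (y := 2 * PI * Im z) in *. assert (Hy0 : 0 < y) by (unfold y; nra).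
  (* the boundary terms at [T] are at most [e^{-yT}] times a linear function of [T] *)
  assert (Dec : forall T, 0 < T -> exp (- (y * T)) * T <= 4 / (y * y) / T /\ exp (- (y * T)) <= 4 / (y * y) / T * / T).
  { intros T HT. assert (E := pow_le_exp 2 (y * T) ltac:(nra)). simpl in E. rewrite exp_Ropp.
    assert (E1 : y * y * (T * T) <= 4 * exp (y * T)) by lra. assert (E0 := exp_pos (y * T)).
    assert (B : / exp (y * T) <= 4 / (y * y) / T * / T).
    { apply Rmult_le_reg_l with (exp (y * T)); auto. rewrite Rinv_r by lra.
      apply Rmult_le_reg_l with (y * y * (T * T)). { assert (0 < y * y) by nra. assert (0 < T * T) by nra. apply Rmult_lt_0_compat; auto. }
      replace (y * y * (T * T) * (exp (y * T) * (4 / (y * y) / T * / T))) with (4 * exp (y * T)) by (field; lra). lra. }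
    split; auto. apply Rle_trans with (4 / (y * y) / T * / T * T). apply Rmult_le_compat_r; lra. right; field; lra. }
  set (K := 4 / (y * y) * (/ Cmod w + / (Cmod w * Cmod w))).
  assert (HK : 0 < K).
  { unfold K. apply Rmult_lt_0_compat. apply Rdiv_lt_0_compat; nra. assert (0 < / Cmod w) by (apply Rinv_0_lt_compat; auto).
    assert (0 < / (Cmod w * Cmod w)) by (apply Rinv_0_lt_compat; nra). lra. }
  exists (Rmax (1 + d) (K / eps)). intros S T HS HT. rewrite Ei.
  generalize (Rmax_l (1 + d) (K / eps)) (Rmax_r (1 + d) (K / eps)); intros.
  assert (Z1 : CInt (fun t => ramp d t * cexp (t * w))%C (- S) 0 = 0%C).
  { rewrite (CInt_ext _ (fun _ => 0%C)). rewrite CInt_const. ring. rewrite Rmin_left, Rmax_right by lra.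
    intros t Ht. rewrite ramp_left by lra. ring. }
  rewrite <- (CInt_Chasles _ (- S) 0 T), Z1, Cplus_0_l by auto.
  set (An := fun t : R => (ramp d t * cexp (t * w) / w - ramp1 d t * cexp (t * w) / (w * w))%C).
  assert (FTC := CInt_FTC An (fun t => ramp d t * cexp (t * w) - / (w * w) * (bump d t * cexp (t * w)))%C 0 T).
  assert (Cb : forall t, rcont (fun t => bump d t * cexp (t * w))%C t) by (intros; apply bump_transform_cont; auto).
  rewrite CInt_minus, CInt_scal in FTC; auto.
  2: intros; apply rcont_mult; auto; apply rcont_const.
  assert (Z2 : CInt (fun t => bump d t * cexp (t * w))%C 0 T = bump_transform d w).
  { rewrite <- (CInt_Chasles _ 0 d T) by auto. fold (bump_transform d w).
    rewrite (CInt_ext _ (fun _ => 0%C) d T). rewrite CInt_const. ring. rewrite Rmin_left by lra. intros; rewrite bump_right by lra. ring. }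
  rewrite Z2 in FTC.
  assert (A0 : An 0 = 0%C). { unfold An. rewrite ramp_left, ramp1_left by lra. field. auto. }
  rewrite A0 in FTC.
  assert (F2 : (CInt (fun t => ramp d t * cexp (t * w)) 0 T - bump_transform d w / (w * w) = An T)%C).
  { transitivity (CInt (fun t => ramp d t * cexp (t * w)) 0 T - / (w * w) * bump_transform d w)%C. field; auto.
    rewrite FTC. ring.
    - intros t.
      assert (D0 : forall c : C, rderiv (fun _ : R => c) t 0%C) by (intros; apply rderiv_intro; simpl; auto_derive; auto).
      assert (D1 := rderiv_mult _ _ t _ _ (rderiv_mult _ _ t _ _ (RC t) (rderiv_cexp_line w t)) (D0 (/ w)%C)).
      assert (D2 := rderiv_mult _ _ t _ _ (rderiv_mult _ _ t _ _ (RC1 t) (rderiv_cexp_line w t)) (D0 (/ (w * w))%C)).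
      eapply rderiv_eq; [|exact (rderiv_minus _ _ t _ _ D1 D2)].
      cbv beta. field. auto.
    - intros t. apply rcont_minus; auto. apply rcont_mult; auto. apply rcont_const. }
  rewrite F2. unfold An.
  eapply Rle_trans; [apply Cmod_minus_le|].
  assert (Hww : (w * w)%C <> 0%C) by (apply Cmult_neq_0; auto).
  rewrite !Cmod_div, !Cmod_mult by auto. rewrite Cmod_cexp, re_scal_l, Rw.
  replace (T * (- 2 * PI * Im z)) with (- (y * T)) by (unfold y; ring).
  assert (RB := ramp_bounds d Hd T ltac:(lra)). assert (RB1 := ramp1_bounds d Hd T).
  rewrite !Cmod_RtoC_nonneg by lra.
  destruct (Dec T ltac:(lra)) as [D1 D2]. assert (E0 := exp_pos (- (y * T))).
  assert (P1 : 0 < / Cmod w) by (apply Rinv_0_lt_compat; auto). assert (P2 : 0 < / (Cmod w * Cmod w)) by (apply Rinv_0_lt_compat; nra).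
  assert (Py : 0 < 4 / (y * y) / T) by (apply Rdiv_lt_0_compat; [apply Rdiv_lt_0_compat; nra|lra]).
  assert (/ T <= 1) by (rewrite <- Rinv_1; apply Rinv_le_contravar; lra).
  apply Rle_trans with (4 / (y * y) / T * / Cmod w + 4 / (y * y) / T * / (Cmod w * Cmod w)).
  - apply Rplus_le_compat.
    + apply Rmult_le_compat_r. lra. apply Rle_trans with (exp (- (y * T)) * T); auto. rewrite Rmult_comm. apply Rmult_le_compat_l; lra.
    + apply Rmult_le_compat_r. lra. apply Rle_trans with (1 * exp (- (y * T))). apply Rmult_le_compat_r; lra. nra.
  - replace (4 / (y * y) / T * / Cmod w + 4 / (y * y) / T * / (Cmod w * Cmod w)) with (K / T) by (unfold K; field; lra).
    apply (Rle_div_l K). lra. assert (HKT : K / eps <= T) by lra. apply (Rle_div_l K) in HKT; lra.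
Qed.

(** * Enumeration of Z *)

(** The order [0, 1, -1, 2, -2, ...]: the first [2 N + 1] indices are exactly those of the symmetric
    partial sum over [|n| <= N]. *)
Definition ix (k : nat) : Z := if Nat.even k then (- Z.of_nat (Nat.div2 k))%Z else Z.of_nat (Nat.div2 (S k)).
Definition rk (p : Z) : nat := if (p <=? 0)%Z then (2 * Z.to_nat (- p))%nat else (2 * Z.to_nat p - 1)%nat.

Lemma ix_even m : ix (2 * m) = (- Z.of_nat m)%Z.
Proof. unfold ix. rewrite Nat.even_mul. cbn [Nat.even orb]. rewrite Nat.div2_double. auto. Qed.

Lemma ix_odd m : ix (2 * m + 1) = Z.of_nat (S m).
Proof.
  unfold ix. rewrite Nat.even_add, Nat.even_mul. cbn [Nat.even orb Bool.eqb].
  replace (S (2 * m + 1)) with (2 * S m)%nat by lia. rewrite Nat.div2_double. auto.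
Qed.

Lemma ix_cases k : (exists m, k = (2 * m)%nat /\ ix k = (- Z.of_nat m)%Z) \/ (exists m, k = (2 * m + 1)%nat /\ ix k = Z.of_nat (S m)).
Proof.
  destruct (Nat.Even_or_Odd k) as [[m ->] | [m ->]].
  - left. exists m. split; auto. apply ix_even.
  - right. exists m. split; auto. apply ix_odd.
Qed.

Lemma ix_rk p : ix (rk p) = p.
Proof.
  unfold rk. destruct (Z.leb_spec p 0).
  - rewrite ix_even. lia.
  - replace (2 * Z.to_nat p - 1)%nat with (2 * (Z.to_nat p - 1) + 1)%nat by lia. rewrite ix_odd. lia.
Qed.

Lemma rk_ix k : rk (ix k) = k.
Proof.
  destruct (ix_cases k) as [[m [-> ->]] | [m [-> ->]]]; unfold rk.
  - destruct (Z.leb_spec (- Z.of_nat m) 0); lia.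
  - destruct (Z.leb_spec (Z.of_nat (S m)) 0); lia.
Qed.

Lemma psum_Zsym (u : Z -> C) N : psum (Zsym u) (S N) = psum (fun k => u (ix k)) (2 * N + 1).
Proof.
  induction N as [|N IH].
  - simpl. reflexivity.
  - change (psum (Zsym u) (S (S N))) with (psum (Zsym u) (S N) + Zsym u (S N))%C. rewrite IH.
    replace (2 * S N + 1)%nat with (S (S (2 * N + 1))) by lia.
    change (psum (fun k => u (ix k)) (S (S (2 * N + 1)))) with
      (psum (fun k => u (ix k)) (2 * N + 1) + u (ix (2 * N + 1)) + u (ix (S (2 * N + 1))))%C.
    rewrite ix_odd. replace (S (2 * N + 1)) with (2 * S N)%nat by lia. rewrite ix_even.
    unfold Zsym. ring.
Qed.

Lemma Zsym_Clim (u : Z -> C) s :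
  is_series (K := R_AbsRing) (V := C_R_NormedModule) (Zsym u) s -> Clim (fun N => psum (fun k => u (ix k)) (2 * N + 1)) s.
Proof.
  rewrite is_series_Clim. intros H eps He. destruct (H eps He) as [N HN]. exists N. intros n Hn. rewrite <- psum_Zsym. apply HN. lia.
Qed.

Lemma rsum_single (p : Z) n : (rk p < n)%nat -> rsum (fun k => if Z.eq_dec (ix k) p then 1 else 0) n = 1.
Proof.
  assert (Z0 : forall n, (n <= rk p)%nat -> rsum (fun k => if Z.eq_dec (ix k) p then 1 else 0) n = 0).
  { induction n0; intros Hn; simpl; auto. rewrite IHn0 by lia. destruct (Z.eq_dec (ix n0) p) as [E | E]; [|lra].
    rewrite <- E, rk_ix in Hn. lia. }
  induction n; intros Hn. lia. simpl.
  destruct (Nat.eq_dec (rk p) n) as [<- | Hne].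
  - rewrite Z0 by lia. rewrite ix_rk. destruct (Z.eq_dec p p); [lra|congruence].
  - rewrite IHn by lia. destruct (Z.eq_dec (ix n) p) as [E | E]; [|lra]. rewrite <- E, rk_ix in Hne. congruence.
Qed.

Lemma rsum_ext u v n : (forall k, u k = v k) -> rsum u n = rsum v n.
Proof. intros H. induction n; simpl; auto. rewrite IHn, H; auto. Qed.

Lemma rsum_plus u v n : rsum (fun k => u k + v k) n = rsum u n + rsum v n.
Proof. induction n; simpl. ring. rewrite IHn. ring. Qed.

Lemma rsum_scal c u n : rsum (fun k => c * u k) n = c * rsum u n.
Proof. induction n; simpl. ring. rewrite IHn. ring. Qed.

Definition zrange (j m p : Z) : R := if Z_le_dec j p then if Z_lt_dec p m then 1 else 0 else 0.

Lemma rsum_zrange (j : Z) (K : nat) : exists N, forall n, (N <= n)%nat -> rsum (fun k => zrange j (j + Z.of_nat K) (ix k)) n = INR K.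
Proof.
  induction K as [|K [N HN]].
  - exists 0%nat. intros n _. rewrite (rsum_ext _ (fun _ => 0 * 0)). rewrite rsum_scal. simpl; ring.
    intros k. unfold zrange. destruct (Z_le_dec j (ix k)); try lra. destruct (Z_lt_dec (ix k) (j + Z.of_nat 0)); try lra. lia.
  - exists (N + S (rk (j + Z.of_nat K)))%nat. intros n Hn.
    rewrite (rsum_ext _ (fun k => zrange j (j + Z.of_nat K) (ix k) + (if Z.eq_dec (ix k) (j + Z.of_nat K) then 1 else 0))).
    + rewrite rsum_plus, HN, rsum_single by lia. rewrite S_INR. auto.
    + intros k. unfold zrange. destruct (Z_le_dec j (ix k)); destruct (Z_lt_dec (ix k) (j + Z.of_nat K));
      destruct (Z_lt_dec (ix k) (j + Z.of_nat (S K))); destruct (Z.eq_dec (ix k) (j + Z.of_nat K)); try lra; try lia.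
Qed.

(** * The density of the zeros *)

Section Quasicrystal.
Variables (a : Z -> R) (gam : nat -> R) (b : nat -> C).
Hypothesis Ha_mono : forall n : Z, a n <= a (n + 1)%Z.
Hypothesis Ha0 : forall n : Z, a n <> 0.
Hypothesis Hmuhat : tempered_B gam b.
Hypothesis HF : fourier_pair a gam b.

Definition al (k : nat) : R := a (ix k).

Lemma a_mono m n : (m <= n)%Z -> a m <= a n.
Proof.
  intros H. replace n with (m + Z.of_nat (Z.to_nat (n - m)))%Z by lia.
  induction (Z.to_nat (n - m)) as [|q IH]. rewrite Z.add_0_r. lra.
  eapply Rle_trans; [apply IH|]. replace (m + Z.of_nat (S q))%Z with (m + Z.of_nat q + 1)%Z by lia. apply Ha_mono.
Qed.

Lemma tempered_sum (w : R -> R) : (forall N : nat, exists M, forall t, 0 <= w t /\ w t * (1 + Rabs t) ^ N <= M) ->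
  ex_series (fun k => Cmod (b k) * w (gam k)).
Proof.
  intros Hw. destruct Hmuhat as [N HN]. destruct (Hw N) as [M HM].
  apply (ex_series_dom (fun k => M * (Cmod (b k) / (1 + Rabs (gam k)) ^ N))).
  - intros k. destruct (HM (gam k)) as [H1 H2]. assert (Pb := Cmod_ge_0 (b k)).
    assert (P : 0 < (1 + Rabs (gam k)) ^ N) by (apply pow_lt; generalize (Rabs_pos (gam k)); lra).
    split. apply Rmult_le_pos; auto.
    replace (M * (Cmod (b k) / (1 + Rabs (gam k)) ^ N)) with (Cmod (b k) * (M / (1 + Rabs (gam k)) ^ N)) by (field; lra).
    apply Rmult_le_compat_l; auto. apply Rle_div_r; auto.
  - apply ex_series_scal_R. auto.
Qed.

Lemma gauss_weight (N : nat) : exists M, forall t, 0 <= gauss t /\ gauss t * (1 + Rabs t) ^ N <= M.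
Proof.
  exists (INR N ^ N * exp 2). intros t. split. left; apply exp_pos.
  assert (H := pow_le_exp N (1 + Rabs t) ltac:(generalize (Rabs_pos t); lra)).
  apply Rle_trans with (gauss t * (INR N ^ N * exp (1 + Rabs t))). apply Rmult_le_compat_l; auto. left; apply exp_pos.
  replace (gauss t * (INR N ^ N * exp (1 + Rabs t))) with (INR N ^ N * (gauss t * exp (1 + Rabs t))) by ring.
  apply Rmult_le_compat_l. apply pow_le, pos_INR. unfold gauss. rewrite <- exp_plus. apply exp_le.
  assert (t * t = Rabs t * Rabs t) by (rewrite <- Rabs_mult, Rabs_pos_eq; auto; apply Rle_0_sqr). rewrite H0.
  generalize (sub_PI_sq_le_1 (Rabs t)). lra.
Qed.

(** On the zero side [gauss_wave x] gives a Gaussian centred at [x]; on the spectral side [x] only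
    enters through phases, so [sum |b_k| gauss (gam k)] is a bound independent of [x]. *)
Lemma gauss_sum_bound : exists B, 0 < B /\ forall x n, rsum (fun k => gauss (al k - x)) n <= B.
Proof.
  destruct gauss_wave_fourier as [c [Hc Hf]].
  assert (HS := tempered_sum gauss gauss_weight).
  set (B0 := Series (fun k => Cmod (b k) * gauss (gam k))).
  exists (B0 / c + 1).
  assert (X : forall x n, rsum (fun k => gauss (al k - x)) n <= B0 / c).
  { intros x n. destruct (HF (gauss_wave x) (gauss_wave_schwartz x)) as [s [H1 H2]].
    apply Zsym_Clim in H1. apply is_series_Clim in H2.
    assert (Dom : forall k, Cmod (b k * gauss_wave x (gam k))%C <= Cmod (b k) * gauss (gam k)).
    { intros k. rewrite Cmod_mult. unfold gauss_wave. rewrite Cmod_mult, Cmod_cexp. simpl. rewrite exp_0, Rmult_1_r, Cmod_RtoC_nonneg by (left; apply exp_pos). lra. }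
    assert (Hs : Cmod s <= B0). { rewrite <- (Clim_Csum _ _ H2). apply Csum_le; auto. }
    assert (E : forall n, psum (fun k => fourier (gauss_wave x) (a (ix k))) n = RtoC (c * rsum (fun k => gauss (al k - x)) n)).
    { induction n0; simpl. rewrite Rmult_0_r; auto. rewrite IHn0, Hf, <- RtoC_plus. f_equal. unfold al. ring. }
    apply Rle_div_r; auto. rewrite Rmult_comm.
    apply le_epsilon. intros eps He. destruct (H1 eps He) as [N HN]. specialize (HN (n + N)%nat ltac:(lia)).
    rewrite E in HN.
    set (q := (2 * (n + N) + 1)%nat) in *.
    assert (I : rsum (fun k => gauss (al k - x)) n <= rsum (fun k => gauss (al k - x)) q).
    { apply rsum_incr. intros; left; apply exp_pos. unfold q; lia. }
    assert (T := Cmod_triangle_sub (RtoC (c * rsum (fun k => gauss (al k - x)) q)) s). rewrite Cmod_R in T.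
    assert (R := Rle_abs (c * rsum (fun k => gauss (al k - x)) q)).
    assert (c * rsum (fun k => gauss (al k - x)) n <= c * rsum (fun k => gauss (al k - x)) q) by (apply Rmult_le_compat_l; lra). lra. }
  assert (0 <= B0 / c) by (apply (X 0 0%nat)).
  split. lra. intros. specialize (X x n). lra.
Qed.

(** Zeros within distance [1] of [a j] contribute at least [exp (- pi)] each to the Gaussian sum
    centred at [a j], so fewer than [K] of them fit. *)
Lemma spacing : exists K : nat, (0 < K)%nat /\ forall j, a j + 1 <= a (j + Z.of_nat K)%Z.
Proof.
  destruct gauss_sum_bound as [B [HB H]].
  assert (P := exp_pos (- PI)).
  destruct (INR_unbounded (B / exp (- PI))) as [K HK].
  assert (HK0 : 0 < B / exp (- PI)) by (apply Rdiv_lt_0_compat; auto).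
  exists K. split. { apply INR_lt. simpl. lra. }
  intros j. apply Rnot_lt_le. intros Hlt.
  destruct (rsum_zrange j K) as [N HN]. specialize (HN N (le_n N)). specialize (H (a j) N).
  assert (exp (- PI) * rsum (fun k => zrange j (j + Z.of_nat K) (ix k)) N <= rsum (fun k => gauss (al k - a j)) N).
  { rewrite <- rsum_scal. apply rsum_le. intros k. unfold zrange.
    assert (0 <= gauss (al k - a j)) by (left; apply exp_pos).
    destruct (Z_le_dec j (ix k)); [|lra]. destruct (Z_lt_dec (ix k) (j + Z.of_nat K)); [|lra].
    rewrite Rmult_1_r. unfold gauss. apply exp_le. unfold al.
    assert (a j <= a (ix k)) by (apply a_mono; lia). assert (a (ix k) <= a (j + Z.of_nat K)%Z) by (apply a_mono; lia).
    assert (0 <= (a (ix k) - a j) * (a (ix k) - a j) <= 1) by nra. assert (P2 := PI2_1). nra. }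
  rewrite HN in H0. assert (B < INR K * exp (- PI)) by (apply (Rlt_div_l B); auto). lra.
Qed.

(** Iterating [spacing] to both sides gives linear growth of [|a_n|]. The finitely many remaining
    indices are covered by a minimum, which is positive because no zero is at the origin. *)
Lemma al_lower : exists c, 0 < c /\ forall k, c * (1 + INR k) <= Rabs (al k).
Proof.
  destruct spacing as [K [HK Hsp]].
  assert (PK : 0 < INR K) by (apply lt_0_INR; auto).
  assert (It : forall j m, a j + INR m <= a (j + Z.of_nat (K * m))%Z).
  { intros j m. induction m. rewrite Nat.mul_0_r, Z.add_0_r. simpl; lra.
    rewrite S_INR. replace (j + Z.of_nat (K * S m))%Z with (j + Z.of_nat (K * m) + Z.of_nat K)%Z by lia.
    specialize (Hsp (j + Z.of_nat (K * m))%Z). lra. }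
  assert (Up : forall n : nat, a 0%Z + INR n / INR K - 1 <= a (Z.of_nat n)).
  { intros n. assert (D := Nat.div_mod_eq n K). assert (R := Nat.mod_upper_bound n K ltac:(lia)).
    specialize (It 0%Z (n / K)%nat). eapply Rle_trans; [|apply (a_mono (0 + Z.of_nat (K * (n / K)))); lia].
    eapply Rle_trans; [|apply It]. apply Rplus_le_reg_r with (1 - a 0%Z).
    replace (a 0%Z + INR n / INR K - 1 + (1 - a 0%Z)) with (INR n / INR K) by ring.
    apply (Rle_div_l (INR n)); auto. replace (a 0%Z + INR (n / K) + (1 - a 0%Z)) with (INR (n / K) + 1) by ring.
    rewrite <- S_INR, <- mult_INR. apply le_INR. lia. }
  assert (Dn : forall n : nat, a (- Z.of_nat n)%Z <= a 0%Z - INR n / INR K + 1).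
  { intros n. assert (D := Nat.div_mod_eq n K). assert (R := Nat.mod_upper_bound n K ltac:(lia)).
    specialize (It (- Z.of_nat n)%Z (n / K)%nat).
    assert (a (- Z.of_nat n + Z.of_nat (K * (n / K)))%Z <= a 0%Z) by (apply a_mono; lia).
    assert (INR n / INR K <= INR (n / K) + 1).
    { apply (Rle_div_l (INR n)); auto. rewrite <- S_INR, <- mult_INR. apply le_INR. lia. } lra. }
  assert (L : forall k, INR k / (2 * INR K) - (1 + Rabs (a 0%Z)) <= Rabs (al k)).
  { intros k. unfold al. assert (A1 := Rle_abs (a 0%Z)). assert (A2 := Rle_abs (- a 0%Z)). rewrite Rabs_Ropp in A2.
    assert (Q : forall x, INR k <= 2 * x -> INR k / (2 * INR K) <= x / INR K).
    { intros x Hx. apply (Rle_div_l (INR k)). lra. replace (x / INR K * (2 * INR K)) with (2 * x) by (field; lra). auto. }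
    destruct (ix_cases k) as [[m [Ek Ei]] | [m [Ek Ei]]].
    - rewrite Ei. specialize (Dn m). assert (Hk : INR k <= 2 * INR m) by (rewrite Ek, mult_INR; simpl; lra).
      specialize (Q (INR m) Hk). assert (A3 := Rle_abs (- a (- Z.of_nat m)%Z)). rewrite Rabs_Ropp in A3. lra.
    - rewrite Ei. specialize (Up (S m)). assert (Hk : INR k <= 2 * INR (S m)) by (rewrite Ek, plus_INR, mult_INR, (S_INR m); simpl; lra).
      specialize (Q (INR (S m)) Hk). assert (A3 := Rle_abs (a (Z.of_nat (S m)))). lra. }
  assert (Fin : forall n : nat, exists c, 0 < c /\ forall k, (k < n)%nat -> c <= Rabs (al k)).
  { induction n as [|n [c [Hc H]]]. exists 1. split. lra. lia.
    exists (Rmin c (Rabs (al n))). split. apply Rmin_pos; auto. apply Rabs_pos_lt, Ha0.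
    intros k Hk. destruct (Nat.eq_dec k n) as [-> | Hn]. apply Rmin_r. eapply Rle_trans; [apply Rmin_l|]. apply H; lia. }
  set (C1 := 1 + Rabs (a 0%Z)). assert (1 <= C1) by (unfold C1; generalize (Rabs_pos (a 0%Z)); lra).
  destruct (INR_unbounded (4 * INR K * C1)) as [N HN].
  destruct (Fin N) as [c [Hc HcN]].
  assert (P8 : 0 < / (8 * INR K)) by (apply Rinv_0_lt_compat; lra).
  assert (PN : 0 < 1 + INR N) by (generalize (pos_INR N); lra).
  exists (Rmin (/ (8 * INR K)) (c / (1 + INR N))).
  split. { apply Rmin_pos; auto. apply Rdiv_lt_0_compat; lra. }
  intros k. assert (Pk := pos_INR k). destruct (Nat.lt_ge_cases k N) as [Hk | Hk].
  - apply Rle_trans with (c / (1 + INR N) * (1 + INR k)). apply Rmult_le_compat_r. lra. apply Rmin_r.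
    apply Rle_trans with c; auto. apply lt_INR in Hk. apply Rle_trans with (c / (1 + INR N) * (1 + INR N)).
    apply Rmult_le_compat_l. left; apply Rdiv_lt_0_compat; lra. lra. right; field; lra.
  - apply Rle_trans with (/ (8 * INR K) * (1 + INR k)). apply Rmult_le_compat_r. lra. apply Rmin_l.
    eapply Rle_trans; [|apply L]. fold C1. apply le_INR in Hk.
    assert (1 <= INR K) by (apply (le_INR 1); lia).
    assert (4 * INR K <= INR k) by nra.
    assert (C1 <= INR k / (4 * INR K)). { apply (Rle_div_r C1); lra. }
    assert (/ (8 * INR K) * (1 + INR k) <= INR k / (4 * INR K)).
    { replace (INR k / (4 * INR K)) with (/ (8 * INR K) * (2 * INR k)) by (field; lra). apply Rmult_le_compat_l; lra. }
    replace (INR k / (2 * INR K)) with (INR k / (4 * INR K) + INR k / (4 * INR K)) by (field; lra). lra.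
Qed.

Lemma al_neq_0 k : al k <> 0.
Proof. apply Ha0. Qed.

Lemma ex_series_inv_al_sq : ex_series (fun k => / (al k * al k)).
Proof.
  destruct al_lower as [c [Hc H]].
  apply (ex_series_dom (fun k => / (c * c) * / ((1 + INR k) * (1 + INR k)))).
  2: apply ex_series_scal_R, ex_series_inv_sq.
  intros k. specialize (H k). assert (Pk := pos_INR k). assert (Ha := al_neq_0 k).
  assert (Psq : 0 < al k * al k) by (apply Rsqr_pos_lt; auto).
  split. left; apply Rinv_0_lt_compat; auto.
  rewrite <- Rinv_mult. apply Rinv_le_contravar.
  - repeat apply Rmult_lt_0_compat; lra.
  - replace (al k * al k) with (Rabs (al k) * Rabs (al k)) by (rewrite <- Rabs_mult, Rabs_pos_eq; lra).
    replace (c * c * ((1 + INR k) * (1 + INR k))) with ((c * (1 + INR k)) * (c * (1 + INR k))) by ring.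
    apply Rmult_le_compat; auto; apply Rmult_le_pos; lra.
Qed.

(** * The exponential sums attached to the positive part of the spectrum *)

(** Outside the positive spectrum the coefficient is [0] and the frequency is set to [1],
    so that dividing by [gp] is always meaningful. *)
Definition bp (k : nat) : C := if Rlt_dec 0 (gam k) then b k else 0%C.
Definition gp (k : nat) : R := if Rlt_dec 0 (gam k) then gam k else 1.

Lemma gp_pos k : 0 < gp k.
Proof. unfold gp. destruct (Rlt_dec 0 (gam k)); lra. Qed.

Definition wave (g : R) (z : C) : C := cexp (g * (2 * PI * Ci * z)).

Lemma Cmod_wave g z : Cmod (wave g z) = exp (- (2 * PI * Im z) * g).
Proof. unfold wave. rewrite Cmod_cexp, re_scal_l, freq_Re. f_equal. ring. Qed.

Lemma wave_add g z h : wave g (z + h) = (wave g z * wave g h)%C.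
Proof. unfold wave. rewrite <- cexp_plus. f_equal. ring. Qed.

Lemma wave_deriv g z : cderiv (wave g) z (2 * PI * Ci * g * wave g z)%C.
Proof.
  unfold wave. eapply cderiv_eq; [|apply (cderiv_comp cexp (fun z => g * (2 * PI * Ci * z))%C); [apply cderiv_cexp|]].
  2: apply cderiv_scal, cderiv_scal, cderiv_id. cbv beta. ring.
Qed.

(** At positive height the exponential beats both the polynomial growth allowed by temperedness and
    the power [gp k ^ j]; the powers [j <= 2] occur in derivatives and Taylor remainders. *)
Lemma spectral_weight (y : R) (j : nat) : 0 < y -> ex_series (fun k => Cmod (bp k) * (gp k ^ j * exp (- (2 * PI * y) * gp k))).
Proof.
  intros Hy. assert (P := PI2_1). set (c := 2 * PI * y). assert (Hc : 0 < c) by (unfold c; nra).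
  set (w := fun t => if Rlt_dec 0 t then t ^ j * exp (- c * t) else 0).
  apply (ex_series_ext (fun k => Cmod (b k) * w (gam k))).
  { intros k. unfold w, bp, gp. destruct (Rlt_dec 0 (gam k)). reflexivity. rewrite Cmod_0, Rmult_0_l, Rmult_0_r. reflexivity. }
  apply tempered_sum. intros N. unfold w.
  exists (INR (N + j) ^ (N + j) * (/ c) ^ (N + j) * exp c). intros t. destruct (Rlt_dec 0 t) as [Ht | Ht].
  - assert (E := exp_pos (- c * t)). split. apply Rmult_le_pos. apply pow_le; lra. lra.
    rewrite (Rabs_pos_eq t) by lra.
    assert (X := pow_le_exp (N + j) (c * (1 + t)) ltac:(nra)). rewrite Rpow_mult_distr in X.
    assert (Y : (1 + t) ^ (N + j) <= INR (N + j) ^ (N + j) * (/ c) ^ (N + j) * exp (c * (1 + t))).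
    { apply Rmult_le_reg_l with (c ^ (N + j)). apply pow_lt; auto. eapply Rle_trans; [apply X|]. right.
      assert (Z : c ^ (N + j) * (/ c) ^ (N + j) = 1) by (rewrite <- Rpow_mult_distr, Rinv_r by lra; apply pow1).
      replace (c ^ (N + j) * (INR (N + j) ^ (N + j) * (/ c) ^ (N + j) * exp (c * (1 + t)))) with
       (c ^ (N + j) * (/ c) ^ (N + j) * (INR (N + j) ^ (N + j) * exp (c * (1 + t)))) by ring. rewrite Z. ring. }
    apply Rle_trans with ((1 + t) ^ (N + j) * exp (- c * t)).
    + rewrite pow_add. assert (t ^ j <= (1 + t) ^ j) by (apply pow_incr; lra). assert (0 <= (1 + t) ^ N) by (apply pow_le; lra).
      replace (t ^ j * exp (- c * t) * (1 + t) ^ N) with ((1 + t) ^ N * t ^ j * exp (- c * t)) by ring.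
      apply Rmult_le_compat_r. lra. apply Rmult_le_compat_l; auto.
    + apply Rle_trans with (INR (N + j) ^ (N + j) * (/ c) ^ (N + j) * exp (c * (1 + t)) * exp (- c * t)).
      apply Rmult_le_compat_r; lra. rewrite Rmult_assoc, <- exp_plus. right. f_equal. f_equal. ring.
  - split. lra. rewrite Rmult_0_l. repeat apply Rmult_le_pos; try (apply pow_le, pos_INR). apply pow_le. left; apply Rinv_0_lt_compat; auto. left; apply exp_pos.
Qed.

(** * The sum of double poles as an exponential sum *)

(** Combines [|z - x| >= Im z] with [|z - x| >= |x| - |z|]. The distance to a zero is thus
    comparable with the zero itself, which transfers the summability of [1 / a_n^2] to the poles. *)
Lemma dist_real_lower (z : C) (x : R) : 0 < Im z -> Rabs x * (Im z / (Im z + Cmod z)) <= Cmod (z - x).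
Proof.
  intros Hy. assert (Pz := Cmod_ge_0 z).
  assert (H1 : Im z <= Cmod (z - x)). { eapply Rle_trans; [|apply Im_le_Cmod]. unfold Cminus. rewrite im_plus, im_opp, im_RtoC. rewrite Ropp_0, Rplus_0_r. apply Rle_abs. }
  assert (H2 : Rabs x <= Cmod (z - x) + Cmod z).
  { rewrite <- Cmod_R. generalize (Cmod_triangle_sub (RtoC x) z). rewrite (Cmod_sub_sym x z). lra. }
  replace (Rabs x * (Im z / (Im z + Cmod z))) with (Rabs x * Im z / (Im z + Cmod z)) by (field; lra).
  apply (Rle_div_l (Rabs x * Im z)). lra. nra.
Qed.

Lemma Im_sub_real (z : C) (x : R) : Im (z - x)%C = Im z.
Proof. unfold Cminus. rewrite im_plus, im_opp, im_RtoC. ring. Qed.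

Lemma sub_real_neq_0 (z : C) (x : R) : 0 < Im z -> (z - x)%C <> 0%C.
Proof. intros Hy E. assert (H := Im_sub_real z x). rewrite E in H. simpl in H. lra. Qed.

Lemma two_PI_Ci_neq_0 : (2 * PI * Ci)%C <> 0%C.
Proof. apply Cmult_neq_0. apply two_PI_neq_0. apply Ci_nz. Qed.

Lemma Cmod_freq (z : C) : Cmod (2 * PI * Ci * z) = 2 * PI * Cmod z.
Proof. rewrite !Cmod_mult, Cmod_Ci. rewrite !Cmod_RtoC_nonneg by (generalize PI_RGT_0; lra). ring. Qed.

Lemma inv_sq_dist_bound (z : C) : 0 < Im z -> exists K, 0 <= K /\ forall k, / (Cmod (z - al k) * Cmod (z - al k)) <= K * / (al k * al k).
Proof.
  intros Hz. set (q := Im z / (Im z + Cmod z)).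
  assert (Hq : 0 < q) by (apply Rdiv_lt_0_compat; auto; generalize (Cmod_ge_0 z); lra).
  exists (/ (q * q)). split. left; apply Rinv_0_lt_compat; nra.
  intros k. rewrite <- Rinv_mult. assert (Ha := Rabs_pos_lt _ (al_neq_0 k)). assert (D := dist_real_lower z (al k) Hz). fold q in D. clearbody q.
  replace (al k * al k) with (Rabs (al k) * Rabs (al k)) by (rewrite <- Rabs_mult, Rabs_pos_eq; auto; apply Rle_0_sqr).
  apply Rinv_le_contravar. repeat apply Rmult_lt_0_compat; auto.
  replace (q * q * (Rabs (al k) * Rabs (al k))) with ((Rabs (al k) * q) * (Rabs (al k) * q)) by ring.
  apply Rmult_le_compat; auto; apply Rmult_le_pos; lra.
Qed.

(** Both sides are dominated uniformly in the smoothing [d]: the pole terms because [bump_transform]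
    is at most [1] in modulus, the spectral terms because [ramp d t <= t]. Frequencies that are not
    positive drop out, since [ramp d] vanishes there. *)
Lemma pole_sum_formula (z : C) : 0 < Im z ->
  Csum (fun k => / ((z - al k) * (z - al k)))%C = (- (4 * PI * PI) * Csum (fun k => bp k * (gp k * wave (gp k) z)))%C.
Proof.
  intros Hz. assert (P := PI2_1).
  destruct (inv_sq_dist_bound z Hz) as [K [HK HKb]].
  set (w := fun k => (2 * PI * Ci * (z - al k))%C).
  assert (Hw : forall k, w k <> 0%C) by (intros; apply Cmult_neq_0; [apply two_PI_Ci_neq_0|apply sub_real_neq_0; auto]).
  assert (Cw : forall k, Cmod (w k) = 2 * PI * Cmod (z - al k)) by (intros; apply Cmod_freq).
  assert (Rw : forall k, Re (w k) <= 0). { intros k. unfold w. rewrite freq_Re, Im_sub_real. nra. }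
  assert (Pd : forall k, 0 < Cmod (z - al k)) by (intros; apply Cmod_gt_0, sub_real_neq_0; auto).
  set (M := fun k => K * / (al k * al k)).
  assert (HM : ex_series M) by (apply ex_series_scal_R, ex_series_inv_al_sq).
  assert (Bw : forall k, / (Cmod (w k) * Cmod (w k)) <= M k).
  { intros k. eapply Rle_trans; [|apply HKb]. rewrite Cw. specialize (Pd k). apply Rinv_le_contravar. nra.
    apply Rmult_le_compat; nra. }
  set (M2 := fun k => Cmod (bp k) * (gp k ^ 1 * exp (- (2 * PI * Im z) * gp k))).
  assert (HM2 : ex_series M2) by (apply spectral_weight; auto).
  set (uL := fun d k => (bump_transform d (w k) / (w k * w k))%C).
  set (uR := fun d k => (b k * ramp_wave d z (gam k))%C).
  assert (BL : forall d k, 0 < d -> Cmod (uL d k) <= M k).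
  { intros d k Hd. eapply Rle_trans; [|apply Bw]. unfold uL. rewrite Cmod_div, Cmod_mult by (apply Cmult_neq_0; auto).
    unfold Rdiv. rewrite <- (Rmult_1_l (/ _)) at 2. apply Rmult_le_compat_r.
    left; apply Rinv_0_lt_compat. assert (0 < Cmod (w k)) by (apply Cmod_gt_0; auto). nra.
    apply bump_transform_le1; auto. }
  assert (BR : forall d k, 0 < d -> Cmod (uR d k) <= M2 k).
  { intros d k Hd. unfold uR, M2, bp, gp, ramp_wave. destruct (Rlt_dec 0 (gam k)) as [Hg | Hg].
    - rewrite !Cmod_mult. apply Rmult_le_compat_l. apply Cmod_ge_0.
      fold (wave (gam k) z). rewrite Cmod_wave. apply Rmult_le_compat_r. left; apply exp_pos. rewrite pow_1.
      destruct (ramp_bounds d Hd (gam k)) as [_ HH]. lra. rewrite Cmod_RtoC_nonneg; auto.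
      apply RInt_ge_0. lra. apply ex_RInt_cont, ramp1_cont; auto. intros; apply ramp1_bounds; auto.
    - rewrite ramp_left by (auto; lra). rewrite Cmult_0_l, Cmult_0_r, Cmod_0. lra. }
  assert (Eq : forall d, 0 < d -> Csum (uL d) = Csum (uR d)).
  { intros d Hd. destruct (HF (ramp_wave d z) (ramp_wave_schwartz d z Hd Hz)) as [s [H1 H2]].
    apply Zsym_Clim in H1. apply is_series_Clim in H2. rewrite (Clim_Csum (uR d) s H2).
    assert (L := Csum_lim (uL d) M (fun k => BL d k Hd) HM).
    (* The Fourier pair provides convergence of symmetric partial sums; they form a subsequence of
       the partial sums in the enumeration [ix], which converge absolutely. *)
    apply (Clim_unique (fun N => psum (uL d) (2 * N + 1))). apply (Clim_subseq (psum (uL d))); auto. intros; lia.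
    apply Clim_ext with (2 := H1). intros n. apply psum_ext. intros k. unfold uL, w. apply ramp_wave_fourier; auto. }
  set (lR := fun k => (bp k * (gp k * wave (gp k) z))%C).
  assert (El : Csum (fun k => / (w k * w k))%C = Csum lR).
  { apply (Ceq_of_small _ _ 2). intros eps He.
    destruct (Csum_tannery uL (fun k => / (w k * w k))%C M HM BL) with (eps := eps) as [d1 [D1 H1]]; auto.
    { intros k. rewrite Cmod_inv, Cmod_mult by (apply Cmult_neq_0; auto). apply Bw. }
    { intros k e Hee. unfold uL. assert (Pw : 0 < Cmod (w k)) by (apply Cmod_gt_0; auto).
      set (Q := Cmod (w k) * exp (Cmod (w k)) / (Cmod (w k) * Cmod (w k))).
      assert (HQ : 0 < Q). { apply Rdiv_lt_0_compat. apply Rmult_lt_0_compat; auto. apply exp_pos. nra. }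
      exists (Rmin 1 (e / Q)). split. apply Rmin_pos. lra. apply Rdiv_lt_0_compat; auto.
      intros d Hd. generalize (Rmin_l 1 (e / Q)) (Rmin_r 1 (e / Q)); intros.
      replace (bump_transform d (w k) / (w k * w k) - / (w k * w k))%C with ((bump_transform d (w k) - 1) / (w k * w k))%C by (field; auto).
      rewrite Cmod_div, Cmod_mult by (apply Cmult_neq_0; auto).
      apply Rle_trans with (d * Q).
      - unfold Q. replace (d * (Cmod (w k) * exp (Cmod (w k)) / (Cmod (w k) * Cmod (w k)))) with (d * Cmod (w k) * exp (Cmod (w k)) / (Cmod (w k) * Cmod (w k))) by (field; lra).
        apply Rmult_le_compat_r. left; apply Rinv_0_lt_compat; nra.
        eapply Rle_trans; [apply bump_transform_near1; lra|]. apply Rmult_le_compat_l. nra. apply exp_le. nra.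
      - apply Rle_trans with (e / Q * Q). apply Rmult_le_compat_r; lra. right; field; lra. }
    destruct (Csum_tannery uR lR M2 HM2 BR) with (eps := eps) as [d2 [D2 H2]]; auto.
    { intros k. unfold lR, M2. rewrite !Cmod_mult, Cmod_wave, pow_1, Cmod_RtoC_nonneg by (left; apply gp_pos). lra. }
    { intros k e Hee. unfold uR, lR, bp, gp, ramp_wave. destruct (Rlt_dec 0 (gam k)) as [Hg | Hg].
      - set (Q := Cmod (b k) * Cmod (wave (gam k) z) + 1).
        assert (HQ : 1 <= Q) by (unfold Q; generalize (Rmult_le_pos _ _ (Cmod_ge_0 (b k)) (Cmod_ge_0 (wave (gam k) z))); lra).
        exists (e / Q). split. apply Rdiv_lt_0_compat; lra. intros d Hd. fold (wave (gam k) z).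
        replace (b k * (ramp d (gam k) * wave (gam k) z) - b k * (gam k * wave (gam k) z))%C with
          (RtoC (ramp d (gam k) - gam k) * (b k * wave (gam k) z))%C by (rewrite RtoC_minus; ring).
        rewrite !Cmod_mult, Cmod_R. assert (RB := ramp_bounds d (proj1 Hd) (gam k) ltac:(lra)).
        apply Rle_trans with (d * Q).
        + apply Rmult_le_compat. apply Rabs_pos. apply Rmult_le_pos; apply Cmod_ge_0. apply Rabs_le; lra. unfold Q; lra.
        + apply Rle_trans with (e / Q * Q). apply Rmult_le_compat_r; lra. right; field; lra.
      - exists 1. split. lra. intros d Hd. rewrite ramp_left by lra.
        replace (b k * (0 * cexp (gam k * (2 * PI * Ci * z))) - 0 * (1 * wave 1 z))%C with (RtoC 0) by ring. rewrite Cmod_0. lra. }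
    set (d := Rmin d1 d2 / 2). assert (Hd : 0 < d < d1 /\ d < d2).
    { unfold d. generalize (Rmin_l d1 d2) (Rmin_r d1 d2) (Rmin_pos d1 d2 D1 D2). lra. }
    specialize (H1 d ltac:(lra)). specialize (H2 d ltac:(lra)). rewrite (Eq d) in H1 by lra.
    eapply Rle_trans; [apply (Cmod_triangle3 _ (Csum (uR d)))|]. rewrite Cmod_sub_sym. lra. }
  fold lR. rewrite <- El.
  rewrite <- (Csum_scal _ _ M); auto.
  - apply Csum_ext. intros k. unfold w.
    assert (I2 : (Ci * Ci = -(1))%C) by (apply C_ext; simpl; ring).
    assert (Hd := sub_real_neq_0 z (al k) Hz). assert (HP : RtoC PI <> 0%C) by (intros E; apply RtoC_inj in E; lra).
    replace (2 * PI * Ci * (z - al k) * (2 * PI * Ci * (z - al k)))%C with (4 * PI * PI * (Ci * Ci) * ((z - al k) * (z - al k)))%C by ring.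
    rewrite I2. field. split; auto.
  - intros k. rewrite Cmod_inv, Cmod_mult by (apply Cmult_neq_0; auto). apply Bw.
Qed.
End Quasicrystal.

(** * Estimates in half-planes *)

Lemma segment_bound_half_plane (f f' : C -> C) (y M : R) (z w : C) : 
  (forall u, y <= Im u -> cderiv f u (f' u)) -> (forall u, y <= Im u -> Cmod (f' u) <= M) ->
  y <= Im z -> y <= Im w -> Cmod (f w - f z) <= M * Cmod (w - z).
Proof.
  intros Hf HM Hz Hw.
  assert (I : forall t, 0 <= t <= 1 -> y <= Im (z + t * (w - z))%C).
  { intros t Ht. rewrite im_plus, im_scal_l. unfold Cminus. rewrite im_plus, im_opp. nra. }
  apply (segment_bound f f'); intros; auto.
Qed.

Lemma half_plane_const (f : C -> C) (z w : C) : (forall u, 0 < Im u -> cderiv f u 0) -> 0 < Im z -> 0 < Im w -> f z = f w.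
Proof.
  intros H Hz Hw. apply Ceq_minus, Cmod_eq_0, Rle_antisym; [|apply Cmod_ge_0].
  set (y := Rmin (Im z) (Im w)). assert (0 < y) by (apply Rmin_pos; auto).
  assert (B := segment_bound_half_plane f (fun _ => 0%C) y 0 w z). rewrite Rmult_0_l in B. apply B.
  intros; apply H; lra. intros; rewrite Cmod_0; lra. apply Rmin_r. apply Rmin_l.
Qed.

Lemma wave_lipschitz (g y : R) (z w : C) : 0 < g -> y <= Im z -> y <= Im w ->
  Cmod (wave g w - wave g z) <= 2 * PI * (g * exp (- (2 * PI * y) * g)) * Cmod (w - z).
Proof.
  intros Hg Hz Hw. assert (P := PI2_1).
  apply (segment_bound_half_plane (wave g) (fun z => 2 * PI * Ci * g * wave g z)%C y); auto.
  - intros; apply wave_deriv.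
  - intros u Hu. rewrite !Cmod_mult, Cmod_Ci, Cmod_wave, !Cmod_RtoC_nonneg by lra.
    replace (2 * PI * 1 * g * exp (- (2 * PI * Im u) * g)) with (2 * PI * (g * exp (- (2 * PI * Im u) * g))) by ring.
    apply Rmult_le_compat_l. lra. apply Rmult_le_compat_l. lra. apply exp_le. apply Rmult_le_compat_r. lra. nra.
Qed.

(** The factor [exp (2 pi g |h|)] of the Taylor remainder is paid for by lowering the height from
    [Im z] to [Im z - r]. *)
Lemma wave_quadratic (g r : R) (z h : C) : 0 < g -> Cmod h <= r ->
  Cmod (wave g (z + h) - wave g z - 2 * PI * Ci * g * wave g z * h)%C
    <= 4 * PI * PI * (g ^ 2 * exp (- (2 * PI * (Im z - r)) * g)) * (Cmod h * Cmod h).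
Proof.
  intros Hg Hh. assert (P := PI2_1). rewrite wave_add.
  replace (wave g z * wave g h - wave g z - 2 * PI * Ci * g * wave g z * h)%C with
    (wave g z * (wave g h - 1 - g * (2 * PI * Ci * h)))%C by ring.
  rewrite Cmod_mult, Cmod_wave. unfold wave.
  assert (B := cexp_bound2 (g * (2 * PI * Ci * h))%C).
  assert (E : Cmod (g * (2 * PI * Ci * h)) = 2 * PI * g * Cmod h).
  { rewrite Cmod_mult, Cmod_freq, Cmod_RtoC_nonneg by lra. ring. }
  rewrite E in B.
  apply Rle_trans with (exp (- (2 * PI * Im z) * g) * (2 * PI * g * Cmod h * (2 * PI * g * Cmod h) * exp (2 * PI * g * Cmod h))).
  apply Rmult_le_compat_l; auto. left; apply exp_pos.
  replace (exp (- (2 * PI * Im z) * g) * (2 * PI * g * Cmod h * (2 * PI * g * Cmod h) * exp (2 * PI * g * Cmod h)))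
    with (4 * PI * PI * (g ^ 2 * (exp (- (2 * PI * Im z) * g) * exp (2 * PI * g * Cmod h))) * (Cmod h * Cmod h)) by (simpl; ring).
  apply Rmult_le_compat_r. generalize (Cmod_ge_0 h); nra.
  apply Rmult_le_compat_l. nra. apply Rmult_le_compat_l. simpl; nra. rewrite <- exp_plus. apply exp_le.
  assert (0 <= 2 * PI * g) by nra. nra.
Qed.

(** * The sums [Ef] and [Gf] in the upper half-plane *)

Section ExponentialSums.
Variables (gam : nat -> R) (b : nat -> C).
Hypothesis Hmuhat : tempered_B gam b.

Local Notation Bp := (bp gam b).
Local Notation Gp := (gp gam).

Definition Ef (z : C) : C := Csum (fun k => Bp k * wave (Gp k) z)%C.
(** Subtracting the value at [Ci] makes the difference of waves of order [Gp k] for small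
    frequencies, which compensates the division by [Gp k] when the frequencies accumulate at [0]. *)
Definition Gf (z : C) : C := Csum (fun k => Bp k / Gp k * (wave (Gp k) z - wave (Gp k) Ci))%C.

Lemma Ef_term_bound y z k : y <= Im z -> Cmod (Bp k * wave (Gp k) z) <= Cmod (Bp k) * (Gp k ^ 0 * exp (- (2 * PI * y) * Gp k)).
Proof.
  intros Hy. assert (P := PI2_1). assert (Hg := gp_pos gam k).
  rewrite Cmod_mult, Cmod_wave, pow_O, Rmult_1_l. apply Rmult_le_compat_l. apply Cmod_ge_0.
  apply exp_le. apply Rmult_le_compat_r. lra. nra.
Qed.

Lemma Ef_bound y z : 0 < y -> y <= Im z -> Cmod (Ef z) <= Series (fun k => Cmod (Bp k) * (Gp k ^ 0 * exp (- (2 * PI * y) * Gp k))).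
Proof. intros Hy Hz. apply Csum_le. intros; apply Ef_term_bound; auto. apply spectral_weight; auto. Qed.

Lemma Gp_neq_0 k : RtoC (Gp k) <> 0%C.
Proof. intros E. apply RtoC_inj in E. generalize (gp_pos gam k). lra. Qed.

Lemma Gf_term_bound y z w k : 0 < y -> y <= Im z -> y <= Im w ->
  Cmod (Bp k / Gp k * (wave (Gp k) z - wave (Gp k) w)) <= 2 * PI * Cmod (z - w) * (Cmod (Bp k) * (Gp k ^ 0 * exp (- (2 * PI * y) * Gp k))).
Proof.
  intros Hy Hz Hw. assert (Hg := gp_pos gam k). assert (L := wave_lipschitz (Gp k) y w z Hg Hw Hz).
  rewrite Cmod_mult, Cmod_div by apply Gp_neq_0. rewrite (Cmod_RtoC_nonneg (Gp k)) by lra.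
  apply Rle_trans with (Cmod (Bp k) / Gp k * (2 * PI * (Gp k * exp (- (2 * PI * y) * Gp k)) * Cmod (z - w))).
  apply Rmult_le_compat_l; auto. apply Rmult_le_pos. apply Cmod_ge_0. left; apply Rinv_0_lt_compat; auto.
  right. simpl. field. lra.
Qed.

Lemma Ef_deriv z : 0 < Im z -> cderiv Ef z (Csum (fun k => Bp k * (2 * PI * Ci * Gp k * wave (Gp k) z))%C).
Proof.
  intros Hz. assert (P := PI2_1). set (r := Im z / 2). assert (Hr : 0 < r) by (unfold r; lra).
  apply (Csum_cderiv (fun k z => Bp k * wave (Gp k) z)%C _
    (fun k => Cmod (Bp k) * (Gp k ^ 0 * exp (- (2 * PI * r) * Gp k)))
    (fun k => 2 * PI * (Cmod (Bp k) * (Gp k ^ 1 * exp (- (2 * PI * Im z) * Gp k))))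
    (fun k => 4 * PI * PI * (Cmod (Bp k) * (Gp k ^ 2 * exp (- (2 * PI * r) * Gp k)))) z r Hr).
  - apply spectral_weight; auto.
  - apply ex_series_scal_R, spectral_weight; auto.
  - apply ex_series_scal_R, spectral_weight; auto.
  - intros k h Hh. apply Ef_term_bound. rewrite im_plus. generalize (Im_le_Cmod h). intros A1. apply Rabs_le_between in A1. unfold r in *; lra.
  - intros k. rewrite !Cmod_mult, Cmod_Ci, Cmod_wave, !Cmod_RtoC_nonneg by (try lra; left; apply gp_pos). rewrite pow_1. right; ring.
  - intros k h Hh. assert (Q := wave_quadratic (Gp k) r z h (gp_pos gam k) ltac:(lra)).
    replace (Im z - r) with r in Q by (unfold r; field).
    replace (Bp k * wave (Gp k) (z + h) - Bp k * wave (Gp k) z - Bp k * (2 * PI * Ci * Gp k * wave (Gp k) z) * h)%C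
      with (Bp k * (wave (Gp k) (z + h) - wave (Gp k) z - 2 * PI * Ci * Gp k * wave (Gp k) z * h))%C by ring.
    rewrite Cmod_mult. eapply Rle_trans. apply Rmult_le_compat_l; [apply Cmod_ge_0|apply Q]. right; ring.
Qed.

Lemma Gf_deriv z : 0 < Im z -> cderiv Gf z (2 * PI * Ci * Ef z)%C.
Proof.
  intros Hz. assert (P := PI2_1). set (r := Im z / 2). assert (Hr : 0 < r) by (unfold r; lra).
  set (y := Rmin r 1). assert (Hy : 0 < y) by (apply Rmin_pos; lra). assert (Hyr : y <= r) by apply Rmin_l. assert (Hy1 : y <= 1) by apply Rmin_r.
  unfold Ef. rewrite <- (Csum_scal _ _ (fun k => Cmod (Bp k) * (Gp k ^ 0 * exp (- (2 * PI * Im z) * Gp k)))).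
  2: intros; apply Ef_term_bound; lra. 2: apply spectral_weight; auto.
  apply (Csum_cderiv (fun k z => Bp k / Gp k * (wave (Gp k) z - wave (Gp k) Ci))%C _
    (fun k => 2 * PI * (Cmod z + r + 1) * (Cmod (Bp k) * (Gp k ^ 0 * exp (- (2 * PI * y) * Gp k))))
    (fun k => 2 * PI * (Cmod (Bp k) * (Gp k ^ 0 * exp (- (2 * PI * Im z) * Gp k))))
    (fun k => 4 * PI * PI * (Cmod (Bp k) * (Gp k ^ 1 * exp (- (2 * PI * r) * Gp k)))) z r Hr).
  - apply ex_series_scal_R, spectral_weight; auto.
  - apply ex_series_scal_R, spectral_weight; auto.
  - apply ex_series_scal_R, spectral_weight; auto.
  - intros k h Hh.
    assert (A1 : y <= Im (z + h)%C). { rewrite im_plus. generalize (Im_le_Cmod h). intros A1. apply Rabs_le_between in A1. unfold r in *; lra. }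
    assert (A2 : y <= Im Ci) by (simpl; lra).
    eapply Rle_trans; [apply (Gf_term_bound y); auto|].
    apply Rmult_le_compat_r. apply Rmult_le_pos. apply Cmod_ge_0. rewrite pow_O, Rmult_1_l. left; apply exp_pos.
    apply Rmult_le_compat_l. lra. eapply Rle_trans; [apply Cmod_minus_le|]. rewrite Cmod_Ci. generalize (Cmod_triangle z h). lra.
  - intros k. rewrite !Cmod_mult, Cmod_Ci, Cmod_wave, !Cmod_RtoC_nonneg by lra. rewrite pow_O. right; ring.
  - intros k h Hh. assert (Q := wave_quadratic (Gp k) r z h (gp_pos gam k) ltac:(lra)).
    replace (Im z - r) with r in Q by (unfold r; field).
    replace (Bp k / Gp k * (wave (Gp k) (z + h) - wave (Gp k) Ci) - Bp k / Gp k * (wave (Gp k) z - wave (Gp k) Ci) - 2 * PI * Ci * (Bp k * wave (Gp k) z) * h)%C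
      with (Bp k / Gp k * (wave (Gp k) (z + h) - wave (Gp k) z - 2 * PI * Ci * Gp k * wave (Gp k) z * h))%C by (field; apply Gp_neq_0).
    rewrite Cmod_mult, Cmod_div by apply Gp_neq_0. assert (Hg := gp_pos gam k). rewrite (Cmod_RtoC_nonneg (Gp k)) by lra.
    eapply Rle_trans. apply Rmult_le_compat_l; [|apply Q]. apply Rmult_le_pos. apply Cmod_ge_0. left; apply Rinv_0_lt_compat; auto.
    right; simpl; field. lra.
Qed.

Lemma Gf_Ci : Gf Ci = 0%C.
Proof.
  unfold Gf. apply Clim_Csum. apply (Clim_ext (fun _ => 0%C)); [|apply Clim_const].
  induction n; simpl. auto. rewrite <- IHn. ring.
Qed.

Lemma Gf_lipschitz (y : R) : 0 < y -> exists K, 0 <= K /\ forall z w, y <= Im z -> y <= Im w -> Cmod (Gf z - Gf w) <= K * Cmod (z - w).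
Proof.
  intros Hy. assert (P := PI2_1).
  exists (2 * PI * Series (fun k => Cmod (Bp k) * (Gp k ^ 0 * exp (- (2 * PI * y) * Gp k)))).
  split. { apply Rmult_le_pos. lra. eapply Rle_trans; [apply Cmod_ge_0|]. apply (Ef_bound y (0, y)); simpl; auto; lra. }
  intros z w Hz Hw. apply (segment_bound_half_plane Gf (fun z => 2 * PI * Ci * Ef z)%C y); auto.
  - intros; apply Gf_deriv; lra.
  - intros u Hu. rewrite Cmod_freq. apply Rmult_le_compat_l. lra. apply Ef_bound; auto.
Qed.

(** All frequencies of the almost periodic function [G'] are positive, so its mean is [0]. *)
Lemma Gf_sublinear (eps : R) : 0 < eps -> exists K, forall x : R, Cmod (Gf (x, 1)) <= eps * Rabs x + K.
Proof.
  intros He. assert (P := PI2_1).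
  set (M := fun k => Cmod (Bp k) * (Gp k ^ 0 * exp (- (2 * PI * 1) * Gp k))).
  assert (HM : ex_series M) by (apply spectral_weight; auto; lra).
  assert (HM0 : forall k, 0 <= M k). { intros k. apply Rmult_le_pos. apply Cmod_ge_0. rewrite pow_O, Rmult_1_l. left; apply exp_pos. }
  (* Each term is bounded in [x] and also at most [2 pi |x| M k]. The second bound on the tail
     beyond [N] gives the slope [eps]; the first, on finitely many terms, gives the constant. *)
  destruct (rsum_tail M (eps / (2 * PI)) HM0 HM) as [N HN]. { apply Rdiv_lt_0_compat; lra. }
  specialize (HN N (le_n N)).
  assert (Fin : forall n, exists K, forall x : R, Cmod (psum (fun k => Bp k / Gp k * (wave (Gp k) (x, 1)%R - wave (Gp k) Ci))%C n) <= K).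
  { induction n as [|n [K HK]]. exists 0. intros; simpl. rewrite Cmod_0; lra.
    exists (K + Cmod (Bp n / Gp n)%C * 2). intros x. simpl. eapply Rle_trans; [apply Cmod_triangle|]. apply Rplus_le_compat; auto.
    rewrite Cmod_mult. apply Rmult_le_compat_l. apply Cmod_ge_0. eapply Rle_trans; [apply Cmod_minus_le|]. rewrite !Cmod_wave. change (Im (x, 1)) with 1. change (Im Ci) with 1.
    assert (exp (- (2 * PI * 1) * Gp n) <= 1). { apply Rle_trans with (exp 0); [|rewrite exp_0; lra]. apply exp_le. assert (0 < PI * Gp n) by (apply Rmult_lt_0_compat; [lra|apply gp_pos]). lra. } lra. }
  destruct (Fin N) as [K HK]. exists K. intros x.
  set (u := fun k => (Bp k / Gp k * (wave (Gp k) (x, 1)%R - wave (Gp k) Ci))%C).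
  assert (Hx : Cmod ((x, 1)%R - Ci) = Rabs x).
  { replace ((x, 1)%R - Ci)%C with (RtoC x) by (apply C_ext; simpl; ring). apply Cmod_R. }
  assert (Du : forall k, Cmod (u k) <= 2 * PI * Rabs x * M k).
  { intros k. rewrite <- Hx. apply (Gf_term_bound 1); simpl; lra. }
  assert (T := Csum_tail u (fun k => 2 * PI * Rabs x * M k) Du (ex_series_scal_R _ _ HM) N).
  rewrite Series_scal_l, rsum_scal in T. fold (Gf (x, 1)) in T. specialize (HK x). fold u in HK.
  assert (E : Csum u = Gf (x, 1)) by reflexivity. rewrite E in T.
  assert (T2 := Cmod_triangle_sub (Gf (x, 1)) (psum u N)).
  assert (2 * PI * Rabs x * Series M - 2 * PI * Rabs x * rsum M N <= eps * Rabs x).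
  { rewrite <- Rmult_minus_distr_l. apply Rle_trans with (2 * PI * Rabs x * (eps / (2 * PI))). apply Rmult_le_compat_l; auto.
    apply Rmult_le_pos. lra. apply Rabs_pos. right; field; lra. }
  lra.
Qed.

(** Every frequency is positive, so each term tends to [0] with growing height. The height is
    written as [1 + / d] so that dominated convergence applies as [d] tends to [0]. *)
Lemma Ef_decay (eps : R) : 0 < eps -> exists Y, 1 <= Y /\ forall z, Y <= Im z -> Cmod (Ef z) <= eps.
Proof.
  intros He. assert (P := PI2_1).
  set (M := fun k => Cmod (Bp k) * (Gp k ^ 0 * exp (- (2 * PI * 1) * Gp k))).
  assert (HM : ex_series M) by (apply spectral_weight; auto; lra).
  destruct (Csum_tannery (fun d k => RtoC (Cmod (Bp k) * exp (- (2 * PI * (1 + / d)) * Gp k))) (fun _ => 0%C) M HM) with (eps := eps) as [d [Hd H]]; auto.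
  - intros d k Hd. assert (0 < / d) by (apply Rinv_0_lt_compat; auto). assert (Hg := gp_pos gam k).
    rewrite Cmod_RtoC_nonneg by (apply Rmult_le_pos; [apply Cmod_ge_0|left; apply exp_pos]). unfold M. rewrite pow_O, Rmult_1_l.
    apply Rmult_le_compat_l. apply Cmod_ge_0. apply exp_le. apply Rmult_le_compat_r. lra. nra.
  - intros k. rewrite Cmod_0. apply Rmult_le_pos. apply Cmod_ge_0. rewrite pow_O, Rmult_1_l. left; apply exp_pos.
  - intros k e Hee. assert (Hg := gp_pos gam k). assert (Pb := Cmod_ge_0 (Bp k)).
    exists (e * Gp k / (Cmod (Bp k) + 1)). split. apply Rdiv_lt_0_compat; nra. intros d Hd.
    replace (RtoC (Cmod (Bp k) * exp (- (2 * PI * (1 + / d)) * Gp k)) - 0)%C with (RtoC (Cmod (Bp k) * exp (- (2 * PI * (1 + / d)) * Gp k))) by ring.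
    rewrite Cmod_RtoC_nonneg by (apply Rmult_le_pos; [apply Cmod_ge_0|left; apply exp_pos]).
    assert (Pd : 0 < / d) by (apply Rinv_0_lt_compat; lra).
    assert (X : exp (- (2 * PI * (1 + / d)) * Gp k) <= d / Gp k).
    { apply Rle_trans with (exp (- (Gp k / d))). apply exp_le. unfold Rdiv. assert (0 < Gp k * / d) by nra. nra.
      rewrite exp_Ropp. assert (E := exp_ineq1_le (Gp k / d)). assert (0 < Gp k / d) by (apply Rdiv_lt_0_compat; lra).
      replace (d / Gp k) with (/ (Gp k / d)) by (field; lra). apply Rinv_le_contravar; lra. }
    apply Rle_trans with ((Cmod (Bp k) + 1) * (d / Gp k)). apply Rmult_le_compat; try lra. left; apply exp_pos.
    destruct Hd as [Hd0 Hd]. apply Rlt_le in Hd. apply (Rle_div_r d) in Hd; [|lra].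
    replace ((Cmod (Bp k) + 1) * (d / Gp k)) with (d * (Cmod (Bp k) + 1) / Gp k) by (field; lra). apply (Rle_div_l (d * (Cmod (Bp k) + 1))); auto.
  - assert (P2 : 0 < / (d / 2)) by (apply Rinv_0_lt_compat; lra).
    exists (1 + / (d / 2)). split. lra. intros z Hz. specialize (H (d / 2) ltac:(lra)).
    assert (Z0 : Csum (fun _ => 0%C) = 0%C). { apply Clim_Csum. apply (Clim_ext (fun _ => 0%C)); [|apply Clim_const]. induction n; simpl; auto. rewrite <- IHn. ring. }
    rewrite Z0 in H. replace (Csum (fun k => RtoC (Cmod (Bp k) * exp (- (2 * PI * (1 + / (d / 2))) * Gp k))) - 0)%C with (Csum (fun k => RtoC (Cmod (Bp k) * exp (- (2 * PI * (1 + / (d / 2))) * Gp k)))) in H by ring.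
    eapply Rle_trans; [apply (Ef_bound (1 + / (d / 2)) z); lra|].
    eapply Rle_trans; [|apply H]. eapply Rle_trans; [|apply re_le_Cmod]. eapply Rle_trans; [|apply Rle_abs].
    right. unfold Csum. simpl. apply Series_ext. intros; simpl; ring.
Qed.
End ExponentialSums.

(** * The logarithmic derivative of the canonical product *)

Section LogDerivative.
Variables (a : Z -> R) (gam : nat -> R) (b : nat -> C).
Hypothesis Ha_mono : forall n : Z, a n <= a (n + 1)%Z.
Hypothesis Ha0 : forall n : Z, a n <> 0.
Hypothesis Hmuhat : tempered_B gam b.
Hypothesis HF : fourier_pair a gam b.

Local Notation Al := (al a).

(** Each genus one factor [(1 - z / x) exp (z / x)] contributes [1 / (z - x) + 1 / x] to the
    logarithmic derivative. *)
Definition Qf (z : C) : C := Csum (fun k => / (z - Al k) + / Al k)%C.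

Lemma Al_neq_0 k : RtoC (Al k) <> 0%C.
Proof. intros E. apply RtoC_inj in E. revert E. apply Ha0. Qed.

Lemma inv_al_sq_pos k : 0 < / (Al k * Al k).
Proof. apply Rinv_0_lt_compat. apply Rsqr_pos_lt, Ha0. Qed.

Lemma inv_dist_bound (y r : R) (z : C) k : 0 < y -> y <= Im z -> Cmod z <= r -> / Cmod (z - Al k) <= (r + y) / y * / Rabs (Al k).
Proof.
  intros Hy Hz Hr. assert (Hz0 : 0 < Im z) by lra. assert (D := dist_real_lower z (Al k) Hz0).
  assert (Pa : 0 < Rabs (Al k)) by (apply Rabs_pos_lt, Ha0). assert (Pz := Cmod_ge_0 z).
  assert (Q : y / (y + r) <= Im z / (Im z + Cmod z)).
  { apply (Rle_div_r (y / (y + r))). lra. replace (y / (y + r) * (Im z + Cmod z)) with (y * (Im z + Cmod z) / (y + r)) by (field; lra).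
    apply (Rle_div_l (y * (Im z + Cmod z))). lra. nra. }
  assert (Q0 : 0 < y / (y + r)) by (apply Rdiv_lt_0_compat; lra).
  replace ((r + y) / y * / Rabs (Al k)) with (/ (Rabs (Al k) * (y / (y + r)))) by (field; lra).
  apply Rinv_le_contravar. nra. eapply Rle_trans; [|apply D]. apply Rmult_le_compat_l; lra.
Qed.

Lemma Qf_term (z : C) k : 0 < Im z -> (/ (z - Al k) + / Al k = z / (Al k * (z - Al k)))%C.
Proof. intros Hz. field. split. apply sub_real_neq_0; auto. apply Al_neq_0. Qed.

Lemma Qf_term_bound (y r : R) (z : C) k : 0 < y -> y <= Im z -> Cmod z <= r ->
  Cmod (/ (z - Al k) + / Al k) <= r * ((r + y) / y) * / (Al k * Al k).
Proof.
  intros Hy Hz Hr. assert (Hz0 : 0 < Im z) by lra. rewrite Qf_term by auto. assert (D := inv_dist_bound y r z k Hy Hz Hr).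
  assert (Hd := sub_real_neq_0 z (Al k) Hz0). assert (Ha := Al_neq_0 k). assert (Pa : 0 < Rabs (Al k)) by (apply Rabs_pos_lt, Ha0).
  rewrite Cmod_div, Cmod_mult by (apply Cmult_neq_0; auto). rewrite Cmod_R.
  assert (Pd : 0 < Cmod (z - Al k)) by (apply Cmod_gt_0; auto).
  replace (Cmod z / (Rabs (Al k) * Cmod (z - Al k))) with (Cmod z * (/ Rabs (Al k) * / Cmod (z - Al k))) by (field; lra).
  replace (Al k * Al k) with (Rabs (Al k) * Rabs (Al k)) by (rewrite <- Rabs_mult, Rabs_pos_eq; auto; apply Rle_0_sqr).
  replace (r * ((r + y) / y) * / (Rabs (Al k) * Rabs (Al k))) with (r * (/ Rabs (Al k) * ((r + y) / y * / Rabs (Al k)))) by (field; lra).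
  assert (0 < / Rabs (Al k)) by (apply Rinv_0_lt_compat; auto). assert (0 < / Cmod (z - Al k)) by (apply Rinv_0_lt_compat; auto).
  apply Rmult_le_compat; auto. apply Cmod_ge_0. nra. apply Rmult_le_compat_l; lra.
Qed.

Lemma Qf_summable : ex_series (fun k => / (Al k * Al k)).
Proof. apply (ex_series_inv_al_sq a gam b); auto. Qed.

Lemma Qf_deriv z : 0 < Im z -> cderiv Qf z (- Csum (fun k => / ((z - Al k) * (z - Al k)))%C)%C.
Proof.
  intros Hz. assert (Hs := Qf_summable). set (y := Im z / 2). assert (Hy : 0 < y) by (unfold y; lra).
  set (r := Cmod z + y). assert (Pz := Cmod_ge_0 z). set (q := (r + y) / y). assert (Hq : 0 < q) by (apply Rdiv_lt_0_compat; unfold r; lra).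
  assert (Iy : forall h, Cmod h < y -> y <= Im (z + h)%C /\ Cmod (z + h) <= r).
  { intros h Hh. split. rewrite im_plus. generalize (Im_le_Cmod h). intros A1. apply Rabs_le_between in A1. unfold y in *; lra.
    unfold r. generalize (Cmod_triangle z h). lra. }
  assert (Dz : forall k, / Cmod (z - Al k) <= q * / Rabs (Al k)) .
  { intros k. apply (inv_dist_bound y r); [exact Hy|unfold y; lra|unfold r; lra]. }
  assert (Pd : forall u k, 0 < Im u -> 0 < / Cmod (u - Al k)) by (intros; apply Rinv_0_lt_compat, Cmod_gt_0, sub_real_neq_0; auto).
  assert (Pa : forall k, 0 < / Rabs (Al k)) by (intros; apply Rinv_0_lt_compat, Rabs_pos_lt, Ha0).
  assert (Sq : forall k, / (Al k * Al k) = / Rabs (Al k) * / Rabs (Al k)).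
  { intros k. rewrite <- Rinv_mult, <- Rabs_mult, Rabs_pos_eq; auto; apply Rle_0_sqr. }
  assert (B1 : forall k, Cmod (/ ((z - Al k) * (z - Al k))) <= q * q * / (Al k * Al k)).
  { intros k. assert (Hn := sub_real_neq_0 z (Al k) Hz). rewrite Cmod_inv, Cmod_mult, Rinv_mult, Sq by (apply Cmult_neq_0; auto).
    replace (q * q * (/ Rabs (Al k) * / Rabs (Al k))) with ((q * / Rabs (Al k)) * (q * / Rabs (Al k))) by ring.
    specialize (Pd z k Hz). apply Rmult_le_compat; auto; lra. }
  eapply cderiv_eq.
  2: apply (Csum_cderiv (fun k z => / (z - Al k) + / Al k)%C (fun k => - / ((z - Al k) * (z - Al k)))%C
    (fun k => r * q * / (Al k * Al k)) (fun k => q * q * / (Al k * Al k)) (fun k => / y * (q * q) * / (Al k * Al k)) z y Hy).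
  - rewrite (Csum_ext _ (fun k => (-(1)) * / ((z - Al k) * (z - Al k)))%C) by (intros; ring).
    rewrite (Csum_scal _ _ (fun k => q * q * / (Al k * Al k))); auto. ring. apply ex_series_scal_R; auto.
  - apply ex_series_scal_R; auto.
  - apply ex_series_scal_R; auto.
  - apply ex_series_scal_R; auto.
  - intros k h Hh. destruct (Iy h Hh) as [I1 I2]. apply Qf_term_bound; auto.
  - intros k. rewrite Cmod_opp. auto.
  - intros k h Hh. destruct (Iy h Hh) as [I1 I2]. assert (Hzh : 0 < Im (z + h)%C) by lra.
    assert (N1 := sub_real_neq_0 z (Al k) Hz). assert (N2 := sub_real_neq_0 (z + h)%C (Al k) Hzh). assert (N3 := Al_neq_0 k).
    replace (/ (z + h - Al k) + / Al k - (/ (z - Al k) + / Al k) - - / ((z - Al k) * (z - Al k)) * h)%C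
      with ((h * h) * (/ ((z - Al k) * (z - Al k)) * / (z + h - Al k)))%C by (field; auto).
    rewrite !Cmod_mult, (Cmod_inv (z + h - Al k)) by auto. rewrite (Rmult_comm (Cmod h * Cmod h)). apply Rmult_le_compat_r. generalize (Cmod_ge_0 h); nra.
    replace (/ y * (q * q) * / (Al k * Al k)) with (q * q * / (Al k * Al k) * / y) by ring.
    apply Rmult_le_compat; auto. apply Cmod_ge_0. specialize (Pd (z + h)%C k Hzh). lra.
    apply Rinv_le_contravar; auto. eapply Rle_trans; [apply I1|]. rewrite <- (Im_sub_real (z + h)%C (Al k)).
    eapply Rle_trans; [apply Rle_abs|apply Im_le_Cmod].
Qed.

(** The derivatives of [Qf] and of [- 2 pi i Ef] agree by [pole_sum_formula]. Once [G] is known to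
    be bounded, the constant of integration acquires a meaning: [- Im c0 / pi] is the density of the
    zeros and [Re c0] the symmetric sum of their inverses. *)
Lemma Qf_formula : exists c0, forall z, 0 < Im z -> Qf z = (c0 - 2 * PI * Ci * Ef gam b z)%C.
Proof.
  exists (Qf Ci + 2 * PI * Ci * Ef gam b Ci)%C. intros z Hz.
  assert (H : (Qf z + 2 * PI * Ci * Ef gam b z = Qf Ci + 2 * PI * Ci * Ef gam b Ci)%C).
  { apply (half_plane_const (fun z => Qf z + 2 * PI * Ci * Ef gam b z)%C); auto. 2: simpl; lra.
    intros u Hu. eapply cderiv_eq; [|apply cderiv_plus; [apply Qf_deriv; auto|apply cderiv_scal, Ef_deriv; auto]].
    rewrite (pole_sum_formula a gam b) by auto.
    assert (I2 : (Ci * Ci = -(1))%C) by (apply C_ext; simpl; ring).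
    rewrite (Csum_ext (fun k => bp gam b k * (2 * PI * Ci * gp gam k * wave (gp gam k) u))%C (fun k => (2 * PI * Ci) * (bp gam b k * (gp gam k * wave (gp gam k) u)))%C) by (intros; ring).
    rewrite (Csum_scal _ _ (fun k => Cmod (bp gam b k) * (gp gam k ^ 1 * exp (- (2 * PI * Im u) * gp gam k)))).
    - set (X := Csum _). transitivity (4 * PI * PI * (1 + Ci * Ci) * X)%C. ring. rewrite I2. ring.
    - intros k. rewrite !Cmod_mult, Cmod_wave, pow_1, Cmod_RtoC_nonneg by (left; apply gp_pos). lra.
    - apply spectral_weight; auto. }
  rewrite <- H. ring.
Qed.
End LogDerivative.

(** * Infinite products *)

Fixpoint pprod (u : nat -> C) (n : nat) : C := match n with O => 1%C | S m => (pprod u m * u m)%C end.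

Lemma entire_mult (f g : C -> C) : entire f -> entire g -> entire (fun z => f z * g z)%C.
Proof.
  rewrite !entire_iff. intros [f' Hf] [g' Hg]. exists (fun z => f' z * g z + f z * g' z)%C. intros z. apply cderiv_mult; auto.
Qed.

Lemma entire_const (c : C) : entire (fun _ => c).
Proof. apply entire_iff. exists (fun _ => 0%C). intros; apply cderiv_const. Qed.

Lemma entire_affine (c d : C) : entire (fun z => c + d * z)%C.
Proof. apply entire_iff. exists (fun _ => d). intros. eapply cderiv_eq; [|apply cderiv_plus; [apply cderiv_const|apply cderiv_scal, cderiv_id]]. ring. Qed.

Lemma entire_ext (f g : C -> C) : (forall z, f z = g z) -> entire f -> entire g.
Proof. intros H. rewrite !entire_iff. intros [f' Hf]. exists f'. intros; apply cderiv_ext with f; auto. Qed.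

Lemma entire_cexp (c : C) : entire (fun z => cexp (c * z)).
Proof.
  apply entire_iff. exists (fun z => cexp (c * z) * c)%C. intros z. apply (cderiv_comp cexp (fun z => c * z)%C). apply cderiv_cexp.
  eapply cderiv_eq; [|apply cderiv_scal, cderiv_id]. ring.
Qed.

Lemma entire_pprod (e : nat -> C -> C) n : (forall k, entire (e k)) -> entire (fun z => pprod (fun k => e k z) n).
Proof. intros H. induction n; simpl. apply entire_const. apply (entire_mult (fun z => pprod (fun k => e k z) n)); auto. Qed.

Lemma pprod_bound (u : nat -> C) (x : nat -> R) n : (forall k, Cmod (u k - 1) <= x k) -> Cmod (pprod u n) <= exp (rsum x n).
Proof.
  intros H. induction n; simpl. rewrite Cmod_1, exp_0; lra.
  rewrite Cmod_mult, exp_plus. apply Rmult_le_compat; try apply Cmod_ge_0; auto.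
  assert (E := exp_ineq1_le (x n)). specialize (H n). generalize (Cmod_triangle_sub (u n) 1). rewrite Cmod_1. lra.
Qed.

(** Beyond [N] the deviations from [1] total at most [1 / 2], and [(1 - s) (1 - x) >= 1 - s - x] can
    be iterated. *)
Lemma pprod_lower (u : nat -> C) (x : nat -> R) N n : (forall k, Cmod (u k - 1) <= x k) -> (forall k, rsum x k - rsum x N <= 1 / 2) ->
  (N <= n)%nat -> Cmod (pprod u N) * (1 - (rsum x n - rsum x N)) <= Cmod (pprod u n).
Proof.
  intros H Hx Hn. assert (Px : forall k, 0 <= x k) by (intros k; eapply Rle_trans; [apply Cmod_ge_0|apply H]).
  induction Hn.
  - rewrite Rminus_diag. lra.
  - assert (HSm := Hx (S m)). simpl in *. rewrite Cmod_mult. specialize (H m). assert (Hm := Hx m). specialize (Px m) as Pm.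
    assert (T := Cmod_triangle_sub 1 (u m)). rewrite Cmod_1, Cmod_sub_sym in T.
    assert (P := Cmod_ge_0 (pprod u N)). assert (P2 := Cmod_ge_0 (pprod u m)).
    assert (Q := rsum_incr x N m Px Hn).
    apply Rle_trans with (Cmod (pprod u N) * (1 - (rsum x m - rsum x N)) * (1 - x m)).
    + rewrite Rmult_assoc. apply Rmult_le_compat_l; auto. nra.
    + apply Rmult_le_compat; auto. apply Rmult_le_pos; lra. generalize (rsum_incr x N (S m) Px ltac:(lia)). simpl. lra. lra.
Qed.

(** Dominating the increments of the partial products gives uniform convergence on discs. For the
    nonvanishing, [N] is taken so large that the later factors can lose at most half of the
    modulus. *)
Lemma locally_uniform_product (e : nat -> C -> C) (m : nat -> R) : (forall k, 0 <= m k) -> ex_series m ->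
  (forall r, exists K, 0 <= K /\ forall k z, Cmod z <= r -> Cmod (e k z - 1) <= K * m k) ->
  exists P, locally_uniform (fun n z => pprod (fun k => e k z) n) P /\
    forall z, (forall k, e k z <> 0%C) -> P z <> 0%C.
Proof.
  intros Hm HS HK.
  assert (X : forall r, exists M, ex_series M /\ (forall k, 0 <= M k) /\ forall z, Cmod z <= r -> exists l, Clim (fun n => pprod (fun k => e k z) n) l /\
     forall n, Cmod (l - pprod (fun k => e k z) n) <= Series M - rsum M n).
  { intros r. destruct (HK r) as [K [HK0 HKb]].
    set (M := fun n => exp (K * Series m) * (K * m n)).
    assert (HM : ex_series M) by (apply ex_series_scal_R, ex_series_scal_R; auto).
    assert (HM0 : forall k, 0 <= M k). { intros k. apply Rmult_le_pos. left; apply exp_pos. apply Rmult_le_pos; auto. }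
    exists M. split; [|split]; auto. intros z Hz. apply Clim_cauchy; auto.
    intros n. simpl. replace (pprod (fun k => e k z) n * e n z - pprod (fun k => e k z) n)%C with (pprod (fun k => e k z) n * (e n z - 1))%C by ring.
    rewrite Cmod_mult. apply Rmult_le_compat; try apply Cmod_ge_0; auto.
    eapply Rle_trans. apply (pprod_bound _ (fun k => K * m k)). intros; apply HKb; auto.
    rewrite rsum_scal. apply exp_le. apply Rmult_le_compat_l; auto. apply rsum_le_Series; auto. }
  assert (Y : forall z, exists l, Clim (fun n => pprod (fun k => e k z) n) l).
  { intros z. destruct (X (Cmod z)) as [M [_ [_ HM]]]. destruct (HM z (Rle_refl _)) as [l [Hl _]]. exists l; auto. }
  apply choice in Y. destruct Y as [P HP]. exists P. split.
  - intros r eps He. destruct (X r) as [M [HM [HM0 HMz]]]. destruct (rsum_tail M eps HM0 HM He) as [N HN].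
    exists N. intros n z Hn Hz. destruct (HMz z Hz) as [l [Hl Hb]]. rewrite (Clim_unique _ _ _ (HP z) Hl). rewrite Cmod_sub_sym.
    eapply Rle_trans; [apply Hb|]. auto.
  - intros z Hz. destruct (HK (Cmod z)) as [K [HK0 HKb]].
    assert (HKm : forall k, 0 <= K * m k) by (intros; apply Rmult_le_pos; auto).
    destruct (rsum_tail (fun k => K * m k) (1 / 2) HKm (ex_series_scal_R _ _ HS) ltac:(lra)) as [N HN]. specialize (HN N (le_n N)).
    assert (PN : pprod (fun k => e k z) N <> 0%C). { clear HN. induction N; simpl. apply C1_nz. apply Cmult_neq_0; auto. }
    apply Cmod_gt_0 in PN. apply Cmod_gt_0.
    apply Rlt_le_trans with (Cmod (pprod (fun k => e k z) N) / 2). lra.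
    apply le_epsilon. intros eps He. destruct (HP z eps He) as [N' HN'].
    specialize (HN' (N + N')%nat ltac:(lia)).
    assert (L := pprod_lower (fun k => e k z) (fun k => K * m k) N (N + N') (fun k => HKb k z (Rle_refl _))).
    assert (Q : forall k, rsum (fun k => K * m k) k <= Series (fun k => K * m k)) by (intros; apply rsum_le_Series; auto; apply ex_series_scal_R; auto).
    specialize (L ltac:(intros k; specialize (Q k); lra) ltac:(lia)).
    specialize (Q (N + N')%nat).
    generalize (Cmod_triangle_sub (pprod (fun k => e k z) (N + N')) (P z)). nra.
Qed.

Lemma locally_uniform_pointwise (Fn : nat -> C -> C) F z : locally_uniform Fn F -> Clim (fun n => Fn n z) (F z).
Proof. intros H eps He. destruct (H (Cmod z) eps He) as [N HN]. exists N. intros; apply HN; auto. lra. Qed.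

Lemma locally_uniform_entire (Fn : nat -> C -> C) F : (forall n, entire (Fn n)) -> locally_uniform Fn F -> entire F.
Proof.
  intros HE HU. assert (X : forall n, exists Fn', forall z, cderiv (Fn n) z (Fn' z)) by (intros; apply entire_iff; auto).
  apply choice in X. destruct X as [Fn' HFn']. destruct (locally_uniform_limit Fn Fn' F HE HFn' HU) as [F' [HF' _]].
  apply entire_iff. eauto.
Qed.

Lemma Clim_mult u v l m : Clim u l -> Clim v m -> Clim (fun n => u n * v n)%C (l * m)%C.
Proof.
  intros Hu Hv. assert (X : Clim (fun n => (u n - l) * (v n - m))%C 0%C).
  { intros eps He. destruct (Hu (Rmin 1 eps) ltac:(apply Rmin_pos; lra)) as [N HN]. destruct (Hv 1 Rlt_0_1) as [N' HN'].
    exists (N + N')%nat. intros n Hn. specialize (HN n ltac:(lia)). specialize (HN' n ltac:(lia)).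
    replace ((u n - l) * (v n - m) - 0)%C with ((u n - l) * (v n - m))%C by ring. rewrite Cmod_mult.
    generalize (Rmin_r 1 eps) (Cmod_ge_0 (u n - l)) (Cmod_ge_0 (v n - m)); intros. nra. }
  apply (Clim_ext (fun n => ((u n - l) * (v n - m)) + (l * v n + (m * u n + - (l * m))))%C). intros; ring.
  assert (Y : Clim (fun n => ((u n - l) * (v n - m)) + (l * v n + (m * u n + - (l * m))))%C (0 + (l * m + (m * l + - (l * m))))%C).
  { apply Clim_plus; auto. apply Clim_plus. apply Clim_scal; auto. apply Clim_plus. apply Clim_scal; auto. apply Clim_const. }
  replace (0 + (l * m + (m * l + - (l * m))))%C with (l * m)%C in Y by ring. exact Y.
Qed.

(** * The canonical product *)

Definition fac (x : R) (z : C) : C := ((1 - z / x) * cexp (z / x))%C.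

(** The factor [fac x] with its zero divided out when [x] is the point [p]. *)
Definition fac_off (p : C) (x : R) (z : C) : C := if Ceq_dec x p then (- / x * cexp (z / x))%C else fac x z.

Lemma entire_fac x : x <> 0 -> entire (fac x).
Proof.
  intros Hx. apply (entire_ext (fun z => (1 + (- / x) * z) * cexp ((/ x) * z))%C).
  - intros z. unfold fac. assert (RtoC x <> 0%C) by (intros E; apply RtoC_inj in E; auto). f_equal. field; auto. f_equal. field; auto.
  - apply entire_mult. apply entire_affine. apply entire_cexp.
Qed.

Lemma entire_fac_off p x : x <> 0 -> entire (fac_off p x).
Proof.
  intros Hx. unfold fac_off. destruct (Ceq_dec x p).
  - apply (entire_ext (fun z => (- / x) * cexp ((/ x) * z))%C).
    + intros z. assert (RtoC x <> 0%C) by (intros E; apply RtoC_inj in E; auto). f_equal. f_equal. field; auto.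
    + apply entire_mult. apply entire_const. apply entire_cexp.
  - apply entire_fac; auto.
Qed.

(** The first-order terms of [1 - u] and [exp u] cancel, so the deviation is of order [u^2];
    convergence of [sum 1 / a_n^2] is therefore enough for the product. *)
Lemma fac_bound (x r : R) (z : C) : x <> 0 -> Cmod z <= r ->
  Cmod (fac x z - 1) <= r * r * (1 + (1 + r / Rabs x) * exp (r / Rabs x)) * / (x * x).
Proof.
  intros Hx Hz. set (u := (z / x)%C). assert (Px : 0 < Rabs x) by (apply Rabs_pos_lt; auto).
  assert (Hx' : RtoC x <> 0%C) by (intros E; apply RtoC_inj in E; auto).
  assert (Hu : Cmod u <= r / Rabs x). { unfold u. rewrite Cmod_div by auto. rewrite Cmod_R. apply Rmult_le_compat_r; auto. left; apply Rinv_0_lt_compat; auto. }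
  assert (Pu := Cmod_ge_0 u). assert (Pz := Cmod_ge_0 z).
  assert (B := cexp_bound2 u).
  change (fac x z) with ((1 - u) * cexp u)%C.
  replace ((1 - u) * cexp u - 1)%C with (- (u * u) + (1 - u) * (cexp u - 1 - u))%C by ring.
  eapply Rle_trans; [apply Cmod_triangle|]. rewrite Cmod_opp, !Cmod_mult.
  assert (B2 : Cmod (1 - u) <= 1 + r / Rabs x). { eapply Rle_trans; [apply Cmod_minus_le|]. rewrite Cmod_1. lra. }
  assert (B3 : Cmod u * Cmod u <= (r / Rabs x) * (r / Rabs x)) by (apply Rmult_le_compat; auto).
  assert (B4 : exp (Cmod u) <= exp (r / Rabs x)) by (apply exp_le; auto).
  assert (B5 : Cmod (cexp u - 1 - u) <= (r / Rabs x) * (r / Rabs x) * exp (r / Rabs x)).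
  { eapply Rle_trans; [apply B|]. apply Rmult_le_compat; auto. nra. left; apply exp_pos. }
  assert (B6 : Cmod (1 - u) * Cmod (cexp u - 1 - u) <= (1 + r / Rabs x) * ((r / Rabs x) * (r / Rabs x) * exp (r / Rabs x))).
  { apply Rmult_le_compat; auto; apply Cmod_ge_0. }
  replace (/ (x * x)) with (/ Rabs x * / Rabs x).
  2: { rewrite <- Rinv_mult, <- Rabs_mult, Rabs_pos_eq; auto. apply Rle_0_sqr. }
  unfold Rdiv in *. lra.
Qed.

Lemma fac_neq_0 x z : x <> 0 -> z <> RtoC x -> fac x z <> 0%C.
Proof.
  intros Hx Hz. assert (Hx' : RtoC x <> 0%C) by (intros E; apply RtoC_inj in E; auto).
  apply Cmult_neq_0; [|apply cexp_neq_0]. intros E. apply Hz. apply Ceq_minus.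
  replace (z - x)%C with (- (x * (1 - z / x)))%C by (field; auto). rewrite E. ring.
Qed.

Lemma fac_off_neq_0 x p : x <> 0 -> fac_off p x p <> 0%C.
Proof.
  intros Hx. assert (Hx' : RtoC x <> 0%C) by (intros E; apply RtoC_inj in E; auto).
  unfold fac_off. destruct (Ceq_dec x p) as [E | E].
  - apply Cmult_neq_0; [|apply cexp_neq_0]. intros E2. apply (Cmult_neq_0 (- / x)%C x); auto. 2: rewrite E2; ring.
    intros E3. apply Hx'. clear E2. assert (X : (- / x * x = -(1))%C) by (field; auto). rewrite E3 in X. rewrite Cmult_0_l in X.
    apply (f_equal Re) in X. simpl in X. lra.
  - apply fac_neq_0; auto.
Qed.

Lemma fac_split x p z : x <> 0 -> fac x z = ((if Ceq_dec x p then (z - p) else 1) * fac_off p x z)%C.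
Proof.
  intros Hx. assert (Hx' : RtoC x <> 0%C) by (intros E; apply RtoC_inj in E; auto).
  unfold fac_off. destruct (Ceq_dec x p) as [<- | E]. unfold fac. field; auto. ring.
Qed.

(** The zero is real, so [|1 - z / x|] grows with [|Im z|] while [|exp (z / x)|] depends on [Re z]
    alone. Bounds on a horizontal line thus extend into the strip below it. *)
Lemma Cmod_fac_mono x t y y' : x <> 0 -> Rabs y <= Rabs y' -> Cmod (fac x (t, y)) <= Cmod (fac x (t, y')).
Proof.
  intros Hx Hy.
  assert (Hx' : RtoC x <> 0%C) by (intros E; apply RtoC_inj in E; auto).
  assert (R : forall s, ((t, s) / x)%C = ((t / x)%R, (s / x)%R)).
  { intros s. apply C_ext; simpl; field; auto. }
  unfold fac. rewrite !Cmod_mult, !R, !Cmod_cexp. simpl Re. apply Rmult_le_compat_r. left; apply exp_pos.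
  apply Rsqr_incr_0; try apply Cmod_ge_0. unfold Rsqr. rewrite !Cmod_sq. simpl.
  assert (Rabs (y / x) <= Rabs (y' / x)). { rewrite !Rabs_div by auto. apply Rmult_le_compat_r; auto. left; apply Rinv_0_lt_compat, Rabs_pos_lt; auto. }
  assert (S : forall s, s * s = Rabs s * Rabs s) by (intros; rewrite <- Rabs_mult, Rabs_pos_eq; auto; apply Rle_0_sqr).
  assert (y / x * (y / x) <= y' / x * (y' / x)). { rewrite (S (y / x)), (S (y' / x)). apply Rmult_le_compat; auto; apply Rabs_pos. }
  lra.
Qed.

Lemma fac_conj x z : x <> 0 -> fac x (Cconj z) = Cconj (fac x z).
Proof.
  intros Hx. assert (Hx' : RtoC x <> 0%C) by (intros E; apply RtoC_inj in E; auto).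
  assert (E : (Cconj z / x)%C = Cconj (z / x)%C). { rewrite Cdiv_conj by auto. f_equal. apply C_ext; simpl; ring. }
  unfold fac. rewrite E, cexp_conj, Cmult_conj, Cminus_conj. f_equal. f_equal. apply C_ext; simpl; ring.
Qed.

Definition fac' (x : R) (z : C) : C := (- (z / (x * x)) * cexp (z / x))%C.

Lemma fac_deriv x z : x <> 0 -> cderiv (fac x) z (fac' x z).
Proof.
  intros Hx. assert (Hx' : RtoC x <> 0%C) by (intros E; apply RtoC_inj in E; auto).
  assert (L : cderiv (fun w => w / x)%C z (/ x)%C).
  { apply cderiv_ext with (fun w => / x * w)%C. intros; unfold Cdiv; ring. eapply cderiv_eq; [|apply cderiv_scal, cderiv_id]. ring. }
  eapply cderiv_eq; [|apply cderiv_mult; [apply cderiv_minus; [apply cderiv_const|apply L]|apply (cderiv_comp cexp (fun w => w / x)%C); [apply cderiv_cexp|apply L]]].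
  unfold fac'. cbv beta. field; auto.
Qed.

Section CanonicalProduct.
Variables (a : Z -> R) (gam : nat -> R) (b : nat -> C).
Hypothesis Ha_mono : forall n : Z, a n <= a (n + 1)%Z.
Hypothesis Ha_pinf : forall M : R, exists n0 : Z, forall n : Z, (n0 <= n)%Z -> M < a n.
Hypothesis Ha_minf : forall M : R, exists n0 : Z, forall n : Z, (n <= n0)%Z -> a n < M.
Hypothesis Ha0 : forall n : Z, a n <> 0.
Hypothesis Hmuhat : tempered_B gam b.
Hypothesis HF : fourier_pair a gam b.

Local Notation Al := (al a).

Lemma fac_uniform r : exists K, 0 <= K /\ forall k z, Cmod z <= r -> Cmod (fac (Al k) z - 1) <= K * / (Al k * Al k).
Proof.
  destruct (al_lower a gam b) as [c [Hc H]]; auto.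
  set (r' := Rmax r 0). assert (0 <= r') by apply Rmax_r. assert (r <= r') by apply Rmax_l.
  assert (Pc : 0 <= r' / c) by (apply Rmult_le_pos; auto; left; apply Rinv_0_lt_compat; auto).
  assert (PE := exp_pos (r' / c)).
  exists (r' * r' * (1 + (1 + r' / c) * exp (r' / c))). split. { apply Rmult_le_pos. nra. nra. }
  intros k z Hz. eapply Rle_trans. apply (fac_bound _ r'). apply Ha0. lra.
  specialize (H k). assert (c <= Rabs (Al k)) by (generalize (pos_INR k); intros; nra).
  assert (r' / Rabs (Al k) <= r' / c) by (apply Rmult_le_compat_l; auto; apply Rinv_le_contravar; auto).
  assert (0 <= r' / Rabs (Al k)) by (apply Rmult_le_pos; auto; left; apply Rinv_0_lt_compat; lra).
  apply Rmult_le_compat_r. left; apply inv_al_sq_pos; auto. apply Rmult_le_compat_l. nra.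
  apply Rplus_le_compat_l. apply Rmult_le_compat; try lra. left; apply exp_pos. apply exp_le; auto.
Qed.

Lemma fac_off_uniform p r : exists K, 0 <= K /\ forall k z, Cmod z <= r -> Cmod (fac_off p (Al k) z - 1) <= K * / (Al k * Al k).
Proof.
  destruct (fac_uniform r) as [K [HK H]].
  destruct (classic (exists k, RtoC (Al k) = p)) as [[k0 Hk0] | Hn].
  - set (x := Al k0). assert (Hx : x <> 0) by apply Ha0. assert (Hx' : RtoC x <> 0%C) by (intros E; apply RtoC_inj in E; auto).
    assert (Px : 0 < Rabs x) by (apply Rabs_pos_lt; auto). assert (Pxx : 0 < x * x) by (apply Rsqr_pos_lt; auto).
    (* Where the factor vanishing at [p] was divided out, the deviation is only bounded, by [C0].
       All these indices share the value [x], so the factor [x * x] turns [C0] into a multiple of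
       [/ (Al k * Al k)]. *)
    set (C0 := / Rabs x * exp (Rmax r 0 / Rabs x) + 1).
    assert (PC : 0 <= C0). { unfold C0. assert (0 < / Rabs x) by (apply Rinv_0_lt_compat; auto). generalize (exp_pos (Rmax r 0 / Rabs x)); intros. nra. }
    exists (K + C0 * (x * x)). split. nra. intros k z Hz. unfold fac_off. assert (Pk := inv_al_sq_pos a Ha0 k).
    destruct (Ceq_dec (Al k) p) as [E | E].
    + assert (Ek : Al k = x). { apply RtoC_inj. unfold x. congruence. } rewrite Ek in *.
      apply Rle_trans with C0.
      * eapply Rle_trans; [apply Cmod_minus_le|]. unfold C0. rewrite Cmod_1. apply Rplus_le_compat_r.
        rewrite Cmod_mult, Cmod_opp, Cmod_inv, Cmod_R, Cmod_cexp by auto. apply Rmult_le_compat_l. left; apply Rinv_0_lt_compat; auto.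
        apply exp_le. eapply Rle_trans; [apply Rle_abs|]. eapply Rle_trans; [apply re_le_Cmod|]. rewrite Cmod_div, Cmod_R by auto.
        apply Rmult_le_compat_r. left; apply Rinv_0_lt_compat; auto. eapply Rle_trans; [apply Hz|apply Rmax_l].
      * replace ((K + C0 * (x * x)) * / (x * x)) with (K * / (x * x) + C0) by (field; auto). nra.
    + eapply Rle_trans; [apply H; auto|]. apply Rmult_le_compat_r. lra. nra.
  - exists K. split; auto. intros k z Hz. unfold fac_off. destruct (Ceq_dec (Al k) p) as [E | E]; auto. exfalso; eauto.
Qed.

Lemma seq_count_exists (p : C) : exists k, seq_count a p k.
Proof.
  destruct (Ha_pinf (Re p)) as [n1 H1]. destruct (Ha_minf (Re p)) as [n0 H0].
  set (L := map (fun i => (n0 + Z.of_nat i)%Z) (seq 0 (Z.to_nat (n1 - n0)))).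
  set (l := filter (fun n => if Ceq_dec (a n) p then true else false) L).
  exists (length l), l. split; [|split]; auto.
  - apply NoDup_filter. apply Injective_map_NoDup. intros x y Hxy; lia. apply seq_NoDup.
  - intros n. unfold l. rewrite filter_In. split.
    + intros [_ E]. destruct (Ceq_dec (a n) p); auto. discriminate.
    + intros E. split; [|destruct (Ceq_dec (a n) p); auto; congruence].
      unfold L. rewrite in_map_iff. exists (Z.to_nat (n - n0)).
      assert (Er : a n = Re p) by (rewrite <- E; auto).
      assert (n0 < n)%Z. { apply Z.nle_gt. intros Hle. specialize (H0 n Hle). lra. }
      assert (n < n1)%Z. { apply Z.nle_gt. intros Hle. specialize (H1 n Hle). lra. }
      split. lia. apply in_seq. lia.
Qed.

Lemma partial_zero_count (p : C) (k : nat) : seq_count a p k ->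
  exists N, forall n, (N <= n)%nat -> length (filter (fun i => if Ceq_dec (Al i) p then true else false) (seq 0 n)) = k.
Proof.
  intros [l [Hnd [Hin Hlen]]].
  assert (X : exists N, forall q, In q l -> (rk q < N)%nat).
  { clear. induction l as [|q l [N HN]]. exists 0%nat. intros q []. exists (N + S (rk q))%nat. intros q' [<- | H]. lia. specialize (HN q' H). lia. }
  destruct X as [N HN]. exists N. intros n Hn. rewrite <- Hlen.
  set (l' := filter (fun i => if Ceq_dec (Al i) p then true else false) (seq 0 n)).
  assert (Nd' : NoDup (map ix l')).
  { apply Injective_map_NoDup. intros x y Hxy. rewrite <- (rk_ix x), <- (rk_ix y). congruence. apply NoDup_filter, seq_NoDup. }
  rewrite <- (length_map ix l'). apply Nat.le_antisymm.
  - apply NoDup_incl_length; auto. intros q Hq. apply in_map_iff in Hq. destruct Hq as [i [<- Hi]]. apply filter_In in Hi. destruct Hi as [_ Hi].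
    apply Hin. unfold al in Hi. destruct (Ceq_dec (a (ix i)) p); auto. discriminate.
  - apply NoDup_incl_length; auto. intros q Hq. apply in_map_iff. exists (rk q). split. apply ix_rk.
    apply filter_In. split. apply in_seq. specialize (HN q Hq). lia. unfold al. rewrite ix_rk. apply Hin in Hq. destruct (Ceq_dec (a q) p); auto.
Qed.

Lemma pprod_fac_split p z n : pprod (fun k => fac (Al k) z) n =
  ((z - p) ^ length (filter (fun i => if Ceq_dec (Al i) p then true else false) (seq 0 n)) * pprod (fun k => fac_off p (Al k) z) n)%C.
Proof.
  induction n. simpl. ring.
  rewrite seq_S, filter_app, length_app. simpl. rewrite IHn, (fac_split (Al n) p z) by apply Ha0.
  destruct (Ceq_dec (Al n) p); simpl; rewrite Cpow_add_r; simpl; ring.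
Qed.

Definition fac_partial' (n : nat) (z : C) : C :=
  (fix d (n : nat) : C := match n with O => 0%C | S m => (d m * fac (Al m) z + pprod (fun k => fac (Al k) z) m * fac' (Al m) z)%C end) n.

Lemma fac_partial_deriv n z : cderiv (fun z => pprod (fun k => fac (Al k) z) n) z (fac_partial' n z).
Proof.
  induction n; simpl. apply cderiv_const.
  apply (cderiv_mult (fun z => pprod (fun k => fac (Al k) z) n)). exact IHn. apply fac_deriv, Ha0.
Qed.

Lemma fac_partial_logderiv n z : 0 < Im z -> fac_partial' n z = (psum (fun k => / (z - Al k) + / Al k) n * pprod (fun k => fac (Al k) z) n)%C.
Proof.
  intros Hz. induction n; simpl. ring. fold (fac_partial' n z). rewrite IHn.
  assert (E : fac' (Al n) z = ((/ (z - Al n) + / Al n) * fac (Al n) z)%C).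
  { assert (H1 := sub_real_neq_0 z (Al n) Hz). assert (H2 := Al_neq_0 a Ha0 n). unfold fac', fac. field. auto. }
  rewrite E. ring.
Qed.

(** For the order of a zero [p], each factor that vanishes at [p] is split into [z - p] and
    [fac_off p]; the product of the [fac_off p] converges locally uniformly and does not vanish at
    [p]. *)
Lemma canonical_product : exists P : C -> C,
  locally_uniform (fun n z => pprod (fun k => fac (Al k) z) n) P /\ entire P /\ zero_set_is P a /\
  (forall z, (forall n, z <> RtoC (a n)) -> P z <> 0%C) /\
  (forall z, 0 < Im z -> cderiv P z (Qf a z * P z)%C).
Proof.
  destruct (locally_uniform_product (fun k => fac (Al k)) (fun k => / (Al k * Al k))) as [P [HU HP0]].
  { intros; left; apply inv_al_sq_pos; auto. } { apply (Qf_summable a gam b); auto. } { apply fac_uniform. }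
  assert (HEn : forall n, entire (fun z => pprod (fun k => fac (Al k) z) n)) by (intros; apply entire_pprod; intros; apply entire_fac, Ha0).
  exists P. split; [|split; [|split; [|split]]]; auto.
  - apply (locally_uniform_entire _ _ HEn HU).
  - intros p k Hk. destruct (partial_zero_count p k Hk) as [N HN].
    destruct (locally_uniform_product (fun k => fac_off p (Al k)) (fun k => / (Al k * Al k))) as [h [HUh Hh0]].
    { intros; left; apply inv_al_sq_pos; auto. } { apply (Qf_summable a gam b); auto. } { apply fac_off_uniform. }
    exists h. split; [|split].
    + apply (locally_uniform_entire (fun n z => pprod (fun k => fac_off p (Al k) z) n)); auto. intros; apply entire_pprod; intros; apply entire_fac_off, Ha0.
    + apply Hh0. intros; apply fac_off_neq_0, Ha0.
    + intros w. apply (Clim_unique (fun n => pprod (fun k => fac (Al k) w) n)).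
      apply (locally_uniform_pointwise (fun n w => pprod (fun k => fac (Al k) w) n)); auto.
      apply (Clim_ext_ge (fun n => (w - p) ^ k * pprod (fun k => fac_off p (Al k) w) n)%C _ _ N).
      * intros n Hn. rewrite (pprod_fac_split p), HN; auto.
      * apply Clim_scal. apply (locally_uniform_pointwise (fun n w => pprod (fun k => fac_off p (Al k) w) n)); auto.
  - intros z Hz. apply HP0. intros k. apply fac_neq_0. apply Ha0. apply Hz.
  - intros z Hz. destruct (locally_uniform_limit _ fac_partial' P HEn fac_partial_deriv HU) as [P' [HP' HL]].
    assert (E : P' z = (Qf a z * P z)%C).
    { apply (Clim_unique _ _ _ (HL z)). apply (Clim_ext (fun n => psum (fun k => / (z - Al k) + / Al k) n * pprod (fun k => fac (Al k) z) n)%C).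
      intros; rewrite fac_partial_logderiv; auto. apply Clim_mult.
      - apply (Csum_lim _ (fun k => Cmod z * ((Cmod z + Im z) / Im z) * / (Al k * Al k))).
        intros k. apply Qf_term_bound; auto; lra. apply ex_series_scal_R, (Qf_summable a gam b); auto.
      - apply (locally_uniform_pointwise (fun n w => pprod (fun k => fac (Al k) w) n)); auto. }
    rewrite <- E. auto.
Qed.
End CanonicalProduct.

Lemma Clim_Cmod_mono u v l m : Clim u l -> Clim v m -> (forall n, Cmod (u n) <= Cmod (v n)) -> Cmod l <= Cmod m.
Proof.
  intros Hu Hv H. apply le_epsilon. intros eps He.
  destruct (Hu (eps / 2) ltac:(lra)) as [N HN]. destruct (Hv (eps / 2) ltac:(lra)) as [N' HN'].
  specialize (HN (N + N')%nat ltac:(lia)). specialize (HN' (N + N')%nat ltac:(lia)). specialize (H (N + N')%nat).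
  rewrite Cmod_sub_sym in HN. generalize (Cmod_triangle_sub l (u (N + N')%nat)) (Cmod_triangle_sub (v (N + N')%nat) m). lra.
Qed.

(** [cexp (v x)] stays in the right half-plane, so [Im (v x)] can never reach [PI / 2] or [- PI / 2]. *)
Lemma log_bound (v : R -> C) : (forall t, rcont v t) -> v 0 = 0%C -> (forall x, Cmod (cexp (v x) - 1) <= 1 / 4) ->
  forall x, Cmod (v x) <= 3.
Proof.
  intros Hc H0 Hv x. assert (P := PI2_1). assert (P4 := PI_4).
  assert (Ho : forall y, Im (v y) <> PI / 2 /\ Im (v y) <> - (PI / 2)).
  { intros y. assert (Hy := Hv y). assert (Q := re_le_Cmod (cexp (v y) - 1)%C).
    unfold Cminus in Q at 1. rewrite re_plus, re_opp, re_RtoC in Q.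
    assert (Hn : Re (cexp (v y)) <> 0). { intros E. rewrite E, Rplus_0_l, Rabs_Ropp, Rabs_R1 in Q. lra. }
    split; intros E; apply Hn; unfold cexp; simpl; rewrite E.
    rewrite cos_PI2. ring. rewrite cos_neg, cos_PI2. ring. }
  assert (Hi : forall y, Rabs (Im (v y)) < PI / 2).
  { intros y. apply Rnot_le_lt. intros Hle.
    assert (Ic : continuity (fun t => Im (v t))). { intros t. apply continuity_pt_filterlim. apply (rcont_Im v). auto. }
    assert (I0 : Im (v 0) = 0) by (rewrite H0; reflexivity).
    assert (Cs : PI / 2 <= Im (v y) \/ Im (v y) <= - (PI / 2)).
    { unfold Rabs in Hle. destruct (Rcase_abs (Im (v y))); [right|left]; lra. }
    destruct Cs as [Hg | Hg].
    - destruct (IVT_gen (fun t => Im (v t)) 0 y (PI / 2)) as [c [_ Hcc]]; auto. rewrite I0, Rmin_left, Rmax_right; lra. destruct (Ho c); auto.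
    - destruct (IVT_gen (fun t => Im (v t)) 0 y (- (PI / 2))) as [c [_ Hcc]]; auto. rewrite I0, Rmin_right, Rmax_left; lra. destruct (Ho c); auto. }
  specialize (Hi x). specialize (Hv x).
  assert (T1 := Cmod_triangle_sub (cexp (v x)) 1). assert (T2 := Cmod_triangle_sub 1 (cexp (v x))).
  rewrite Cmod_1, Cmod_cexp in *. rewrite Cmod_sub_sym in T2.
  assert (Rabs (Re (v x)) <= 1).
  { apply Rabs_le. split; apply Rnot_lt_le; intros Hl.
    - assert (exp (Re (v x)) < exp (- (1))) by (apply exp_increasing; lra). rewrite exp_Ropp in H.
      assert (E := exp_ineq1_le 1). assert (/ exp 1 <= / 2) by (apply Rinv_le_contravar; lra). lra.
    - assert (E := exp_ineq1_le (Re (v x))). lra. }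
  generalize (Cmod_le_abs (v x)). lra.
Qed.

(** * The line [Im z = 1] and the growth of the canonical product *)

Section Equivalence.
Variables (a : Z -> R) (gam : nat -> R) (b : nat -> C).
Hypothesis Ha_mono : forall n : Z, a n <= a (n + 1)%Z.
Hypothesis Ha_pinf : forall M : R, exists n0 : Z, forall n : Z, (n0 <= n)%Z -> M < a n.
Hypothesis Ha_minf : forall M : R, exists n0 : Z, forall n : Z, (n <= n0)%Z -> a n < M.
Hypothesis Ha0 : forall n : Z, a n <> 0.
Hypothesis Hmuhat : tempered_B gam b.
Hypothesis HF : fourier_pair a gam b.

Local Notation Al := (al a).
Local Notation Bp := (bp gam b).
Local Notation Gp := (gp gam).
Local Notation G := (Gf gam b).

Definition primitive_bounded : Prop := exists M, forall x : R, Cmod (G (x, 1)) <= M.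

Definition line_weight k := Cmod (Bp k) * (Gp k ^ 0 * exp (- (2 * PI * 1) * Gp k)).

(** For [0 < gam k < 1] the two terms differ by the factor [exp (- 2 pi gam k) - 1], of order
    [gam k], and [exp (2 pi)] compensates the weight. For [gam k >= 1] the term of [Gf] is itself at
    most twice the weight. *)
Lemma g_term_close x k : Cmod (Bp k / Gp k * (wave (Gp k) (x, 1)%R - wave (Gp k) Ci) - g_term gam b x k) <= (4 * PI * exp (2 * PI) + 2) * line_weight k.
Proof.
  assert (P := PI2_1). assert (PE := exp_pos (2 * PI)). unfold line_weight, bp, gp, g_term. rewrite pow_O, Rmult_1_l.
  destruct (Rlt_dec 0 (gam k)) as [Hg | Hg].
  2: { replace (0 / 1 * (wave 1 (x, 1)%R - wave 1 Ci) - 0)%C with (RtoC 0). rewrite Cmod_0, Rmult_0_l. lra. field. }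
  assert (Hgc : RtoC (gam k) <> 0%C) by (intros E; apply RtoC_inj in E; lra).
  set (e := cexp (0, 2 * PI * gam k * x)%R).
  assert (W1 : wave (gam k) (x, 1)%R = (RtoC (exp (- (2 * PI * 1) * gam k)) * e)%C).
  { unfold wave, e. unfold cexp at 1. rewrite re_scal_l, im_scal_l, freq_Re, freq_Im. change (Re (x, 1)) with x. change (Im (x, 1)) with 1.
    unfold cexp; simpl Re; simpl Im. rewrite exp_0. apply C_ext.
    - rewrite re_scal_l. simpl Re. rewrite Rmult_1_l. f_equal; f_equal; ring.
    - rewrite im_scal_l. simpl Im. rewrite Rmult_1_l. f_equal; f_equal; ring. }
  assert (W2 : wave (gam k) Ci = RtoC (exp (- (2 * PI * 1) * gam k))).
  { unfold wave. unfold cexp. rewrite re_scal_l, im_scal_l, freq_Re, freq_Im. change (Re Ci) with 0. change (Im Ci) with 1.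
    rewrite !Rmult_0_r, cos_0, sin_0. apply C_ext; simpl Re; simpl Im. rewrite Rmult_1_r. f_equal; ring. ring. }
  rewrite W1, W2. set (q := exp (- (2 * PI * 1) * gam k)).
  assert (Hq : 0 < q) by apply exp_pos. assert (Pb := Cmod_ge_0 (b k)).
  assert (He : Cmod (e - 1) <= 2). { eapply Rle_trans; [apply Cmod_minus_le|]. unfold e. rewrite Cmod_cexp. simpl Re. rewrite exp_0, Cmod_1. lra. }
  destruct (Rlt_dec (gam k) 1) as [H1 | H1].
  - fold e. replace (b k / gam k * (q * e - q) - b k * (e - 1) / gam k)%C with (b k / gam k * (RtoC (q - 1) * (e - 1)))%C.
    2: { rewrite RtoC_minus. field. auto. }
    rewrite !Cmod_mult, Cmod_div, (Cmod_RtoC_nonneg (gam k)), Cmod_R by (auto; lra).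
    assert (Q1 : Rabs (q - 1) <= 2 * PI * gam k).
    { assert (E := exp_ineq1_le (- (2 * PI * 1) * gam k)). fold q in E.
      assert (q <= 1). { unfold q. apply Rle_trans with (exp 0). apply exp_le. assert (0 < PI * gam k) by (apply Rmult_lt_0_compat; lra). lra. rewrite exp_0; lra. }
      apply Rabs_le. lra. }
    assert (Q2 : 1 <= exp (2 * PI) * q).
    { unfold q. rewrite <- exp_plus. rewrite <- exp_0 at 1. apply exp_le. nra. }
    apply Rle_trans with (Cmod (b k) / gam k * (2 * PI * gam k * 2)).
    + apply Rmult_le_compat_l. apply Rmult_le_pos; auto. left; apply Rinv_0_lt_compat; auto. apply Rmult_le_compat; auto. apply Rabs_pos. apply Cmod_ge_0.
    + replace (Cmod (b k) / gam k * (2 * PI * gam k * 2)) with (Cmod (b k) * (4 * PI)) by (field; lra).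
      replace ((4 * PI * exp (2 * PI) + 2) * (Cmod (b k) * q)) with (Cmod (b k) * (4 * PI * (exp (2 * PI) * q) + 2 * q)) by ring.
      apply Rmult_le_compat_l; auto. nra.
  - replace (b k / gam k * (q * e - q) - 0)%C with (b k / gam k * (q * (e - 1)))%C by ring.
    rewrite !Cmod_mult, Cmod_div, (Cmod_RtoC_nonneg q), (Cmod_RtoC_nonneg (gam k)) by (auto; lra).
    assert (/ gam k <= 1) by (rewrite <- Rinv_1; apply Rinv_le_contravar; lra). assert (0 < / gam k) by (apply Rinv_0_lt_compat; auto).
    apply Rle_trans with (Cmod (b k) * (q * 2)).
    + unfold Rdiv. rewrite Rmult_assoc. apply Rmult_le_compat_l; auto. rewrite <- (Rmult_1_l (q * 2)). assert (Pe := Cmod_ge_0 (e - 1)). apply Rmult_le_compat; auto; try nra.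
    + replace ((4 * PI * exp (2 * PI) + 2) * (Cmod (b k) * q)) with (Cmod (b k) * (q * 2) + 4 * PI * exp (2 * PI) * (Cmod (b k) * q)) by ring.
      assert (0 <= 4 * PI * exp (2 * PI) * (Cmod (b k) * q)) by (apply Rmult_le_pos; nra). lra.
Qed.

Lemma g_bounded_iff : g_bounded gam b <-> primitive_bounded.
Proof.
  assert (P := PI2_1). set (K := 4 * PI * exp (2 * PI) + 2).
  assert (HSW : ex_series line_weight) by (apply spectral_weight; auto; lra).
  assert (PSW : forall k, 0 <= line_weight k). { intros k. apply Rmult_le_pos. apply Cmod_ge_0. rewrite pow_O, Rmult_1_l. left; apply exp_pos. }
  assert (GB : forall x k, Cmod (Bp k / Gp k * (wave (Gp k) (x, 1)%R - wave (Gp k) Ci)) <= 2 * PI * Rabs x * line_weight k).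
  { intros x k. replace (Rabs x) with (Cmod ((x, 1)%R - Ci)). apply (Gf_term_bound gam b 1); simpl; lra.
    replace ((x, 1)%R - Ci)%C with (RtoC x) by (apply C_ext; simpl; ring). apply Cmod_R. }
  assert (gB : forall x k, Cmod (g_term gam b x k) <= (2 * PI * Rabs x + K) * line_weight k).
  { intros x k. generalize (Cmod_triangle_sub (g_term gam b x k) (Bp k / Gp k * (wave (Gp k) (x, 1)%R - wave (Gp k) Ci))).
    rewrite (Cmod_sub_sym (g_term gam b x k)). generalize (g_term_close x k) (GB x k). fold K. lra. }
  assert (D : forall x, Cmod (G (x, 1) - Csum (g_term gam b x)) <= K * Series line_weight).
  { intros x. unfold Gf. rewrite <- (Csum_minus _ _ (fun k => 2 * PI * Rabs x * line_weight k) (fun k => (2 * PI * Rabs x + K) * line_weight k)); auto; try (apply ex_series_scal_R; auto).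
    rewrite <- Series_scal_l. apply Csum_le. intros; apply g_term_close. apply ex_series_scal_R; auto. }
  assert (L : forall x, is_series (K := R_AbsRing) (V := C_R_NormedModule) (g_term gam b x) (Csum (g_term gam b x))).
  { intros x. apply is_series_Clim. apply (Csum_lim _ (fun k => (2 * PI * Rabs x + K) * line_weight k)); auto. apply ex_series_scal_R; auto. }
  split.
  - intros [M HM]. exists (M + K * Series line_weight). intros x. destruct (HM x) as [s [Hs Hsb]].
    apply is_series_Clim in Hs. apply Clim_Csum in Hs. rewrite <- Hs in Hsb.
    generalize (Cmod_triangle_sub (G (x, 1)) (Csum (g_term gam b x))) (D x). lra.
  - intros [M HM]. exists (M + K * Series line_weight). intros x. exists (Csum (g_term gam b x)). split; auto.
    generalize (Cmod_triangle_sub (Csum (g_term gam b x)) (G (x, 1))) (D x) (HM x). rewrite (Cmod_sub_sym (Csum _)). lra.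
Qed.

Variables (P : C -> C) (c0 : C).
Hypothesis HU : locally_uniform (fun n z => pprod (fun k => fac (Al k) z) n) P.
Hypothesis HPE : entire P.
Hypothesis HPZ : zero_set_is P a.
Hypothesis HPnz : forall z, (forall n, z <> RtoC (a n)) -> P z <> 0%C.
Hypothesis HPQ : forall z, 0 < Im z -> cderiv P z (Qf a z * P z)%C.
Hypothesis HQ : forall z, 0 < Im z -> Qf a z = (c0 - 2 * PI * Ci * Ef gam b z)%C.

Lemma P_neq_0 z : Im z <> 0 -> P z <> 0%C.
Proof. intros Hz. apply HPnz. intros n E. apply Hz. rewrite E. reflexivity. Qed.

Lemma P_formula z : 0 < Im z -> P z = (P Ci * cexp (c0 * (z - Ci) - G z))%C.
Proof.
  intros Hz.
  assert (E : (P z * cexp (- (c0 * (z - Ci) - G z)) = P Ci * cexp (- (c0 * (Ci - Ci) - G Ci)))%C).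
  { apply (half_plane_const (fun z => P z * cexp (- (c0 * (z - Ci) - G z)))%C); auto. 2: simpl; lra.
    intros u Hu. eapply cderiv_eq.
    2: { apply cderiv_mult. apply HPQ; auto. apply (cderiv_comp cexp (fun z => - (c0 * (z - Ci) - G z))%C). apply cderiv_cexp.
      apply cderiv_opp, cderiv_minus. apply cderiv_scal, cderiv_minus. apply cderiv_id. apply cderiv_const. apply Gf_deriv; auto. }
    cbv beta. rewrite HQ by auto. ring. }
  rewrite Gf_Ci in E. replace (- (c0 * (Ci - Ci) - 0))%C with (RtoC 0) in E by ring. rewrite cexp_0, Cmult_1_r in E.
  rewrite <- E. rewrite cexp_neg. field. apply cexp_neq_0.
Qed.

Lemma P_mono t y y' : Rabs y <= Rabs y' -> Cmod (P (t, y)) <= Cmod (P (t, y')).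
Proof.
  intros Hy. apply (Clim_Cmod_mono (fun n => pprod (fun k => fac (Al k) (t, y)) n) (fun n => pprod (fun k => fac (Al k) (t, y')) n)).
  apply (locally_uniform_pointwise _ P (t, y) HU). apply (locally_uniform_pointwise _ P (t, y') HU).
  induction n; simpl. lra. rewrite !Cmod_mult. apply Rmult_le_compat; try apply Cmod_ge_0; auto. apply Cmod_fac_mono; auto. apply Ha0.
Qed.

Lemma P_conj z : P (Cconj z) = Cconj (P z).
Proof.
  apply (Clim_unique (fun n => pprod (fun k => fac (Al k) (Cconj z)) n)).
  apply (locally_uniform_pointwise _ P _ HU).
  assert (L := locally_uniform_pointwise _ P z HU).
  intros eps He. destruct (L eps He) as [N HN]. exists N. intros n Hn. specialize (HN n Hn).
  assert (E : pprod (fun k => fac (Al k) (Cconj z)) n = Cconj (pprod (fun k => fac (Al k) z) n)).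
  { clear - Ha0. induction n; simpl. apply C_ext; simpl; ring. rewrite IHn, fac_conj, Cmult_conj by apply Ha0. auto. }
  rewrite E, <- Cminus_conj, Cmod_conj. auto.
Qed.

(** For [Im z >= 1] the exponent in [P_formula] is Lipschitz, hence at most linear, and this gives
    both bounds; conjugation covers the lower half-plane. *)
Lemma P_size : exists B, 0 <= B /\ forall z, 1 <= Rabs (Im z) ->
  Cmod (P Ci) * exp (- (B * (Cmod z + 1))) <= Cmod (P z) <= Cmod (P Ci) * exp (B * (Cmod z + 1)).
Proof.
  destruct (Gf_lipschitz gam b Hmuhat 1 Rlt_0_1) as [K [HK HL]].
  exists (Cmod c0 + K). assert (Pc := Cmod_ge_0 c0). split. lra.
  assert (Up : forall z, 1 <= Im z -> Cmod (P Ci) * exp (- ((Cmod c0 + K) * (Cmod z + 1))) <= Cmod (P z) <= Cmod (P Ci) * exp ((Cmod c0 + K) * (Cmod z + 1))).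
  { intros z Hz. rewrite (P_formula z) by lra. rewrite Cmod_mult, Cmod_cexp.
    assert (Hr : Rabs (Re (c0 * (z - Ci) - G z)) <= (Cmod c0 + K) * (Cmod z + 1)).
    { eapply Rle_trans; [apply re_le_Cmod|]. eapply Rle_trans; [apply Cmod_minus_le|]. rewrite Cmod_mult.
      assert (Hg := HL z Ci Hz ltac:(simpl; lra)). rewrite Gf_Ci in Hg. replace (G z - 0)%C with (G z) in Hg by ring.
      assert (T := Cmod_minus_le z Ci). rewrite Cmod_Ci in T. nra. }
    apply Rabs_le_between in Hr. split; (apply Rmult_le_compat_l; [apply Cmod_ge_0|apply exp_le; lra]). }
  intros z Hz. destruct (Rle_dec 0 (Im z)) as [Hp | Hp].
  - rewrite Rabs_pos_eq in Hz by lra. apply Up; auto.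
  - rewrite Rabs_left in Hz by lra. specialize (Up (Cconj z)). rewrite im_conj, Cmod_conj, P_conj, Cmod_conj in Up. apply Up; auto.
Qed.

Lemma P_exponential_type : exponential_type P.
Proof.
  destruct P_size as [B [HB H]]. assert (Pp := Cmod_ge_0 (P Ci)).
  exists (Cmod (P Ci) * exp (2 * B)), B. intros z. rewrite Rmult_assoc, <- exp_plus.
  destruct (Rle_dec 1 (Rabs (Im z))) as [Hz | Hz].
  - eapply Rle_trans; [apply H; auto|]. apply Rmult_le_compat_l; auto. apply exp_le. nra.
  - destruct z as [t y]. simpl in Hz. eapply Rle_trans; [apply (P_mono t y 1); rewrite Rabs_R1; lra|].
    eapply Rle_trans; [apply (H (t, 1)); simpl; rewrite Rabs_R1; lra|]. apply Rmult_le_compat_l; auto. apply exp_le.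
    assert (Cmod (t, 1) <= Cmod (t, y) + 1).
    { assert (Q := Cmod_le_abs (t, 1)). assert (Q2 := re_le_Cmod (t, y)). simpl Re in *. simpl Im in *. rewrite Rabs_R1 in Q. lra. }
    nra.
Qed.

(** * From an almost periodic function to boundedness of the primitive *)

Section Forward.
Variable F : C -> C.
Hypothesis HFE : entire F.
Hypothesis HFap : almost_periodic F.
Hypothesis HFexp : exponential_type F.
Hypothesis HFZ : zero_set_is F a.

(** At every point the number of indices fixes a common order [k] of [F] and [P]. The quotient of
    the cofactors defines [H] there, and nearby it agrees with [F / P]. *)
Lemma quotient_entire : exists H, entire H /\ (forall z, H z <> 0%C) /\ forall z, F z = (H z * P z)%C.
Proof.
  assert (X : forall z, exists v, exists (k : nat) h1 h2, entire h1 /\ entire h2 /\ h1 z <> 0%C /\ h2 z <> 0%C /\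
    (forall w, F w = ((w - z) ^ k * h1 w)%C) /\ (forall w, P w = ((w - z) ^ k * h2 w)%C) /\ v = (h1 z / h2 z)%C).
  { intros z. destruct (seq_count_exists a Ha_pinf Ha_minf z) as [k Hk].
    destruct (HFZ z k Hk) as [h1 [E1 [N1 Q1]]]. destruct (HPZ z k Hk) as [h2 [E2 [N2 Q2]]].
    exists (h1 z / h2 z)%C, k, h1, h2. repeat split; auto. }
  apply choice in X. destruct X as [H HH]. exists H.
  assert (Hoff : forall w, P w <> 0%C -> H w = (F w / P w)%C).
  { intros w Hw. destruct (HH w) as [k [h1 [h2 [E1 [E2 [N1 [N2 [Q1 [Q2 Ev]]]]]]]]].
    destruct k as [|k].
    - rewrite Ev, (Q1 w), (Q2 w). simpl. field. auto.
    - exfalso. apply Hw. rewrite Q2. rewrite Cpow_S. ring. }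
  split; [|split].
  - intros z. destruct (HH z) as [k [h1 [h2 [E1 [E2 [N1 [N2 [Q1 [Q2 Ev]]]]]]]]].
    assert (Hc := entire_cont h2 E2 z). apply entire_iff in E1, E2. destruct E1 as [h1' D1]. destruct E2 as [h2' D2].
    destruct (Hc (Cmod (h2 z)) ltac:(apply Cmod_gt_0; auto)) as [r [Hr Hrb]].
    eexists. apply cderiv_is_derive. apply (cderiv_ext_near (fun w => h1 w * / h2 w)%C H z _ r Hr).
    2: apply cderiv_mult; [apply D1|apply cderiv_inv; auto; apply D2].
    intros w Hw. destruct (Ceq_dec w z) as [-> | Hne]. rewrite Ev. reflexivity.
    assert (Hh2 : h2 w <> 0%C).
    { intros E. specialize (Hrb (w - z)%C Hw). replace (z + (w - z))%C with w in Hrb by ring. rewrite E in Hrb.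
      replace (0 - h2 z)%C with (- h2 z)%C in Hrb by ring. rewrite Cmod_opp in Hrb. lra. }
    assert (Hwz : ((w - z) ^ k)%C <> 0%C) by (apply Cpow_nz, Cminus_eq_contra; auto).
    assert (HPw : P w <> 0%C) by (rewrite Q2; apply Cmult_neq_0; auto).
    rewrite Hoff, Q1, Q2 by auto. field. auto.
  - intros z. destruct (HH z) as [k [h1 [h2 [E1 [E2 [N1 [N2 [Q1 [Q2 Ev]]]]]]]]]. rewrite Ev.
    apply Cmult_neq_0; auto. intros E. apply N2. rewrite <- (Cmult_1_l (h2 z)), <- (Cinv_l (h2 z)) at 1 by auto. rewrite E. ring.
  - intros z. destruct (Ceq_dec (P z) 0) as [E | E].
    + destruct (HH z) as [k [h1 [h2 [E1 [E2 [N1 [N2 [Q1 [Q2 Ev]]]]]]]]]. rewrite Q1, Q2, Ev. field. auto.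
    + rewrite Hoff by auto. field. auto.
Qed.

(** A pigeonhole argument on the midpoints of [S K] equal cells of [[x, x + 1]]. If each were within
    half a cell of a zero, these zeros would have increasing indices, and more than [K] steps of the
    enumeration would fit into a length below [1], against [spacing]. *)
Lemma gap_points : exists eta, 0 < eta /\ forall x, exists t, x <= t <= x + 1 /\ forall n, eta <= Rabs (t - a n).
Proof.
  destruct (spacing a gam b) as [K [HK Hsp]]; auto.
  set (q := INR (S K)). assert (Hq : 1 <= q) by (unfold q; rewrite S_INR; generalize (pos_INR K); lra).
  exists (/ (2 * q)). split. apply Rinv_0_lt_compat; lra. intros x.
  apply NNPP. intros Hn.
  set (p := fun i : nat => x + (2 * INR i + 1) / (2 * q)).
  assert (Hp : forall i, (i <= K)%nat -> exists n, Rabs (p i - a n) < / (2 * q)).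
  { intros i Hi. apply NNPP. intros Hc. apply Hn. exists (p i). split.
    - unfold p. assert (0 <= (2 * INR i + 1) / (2 * q)). { apply Rmult_le_pos. generalize (pos_INR i); lra. left; apply Rinv_0_lt_compat; lra. }
      split. lra. apply Rplus_le_compat_l. apply (Rle_div_l (2 * INR i + 1)). lra. apply le_INR in Hi. unfold q. rewrite S_INR. lra.
    - intros n. apply Rnot_lt_le. intros Hl. apply Hc. exists n. auto. }
  assert (X : forall i, (i <= K)%nat -> exists j0 j, Rabs (p 0%nat - a j0) < / (2 * q) /\ Rabs (p i - a j) < / (2 * q) /\ (j0 + Z.of_nat i <= j)%Z).
  { induction i as [|i IH]; intros Hi.
    - destruct (Hp 0%nat Hi) as [j Hj]. exists j, j. repeat split; auto. lia.
    - destruct (IH ltac:(lia)) as [j0 [j [H0 [H1 H2]]]]. destruct (Hp (S i) Hi) as [j' Hj']. exists j0, j'. repeat split; auto.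
      assert (a j < a j').
      { apply Rabs_lt_between in H1, Hj'.
        assert (p (S i) = p i + 2 * / (2 * q)) by (unfold p; rewrite S_INR; field; lra). lra. }
      assert (j < j')%Z. { apply Z.nle_gt. intros Hle. apply (a_mono a Ha_mono) in Hle. lra. } lia. }
  destruct (X K (le_n K)) as [j0 [j [H0 [H1 H2]]]]. apply (a_mono a Ha_mono) in H2. specialize (Hsp j0).
  apply Rabs_lt_between in H0, H1. unfold p in H0, H1. simpl INR in H0.
  assert ((2 * INR K + 1) / (2 * q) = 1 - / (2 * q)) by (unfold q; rewrite S_INR; field; generalize (pos_INR K); lra).
  assert ((2 * 0 + 1) / (2 * q) = / (2 * q)) by (field; lra). lra.
Qed.

Lemma Im_Qf_term (x : R) k : Im (/ ((x, 1)%R - Al k) + / Al k)%C = - / (1 + (x - Al k) * (x - Al k)).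
Proof.
  assert (Ha := Ha0 (ix k)). fold (al a k) in Ha. assert (0 < 1 + (x - Al k) * (x - Al k)) by (generalize (Rle_0_sqr (x - Al k)); unfold Rsqr; lra).
  rewrite im_plus. simpl. field. repeat split; nra.
Qed.

Lemma Re_Qf_term (x : R) k : Re (/ ((x, 1)%R - Al k) + / Al k)%C = (x - Al k) / (1 + (x - Al k) * (x - Al k)) + / Al k.
Proof.
  assert (Ha := Ha0 (ix k)). fold (al a k) in Ha. assert (0 < 1 + (x - Al k) * (x - Al k)) by (generalize (Rle_0_sqr (x - Al k)); unfold Rsqr; lra).
  rewrite re_plus. simpl. field. repeat split; nra.
Qed.

Lemma Qf_dom (z : C) : 0 < Im z -> forall k, Cmod (/ (z - Al k) + / Al k) <= Cmod z * ((Cmod z + Im z) / Im z) * / (Al k * Al k).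
Proof. intros Hz k. apply Qf_term_bound; auto; lra. Qed.

(** The imaginary part of [1 / (x + i - a_n)] is minus a Poisson kernel, and the real correction
    [1 / a_n] drops out; bounds for [Qf] on the line therefore control the zeros near [x]. *)
Lemma density_series (x : R) : ex_series (fun k => / (1 + (x - Al k) * (x - Al k))) /\ Series (fun k => / (1 + (x - Al k) * (x - Al k))) = - Im (Qf a (x, 1)).
Proof.
  assert (HS := Qf_summable a gam b Ha_mono Ha0 Hmuhat HF).
  assert (L := Csum_lim _ _ (Qf_dom (x, 1) ltac:(simpl; lra)) (ex_series_scal_R _ _ HS)). fold (Qf a (x, 1)) in L.
  assert (I : is_series (fun k => / (1 + (x - Al k) * (x - Al k))) (- Im (Qf a (x, 1)))).
  { apply rsum_is_series. intros eps He. destruct (L eps He) as [N HN]. exists N. intros n Hn. specialize (HN n Hn).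
    assert (E : rsum (fun k => / (1 + (x - Al k) * (x - Al k))) n = - Im (psum (fun k => / ((x, 1)%R - Al k) + / Al k)%C n)).
    { clear - Ha0. induction n. simpl. ring. simpl rsum. simpl psum. rewrite im_plus, Im_Qf_term, IHn. ring. }
    rewrite E. assert (Q := Im_le_Cmod (psum (fun k => / ((x, 1)%R - Al k) + / Al k)%C n - Qf a (x, 1))%C).
    unfold Cminus in Q at 1. rewrite im_plus, im_opp in Q. rewrite <- Rabs_Ropp.
    replace (- (- Im (psum (fun k => / ((x, 1)%R - Al k) + / Al k)%C n) - - Im (Qf a (x, 1)))) with (Im (psum (fun k => / ((x, 1)%R - Al k) + / Al k)%C n) + - Im (Qf a (x, 1))) by ring. lra. }
  split. eexists; apply I. apply is_series_unique, I.
Qed.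

Lemma Qf_line_bound : exists B, 0 <= B /\ forall x : R, Cmod (Qf a (x, 1)) <= B.
Proof.
  set (S := Series line_weight). assert (P1 := PI2_1).
  assert (HS : forall x : R, Cmod (Ef gam b (x, 1)) <= S). { intros x. apply (Ef_bound gam b Hmuhat 1); simpl; lra. }
  assert (HS0 : 0 <= S) by (eapply Rle_trans; [apply Cmod_ge_0|apply (HS 0)]).
  exists (Cmod c0 + 2 * PI * S). split. { generalize (Cmod_ge_0 c0); intros; nra. }
  intros x. rewrite HQ by (simpl; lra). eapply Rle_trans; [apply Cmod_minus_le|]. rewrite Cmod_freq.
  apply Rplus_le_compat_l, Rmult_le_compat_l; auto. lra.
Qed.

Lemma density_bound : exists B, 0 <= B /\ forall x : R, Series (fun k => / (1 + (x - Al k) * (x - Al k))) <= B.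
Proof.
  destruct Qf_line_bound as [B [HB H]]. exists B. split; auto. intros x. destruct (density_series x) as [_ ->].
  generalize (Im_le_Cmod (Qf a (x, 1))) (Rle_abs (- Im (Qf a (x, 1)))) (H x). rewrite Rabs_Ropp. lra.
Qed.

(** The squared modulus of the factor [1 - z / x] grows by [1 + 1 / (t - x)^2] from [t] to [t + i], and these excesses are summable over the zeros [x], uniformly in [t]. *)
Lemma P_lower_gap (eta : R) : 0 < eta -> exists c, 0 < c /\ forall t y, (forall n, eta <= Rabs (t - a n)) -> c * Cmod (P (t, 1)) <= Cmod (P (t, y)).
Proof.
  intros He. destruct density_bound as [B [HB H]].
  (* This factor ensures [1 / s^2 <= q / (1 + s^2)] as soon as [|s| >= eta]. *)
  set (q := 1 + / (eta * eta)). assert (Pe : 0 < / (eta * eta)) by (apply Rinv_0_lt_compat; nra).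
  exists (exp (- (q * B))). split. apply exp_pos. intros t y Ht.
  apply Rle_trans with (Cmod (P (t, 0))). 2: apply P_mono; rewrite Rabs_R0; apply Rabs_pos.
  set (x := fun k => q * / (1 + (t - Al k) * (t - Al k))).
  assert (Px : forall k, 0 <= / (1 + (t - Al k) * (t - Al k))).
  { intros k. left; apply Rinv_0_lt_compat. generalize (Rle_0_sqr (t - Al k)); unfold Rsqr; lra. }
  assert (Tn : forall n, exp (- rsum x n) * Cmod (pprod (fun k => fac (Al k) (t, 1)) n) <= Cmod (pprod (fun k => fac (Al k) (t, 0)) n)).
  { induction n; simpl. rewrite Ropp_0, exp_0; lra.
    rewrite !Cmod_mult, Ropp_plus_distr, exp_plus.
    replace (exp (- rsum x n) * exp (- x n) * (Cmod (pprod (fun k => fac (Al k) (t, 1)%R) n) * Cmod (fac (Al n) (t, 1)%R)))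
      with ((exp (- rsum x n) * Cmod (pprod (fun k => fac (Al k) (t, 1)%R) n)) * (exp (- x n) * Cmod (fac (Al n) (t, 1)%R))) by ring.
    apply Rmult_le_compat; auto.
    - apply Rmult_le_pos. left; apply exp_pos. apply Cmod_ge_0.
    - apply Rmult_le_pos. left; apply exp_pos. apply Cmod_ge_0.
    - set (w := Al n). assert (Hw : w <> 0) by apply Ha0. assert (Hw' : RtoC w <> 0%C) by (intros E; apply RtoC_inj in E; auto).
      assert (Hgap : eta <= Rabs (t - w)) by apply Ht. set (s := t - w) in *.
      assert (Hs2 : eta * eta <= s * s). { replace (s * s) with (Rabs s * Rabs s) by (rewrite <- Rabs_mult, Rabs_pos_eq; auto; apply Rle_0_sqr). apply Rmult_le_compat; lra. }
      assert (Hs0 : 0 < s * s) by nra.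
      assert (Ef : forall y, Cmod (fac w (t, y)) * Cmod (fac w (t, y)) = (s * s + y * y) / (w * w) * (exp (t / w) * exp (t / w))).
      { intros y0. unfold fac. rewrite Cmod_mult, Cmod_cexp.
        replace (Re ((t, y0) / w)%C) with (t / w) by (simpl; field; auto).
        replace (Cmod (1 - (t, y0) / w)%C * exp (t / w) * (Cmod (1 - (t, y0) / w)%C * exp (t / w))) with (Cmod (1 - (t, y0) / w)%C * Cmod (1 - (t, y0) / w)%C * (exp (t / w) * exp (t / w))) by ring.
        f_equal. rewrite Cmod_sq. unfold s. simpl. field. auto. }
      apply Rsqr_incr_0; [|apply Rmult_le_pos; [left; apply exp_pos|apply Cmod_ge_0]|apply Cmod_ge_0]. unfold Rsqr.
      replace (exp (- x n) * Cmod (fac w (t, 1)%R) * (exp (- x n) * Cmod (fac w (t, 1)%R))) with (exp (- x n) * exp (- x n) * (Cmod (fac w (t, 1)%R) * Cmod (fac w (t, 1)%R))) by ring.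
      rewrite !Ef.
      assert (Hx : / (s * s) <= x n).
      { unfold x, q. fold w. fold s. apply Rmult_le_reg_l with (s * s); auto. rewrite Rinv_r by lra.
        replace (s * s * ((1 + / (eta * eta)) * / (1 + s * s))) with ((s * s + s * s * / (eta * eta)) / (1 + s * s)) by (field; split; nra).
        apply (Rle_div_r 1). lra. assert (1 <= s * s * / (eta * eta)). { rewrite <- (Rinv_r (eta * eta)) by nra. apply Rmult_le_compat_r; lra. } lra. }
      assert (E1 : exp (- x n) * (1 + s * s) <= s * s).
      { apply Rle_trans with (exp (- / (s * s)) * (1 + s * s)). apply Rmult_le_compat_r. lra. apply exp_le; lra.
        rewrite exp_Ropp. rewrite Rmult_comm. apply (Rle_div_l (1 + s * s)). apply exp_pos.
        assert (E := exp_ineq1_le (/ (s * s))). apply Rle_trans with (s * s * (1 + / (s * s))). right; field; nra. apply Rmult_le_compat_l; lra. }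
      assert (E2 : exp (- x n) <= 1). { rewrite <- exp_0. apply exp_le. assert (0 < / (s * s)) by (apply Rinv_0_lt_compat; auto). lra. }
      assert (E3 := exp_pos (- x n)).
      assert (E4 : exp (- x n) * exp (- x n) * (s * s + 1 * 1) <= s * s + 0 * 0) by nra.
      assert (Pw : 0 < / (w * w)) by (apply Rinv_0_lt_compat, Rsqr_pos_lt; auto). assert (Pex := exp_pos (t / w)).
      unfold Rdiv. replace (exp (- x n) * exp (- x n) * ((s * s + 1 * 1) * / (w * w) * (exp (t * / w) * exp (t * / w)))) with ((exp (- x n) * exp (- x n) * (s * s + 1 * 1)) * (/ (w * w) * (exp (t * / w) * exp (t * / w)))) by ring.
      rewrite (Rmult_assoc (s * s + 0 * 0)). apply Rmult_le_compat_r; auto. apply Rmult_le_pos. lra. unfold Rdiv in Pex. nra. }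
  assert (Bn : forall n, rsum x n <= q * B).
  { intros n. unfold x. rewrite rsum_scal. apply Rmult_le_compat_l. unfold q; lra.
    destruct (density_series t) as [Ex _]. eapply Rle_trans; [apply rsum_le_Series; auto|apply H]. }
  rewrite <- (Cmod_RtoC_nonneg (exp (- (q * B)))) by (left; apply exp_pos). rewrite <- Cmod_mult.
  apply (Clim_Cmod_mono (fun n => exp (- (q * B)) * pprod (fun k => fac (Al k) (t, 1)%R) n)%C (fun n => pprod (fun k => fac (Al k) (t, 0)) n)).
  - apply Clim_scal. apply (locally_uniform_pointwise _ P (t, 1) HU).
  - apply (locally_uniform_pointwise _ P (t, 0) HU).
  - intros n. rewrite Cmod_mult, Cmod_RtoC_nonneg by (left; apply exp_pos). eapply Rle_trans; [|apply Tn].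
    apply Rmult_le_compat_r. apply Cmod_ge_0. apply exp_le. specialize (Bn n). lra.
Qed.

(** Off the strip [|Im z| < 1] the lower bound of [P_size] suffices. A point of the strip is
    enclosed in a rectangle whose vertical sides pass through gap points, where [P_lower_gap]
    compares [P] with its size on the line [Im z = 1]. *)
Lemma quotient_exponential_type H : entire H -> (forall z, F z = (H z * P z)%C) -> exponential_type H.
Proof.
  intros HE HH. destruct HFexp as [A0 [B0 HAB]].
  destruct P_size as [B [HB HPs]]. destruct gap_points as [eta [Heta Hgap]]. destruct (P_lower_gap eta Heta) as [c [Hc HPl]].
  assert (PI0 : 0 < Cmod (P Ci)). { apply Cmod_gt_0, P_neq_0. simpl. lra. }
  set (A1 := Rabs A0). assert (0 <= A1) by apply Rabs_pos. set (B1 := Rabs B0). assert (0 <= B1) by apply Rabs_pos.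
  assert (HFb : forall z, Cmod (F z) <= A1 * exp (B1 * Cmod z)).
  { intros z. eapply Rle_trans; [apply HAB|]. apply Rle_trans with (A1 * exp (B0 * Cmod z)). apply Rmult_le_compat_r. left; apply exp_pos. apply Rle_abs.
    apply Rmult_le_compat_l; auto. apply exp_le. apply Rmult_le_compat_r. apply Cmod_ge_0. apply Rle_abs. }
  set (D := A1 / (c * Cmod (P Ci)) + A1 / Cmod (P Ci)).
  assert (Pcc : 0 < c * Cmod (P Ci)) by (apply Rmult_lt_0_compat; auto).
  assert (HD1 : A1 / Cmod (P Ci) <= D). { unfold D. assert (0 <= A1 / (c * Cmod (P Ci))) by (apply Rmult_le_pos; auto; left; apply Rinv_0_lt_compat; auto). lra. }
  assert (HD2 : A1 / (c * Cmod (P Ci)) <= D). { unfold D. assert (0 <= A1 / Cmod (P Ci)) by (apply Rmult_le_pos; auto; left; apply Rinv_0_lt_compat; auto). lra. }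
  assert (HD0 : 0 <= D). { eapply Rle_trans; [|apply HD1]. apply Rmult_le_pos; auto; left; apply Rinv_0_lt_compat; auto. }
  assert (Q : forall z c' r, 0 < c' -> A1 / c' <= D -> Cmod z <= r -> c' * exp (- (B * (r + 2))) <= Cmod (P z) -> Cmod (H z) <= D * exp ((B1 + B) * (r + 2))).
  { intros z c' r Hc' HDc Hz HPz. assert (E := exp_pos (- (B * (r + 2)))).
    assert (Pp : 0 < Cmod (P z)) by nra. specialize (HFb z). rewrite HH, Cmod_mult in HFb.
    assert (E1 : exp (B1 * Cmod z) <= exp (B1 * (r + 2))) by (apply exp_le; apply Rmult_le_compat_l; lra).
    assert (Cmod (H z) * (c' * exp (- (B * (r + 2)))) <= A1 * exp (B1 * (r + 2))).
    { apply Rle_trans with (Cmod (H z) * Cmod (P z)). apply Rmult_le_compat_l; auto. apply Cmod_ge_0. eapply Rle_trans; [apply HFb|]. apply Rmult_le_compat_l; auto. }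
    apply Rle_trans with (A1 / c' * exp ((B1 + B) * (r + 2))).
    2: apply Rmult_le_compat_r; auto; left; apply exp_pos.
    apply Rmult_le_reg_r with (c' * exp (- (B * (r + 2)))). apply Rmult_lt_0_compat; auto.
    eapply Rle_trans; [apply H2|]. right.
    replace ((B1 + B) * (r + 2)) with (B1 * (r + 2) + B * (r + 2)) by ring. rewrite exp_plus, exp_Ropp. field.
    split. apply Rgt_not_eq, exp_pos. lra. }
  assert (Hout : forall z r, 1 <= Rabs (Im z) -> Cmod z <= r -> Cmod (H z) <= D * exp ((B1 + B) * (r + 2))).
  { intros z r Hz Hr. apply (Q z (Cmod (P Ci)) r); auto. eapply Rle_trans; [|apply HPs; auto]. apply Rmult_le_compat_l. lra. apply exp_le. nra. }
  assert (Hgp : forall t y r, (forall n, eta <= Rabs (t - a n)) -> Cmod (t, y) <= r -> Cmod (H (t, y)) <= D * exp ((B1 + B) * (r + 2))).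
  { intros t y r Ht Hr. apply (Q (t, y) (c * Cmod (P Ci)) r); auto. eapply Rle_trans; [|apply HPl; auto]. rewrite Rmult_assoc. apply Rmult_le_compat_l. lra.
    eapply Rle_trans; [|apply HPs; simpl; rewrite Rabs_R1; lra]. apply Rmult_le_compat_l. lra. apply exp_le.
    assert (Cmod (t, 1) <= r + 1). { assert (Q1 := Cmod_le_abs (t, 1)). assert (Q2 := re_le_Cmod (t, y)). simpl Re in *. simpl Im in *. rewrite Rabs_R1 in Q1. lra. } nra. }
  (* The enclosing rectangle lies in the disc of radius [|z| + 3], and the bound [Q] adds [2] to the
     radius; together they give [5]. *)
  exists (D * exp ((B1 + B) * 5)), (B1 + B). intros z. rewrite Rmult_assoc, <- exp_plus.
  replace ((B1 + B) * 5 + (B1 + B) * Cmod z) with ((B1 + B) * (Cmod z + 3 + 2)) by ring.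
  destruct (Rle_dec 1 (Rabs (Im z))) as [Hz | Hz]. { apply Hout; auto; lra. }
  apply Rnot_le_lt, Rabs_lt_between in Hz.
  destruct (Hgap (Cmod z + 1)) as [t2 [Ht2 Hg2]]. destruct (Hgap (- Cmod z - 1)) as [t1 [Ht1 Hg1]].
  assert (Hre := re_le_Cmod z). apply Rabs_le_between in Hre. assert (Pz := Cmod_ge_0 z).
  apply (rectangle_max_principle H t1 t2 (-1) 1); auto; try lra.
  intros w Hwx Hwy Hbd.
  assert (Hw : Cmod w <= Cmod z + 3).
  { eapply Rle_trans; [apply Cmod_le_abs|]. assert (Rabs (Re w) <= Cmod z + 2) by (apply Rabs_le; lra). assert (Rabs (Im w) <= 1) by (apply Rabs_le; lra). lra. }
  destruct w as [t y]. simpl in Hbd, Hwx, Hwy. destruct Hbd as [-> | [-> | [-> | ->]]].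
  - apply Hgp; auto.
  - apply Hgp; auto.
  - apply Hout; auto. simpl. rewrite Rabs_left; lra.
  - apply Hout; auto. simpl. rewrite Rabs_R1; lra.
Qed.

Lemma F_formula : exists e k : C, k <> 0%C /\ forall x : R, F (x, 1) = (k * cexp (e * x - G (x, 1)%R))%C.
Proof.
  destruct quotient_entire as [H [HE [HZ HH]]].
  destruct (zero_free_exponential_type H HE HZ (quotient_exponential_type H HE HH)) as [d Hd].
  exists (d + c0)%C, (H 0 * P Ci * cexp (d * Ci))%C. split.
  - repeat apply Cmult_neq_0; auto. apply P_neq_0. simpl; lra. apply cexp_neq_0.
  - intros x. rewrite HH, Hd, P_formula by (simpl; lra).
    replace (H 0 * P Ci * cexp (d * Ci) * cexp ((d + c0) * x - G (x, 1)%R))%C with (H 0 * P Ci * (cexp (d * Ci) * cexp ((d + c0) * x - G (x, 1)%R)))%C by ring.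
    rewrite <- cexp_plus.
    replace (H 0 * cexp (d * (x, 1)%R) * (P Ci * cexp (c0 * ((x, 1)%R - Ci) - G (x, 1)%R)))%C with (H 0 * P Ci * (cexp (d * (x, 1)%R) * cexp (c0 * ((x, 1)%R - Ci) - G (x, 1)%R)))%C by ring.
    rewrite <- cexp_plus. f_equal. f_equal.
    replace ((x, 1)%R : C) with (x + Ci)%C at 1 2 by (apply C_ext; simpl; ring). ring.
Qed.

Lemma primitive_bounded_of_almost_periodic : primitive_bounded.
Proof.
  destruct F_formula as [e [k [Hk Hform]]].
  destruct (Gf_lipschitz gam b Hmuhat 1 Rlt_0_1) as [K [HK HL]].
  set (g := fun x : R => G (x, 1)).
  assert (Hg : forall x y, Cmod (g x - g y) <= K * Rabs (x - y)).
  { intros x y. unfold g. eapply Rle_trans; [apply HL; simpl; lra|]. replace ((x, 1)%R - (y, 1)%R)%C with (RtoC (x - y)) by (apply C_ext; simpl; ring). rewrite Cmod_R. lra. }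
  assert (g0 : g 0 = 0%C) by (apply (Gf_Ci gam b)).
  set (f := fun x : R => F (x, 1)). change (forall x : R, f x = (k * cexp (e * x - g x))%C) in Hform.
  assert (Hf0 : forall x, f x <> 0%C) by (intros x; rewrite Hform; apply Cmult_neq_0; auto; apply cexp_neq_0).
  assert (Hratio : forall x y, f y = (f x * cexp (e * (y - x)%R - (g y - g x)))%C).
  { intros x y. rewrite !Hform, <- Cmult_assoc, <- cexp_plus. f_equal. f_equal. rewrite RtoC_minus. ring. }
  assert (Ap : forall eps, 0 < eps -> relatively_dense (fun tau => exists M, M < eps /\ forall x, Cmod (f (x + tau)%R - f x)%C <= M)).
  { intros eps He. destruct (HFap 1 1 eps (Rle_refl _) He) as [L [HLp HLd]]. exists L. split; auto. intros u. destruct (HLd u) as [tau [[M [HM HMb]] Ht]].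
    exists tau. split; auto. exists M. split; auto. intros x. apply HMb. lra. }
  (* Within distance [L] of [x] lies an almost period [tau], where [|f tau| >= |f 0| / 2]; between
     [tau] and [x] the exponent changes by at most [(|e| + K) L]. *)
  assert (Plow : exists m, 0 < m /\ forall x, m <= Cmod (f x)).
  { assert (F0 : 0 < Cmod (f 0)) by (apply Cmod_gt_0; auto).
    destruct (Ap (Cmod (f 0) / 2) ltac:(lra)) as [L [HLp HLd]].
    exists (Cmod (f 0) / 2 * exp (- ((Cmod e + K) * L))). split. apply Rmult_lt_0_compat. lra. apply exp_pos.
    intros x. destruct (HLd x) as [tau [[M [HM HMb]] Ht]]. specialize (HMb 0). rewrite Rplus_0_l in HMb.
    assert (T := Cmod_triangle_sub (f 0) (f tau)). rewrite (Cmod_sub_sym (f 0)) in T.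
    rewrite (Hratio tau x), Cmod_mult, Cmod_cexp.
    apply Rmult_le_compat. lra. left; apply exp_pos. lra. apply exp_le.
    assert (Hr := re_le_Cmod (e * (x - tau)%R - (g x - g tau))%C). apply Rabs_le_between in Hr.
    assert (Hm := Cmod_minus_le (e * (x - tau)%R)%C (g x - g tau)%C). rewrite Cmod_mult, Cmod_R in Hm.
    specialize (Hg x tau). assert (Rabs (x - tau) <= L) by (apply Rabs_le; lra). generalize (Cmod_ge_0 e) (Rabs_pos (x - tau)); intros. nra. }
  destruct Plow as [m [Hm Hlow]].
  destruct (Ap (m / 10) ltac:(lra)) as [L [HLp HLd]].
  (* [f (x + tau) / f x] stays within [1/10] of [1], so all increments [g (x + tau) - g x] are within 3 of [g tau]; summed over
     [x = 0, tau, 2 tau, ...] this gives [g (n tau) = n g tau + O(3 n)], and [g] is sublinear. *)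
  assert (Htau : forall tau M, M < m / 10 -> (forall x, Cmod (f (x + tau)%R - f x)%C <= M) -> Cmod (g tau) <= 3).
  { intros tau M HM HMb.
    set (v := fun x : R => (g tau - (g (x + tau)%R - g x))%C).
    assert (Hv : forall x, Cmod (v x) <= 3).
    { apply log_bound.
      - intros t eps He. exists (eps / (2 * K + 1)). split. apply Rdiv_lt_0_compat; lra. intros h Hh.
        replace (v (t + h)%R - v t)%C with ((g (t + h)%R - g t) - (g (t + h + tau)%R - g (t + tau)%R))%C by (unfold v; ring).
        eapply Rle_lt_trans; [apply Cmod_minus_le|]. assert (G1 := Hg (t + h) t). assert (G2 := Hg (t + h + tau) (t + tau)).
        replace (t + h - t) with h in G1 by ring. replace (t + h + tau - (t + tau)) with h in G2 by ring.
        assert (Rabs h * (2 * K + 1) < eps). { apply Rlt_le_trans with (eps / (2 * K + 1) * (2 * K + 1)). apply Rmult_lt_compat_r; lra. right; field; lra. }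
        generalize (Rabs_pos h); intros. lra.
      - unfold v. rewrite Rplus_0_l, g0. ring.
      - intros x.
        assert (R1 : (f (x + tau)%R / f x = f tau / f 0 * cexp (v x))%C).
        { rewrite (Hratio x (x + tau)%R), (Hratio 0 tau), g0. unfold v.
          replace (x + tau - x) with tau by ring. rewrite Rminus_0_r.
          replace (f x * cexp (e * tau - (g (x + tau)%R - g x)) / f x)%C with (cexp (e * tau - (g (x + tau)%R - g x)))%C by (field; auto).
          replace (f 0 * cexp (e * tau - (g tau - 0)) / f 0)%C with (cexp (e * tau - (g tau - 0)))%C by (field; auto).
          rewrite <- cexp_plus. f_equal. ring. }
        assert (N : forall y, Cmod (f (y + tau)%R / f y - 1) <= 1 / 10).
        { intros y. replace (f (y + tau)%R / f y - 1)%C with ((f (y + tau)%R - f y) / f y)%C by (field; auto). rewrite Cmod_div by auto.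
          apply (Rle_div_l (Cmod (f (y + tau)%R - f y)%C)). apply Cmod_gt_0; auto. specialize (HMb y). specialize (Hlow y). lra. }
        assert (N0 := N 0). rewrite Rplus_0_l in N0. assert (Nx := N x). rewrite R1 in Nx.
        set (q := (f tau / f 0)%C) in *.
        assert (Hq : 9 / 10 <= Cmod q). { generalize (Cmod_triangle_sub 1 q). rewrite Cmod_1, Cmod_sub_sym. lra. }
        assert (Hd : Cmod q * Cmod (cexp (v x) - 1) <= 2 / 10).
        { rewrite <- Cmod_mult. replace (q * (cexp (v x) - 1))%C with ((q * cexp (v x) - 1) - (q - 1))%C by ring. eapply Rle_trans; [apply Cmod_minus_le|]. lra. }
        generalize (Cmod_ge_0 (cexp (v x) - 1)%C); intros. nra. }
    assert (Hn : forall n : nat, Cmod (g (INR n * tau)%R - INR n * g tau)%C <= 3 * INR n).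
    { induction n as [|n IH]. simpl INR. rewrite Rmult_0_l, g0. replace (0 - 0 * g tau)%C with (RtoC 0) by ring. rewrite Cmod_0. lra.
      rewrite S_INR, RtoC_plus. replace ((INR n + 1) * tau) with (INR n * tau + tau) by ring.
      specialize (Hv (INR n * tau)). unfold v in Hv.
      replace (g (INR n * tau + tau)%R - (INR n + 1) * g tau)%C with ((g (INR n * tau)%R - INR n * g tau) - (g tau - (g (INR n * tau + tau)%R - g (INR n * tau)%R)))%C by ring.
      eapply Rle_trans; [apply Cmod_minus_le|]. lra. }
    apply Rnot_lt_le. intros Hgt. set (del := Cmod (g tau) - 3). assert (Hdel : 0 < del) by (unfold del; lra).
    assert (Pt := Rabs_pos tau).
    destruct (Gf_sublinear gam b Hmuhat (del / (2 * (Rabs tau + 1)))) as [K1 HK1]. { apply Rdiv_lt_0_compat; lra. }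
    destruct (INR_unbounded (2 * Rabs K1 / del)) as [n Hnn].
    specialize (Hn n). specialize (HK1 (INR n * tau)). fold (g (INR n * tau)) in HK1.
    assert (Pn := pos_INR n). rewrite Rabs_mult, (Rabs_pos_eq (INR n)) in HK1 by auto.
    assert (T := Cmod_triangle_sub (INR n * g tau)%C (g (INR n * tau)%R)). rewrite Cmod_sub_sym, Cmod_mult, Cmod_RtoC_nonneg in T by auto.
    assert (Q1 : del / (2 * (Rabs tau + 1)) * (INR n * Rabs tau) <= INR n * del / 2).
    { replace (del / (2 * (Rabs tau + 1)) * (INR n * Rabs tau)) with (INR n * del / 2 * (Rabs tau / (Rabs tau + 1))) by (field; lra).
      rewrite <- (Rmult_1_r (INR n * del / 2)) at 2. apply Rmult_le_compat_l. nra. apply (Rle_div_l (Rabs tau)); lra. }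
    apply (Rlt_div_l (2 * Rabs K1)) in Hnn; auto. generalize (Rle_abs K1); intros. unfold del in *. nra. }
  exists (3 + K * L). intros x. destruct (HLd x) as [tau [[M [HM HMb]] Ht]]. specialize (Htau tau M HM HMb).
  fold (g x). generalize (Cmod_triangle_sub (g x) (g tau)) (Hg x tau). assert (Rabs (x - tau) <= L) by (apply Rabs_le; lra). intros.
  assert (K * Rabs (x - tau) <= K * L) by (apply Rmult_le_compat_l; auto). lra.
Qed.
End Forward.
End Equivalence.

(** * Almost periods *)

(** Total boundedness of the curve [x |-> (v 0 x, ..., v (n-1) x)]; the points of the net are taken in [X] so that the cells of one coordinate can be treated one after the other. *)
Lemma finite_net (v : nat -> R -> R) (theta : R) : 0 < theta -> (forall k x, Rabs (v k x) <= 1) ->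
  forall (n : nat) (X : R -> Prop), exists L, 0 <= L /\ forall x, X x -> exists t, X t /\ Rabs t <= L /\ forall k, (k < n)%nat -> Rabs (v k x - v k t) <= theta.
Proof.
  intros Ht Hv. induction n as [|n IH]; intros X.
  - destruct (classic (exists t, X t)) as [[t Xt] | N].
    + exists (Rabs t). split. apply Rabs_pos. intros x Xx. exists t. repeat split; auto. lra. intros; lia.
    + exists 0. split. lra. intros x Xx. exfalso; eauto.
  - assert (Hj : forall j : nat, exists L, 0 <= L /\ forall x, X x -> v n x < -1 + INR j * theta -> exists t, X t /\ Rabs t <= L /\ forall k, (k < S n)%nat -> Rabs (v k x - v k t) <= theta).
    { induction j as [|j [L1 [P1 H1]]].
      - exists 0. split. lra. intros x _ Hx. simpl in Hx. specialize (Hv n x). apply Rabs_le_between in Hv. lra.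
      - destruct (IH (fun x => X x /\ -1 + INR j * theta <= v n x < -1 + INR (S j) * theta)) as [L2 [P2 H2]].
        exists (Rmax L1 L2). assert (M1 := Rmax_l L1 L2). assert (M2 := Rmax_r L1 L2). split. lra. intros x Xx Hx.
        destruct (Rlt_dec (v n x) (-1 + INR j * theta)) as [Hl | Hl].
        + destruct (H1 x Xx Hl) as [t [T1 [T2 T3]]]. exists t. repeat split; auto. lra.
        + destruct (H2 x) as [t [[T1 T1'] [T2 T3]]]. split; auto. lra. exists t. repeat split; auto. lra.
          intros k Hk. destruct (Nat.eq_dec k n) as [-> | ]. 2: apply T3; lia. rewrite S_INR in *. apply Rabs_le. lra. }
    destruct (INR_unbounded (2 / theta)) as [j Hj']. destruct (Hj j) as [L [P1 H1]]. exists L. split; auto.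
    intros x Xx. apply H1; auto. apply (Rlt_div_l 2) in Hj'; auto. specialize (Hv n x). apply Rabs_le_between in Hv. lra.
Qed.

Lemma Cmod_cis_sub_1 x y : Cmod (cis (x - y) - 1) = Cmod (cis x - cis y).
Proof.
  replace (cis x - cis y)%C with (cis y * (cis (x - y) - 1))%C. rewrite Cmod_mult, Cmod_cis. ring.
  unfold cis. set (d := x - y). replace x with (y + d) by (unfold d; ring). rewrite cos_plus, sin_plus. apply C_ext; simpl; ring.
Qed.

(** If [t] in the net has nearly the same phases as [u + L], then [u + L - t] nearly preserves all
    phases, and it is close to [u] because [|t| <= L]. Even coordinates of the net carry the
    cosines, odd ones the sines. *)
Lemma common_almost_periods (om : nat -> R) (n : nat) (theta : R) : 0 < theta ->
  relatively_dense (fun tau => forall k, (k < n)%nat -> Cmod (cis (om k * tau) - 1) <= theta).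
Proof.
  intros Ht.
  destruct (finite_net (fun k x => if Nat.even k then cos (om (Nat.div2 k) * x) else sin (om (Nat.div2 k) * x)) (theta / 2) ltac:(lra)
    ltac:(intros k x; cbv beta; destruct (Nat.even k); apply Rabs_le; [apply COS_bound | apply SIN_bound]) (2 * n)%nat (fun _ => True)) as [L [HL H]].
  exists (2 * L + 1). split. lra. intros u. destruct (H (u + L) I) as [t [_ [Htl Hk]]].
  apply Rabs_le_between in Htl. exists (u + L - t). split. 2: lra.
  intros k Hkn. rewrite Rmult_minus_distr_l, Cmod_cis_sub_1. eapply Rle_trans; [apply Cmod_le_abs|].
  assert (H1 := Hk (2 * k)%nat ltac:(lia)). assert (H2 := Hk (S (2 * k))%nat ltac:(lia)). cbv beta in H1, H2.
  rewrite Nat.div2_double in H1. rewrite Nat.div2_succ_double in H2.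
  rewrite Nat.even_succ, <- Nat.negb_even in H2. rewrite Nat.even_even in H1, H2. simpl negb in H2. cbv iota in H1, H2.
  unfold cis. unfold Cminus. rewrite re_plus, im_plus, re_opp, im_opp. simpl Re. simpl Im. unfold Rminus in H1, H2. lra.
Qed.

(** Bohr's theorem on bounded primitives: if [u x2 - u x1] is almost the oscillation of [u], so is [u (x2 + t) - u (x1 + t)] for an almost period [t] of [p], hence [u] is almost minimal at [x1 + t] and almost maximal at [x2 + t]. *)
Lemma bohr_primitive (u p : R -> R) (M : R) : (forall x, is_derive u x (p x)) -> (forall x, Rabs (u x) <= M) ->
  (forall eta, 0 < eta -> relatively_dense (fun tau => forall x, Rabs (p (x + tau) - p x) <= eta)) ->
  forall eps, 0 < eps -> exists eta, 0 < eta /\ forall tau, (forall x, Rabs (p (x + tau) - p x) <= eta) -> forall x, Rabs (u (x + tau) - u x) <= eps.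
Proof.
  intros Hd HM Hap eps He.
  (* The increment [u (t + tau) - u t] has the small derivative [p (t + tau) - p t], so it varies
     little over bounded distances. *)
  assert (HL : forall eta tau x y, (forall x, Rabs (p (x + tau) - p x) <= eta) -> Rabs ((u (y + tau) - u y) - (u (x + tau) - u x)) <= eta * Rabs (y - x)).
  { intros eta tau x y Hp.
    destruct (MVT_gen (fun t => u (t + tau) - u t) x y (fun t => p (t + tau) - p t)) as [c [_ ->]].
    - intros t _. apply (is_derive_minus (fun t => u (t + tau)) u). replace (p (t + tau)) with (scal 1 (p (t + tau))) by (unfold scal; simpl; unfold mult; simpl; ring).
      apply (is_derive_comp u (fun t => t + tau)). apply Hd. auto_derive; auto. apply Hd.
    - intros t _. apply continuity_pt_minus.
      + apply (continuity_pt_comp (fun t => t + tau) u). apply continuity_pt_plus. apply continuity_pt_id. apply continuity_pt_const. intros ? ?; auto.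
        apply derivable_continuous_pt. exists (p (t + tau)). apply is_derive_Reals, Hd.
      + apply derivable_continuous_pt. exists (p t). apply is_derive_Reals, Hd.
    - rewrite Rabs_mult. apply Rmult_le_compat_r. apply Rabs_pos. apply Hp. }
  destruct (completeness (fun d => exists x y, d = u y - u x)) as [Dm [Ub Lub]].
  { exists (2 * M). intros d [x [y ->]]. assert (H1 := HM x). assert (H2 := HM y). apply Rabs_le_between in H1, H2. lra. }
  { exists (u 0 - u 0), 0, 0. auto. }
  (* Three errors of size [e] accumulate: from nearly attaining the oscillation, from the shift by
     [s], and from moving the increment to [x]. *)
  set (e := eps / 4).
  assert (X : exists x1 x2, Dm - e < u x2 - u x1).
  { apply NNPP. intros N. apply (Rlt_irrefl Dm). apply Rle_lt_trans with (Dm - e). 2: unfold e; lra. apply Lub. intros d [x [y ->]].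
    apply Rnot_lt_le. intros Hlt. apply N. eauto. }
  destruct X as [x1 [x2 Hx]]. set (d := Rabs (x2 - x1)). assert (Hd0 : 0 <= d) by apply Rabs_pos.
  destruct (Hap (e / (d + 1)) ltac:(apply Rdiv_lt_0_compat; unfold e; lra)) as [L [HLp HLd]].
  assert (Ed : e / (d + 1) * d <= e).
  { replace (e / (d + 1) * d) with (e * (d / (d + 1))) by (field; lra). rewrite <- (Rmult_1_r e) at 2. apply Rmult_le_compat_l. unfold e; lra. apply (Rle_div_l d); lra. }
  (* The shift [s] is chosen so that [x1 + s] and [x2 + s] lie within [L + d] of [x], whence moving
     the increment costs at most [e]. *)
  exists (e / (L + d + 1)). split. apply Rdiv_lt_0_compat; unfold e; lra. intros tau Htau x.
  destruct (HLd (x - x1)) as [s [Hs Hsx]].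
  assert (H1 := HL _ s x1 x2 Hs). fold d in H1.
  assert (Ed2 : forall y, Rabs (y - x) <= L + d -> e / (L + d + 1) * Rabs (y - x) <= e).
  { intros y Hy. apply Rle_trans with (e / (L + d + 1) * (L + d + 1)). apply Rmult_le_compat_l. left; apply Rdiv_lt_0_compat; unfold e; lra. lra. right; field; lra. }
  assert (A1 : Rabs (x1 + s - x) <= L + d) by (apply Rabs_le; lra).
  assert (A2 : Rabs (x2 + s - x) <= L + d).
  { replace (x2 + s - x) with ((x2 - x1) + (x1 + s - x)) by ring. eapply Rle_trans; [apply Rabs_triang|]. fold d. assert (Rabs (x1 + s - x) <= L) by (apply Rabs_le; lra). lra. }
  assert (H2 := HL _ tau x (x1 + s) Htau). assert (H3 := HL _ tau x (x2 + s) Htau).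
  specialize (Ed2 (x1 + s) A1) as E1. specialize (Ed2 (x2 + s) A2) as E2.
  assert (U1 : u (x2 + s) - u (x1 + s + tau) <= Dm) by (apply Ub; eauto).
  assert (U2 : u (x2 + s + tau) - u (x1 + s) <= Dm) by (apply Ub; eauto).
  assert (H1' := Rle_trans _ _ _ H1 Ed). assert (H2' := Rle_trans _ _ _ H2 E1). assert (H3' := Rle_trans _ _ _ H3 E2).
  apply Rabs_le_between in H1', H2', H3'. apply Rabs_le. unfold e in *. lra.
Qed.

(** * The asymptotic distribution of the zeros *)

(** The rational term cancels the [1 / t] tail of the arctangent, so the limits [PI / 2] and
    [- PI / 2] are approached within [4 / (1 + t^2)], which is summable over the zeros. Both terms
    come from [Qf] on the line: the real part of [1 / (t + i)] and a primitive of minus its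
    imaginary part. *)
Definition smooth_step (t : R) : R := atan t + t / (1 + t * t).

Lemma smooth_step_close t : 0 <= t -> Rabs (smooth_step t - PI / 2) <= 4 / (1 + t * t).
Proof.
  intros Ht. unfold smooth_step. assert (P := PI_4). assert (P1 := PI2_1).
  destruct (Rle_dec t 1) as [H1 | H1].
  - assert (A1 : 0 <= atan t). { destruct (Req_dec t 0) as [-> | ]. rewrite atan_0; lra. rewrite <- atan_0. left; apply atan_increasing. lra. }
    assert (A2 : atan t < PI / 2) by apply atan_bound.
    assert (0 <= t / (1 + t * t) <= 1). { split. apply Rmult_le_pos; auto. left; apply Rinv_0_lt_compat; nra. apply (Rle_div_l t); nra. }
    assert (2 <= 4 / (1 + t * t)). { apply (Rle_div_r 2); nra. }
    apply Rabs_le. lra.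
  - set (u := / t). assert (Hu : 0 < u < 1). { unfold u. split. apply Rinv_0_lt_compat; lra. rewrite <- Rinv_1. apply Rinv_lt_contravar; lra. }
    replace (atan t) with (PI / 2 - atan u) by (unfold u; rewrite atan_inv by lra; ring).
    replace (t / (1 + t * t)) with (u / (1 + u * u)) by (unfold u; field; split; nra).
    destruct (MVT_gen (fun s => atan s - s / (1 + s * s)) 0 u (fun s => 2 * (s * s) / ((1 + s * s) * (1 + s * s)))) as [c [Hc Eq]].
    + intros s _. auto_derive. nra. field. nra.
    + intros s _. apply continuity_pt_filterlim. apply (ex_derive_continuous (fun s => atan s - s / (1 + s * s))). auto_derive. nra.
    + rewrite atan_0 in Eq. rewrite Rmin_left, Rmax_right in Hc by lra.
      assert (Hb : 0 <= 2 * (c * c) / ((1 + c * c) * (1 + c * c)) <= 2 * (u * u)).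
      { assert (1 <= (1 + c * c) * (1 + c * c)) by nra. split. apply Rmult_le_pos. nra. left; apply Rinv_0_lt_compat; lra. apply (Rle_div_l (2 * (c * c))). lra. nra. }
      assert (Hu2 : 2 * (u * u) <= 4 / (1 + t * t)). { apply (Rle_div_r (2 * (u * u))). nra. replace (2 * (u * u) * (1 + t * t)) with (2 * (u * u) + 2) by (unfold u; field; lra). nra. }
      replace (PI / 2 - atan u + u / (1 + u * u) - PI / 2) with (- (atan u - u / (1 + u * u) - (0 - 0 / (1 + 0 * 0)))) by (field; nra).
      rewrite Eq, Rabs_Ropp. apply Rabs_le. nra.
Qed.

Lemma smooth_step_odd t : smooth_step (- t) = - smooth_step t.
Proof. unfold smooth_step. rewrite atan_opp. field. nra. Qed.

Lemma smooth_step_close_neg t : t <= 0 -> Rabs (smooth_step t + PI / 2) <= 4 / (1 + t * t).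
Proof.
  intros Ht. assert (H := smooth_step_close (- t) ltac:(lra)). rewrite smooth_step_odd in H.
  replace (- t * - t) with (t * t) in H by ring. rewrite <- Rabs_Ropp. replace (- (smooth_step t + PI / 2)) with (- smooth_step t - PI / 2) by ring. auto.
Qed.

Section Distribution.
Variables (a : Z -> R) (gam : nat -> R) (b : nat -> C).
Hypothesis Ha_mono : forall n : Z, a n <= a (n + 1)%Z.
Hypothesis Ha0 : forall n : Z, a n <> 0.
Hypothesis Hmuhat : tempered_B gam b.
Hypothesis HF : fourier_pair a gam b.
Variable c0 : C.
Hypothesis HQ : forall z, 0 < Im z -> Qf a z = (c0 - 2 * PI * Ci * Ef gam b z)%C.
Hypothesis Hbd : primitive_bounded gam b.

Local Notation Al := (al a).
Local Notation G := (Gf gam b).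
Local Notation Dn := (- Im c0).

Lemma Qf_rderiv t : rderiv (fun s => G (s, 1)%R) t (c0 - Qf a (t, 1)%R)%C.
Proof.
  assert (H1 : 0 < Im (t, 1)) by (simpl; lra).
  apply (rderiv_eq _ _ (2 * PI * Ci * Ef gam b (t, 1)%R * 1)%C). rewrite HQ by auto. ring.
  apply (rderiv_comp G (fun s : R => (s, 1)%R)). apply Gf_deriv; auto.
  intros eps He. exists 1. split. lra. intros h _. replace ((t + h, 1)%R - (t, 1)%R - 1 * h)%C with (RtoC 0) by (apply C_ext; simpl; ring).
  rewrite Cmod_0. generalize (Rabs_pos h); intros; nra.
Qed.

Lemma Qf_uniform_tail (r eps : R) : 0 < eps -> exists N, forall n t, (N <= n)%nat -> Rabs t <= r ->
  Cmod (Qf a (t, 1)%R - psum (fun k => / ((t, 1)%R - Al k) + / Al k)%C n) <= eps.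
Proof.
  intros He. set (K := (Rabs r + 1) * ((Rabs r + 1 + 1) / 1)). assert (Pr := Rabs_pos r). assert (HK : 0 < K) by (unfold K; nra).
  assert (HS := Qf_summable a gam b Ha_mono Ha0 Hmuhat HF).
  assert (Pal : forall k, 0 <= / (Al k * Al k)) by (intros k; left; apply inv_al_sq_pos; auto).
  destruct (rsum_tail (fun k => / (Al k * Al k)) (eps / K) Pal HS ltac:(apply Rdiv_lt_0_compat; auto)) as [N HN].
  exists N. intros n t Hn Ht. specialize (HN n Hn).
  eapply Rle_trans. apply (Csum_tail _ (fun k => K * / (Al k * Al k))). 2: apply ex_series_scal_R; auto.
  - intros k. apply Qf_term_bound; simpl; auto; try lra. eapply Rle_trans; [apply Cmod_le_abs|]. simpl Re. simpl Im. rewrite Rabs_R1. generalize (Rle_abs r); lra.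
  - rewrite Series_scal_l, rsum_scal, <- Rmult_minus_distr_l. apply Rle_trans with (K * (eps / K)). apply Rmult_le_compat_l; lra. right; field; lra.
Qed.

Lemma rsum_atan_deriv n t : is_derive (fun s => rsum (fun k => atan (s - Al k)) n) t (- Im (psum (fun k => / ((t, 1)%R - Al k) + / Al k)%C n)).
Proof.
  induction n; simpl rsum; simpl psum.
  - replace (- Im 0) with 0 by (simpl; ring). auto_derive; auto.
  - rewrite im_plus, Im_Qf_term by auto. set (p := Im _).
    replace (- (p + - / (1 + (t - Al n) * (t - Al n)))) with (plus (- p) (/ (1 + (t - Al n) * (t - Al n)))) by (unfold plus; simpl; ring).
    apply (is_derive_plus (fun s => rsum (fun k => atan (s - Al k)) n)). apply IHn. auto_derive. auto. field. generalize (Rle_0_sqr (t - Al n)); unfold Rsqr; intros; nra.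
Qed.

(** The arctangent sums integrate minus the imaginary part of the partial sums of [Qf], whose limit
    is [Dn] plus the derivative of [Im G]. The rational parts add up to the change of [Re Qf], in
    which the constants [1 / a_n] cancel. *)
Lemma step_sum_limit x x' eps : 0 < eps -> exists N, forall n, (N <= n)%nat ->
  Rabs (rsum (fun k => smooth_step (x' - Al k) - smooth_step (x - Al k)) n
    - (Dn * (x' - x) + Im (G (x', 1)%R - G (x, 1)%R)%C + Re (Qf a (x', 1)%R - Qf a (x, 1)%R)%C)) <= eps.
Proof.
  intros He. set (r := Rabs x + Rabs x'). set (d := Rabs (x' - x) + 2). assert (Hd : 2 <= d) by (unfold d; generalize (Rabs_pos (x' - x)); lra).
  destruct (Qf_uniform_tail r (eps / d)) as [N HN]. { apply Rdiv_lt_0_compat; lra. }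
  exists N. intros n Hn.
  set (ps := fun t : R => psum (fun k => / ((t, 1)%R - Al k) + / Al k)%C n).
  set (Psi := fun t : R => rsum (fun k => atan (t - Al k)) n - (Dn * t + Im (G (t, 1)%R))).
  assert (E : rsum (fun k => smooth_step (x' - Al k) - smooth_step (x - Al k)) n
    = rsum (fun k => atan (x' - Al k)) n - rsum (fun k => atan (x - Al k)) n + (Re (ps x') - Re (ps x))).
  { unfold ps. clear - Ha0. induction n; simpl rsum; simpl psum. simpl; ring. rewrite !(re_plus (psum _ _)), !Re_Qf_term, IHn by auto. unfold smooth_step. ring. }
  assert (DP : forall t, is_derive Psi t (Im (Qf a (t, 1)%R - ps t)%C)).
  { intros t. unfold Psi. replace (Im (Qf a (t, 1)%R - ps t)%C) with (minus (- Im (ps t)) (Dn * 1 + Im (c0 - Qf a (t, 1)%R)%C)).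
    2: { change (- Im (ps t) - (Dn * 1 + Im (c0 - Qf a (t, 1)%R)%C) = Im (Qf a (t, 1)%R - ps t)%C). unfold Cminus. rewrite !im_plus, !im_opp. ring. }
    apply (is_derive_minus (fun s => rsum (fun k => atan (s - Al k)) n)). apply rsum_atan_deriv.
    apply (is_derive_plus (fun s => Dn * s) (fun s => Im (G (s, 1)%R))). apply is_derive_scal. auto_derive; auto. apply rderiv_Im, Qf_rderiv. }
  assert (Hr : forall t, Rmin x x' <= t <= Rmax x x' -> Rabs t <= r).
  { intros t Ht. unfold r. generalize (Rle_abs x) (Rle_abs x') (Rle_abs (- x)) (Rle_abs (- x')) (Rabs_pos x) (Rabs_pos x'). rewrite !Rabs_Ropp. intros.
    apply Rabs_le. unfold Rmin, Rmax in Ht. destruct (Rle_dec x x'); lra. }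
  assert (H1 : Rabs (Psi x' - Psi x) <= eps / d * Rabs (x' - x)).
  { destruct (MVT_gen Psi x x' (fun t => Im (Qf a (t, 1)%R - ps t)%C)) as [c [Hc ->]].
    - intros; apply DP.
    - intros t _. apply derivable_continuous_pt. eexists. apply is_derive_Reals, DP.
    - rewrite Rabs_mult. apply Rmult_le_compat_r. apply Rabs_pos. eapply Rle_trans; [apply Im_le_Cmod|]. apply HN; auto. }
  assert (T1 := HN n x' Hn ltac:(apply Hr; generalize (Rmin_r x x') (Rmax_r x x'); lra)). assert (T2 := HN n x Hn ltac:(apply Hr; generalize (Rmin_l x x') (Rmax_l x x'); lra)).
  fold (ps x) in T2. fold (ps x') in T1.
  assert (R1 := Rle_trans _ _ _ (re_le_Cmod _) T1). assert (R2 := Rle_trans _ _ _ (re_le_Cmod _) T2).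
  assert (Ed : eps / d * Rabs (x' - x) + eps / d + eps / d = eps) by (unfold d; field; fold d; lra).
  rewrite E. unfold Psi in H1. unfold Cminus in R1, R2 |- *. rewrite re_plus, re_opp in R1, R2. rewrite im_plus, im_opp, re_plus, re_opp.
  apply Rabs_le_between in H1, R1, R2. apply Rabs_le. lra.
Qed.

(** The number of zeros in [[a m, a n)] is counted by the sum of [smooth_step (a n - t) - smooth_step (a m - t)] over the zeros [t]. *)
Lemma zero_count_estimate : exists K, forall m n : Z, (m <= n)%Z -> Rabs (PI * IZR (n - m) - Dn * (a n - a m)) <= K.
Proof.
  destruct Hbd as [M HM]. destruct (density_bound a gam b Ha_mono Ha0 Hmuhat HF c0 HQ) as [B [HB HD]].
  destruct (Qf_line_bound a gam b Hmuhat c0 HQ) as [B2 [HB2 HQb]].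
  (* [2 M] bounds the change of [Im G], [2 B2] that of [Re Qf], [1] the truncation, and [8 B] the
     smoothing error, which is [4 B] at each of the two ends. *)
  exists (2 * M + 2 * B2 + 1 + 8 * B). intros m n Hmn.
  destruct (step_sum_limit (a m) (a n) 1 Rlt_0_1) as [N1 H1].
  destruct (rsum_zrange m (Z.to_nat (n - m))) as [N2 H2]. rewrite INR_IZR_INZ, Z2Nat.id in H2 by lia. replace (m + (n - m))%Z with n in H2 by ring.
  specialize (H1 (N1 + N2)%nat ltac:(lia)). specialize (H2 (N1 + N2)%nat ltac:(lia)). set (N := (N1 + N2)%nat) in *.
  assert (St : forall j i : Z, Rabs (smooth_step (a j - a i) - (if Z_lt_dec i j then PI / 2 else - (PI / 2))) <= 4 * / (1 + (a j - a i) * (a j - a i))).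
  { intros j i. destruct (Z_lt_dec i j) as [Hl | Hl].
    - apply smooth_step_close. assert (a i <= a j) by (apply (a_mono a Ha_mono); lia). lra.
    - replace (smooth_step (a j - a i) - - (PI / 2)) with (smooth_step (a j - a i) + PI / 2) by ring. apply smooth_step_close_neg. assert (a j <= a i) by (apply (a_mono a Ha_mono); lia). lra. }
  assert (Sb : Rabs (rsum (fun k => smooth_step (a n - Al k) - smooth_step (a m - Al k)) N - PI * IZR (n - m)) <= 4 * rsum (fun k => / (1 + (a n - Al k) * (a n - Al k))) N + 4 * rsum (fun k => / (1 + (a m - Al k) * (a m - Al k))) N).
  { rewrite <- H2. clear - St Hmn. induction N as [|N IH]; simpl rsum. rewrite !Rmult_0_r, Rplus_0_l, Rminus_0_r, Rabs_R0. lra.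
    assert (S1 := St n (ix N)). assert (S2 := St m (ix N)). fold (al a N) in S1, S2.
    set (x := smooth_step (a n - Al N)) in *. set (y := smooth_step (a m - Al N)) in *.
    assert (Ez : PI * zrange m n (ix N) = (if Z_lt_dec (ix N) n then PI / 2 else - (PI / 2)) - (if Z_lt_dec (ix N) m then PI / 2 else - (PI / 2))).
    { unfold zrange. destruct (Z_le_dec m (ix N)), (Z_lt_dec (ix N) n), (Z_lt_dec (ix N) m); try lia; field. }
    rewrite Rmult_plus_distr_l, Ez. apply Rabs_le_between in IH, S1, S2. apply Rabs_le. lra. }
  assert (Px : forall x k, 0 <= / (1 + (x - Al k) * (x - Al k))).
  { intros x k. left; apply Rinv_0_lt_compat. generalize (Rle_0_sqr (x - Al k)); unfold Rsqr; lra. }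
  assert (Bd : forall x, rsum (fun k => / (1 + (x - Al k) * (x - Al k))) N <= B).
  { intros x. eapply Rle_trans; [|apply (HD x)]. apply rsum_le_Series; auto. apply (density_series a gam b); auto. }
  assert (B1' := Bd (a n)). assert (B2' := Bd (a m)).
  assert (I1 := Rle_trans _ _ _ (Im_le_Cmod _) (HM (a n))). assert (I2 := Rle_trans _ _ _ (Im_le_Cmod _) (HM (a m))).
  assert (R1 := Rle_trans _ _ _ (re_le_Cmod _) (HQb (a n))). assert (R2 := Rle_trans _ _ _ (re_le_Cmod _) (HQb (a m))).
  unfold Cminus in H1. rewrite im_plus, im_opp, re_plus, re_opp in H1.
  apply Rabs_le_between in I1, I2, R1, R2, H1, Sb. apply Rabs_le. lra.
Qed.

(** The [n] steps to the right and to the left of [a 0] have the same number of zeros, hence the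
    same length up to a constant. Division by [Dn] is possible because [Dn <= 0] would keep [PI * n]
    bounded. *)
Lemma zero_symmetry : exists K, 0 <= K /\ forall n : nat, Rabs (a (Z.of_nat n) + a (- Z.of_nat n)%Z) <= K.
Proof.
  destruct zero_count_estimate as [K HK]. assert (P := PI2_1).
  assert (HK0 : 0 <= K) by (eapply Rle_trans; [apply Rabs_pos|apply (HK 0%Z 0%Z); lia]).
  assert (HD : 0 < Dn).
  { apply Rnot_le_lt. intros Hle. destruct (INR_unbounded K) as [n Hn].
    specialize (HK 0%Z (Z.of_nat n) ltac:(lia)). rewrite Z.sub_0_r, <- INR_IZR_INZ in HK.
    assert (a 0%Z <= a (Z.of_nat n)) by (apply (a_mono a Ha_mono); lia). apply Rabs_le_between in HK.
    assert (0 <= - Dn * (a (Z.of_nat n) - a 0%Z)) by (apply Rmult_le_pos; lra). generalize (pos_INR n); intros. nra. }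
  exists (2 * K / Dn + 2 * Rabs (a 0%Z)). split. { assert (0 <= 2 * K / Dn) by (apply Rmult_le_pos; [lra|left; apply Rinv_0_lt_compat; auto]). generalize (Rabs_pos (a 0%Z)); lra. }
  intros n. assert (H1 := HK 0%Z (Z.of_nat n) ltac:(lia)). assert (H2 := HK (- Z.of_nat n)%Z 0%Z ltac:(lia)).
  replace (Z.of_nat n - 0)%Z with (Z.of_nat n) in H1 by ring. replace (0 - - Z.of_nat n)%Z with (Z.of_nat n) in H2 by ring.
  set (u := a (Z.of_nat n)) in *. set (v := a (- Z.of_nat n)%Z) in *. set (w := a 0%Z) in *.
  assert (H3 : Rabs (u + v - 2 * w) <= 2 * K / Dn).
  { apply (Rle_div_r (Rabs (u + v - 2 * w))); auto. rewrite <- (Rabs_pos_eq Dn) by lra. rewrite <- Rabs_mult.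
    replace ((u + v - 2 * w) * Dn) with (Dn * (u - w) - Dn * (w - v)) by ring. apply Rabs_le_between in H1, H2. apply Rabs_le. lra. }
  assert (Q := Rle_abs w). assert (Q2 := Rle_abs (- w)). rewrite Rabs_Ropp in Q2. apply Rabs_le_between in H3. apply Rabs_le. lra.
Qed.
End Distribution.

(** * The symmetric product *)

Lemma Cmod_psum_le (u : nat -> C) (v : nat -> R) n : (forall k, (k < n)%nat -> Cmod (u k) <= v k) -> Cmod (psum u n) <= rsum v n.
Proof.
  induction n; intros H; simpl. rewrite Cmod_0; lra.
  eapply Rle_trans; [apply Cmod_triangle|]. apply Rplus_le_compat; auto.
Qed.

Lemma f_partial_pprod (a : Z -> R) N z : f_partial a N z = pprod (fun k => 1 - z / al a k)%C (2 * N + 1).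
Proof.
  induction N as [|N IH]. change (1 - z / a 0%Z = 1 * (1 - z / a 0%Z))%C. ring.
  replace (2 * S N + 1)%nat with (S (S (2 * N + 1))) by lia. simpl f_partial. cbn [pprod]. rewrite IH. unfold al.
  replace (S (2 * N + 1)) with (2 * S N)%nat by lia. rewrite ix_odd, ix_even. simpl Z.of_nat. simpl Z.opp. ring.
Qed.

Lemma pprod_fac (x : nat -> R) n z : pprod (fun k => fac (x k) z) n = (pprod (fun k => 1 - z / x k) n * cexp (z * psum (fun k => / x k) n))%C.
Proof.
  induction n; simpl. rewrite Cmult_0_r, cexp_0. ring.
  rewrite IHn. unfold fac. rewrite Cmult_plus_distr_l, cexp_plus. unfold Cdiv. ring.
Qed.

Section Construction.
Variables (a : Z -> R) (gam : nat -> R) (b : nat -> C).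
Hypothesis Ha_mono : forall n : Z, a n <= a (n + 1)%Z.
Hypothesis Ha0 : forall n : Z, a n <> 0.
Hypothesis Hmuhat : tempered_B gam b.
Hypothesis HF : fourier_pair a gam b.
Variables (P : C -> C) (c0 : C).
Hypothesis HU : locally_uniform (fun n z => pprod (fun k => fac (al a k) z) n) P.
Hypothesis HPE : entire P.
Hypothesis HPZ : zero_set_is P a.
Hypothesis HPQ : forall z, 0 < Im z -> cderiv P z (Qf a z * P z)%C.
Hypothesis HQ : forall z, 0 < Im z -> Qf a z = (c0 - 2 * PI * Ci * Ef gam b z)%C.
Hypothesis Hbd : primitive_bounded gam b.

Local Notation Al := (al a).
Local Notation Bp := (bp gam b).
Local Notation Gp := (gp gam).
Local Notation E := (Ef gam b).
Local Notation G := (Gf gam b).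

(** Paired inverses equal [(v + w) / (v w)], with numerator bounded by [zero_symmetry] and
    denominator of order [n^2]. The limit is real because its terms are. *)
Lemma inverse_sum : exists c1 : R, Clim (fun N => psum (fun k => / Al k)%C (2 * N + 1)) c1.
Proof.
  destruct (zero_symmetry a gam b Ha_mono Ha0 Hmuhat HF c0 HQ Hbd) as [K [HK Hs]].
  destruct (al_lower a gam b Ha_mono Ha0 Hmuhat HF) as [c [Hc Hl]].
  set (u := fun n : Z => (/ a n)%C).
  assert (Hu : forall k, Cmod (Zsym u k) <= (K / (c * c) + / c) * / ((1 + INR k) * (1 + INR k))).
  { assert (0 < / c) by (apply Rinv_0_lt_compat; auto). assert (0 <= K / (c * c)) by (apply Rmult_le_pos; auto; left; apply Rinv_0_lt_compat; nra).
    intros [|m].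
    - simpl Zsym. unfold u. simpl INR. rewrite <- RtoC_inv, Cmod_R, Rabs_inv, !Rplus_0_r, !Rmult_1_r, Rinv_1, Rmult_1_r.
      specialize (Hl 0%nat). simpl INR in Hl. unfold al in Hl. change (ix 0) with 0%Z in Hl. assert (/ Rabs (a 0%Z) <= / c) by (apply Rinv_le_contravar; lra). lra. apply Ha0.
    - cbn [Zsym]. unfold u. assert (L1 := Hl (2 * m + 1)%nat). assert (L2 := Hl (2 * S m)%nat). unfold al in L1, L2. rewrite ix_odd in L1. rewrite ix_even in L2.
      specialize (Hs (S m)). set (v := a (Z.of_nat (S m))) in *. set (w := a (- Z.of_nat (S m))%Z) in *.
      assert (Hv : v <> 0) by apply Ha0. assert (Hw : w <> 0) by apply Ha0.
      assert (Pm := pos_INR (S m)). set (q := 1 + INR (S m)) in *.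
      assert (A1 : c * q <= Rabs v). { eapply Rle_trans; [|apply L1]. apply Rmult_le_compat_l. lra. unfold q. apply Rplus_le_compat_l, le_INR. lia. }
      assert (A2 : c * q <= Rabs w). { eapply Rle_trans; [|apply L2]. apply Rmult_le_compat_l. lra. unfold q. apply Rplus_le_compat_l, le_INR. lia. }
      assert (Pq : 0 < q) by (unfold q; lra). clearbody v w q. assert (Pcq : 0 < c * q) by (apply Rmult_lt_0_compat; auto).
      replace (/ v + / w)%C with (RtoC ((v + w) / (v * w))). 2: { rewrite RtoC_div, RtoC_plus, RtoC_mult. field. split; intros Q; apply RtoC_inj in Q; auto. all: apply Rmult_integral_contrapositive; auto. }
      rewrite Cmod_R. unfold Rdiv at 1. rewrite Rabs_mult, Rabs_inv, Rabs_mult.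
      apply Rle_trans with (K * / ((c * q) * (c * q))).
      + apply Rmult_le_compat; auto. apply Rabs_pos. left; apply Rinv_0_lt_compat. nra. apply Rinv_le_contravar. nra. apply Rmult_le_compat; lra.
      + replace (K * / (c * q * (c * q))) with (K / (c * c) * / (q * q)) by (field; lra). apply Rmult_le_compat_r. left; apply Rinv_0_lt_compat; nra. lra. }
  assert (HS : ex_series (fun k => (K / (c * c) + / c) * / ((1 + INR k) * (1 + INR k)))) by (apply ex_series_scal_R, ex_series_inv_sq).
  assert (L := Csum_lim _ _ Hu HS). apply (Clim_subseq _ _ S) in L. 2: intros; lia.
  apply (Clim_ext _ (fun N => psum (fun k => / Al k)%C (2 * N + 1))) in L. 2: intros; apply psum_Zsym.
  assert (I : Im (Csum (Zsym u)) = 0).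
  { apply Clim_Im in L. assert (L0 := is_lim_seq_const 0).
    assert (Q : Finite (Im (Csum (Zsym u))) = Finite 0). 2: inversion Q; auto.
    rewrite <- (is_lim_seq_unique _ _ L). rewrite <- (is_lim_seq_unique _ _ L0). apply Lim_seq_ext. intros n. rewrite psum_Im.
    generalize (2 * n + 1)%nat. intros m. induction m as [|m IHm]. reflexivity. change (rsum (fun k => Im (/ Al k)%C) m + Im (/ Al m)%C = 0). rewrite IHm, <- RtoC_inv, im_RtoC by apply Ha0. ring. }
  exists (Re (Csum (Zsym u))). replace (RtoC (Re (Csum (Zsym u)))) with (Csum (Zsym u)); auto. apply C_ext; simpl; auto.
Qed.

(** At [z = i y] the difference [Re Qf - c1] is minus the symmetric sum of [a / (y^2 + a^2)]. In
    pairs it is at most [K] times the sum of [1 / (y^2 + a^2)], that is [K |Im Qf| / y], and it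
    tends to [0] because [Qf] tends to [c0]. *)
Lemma Re_c0 (c1 : R) : Clim (fun N => psum (fun k => / Al k)%C (2 * N + 1)) c1 -> Re c0 = c1.
Proof.
  intros Hc1.
  destruct (zero_symmetry a gam b Ha_mono Ha0 Hmuhat HF c0 HQ Hbd) as [K [HK Hs]].
  assert (X : forall y, 1 <= y -> Rabs (Re (Qf a (0, y)%R - c1)%C) <= K / y * Cmod (Qf a (0, y)%R)).
  { intros y Hy. set (z := (0, y)%R : C).
    assert (Py : forall k, 0 < y * y + Al k * Al k) by (intros k; generalize (Rle_0_sqr (Al k)); unfold Rsqr; nra).
    assert (LQ : Clim (fun N => psum (fun k => / (z - Al k) + / Al k)%C (2 * N + 1)) (Qf a z)).
    { apply (Clim_subseq (psum (fun k => / (z - Al k) + / Al k)%C) _ (fun N => 2 * N + 1)%nat). intros; lia.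
      apply (Csum_lim _ _ (Qf_dom a Ha0 z ltac:(simpl; lra))). apply ex_series_scal_R. apply (Qf_summable a gam b); auto. }
    assert (Rw : forall n, Re (psum (fun k => / (z - Al k) + / Al k)%C n) = Re (psum (fun k => / Al k)%C n) - rsum (fun k => Al k / (y * y + Al k * Al k)) n).
    { intros n. rewrite !psum_Re. clear - Py. induction n; cbn [rsum]. ring. rewrite IHn, re_plus. specialize (Py n). replace (Re (/ (z - Al n))%C) with (- (Al n / (y * y + Al n * Al n))). ring.
      unfold z. simpl. field; repeat split; nra. }
    assert (Iw : forall n, Im (psum (fun k => / (z - Al k) + / Al k)%C n) = - y * rsum (fun k => / (y * y + Al k * Al k)) n).
    { intros n. rewrite !psum_Im. clear - Py Ha0. induction n; cbn [rsum]. ring. rewrite IHn, im_plus, <- RtoC_inv, im_RtoC, Rplus_0_r by apply Ha0. specialize (Py n). replace (Im (/ (z - Al n))%C) with (- y * / (y * y + Al n * Al n)). ring.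
      unfold z. simpl. field; repeat split; nra. }
    assert (Pair : forall u v, u <> 0 -> v <> 0 -> Rabs (u + v) <= K -> Rabs (u / (y * y + u * u) + v / (y * y + v * v)) <= K * (/ (y * y + u * u) + / (y * y + v * v))).
    { intros u v Hu Hv Huv. assert (0 < y * y + u * u) by nra. assert (0 < y * y + v * v) by nra.
      replace (u / (y * y + u * u) + v / (y * y + v * v)) with ((u + v) * ((y * y + u * v) / ((y * y + u * u) * (y * y + v * v)))) by (field; lra).
      rewrite Rabs_mult. apply Rmult_le_compat; auto; try apply Rabs_pos.
      replace (/ (y * y + u * u) + / (y * y + v * v)) with ((2 * (y * y) + u * u + v * v) / ((y * y + u * u) * (y * y + v * v))) by (field; lra).
      assert (Pp : 0 < (y * y + u * u) * (y * y + v * v)) by (apply Rmult_lt_0_compat; auto).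
      unfold Rdiv. rewrite Rabs_mult, (Rabs_pos_eq (/ _)) by (left; apply Rinv_0_lt_compat; auto).
      apply Rmult_le_compat_r. left; apply Rinv_0_lt_compat; auto.
      generalize (Rle_0_sqr (u + v)) (Rle_0_sqr (u - v)); unfold Rsqr; intros. apply Rabs_le; nra. }
    assert (Sum : forall N, Rabs (rsum (fun k => Al k / (y * y + Al k * Al k)) (2 * N + 1)) <= K * rsum (fun k => / (y * y + Al k * Al k)) (2 * N + 1)).
    { induction N as [|N IH].
      - simpl rsum. rewrite !Rplus_0_l. specialize (Hs 0%nat). simpl in Hs. specialize (Py 0%nat). change (Al 0) with (a 0%Z) in *.
        unfold Rdiv. rewrite Rabs_mult, (Rabs_pos_eq (/ _)) by (left; apply Rinv_0_lt_compat; auto). apply Rmult_le_compat_r. left; apply Rinv_0_lt_compat; auto.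
        replace (a 0%Z + a 0%Z) with (2 * a 0%Z) in Hs by ring. rewrite Rabs_mult, Rabs_pos_eq in Hs by lra. generalize (Rabs_pos (a 0%Z)). lra.
      - replace (2 * S N + 1)%nat with (S (S (2 * N + 1))) by lia. cbn [rsum]. replace (S (2 * N + 1)) with (2 * S N)%nat by lia.
        set (s1 := rsum (fun k => Al k / (y * y + Al k * Al k)) (2 * N + 1)) in *. set (s2 := rsum (fun k => / (y * y + Al k * Al k)) (2 * N + 1)) in *.
        specialize (Hs (S N)). assert (Pr := Pair (Al (2 * N + 1)) (Al (2 * S N)) (Ha0 _) (Ha0 _)). unfold al in Pr at 1 2. rewrite ix_odd, ix_even in Pr. specialize (Pr Hs).
        rewrite Rplus_assoc. eapply Rle_trans; [apply Rabs_triang|]. rewrite Rplus_assoc, (Rmult_plus_distr_l K s2). apply Rplus_le_compat; auto. }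
    apply le_epsilon. intros eps He. assert (PKy : 0 <= K / y) by (apply Rmult_le_pos; auto; left; apply Rinv_0_lt_compat; lra).
    set (e := eps / (2 * (K / y) + 4)). assert (Pe : 0 < e) by (apply Rdiv_lt_0_compat; lra).
    destruct (LQ e Pe) as [N1 H1]. destruct (Hc1 e Pe) as [N2 H2]. set (N := (N1 + N2)%nat). specialize (H1 N ltac:(lia)). specialize (H2 N ltac:(lia)). specialize (Sum N).
    specialize (Rw (2 * N + 1)%nat). specialize (Iw (2 * N + 1)%nat).
    set (T := psum (fun k => / (z - Al k) + / Al k)%C (2 * N + 1)) in *. set (S1 := psum (fun k => / Al k)%C (2 * N + 1)) in *.
    assert (R1 := Rle_trans _ _ _ (re_le_Cmod _) H1). assert (R2 := Rle_trans _ _ _ (re_le_Cmod _) H2).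
    assert (I1 := Rle_trans _ _ _ (Im_le_Cmod _) H1). assert (I2 := Im_le_Cmod (Qf a z)).
    unfold Cminus in R1, R2, I1 |- *. rewrite re_plus, re_opp in R1, R2 |- *. rewrite im_plus, im_opp in I1. rewrite re_RtoC in *.
    set (s2 := rsum (fun k => / (y * y + Al k * Al k)) (2 * N + 1)) in *.
    assert (Q1 : K * s2 <= K / y * (Cmod (Qf a z) + e)).
    { replace (K * s2) with (K / y * (y * s2)) by (field; lra). apply Rmult_le_compat_l; auto. apply Rabs_le_between in I1, I2. lra. }
    assert (Q2 : K / y * e + 2 * e <= eps). { unfold e. apply Rle_trans with (eps / (2 * (K / y) + 4) * (2 * (K / y) + 4)). assert (0 <= K / y * e) by (apply Rmult_le_pos; lra). fold e. lra. right; field; lra. }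
    apply Rabs_le_between in R1, R2, Sum. apply Rabs_le. lra. }
  destruct (Req_dec (Re c0) c1) as [|Hne]; auto. exfalso.
  set (del := Rabs (Re c0 - c1)). assert (Pdel : 0 < del) by (apply Rabs_pos_lt; lra).
  assert (Ppi := PI2_1). assert (Pc := Cmod_ge_0 c0).
  (* With [|Ef| <= eta] and [1 / y <= eta], all errors add up to at most [eta * W]; the choice of
     [eta] keeps this below the assumed distance [del]. *)
  set (W := 2 * PI + K * (Cmod c0 + 2 * PI)). assert (PW : 0 <= W) by (unfold W; assert (0 <= K * (Cmod c0 + 2 * PI)) by (apply Rmult_le_pos; lra); lra).
  set (eta := Rmin 1 (del / (2 * (W + 1)))). assert (Pd' : 0 < del / (2 * (W + 1))) by (apply Rdiv_lt_0_compat; lra).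
  assert (Pe : 0 < eta) by (apply Rmin_pos; lra). assert (E1 : eta <= 1) by apply Rmin_l. assert (E2 : eta <= del / (2 * (W + 1))) by apply Rmin_r.
  destruct (Ef_decay gam b Hmuhat eta Pe) as [Y [HY HYb]].
  set (y := Rmax Y (/ eta)). assert (Y1 : Y <= y) by apply Rmax_l. assert (Y2 : / eta <= y) by apply Rmax_r.
  specialize (X y ltac:(lra)). specialize (HYb (0, y)%R Y1). rewrite HQ in X by (simpl; lra).
  set (e := E (0, y)%R) in *.
  assert (B1 : Cmod (2 * PI * Ci * e) <= 2 * PI * eta) by (rewrite Cmod_freq; apply Rmult_le_compat_l; lra).
  assert (B2 : Cmod (c0 - 2 * PI * Ci * e) <= Cmod c0 + 2 * PI) by (eapply Rle_trans; [apply Cmod_minus_le|]; nra).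
  assert (B3 : K / y * Cmod (c0 - 2 * PI * Ci * e) <= eta * (K * (Cmod c0 + 2 * PI))).
  { replace (eta * (K * (Cmod c0 + 2 * PI))) with (K * eta * (Cmod c0 + 2 * PI)) by ring. apply Rmult_le_compat; auto. apply Rmult_le_pos; auto; left; apply Rinv_0_lt_compat; lra. apply Cmod_ge_0.
    apply Rmult_le_compat_l; auto. rewrite <- (Rinv_inv eta). apply Rinv_le_contravar; auto. apply Rinv_0_lt_compat; auto. }
  assert (B4 := Rle_trans _ _ _ (re_le_Cmod _) B1).
  set (w := (2 * PI * Ci * e)%C) in *. unfold Cminus in X at 1 2. rewrite !re_plus, !re_opp, re_RtoC in X.
  assert (del <= eta * W).
  { unfold del, W. apply Rabs_le_between in X, B4. apply Rabs_le. lra. }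
  assert (eta * W <= del / 2). { apply Rle_trans with (del / (2 * (W + 1)) * (W + 1)). apply Rmult_le_compat; lra. right; field; lra. }
  lra.
Qed.

Variable c1 : R.
Hypothesis Hc1 : Clim (fun N => psum (fun k => / Al k)%C (2 * N + 1)) c1.

(** The convergence factors of the genus one product have total exponent [z] times the partial sum
    of the inverses, which tends to [c1 z] along symmetric partial sums; the exponential undoes
    them. *)
Definition genus0 (z : C) : C := (P z * cexp (- c1 * z))%C.
Local Notation f := genus0.

Lemma genus0_product z : f_product_converges a z (f z).
Proof.
  assert (L : Clim (fun N => f_partial a N z) (f z)).
  { apply (Clim_ext (fun N => pprod (fun k => fac (Al k) z) (2 * N + 1) * cexp (- z * psum (fun k => / Al k) (2 * N + 1)))%C).
    { intros N. rewrite pprod_fac, f_partial_pprod, <- Cmult_assoc, <- cexp_plus.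
      set (s := psum _ _). replace (z * s + - z * s)%C with (RtoC 0) by ring. rewrite cexp_0. ring. }
    apply Clim_mult.
    - apply (Clim_subseq (fun n => pprod (fun k => fac (Al k) z) n) _ (fun N => 2 * N + 1)%nat). intros; lia. apply (locally_uniform_pointwise _ P z HU).
    - replace (- c1 * z)%C with (- z * c1)%C by ring. apply (Clim_continuous cexp). eapply cderiv_ccont, cderiv_cexp. apply Clim_scal, Hc1. }
  apply filterlim_locally. intros eps. destruct (L (eps / 2)) as [N HN]. generalize (cond_pos eps); lra.
  exists N. intros n Hn. specialize (HN n Hn). assert (Pe := cond_pos eps).
  split; unfold ball; simpl; unfold AbsRing_ball, abs, minus, plus, opp; simpl.
  - eapply Rle_lt_trans; [|apply (Rle_lt_trans _ _ eps HN); lra]. apply (re_le_Cmod (f_partial a n z - f z)%C).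
  - eapply Rle_lt_trans; [|apply (Rle_lt_trans _ _ eps HN); lra]. apply (Im_le_Cmod (f_partial a n z - f z)%C).
Qed.

Lemma genus0_entire : entire f.
Proof. apply entire_mult; auto. apply entire_cexp. Qed.

Lemma genus0_zero_set : zero_set_is f a.
Proof.
  intros z k Hk. destruct (HPZ z k Hk) as [h [HE [Hn Hh]]]. exists (fun w => h w * cexp (- c1 * w))%C. split; [|split].
  - apply entire_mult; auto. apply entire_cexp.
  - apply Cmult_neq_0; auto. apply cexp_neq_0.
  - intros w. unfold genus0. rewrite Hh. ring.
Qed.

Lemma genus0_exponential_type : exponential_type f.
Proof.
  destruct (P_exponential_type a gam b Ha0 Hmuhat P c0 HU HPQ HQ) as [A0 [B0 H]].
  exists A0, (B0 + Rabs c1). intros z. unfold genus0. rewrite Cmod_mult, Cmod_cexp, Rmult_plus_distr_r, exp_plus, <- Rmult_assoc.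
  apply Rmult_le_compat; auto. apply Cmod_ge_0. left; apply exp_pos. apply exp_le.
  eapply Rle_trans; [apply Rle_abs|]. eapply Rle_trans; [apply re_le_Cmod|]. rewrite Cmod_mult, Cmod_opp, Cmod_R. lra.
Qed.

Lemma genus0_conj z : f (Cconj z) = Cconj (f z).
Proof.
  unfold genus0. rewrite (P_conj a Ha0 P HU), Cmult_conj, <- cexp_conj. f_equal. f_equal. rewrite Cmult_conj, Copp_conj. f_equal. f_equal. apply C_ext; simpl; ring.
Qed.

Lemma genus0_mono x y y' : Rabs y <= Rabs y' -> Cmod (f (x, y)) <= Cmod (f (x, y')).
Proof.
  intros H. unfold genus0. rewrite !Cmod_mult, !Cmod_cexp. replace (Re (- c1 * (x, y)%R)%C) with (Re (- c1 * (x, y')%R)%C) by (simpl; ring).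
  apply Rmult_le_compat_r. left; apply exp_pos. apply (P_mono a Ha0 P HU); auto.
Qed.

(** Since [Re c0 = c1], the linear exponent [c0 - c1] is purely imaginary; a nonzero real part would
    make [f] grow exponentially along horizontal lines. *)
Lemma genus0_upper : exists k0 : C, forall z, 0 < Im z -> f z = (k0 * cexp (Ci * Im c0 * z - G z))%C.
Proof.
  exists (P Ci * cexp (- c0 * Ci))%C. intros z Hz. unfold genus0. rewrite (P_formula a gam b Hmuhat P c0 HPQ HQ z Hz).
  replace (Ci * Im c0)%C with (c0 - c1)%C. rewrite <- !Cmult_assoc, <- !cexp_plus. f_equal. f_equal. ring.
  rewrite <- (Re_c0 c1 Hc1). destruct c0 as [p q]. apply C_ext; simpl; ring.
Qed.

Lemma primitive_bounded_line s : 1 <= s -> exists M, 0 <= M /\ forall x : R, Cmod (G (x, s)) <= M.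
Proof.
  intros Hs. destruct Hbd as [M HM]. destruct (Gf_lipschitz gam b Hmuhat 1 Rlt_0_1) as [K [HK HL]].
  assert (HM0 : 0 <= M) by (eapply Rle_trans; [apply Cmod_ge_0|apply (HM 0)]).
  exists (M + K * (s - 1)). split. assert (0 <= K * (s - 1)) by (apply Rmult_le_pos; lra). lra. intros x.
  generalize (Cmod_triangle_sub (G (x, s)) (G (x, 1))) (HM x) (HL (x, s) (x, 1) Hs ltac:(simpl; lra)).
  replace ((x, s)%R - (x, 1)%R)%C with (Ci * (s - 1)%R)%C by (apply C_ext; simpl; ring). rewrite Cmod_mult, Cmod_Ci, Cmod_R, Rabs_pos_eq by lra. lra.
Qed.

(** On the line [Im z = s] the formula of [genus0_upper] has a bounded exponent in its real part,
    and [genus0_mono] carries the bound into the strip. *)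
Lemma genus0_bounded s : 1 <= s -> exists K, 0 <= K /\ forall z, - s <= Im z <= s -> Cmod (f z) <= K.
Proof.
  intros Hs. destruct genus0_upper as [k0 Hk]. destruct (primitive_bounded_line s Hs) as [M [HM HMb]]. assert (Pk := Cmod_ge_0 k0).
  exists (Cmod k0 * exp (Rabs (Im c0) * s + M)). split. apply Rmult_le_pos; auto. left; apply exp_pos.
  intros [x y] Hy. simpl in Hy. eapply Rle_trans; [apply (genus0_mono x y s); rewrite (Rabs_pos_eq s) by lra; apply Rabs_le; lra|].
  rewrite Hk by (simpl; lra). rewrite Cmod_mult, Cmod_cexp. apply Rmult_le_compat_l; auto. apply exp_le.
  unfold Cminus. rewrite re_plus, re_opp. replace (Re (Ci * Im c0 * (x, s)%R)%C) with (- Im c0 * s) by (simpl; ring).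
  assert (R1 := Rle_trans _ _ _ (re_le_Cmod _) (HMb x)). apply Rabs_le_between in R1.
  assert (- Im c0 * s <= Rabs (Im c0) * s). { apply Rmult_le_compat_r. lra. rewrite <- Rabs_Ropp. apply Rle_abs. } lra.
Qed.

(** * Almost periodicity of the symmetric product *)

(** Finitely many frequencies carry all but a small part of the weight, and they have common almost
    periods. The additional phase [w] is included so that the same [tau] also preserves the linear
    exponential factor of [f]. *)
Lemma Ef_almost_periods s (w theta : R) : 0 < s -> 0 < theta ->
  relatively_dense (fun tau => (forall x, Cmod (E (x + tau, s)%R - E (x, s)%R) <= theta) /\ Cmod (cis (w * tau) - 1) <= theta).
Proof.
  intros Hs Ht. set (SWs := fun k => Cmod (Bp k) * (Gp k ^ 0 * exp (- (2 * PI * s) * Gp k))).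
  assert (HS : ex_series SWs) by (apply spectral_weight; auto).
  assert (PS : forall k, 0 <= SWs k). { intros k. apply Rmult_le_pos. apply Cmod_ge_0. rewrite pow_O, Rmult_1_l. left; apply exp_pos. }
  destruct (rsum_tail SWs (theta / 4) PS HS ltac:(lra)) as [N HN]. specialize (HN N (le_n N)).
  set (S0 := Series SWs) in *. assert (PS0 : 0 <= S0) by (apply (Rle_trans _ (rsum SWs 0)); [simpl; lra|apply rsum_le_Series; auto]).
  set (th := theta / (2 * (S0 + 1))). assert (Pth : 0 < th) by (apply Rdiv_lt_0_compat; lra).
  assert (Th1 : th <= theta). { apply (Rle_div_l theta). lra. nra. }
  assert (Th2 : th * S0 <= theta / 2). { apply Rle_trans with (th * (S0 + 1)). apply Rmult_le_compat_l; lra. unfold th. right; field; lra. }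
  (* Index [0] is reserved for the phase [w], so the frequencies are shifted by one and [S N] phases
     are requested. *)
  destruct (common_almost_periods (fun k => match k with O => w | S j => 2 * PI * Gp j end) (S N) th Pth) as [L [HL H]].
  exists L. split; auto. intros u. destruct (H u) as [tau [Hk Hu]]. exists tau. split; auto. split.
  2: { eapply Rle_trans; [apply (Hk 0%nat); lia|auto]. }
  intros x.
  assert (Wv : forall k, wave (Gp k) (x + tau, s)%R = (wave (Gp k) (x, s)%R * cis (2 * PI * Gp k * tau))%C).
  { intros k. replace ((x + tau, s)%R : C) with ((x, s)%R + tau)%C by (apply C_ext; simpl; ring). rewrite wave_add. f_equal.
    unfold wave, cexp, cis. rewrite re_scal_l, im_scal_l, freq_Re, freq_Im, im_RtoC, re_RtoC, !Rmult_0_r, exp_0, !Rmult_1_l.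
    replace (Gp k * (2 * PI * tau)) with (2 * PI * Gp k * tau) by ring. reflexivity. }
  assert (Wb : forall k t, Cmod (Bp k * wave (Gp k) (t, s)%R) = SWs k).
  { intros k t. rewrite Cmod_mult. unfold SWs. f_equal. unfold wave. rewrite Cmod_cexp, re_scal_l, freq_Re. change (Im (t, s)) with s. rewrite pow_O, Rmult_1_l. f_equal. ring. }
  unfold Ef. rewrite <- (Csum_minus _ _ SWs SWs) by (auto; intros; rewrite Wb; lra).
  set (v := fun k => _).
  assert (Vk : forall k, Cmod (v k) = SWs k * Cmod (cis (2 * PI * Gp k * tau) - 1)).
  { intros k. unfold v. rewrite Wv, <- (Wb k x), <- Cmod_mult. f_equal. ring. }
  assert (V2 : forall k, Cmod (v k) <= 2 * SWs k).
  { intros k. rewrite Vk, Rmult_comm. apply Rmult_le_compat_r; auto. eapply Rle_trans; [apply Cmod_minus_le|]. rewrite Cmod_cis, Cmod_1. lra. }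
  assert (T := Csum_tail v _ V2 (ex_series_scal_R _ _ HS) N). rewrite Series_scal_l, rsum_scal in T. fold S0 in T.
  assert (Hp : Cmod (psum v N) <= rsum (fun k => th * SWs k) N).
  { apply Cmod_psum_le. intros k Hkn. rewrite Vk, Rmult_comm. apply Rmult_le_compat_r; auto. apply (Hk (S k)). lia. }
  rewrite rsum_scal in Hp. assert (rsum SWs N <= S0) by (apply rsum_le_Series; auto).
  assert (th * rsum SWs N <= th * S0) by (apply Rmult_le_compat_l; lra).
  generalize (Cmod_triangle_sub (Csum v) (psum v N)). lra.
Qed.

(** [bohr_primitive] is applied to the real and imaginary parts. Both derivatives are controlled by
    [p], so every [tau] that moves [E] by at most the smaller threshold serves both. *)
Lemma primitive_almost_periods s eps : 1 <= s -> 0 < eps -> exists eta, 0 < eta /\ forall tau,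
  (forall x, Cmod (E (x + tau, s)%R - E (x, s)%R) <= eta) -> forall x, Cmod (G (x + tau, s)%R - G (x, s)%R) <= eps.
Proof.
  intros Hs He. destruct (primitive_bounded_line s Hs) as [M [HM HMb]]. assert (Ppi := PI2_1).
  set (p := fun x : R => (2 * PI * Ci * E (x, s)%R)%C).
  assert (Dp : forall x, rderiv (fun t => G (t, s)%R) x (p x)).
  { intros x. apply (rderiv_eq _ _ (2 * PI * Ci * E (x, s)%R * 1)%C). unfold p; ring.
    apply (rderiv_comp G (fun t : R => (t, s)%R)). apply Gf_deriv; auto. simpl; lra.
    intros ep Hep. exists 1. split. lra. intros h _. replace ((x + h, s)%R - (x, s)%R - 1 * h)%C with (RtoC 0) by (apply C_ext; simpl; ring).
    rewrite Cmod_0. generalize (Rabs_pos h); intros; nra. }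
  assert (Pd : forall tau eta, (forall x, Cmod (E (x + tau, s)%R - E (x, s)%R) <= eta / (2 * PI)) -> forall x, Cmod (p (x + tau)%R - p x)%C <= eta).
  { intros tau eta H x. unfold p. replace (2 * PI * Ci * E (x + tau, s)%R - 2 * PI * Ci * E (x, s)%R)%C with (2 * PI * Ci * (E (x + tau, s)%R - E (x, s)%R))%C by ring.
    rewrite Cmod_freq. apply Rle_trans with (2 * PI * (eta / (2 * PI))). apply Rmult_le_compat_l; auto; lra. right; field; lra. }
  assert (Rd : forall eta, 0 < eta -> relatively_dense (fun tau => forall x, Cmod (p (x + tau)%R - p x)%C <= eta)).
  { intros eta Hn. destruct (Ef_almost_periods s 0 (eta / (2 * PI)) ltac:(lra) ltac:(apply Rdiv_lt_0_compat; lra)) as [L [HL H]].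
    exists L. split; auto. intros u. destruct (H u) as [tau [[H1 _] H2]]. exists tau. split; auto. }
  assert (Hre : forall w z : C, Rabs (Re w - Re z) <= Cmod (w - z)).
  { intros w z. generalize (re_le_Cmod (w - z)). unfold Cminus at 1. rewrite re_plus, re_opp. auto. }
  assert (Him : forall w z : C, Rabs (Im w - Im z) <= Cmod (w - z)).
  { intros w z. generalize (Im_le_Cmod (w - z)). unfold Cminus at 1. rewrite im_plus, im_opp. auto. }
  destruct (bohr_primitive (fun x => Re (G (x, s)%R)) (fun x => Re (p x)) M) with (eps := eps / 2) as [e1 [P1 H1]].
  { intros x. apply rderiv_Re; auto. } { intros x. eapply Rle_trans; [apply re_le_Cmod|auto]. }
  { intros eta Hn. destruct (Rd eta Hn) as [L [HL H]]. exists L. split; auto. intros u. destruct (H u) as [tau [Q1 Q2]]. exists tau. split; auto. intros x. eapply Rle_trans; [apply Hre|auto]. }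
  lra.
  destruct (bohr_primitive (fun x => Im (G (x, s)%R)) (fun x => Im (p x)) M) with (eps := eps / 2) as [e2 [P2 H2]].
  { intros x. apply rderiv_Im; auto. } { intros x. eapply Rle_trans; [apply Im_le_Cmod|auto]. }
  { intros eta Hn. destruct (Rd eta Hn) as [L [HL H]]. exists L. split; auto. intros u. destruct (H u) as [tau [Q1 Q2]]. exists tau. split; auto. intros x. eapply Rle_trans; [apply Him|auto]. }
  lra.
  assert (Pm : 0 < Rmin e1 e2) by (apply Rmin_pos; auto). assert (M1 := Rmin_l e1 e2). assert (M2 := Rmin_r e1 e2).
  exists (Rmin e1 e2 / (2 * PI)). split. apply Rdiv_lt_0_compat; lra.
  intros tau Htau x. assert (Hp := Pd _ _ Htau).
  eapply Rle_trans; [apply Cmod_le_abs|]. unfold Cminus. rewrite re_plus, im_plus, re_opp, im_opp.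
  assert (Q1 : Rabs (Re (G (x + tau, s)%R) - Re (G (x, s)%R)) <= eps / 2).
  { apply (H1 tau). intros t. eapply Rle_trans; [apply Hre|]. eapply Rle_trans; [apply Hp|auto]. }
  assert (Q2 : Rabs (Im (G (x + tau, s)%R) - Im (G (x, s)%R)) <= eps / 2).
  { apply (H2 tau). intros t. eapply Rle_trans; [apply Him|]. eapply Rle_trans; [apply Hp|auto]. }
  unfold Rminus in Q1, Q2. lra.
Qed.

(** Multiplicativity gives smallness of [f (z + tau) - f z] on the line [Im z = s], conjugation on
    [Im z = - s]. In between this difference is bounded, so [strip_max_principle] applies to it. *)
Lemma genus0_almost_periodic : almost_periodic f.
Proof.
  intros alpha beta eps Hab He. set (s := Rabs alpha + Rabs beta + 1).
  assert (Hs : 1 <= s) by (unfold s; generalize (Rabs_pos alpha) (Rabs_pos beta); lra).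
  assert (Hsa : - s <= alpha /\ beta <= s).
  { unfold s. generalize (Rle_abs (- alpha)) (Rle_abs beta) (Rabs_pos alpha) (Rabs_pos beta). rewrite Rabs_Ropp. lra. }
  destruct (genus0_bounded s Hs) as [K [HK HKb]]. destruct genus0_upper as [k0 Hk0].
  (* The relative change of [f] on the line is at most [4 del] from the phase and [3 del] from the
     primitive; multiplied by [K], the total [7 del] stays below [eps / 2]. *)
  set (del := Rmin 1 (eps / (14 * (K + 1)))). assert (Pe : 0 < eps / (14 * (K + 1))) by (apply Rdiv_lt_0_compat; lra).
  assert (Pd : 0 < del) by (apply Rmin_pos; lra). assert (D1 : del <= 1) by apply Rmin_l. assert (D2 : del <= eps / (14 * (K + 1))) by apply Rmin_r.
  assert (D3 : K * (7 * del) <= eps / 2).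
  { apply Rle_trans with ((K + 1) * (7 * (eps / (14 * (K + 1))))). apply Rmult_le_compat; lra. right; field; lra. }
  clearbody del.
  destruct (primitive_almost_periods s del Hs Pd) as [eta [Peta Heta]].
  assert (Pm : 0 < Rmin eta del) by (apply Rmin_pos; auto). assert (M1 := Rmin_l eta del). assert (M2 := Rmin_r eta del).
  destruct (Ef_almost_periods s (Im c0) (Rmin eta del) ltac:(lra) Pm) as [L [HL H]].
  exists L. split; auto. intros u. destruct (H u) as [tau [[Ht1 Ht2] Hu]]. exists tau. split; auto.
  exists (eps / 2). split. lra. intros x y Hy.
  assert (HG := Heta tau ltac:(intros; eapply Rle_trans; [apply Ht1|auto])).
  assert (Line : forall t, Cmod (f (t + tau, s)%R - f (t, s)%R) <= eps / 2).
  { intros t. set (A0 := cis (Im c0 * tau)) in *. set (d := (- (G (t + tau, s)%R - G (t, s)%R))%C).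
    assert (Hd : Cmod d <= del) by (unfold d; rewrite Cmod_opp; apply HG).
    assert (Ef0 : f (t + tau, s)%R = (f (t, s)%R * (A0 * cexp d))%C).
    { rewrite !Hk0 by (simpl; lra). replace A0 with (cexp (Ci * Im c0 * tau)).
      - rewrite <- (Cmult_assoc k0), <- !cexp_plus. f_equal. f_equal. unfold d. set (g1 := G (t + tau, s)%R). replace ((t + tau, s)%R : C) with ((t, s)%R + tau)%C by (apply C_ext; simpl; ring). ring.
      - unfold cexp, A0, cis. replace (Re (Ci * Im c0 * tau)) with 0 by (simpl; ring). replace (Im (Ci * Im c0 * tau)) with (Im c0 * tau) by (simpl; ring).
        rewrite exp_0, !Rmult_1_l. auto. }
    rewrite Ef0. replace (f (t, s)%R * (A0 * cexp d) - f (t, s)%R)%C with (f (t, s)%R * ((A0 - 1) * cexp d + (cexp d - 1)))%C by ring.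
    rewrite Cmod_mult. apply Rle_trans with (K * (7 * del)); auto.
    apply Rmult_le_compat; try apply Cmod_ge_0. apply HKb. simpl; lra.
    assert (Hb1 : Cmod (cexp d - 1) <= 3 * del).
    { eapply Rle_trans; [apply cexp_bound1|]. rewrite Rmult_comm. apply Rmult_le_compat; auto. left; apply exp_pos. apply Cmod_ge_0.
      apply Rle_trans with (exp 1). apply exp_le. lra. apply exp_le_3. }
    assert (Hb2 : Cmod (cexp d) <= 4) by (generalize (Cmod_triangle_sub (cexp d) 1); rewrite Cmod_1; lra).
    eapply Rle_trans; [apply Cmod_triangle|]. rewrite Cmod_mult.
    assert (Cmod (A0 - 1) * Cmod (cexp d) <= del * 4). { apply Rmult_le_compat; try apply Cmod_ge_0; auto. eapply Rle_trans; [apply Ht2|auto]. } lra. }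
  assert (Sh : forall t r, ((t, r)%R + tau)%C = (t + tau, r)%R) by (intros; apply C_ext; simpl; ring).
  rewrite <- (Sh x y).
  apply (strip_max_principle (fun z => f (z + tau) - f z)%C s (2 * K) (eps / 2)).
  - assert (FE := genus0_entire). apply entire_iff in FE. destruct FE as [f' Hf']. apply entire_iff. exists (fun z => f' (z + tau) * 1 - f' z)%C. intros z.
    apply cderiv_minus; auto. apply (cderiv_comp f (fun w => w + tau)%C). apply Hf'.
    eapply cderiv_eq; [|apply cderiv_plus; [apply cderiv_id|apply cderiv_const]]. ring.
  - lra.
  - intros z Hz. eapply Rle_trans; [apply Cmod_minus_le|]. assert (Cmod (f z) <= K) by auto. assert (Cmod (f (z + tau)%C) <= K) by (apply HKb; rewrite im_plus, im_RtoC, Rplus_0_r; auto). lra.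
  - assert (Up : forall z, Im z = s -> Cmod (f (z + tau) - f z) <= eps / 2).
    { intros [t r] Hr. simpl in Hr. subst r. rewrite Sh. apply Line. }
    intros z [Hz | Hz]; auto. rewrite <- (Cmod_conj (f (z + tau) - f z)%C), Cminus_conj, <- !genus0_conj, Cplus_conj.
    replace (Cconj tau) with (RtoC tau) by (apply C_ext; simpl; ring). apply Up. rewrite im_conj, Hz. ring.
  - simpl. lra.
Qed.
End Construction.

Theorem theorem3
  (a : Z -> R) (gam : nat -> R) (b : nat -> C)
  (* A = {a_n}_{n in Z}, enumerated nondecreasingly *)
  (Ha_mono : forall n : Z, a n <= a (n + 1)%Z)
  (* local finiteness of Lambda (A is a bi-infinite locally finite multiset) *)
  (Ha_pinf : forall M : R, exists n0 : Z, forall n : Z, (n0 <= n)%Z -> M < a n)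
  (Ha_minf : forall M : R, exists n0 : Z, forall n : Z, (n <= n0)%Z -> a n < M)
  (* 0 is not in A *)
  (Ha0 : forall n : Z, a n <> 0)
  (* Gamma = {gamma_k} countable, listed without repetition *)
  (Hgam_inj : forall k l : nat, gam k = gam l -> k = l)
  (* mu and |hat mu| are tempered *)
  (Hmu : tempered_A a)
  (Hmuhat : tempered_B gam b)
  (* hat mu = sum_k b_k delta_{gamma_k} *)
  (HF : fourier_pair a gam b) :
  ((exists F : C -> C, entire F /\ almost_periodic F /\ exponential_type F
                       /\ zero_set_is F a)
   <-> g_bounded gam b)
  /\
  ((exists F : C -> C, entire F /\ almost_periodic F /\ exponential_type F
                       /\ zero_set_is F a) ->
   exists f : C -> C,
     (forall z : C, f_product_converges a z (f z)) /\
     entire f /\ almost_periodic f).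
Proof.
  destruct (Qf_formula a gam b Ha_mono Ha0 Hmuhat HF) as [c0 HQ].
  destruct (canonical_product a gam b Ha_mono Ha0 Hmuhat HF) as [P [HU [HPE [HPZ [HPnz HPQ]]]]].
  assert (Forward : (exists F : C -> C, entire F /\ almost_periodic F /\ exponential_type F /\ zero_set_is F a) -> primitive_bounded gam b).
  { intros [F [_ [Fap [Fexp FZ]]]]. apply (primitive_bounded_of_almost_periodic a gam b) with (P := P) (c0 := c0) (F := F); auto. }
  assert (Backward : primitive_bounded gam b -> exists f : C -> C, (forall z : C, f_product_converges a z (f z)) /\
    entire f /\ almost_periodic f /\ exponential_type f /\ zero_set_is f a).
  { intros Hbd. destruct (inverse_sum a gam b Ha_mono Ha0 Hmuhat HF c0 HQ Hbd) as [c1 Hc1]. exists (genus0 P c1). split; [|split; [|split; [|split]]].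
    - intros z. apply (genus0_product a P HU c1 Hc1).
    - apply (genus0_entire P HPE).
    - apply (genus0_almost_periodic a gam b) with (c0 := c0); auto.
    - apply (genus0_exponential_type a gam b) with (c0 := c0); auto.
    - apply (genus0_zero_set a P HPZ). }
  split.
  - rewrite (g_bounded_iff gam b Hmuhat). split; auto.
    intros H. destruct (Backward H) as [f [_ Hf]]. exists f. auto.
  (* The product is rebuilt from the boundedness of the primitive, so no relation between it and the
     given function has to be established. *)
  - intros H. destruct (Backward (Forward H)) as [f [Hf [Hfe [Hfa _]]]]. exists f. auto.
Qed.
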